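(* Let $E_0\subset\mathbb{R}^n$ be a bounded open set which is $\delta$-outward minimizing for some $\delta>0$. For $h>0$ let $u_h$ be the arrival time of the implicit time discretization with time step $h$ starting from $E_0$. Let $h_j\downarrow0$ be a sequence and $u:\mathbb{R}^n\to[0,\infty)$ a continuous function with $\operatorname{supp}u\subset\overline{E_0}$ such that $u_{h_j}\to u$ uniformly and $Du_{h_j}\rightharpoonup Du$ as measures. Then $$|Du_{h_j}|\rightharpoonup|Du|\quad\text{as measures.}$$ In particular, $$\int_{\mathbb{R}^n}|Du_{h_j}|\to\int_{\mathbb{R}^n}|Du|.$$
   Context: Notation: $P(E)=\sup\{\int_E \operatorname{div}\xi\,dx:\ \xi\in C^1_c(\mathbb{R}^n;\mathbb{R}^n),\ \|\xi\|_\infty\le 1\}$ is the De Giorgi perimeter in $\mathbb{R}^n$; $\Delta$ between sets is the symmetric difference; $d_F(x)=\operatorname{dist}(x,\partial F)$ (with $\operatorname{dist}(x,\emptyset)=+\infty$). For sets of finite perimeter $F$ one uses the representative with $\overline{\partial^*F}=\partial F$, where $\partial^*F$ is the reduced boundary. For a $BV$ function $v$, $Dv$ is its distributional derivative (a vector measure) and $|Dv|$ its total variation measure. $\delta$-outward minimizing: $E$ is $\delta$-outward minimizing if $P(E)\le P(F)$ for all $F\supset E$ with $\sup_{x\in F}\operatorname{dist}(x,E)<\delta$; that is, $E$ is outward minimizing in its $\delta$-neighborhood $\Omega=E+B_\delta=\{x:\operatorname{dist}(x,E)<\delta\}$, meaning $P(E)\le P(F)$ for all $F$ with $E\subset F\subset\Omega$.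 Implicit time discretization: given $E_0$ and $h>0$, the sets $E_1,E_2,\dots$ are successively chosen as minimizers $$E_k\in\arg\min_{E}\Big\{P(E)+\frac1h\int_{E\Delta E_{k-1}}d_{E_{k-1}}\,dx\Big\},$$ (so once $E_{k-1}$ is empty, $E_k$ is empty), and $E_h(t)=E_k$ for $t\in[kh,(k+1)h)$. The arrival time is $$u_h(x)=h\sum_{k\ge0}\chi_{E_k}(x)=\int_0^\infty\chi_{E_h(t)}(x)\,dt,\qquad x\in\mathbb{R}^n.$$ *)

(* Defs.v *)
From HB Require Import structures.
From mathcomp Require Import all_boot all_order all_algebra.
From mathcomp Require Import all_classical all_reals all_analysis.
From mathcomp Require Import ring.

Set Implicit Arguments.
Unset Strict Implicit.
Unset Printing Implicit Defensive.

Import Order.TTheory GRing.Theory Num.Theory.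
Import numFieldNormedType.Exports.

Local Open Scope classical_set_scope.
Local Open Scope ring_scope.

(* R^n is 'rV[R]_n.+1, so that n + 1 >= 1 is the dimension of the space.  The
   library norm on 'rV[R]_n.+1 is the max norm: it is used for topological
   notions only, everything metric goes through enorm. *)
Section euclidean.
Context {R : realType} {n : nat}.
Implicit Types (x y : 'rV[R]_n) (A : set 'rV[R]_n).

Definition enorm x : R := Num.sqrt (\sum_i x 0 i ^+ 2).

Definition eball x (r : R) : set 'rV[R]_n := [set y | enorm (y - x) < r].

(* dist x set0 = +oo *)
Definition dist x A : \bar R := ereal_inf [set (enorm (x - y))%:E | y in A].

Lemma enorm_ge0 x : 0 <= enorm x.
Proof. exact: sqrtr_ge0. Qed.

Lemma enorm_sqr x : enorm x ^+ 2 = \sum_i x 0 i * x 0 i.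
Proof. by rewrite sqr_sqrtr ?sumr_ge0// => i _; rewrite sqr_ge0. Qed.

Lemma enorm0_eq0 x : enorm x = 0 -> x = 0.
Proof.
move=> /(congr1 (fun r => r ^+ 2)); rewrite enorm_sqr expr0n /= => /eqP.
rewrite psumr_eq0 => [/allP x0|i _]; last by rewrite -expr2 sqr_ge0.
apply/rowP => i; rewrite mxE; apply/eqP.
by have := x0 i (mem_index_enum _); rewrite /= mulf_eq0 orbb.
Qed.

Lemma enorm0 : enorm 0 = 0.
Proof. by rewrite /enorm big1 ?sqrtr0// => i _; rewrite mxE expr0n. Qed.

Lemma dot_le_enorm x y : \sum_i x 0 i * y 0 i <= enorm x * enorm y.
Proof.
have [x0|xN0] := eqVneq (enorm x) 0.
  rewrite x0 mul0r big1// => i _.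
  by rewrite (enorm0_eq0 x0) mxE mul0r.
have [y0|yN0] := eqVneq (enorm y) 0.
  rewrite y0 mulr0 big1// => i _.
  by rewrite (enorm0_eq0 y0) mxE mulr0.
have xp : 0 < enorm x by rewrite lt0r xN0 enorm_ge0.
have yp : 0 < enorm y by rewrite lt0r yN0 enorm_ge0.
set a := enorm x; set b := enorm y.
have : 0 <= \sum_i (b * x 0 i - a * y 0 i) ^+ 2.
  by apply: sumr_ge0 => i _; rewrite sqr_ge0.
have -> : \sum_i (b * x 0 i - a * y 0 i) ^+ 2 =
    b ^+ 2 * (\sum_i x 0 i * x 0 i) + a ^+ 2 * (\sum_i y 0 i * y 0 i)
    - (a * b) * (\sum_i x 0 i * y 0 i) *+ 2.
  rewrite -mulrnAr -sumrMnl !mulr_sumr -big_split -sumrB /=.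
  by apply: eq_bigr => i _; ring.
rewrite -!enorm_sqr -/a -/b mulrC -exprMn -mulr2n -mulrnBl pmulrn_lge0//.
by rewrite subr_ge0 expr2 ler_pM2l// mulr_gt0.
Qed.

End euclidean.

Section lebesgue.
Context {R : realType} {n : nat}.
Local Notation Rn := 'rV[R]_n.+1.

Definition borel : Type := g_sigma_algebraType (@open Rn).

Definition box (a b : Rn) : set Rn :=
  [set x | forall i, a 0 i < x 0 i <= b 0 i].

(* +oo on the sets that are not boxes, so that the infimum in mu_ext box_vol
   ranges over the countable coverings by boxes. *)
Definition box_vol (B : set borel) : \bar R :=
  ereal_inf [set (\prod_i (ab.2 0 i - ab.1 0 i))%:E | ab in
    [set ab : Rn * Rn | (forall i, ab.1 0 i <= ab.2 0 i)
                        /\ box ab.1 ab.2 = B]].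

Lemma box_vol_ge0 B : (0 <= box_vol B)%E.
Proof.
apply: le_ereal_inf_tmp => _ [[a b] /= [ab _] <-].
by rewrite lee_fin prodr_ge0// => i _; rewrite subr_ge0.
Qed.

Lemma box_vol0 : box_vol set0 = 0%E.
Proof.
apply/eqP; rewrite eq_le box_vol_ge0 andbT; apply: ereal_inf_lbound.
exists (0, 0) => /=.
  split=> //; apply/seteqP; split=> // x /(_ ord0) /andP[/lt_le_trans h /h].
  by rewrite ltxx.
by rewrite big_ord_recl subrr mul0r.
Qed.

Definition lebesgue_outer : set Rn -> \bar R := mu_ext box_vol.

HB.instance Definition _ := isOuterMeasure.Build R Rn lebesgue_outer
  (mu_ext0 box_vol0 box_vol_ge0) (mu_ext_ge0 box_vol_ge0)
  (@le_mu_ext _ _ _ box_vol) (mu_ext_sigma_subadditive box_vol_ge0).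

Definition Lmeasurable : set (set Rn) := lebesgue_outer.-cara.-measurable.

Definition leb : set (caratheodory_type lebesgue_outer) -> \bar R :=
  lebesgue_outer.

Let leb0 : leb set0 = 0%E.
Proof. exact: outer_measure0. Qed.

Let leb_ge0 A : (0 <= leb A)%E.
Proof. exact: outer_measure_ge0. Qed.

Let leb_sigma_additive : semi_sigma_additive leb.
Proof. exact: caratheodory_measure_sigma_additive. Qed.

HB.instance Definition _ := isMeasure.Build _ _ _ leb
  leb0 leb_ge0 leb_sigma_additive.

End lebesgue.
Arguments borel : clear implicits.

Section vector_variation.
Context d (T : measurableType d) {R : realType} {n : nat}.
Variable mu : 'I_n -> {charge set T -> \bar R}.
Implicit Types A B : set T.
Local Open Scope ereal_scope.

Definition vcharge A : 'rV[R]_n := \row_i fine (mu i A).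

(* Packings of A rather than partitions of A: the supremum is the same when A is
   measurable, and it is nonnegative for any A. *)
Definition packing A : set (set T)^nat := [set F |
  [/\ forall k, measurable (F k), trivIset setT F & \bigcup_k F k `<=` A]].

Definition vector_variation A : \bar R :=
  ereal_sup [set \sum_(0 <= k <oo) (enorm (vcharge (F k)))%:E | F in packing A].

Local Notation nrm A := (enorm (vcharge A))%:E.

Let nrm_ge0 A : 0 <= nrm A. Proof. by rewrite lee_fin enorm_ge0. Qed.

Let nrm0 : nrm set0 = 0.
Proof.
by rewrite /vcharge (_ : \row_i _ = 0%R) ?enorm0//; apply/rowP => i; rewrite !mxE charge0.
Qed.

Let packing0 A : packing A (fun=> set0).
Proof. by split=> //; [exact: trivIset_set0 | rewrite bigcup0]. Qed.

Let tv_ge A F : packing A F -> \sum_(0 <= k <oo) nrm (F k) <= vector_variation A.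
Proof. by move=> AF; apply: ereal_sup_ubound; exists F. Qed.

Let tv_ge0 A : 0 <= vector_variation A.
Proof. by apply: le_trans (tv_ge (packing0 A)); exact: nneseries_ge0. Qed.

Let vector_variation0 : vector_variation set0 = 0.
Proof.
apply/eqP; rewrite eq_le tv_ge0 andbT; apply: ge_ereal_sup => _ [F [_ _ F0] <-].
rewrite eseries0// => k _ _; have -> : F k = set0; last exact: nrm0.
by rewrite -subset0; apply: subset_trans F0; exact: bigcup_sup.
Qed.

Let nrm_subadd F : (forall k, measurable (F k)) -> trivIset setT F ->
  nrm (\bigcup_k F k) <= \sum_(0 <= k <oo) nrm (F k).
Proof.
move=> mF tF; set v := vcharge _; set s := enorm v.
have [->|sN0] := eqVneq s 0%R; first exact: nneseries_ge0.
have s0 : (0 < s)%R by rewrite lt0r sN0 enorm_ge0.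
have mUF : measurable (\bigcup_k F k) by exact: bigcup_measurable.
have [Soo|] := eqVneq (\sum_(0 <= k <oo) nrm (F k)) +oo; first by rewrite Soo leey.
rewrite -ltey -ge0_fin_numE ?nneseries_ge0// => Sfin.
rewrite -(fineK Sfin) lee_fin; set S := fine _.
have leS N : (\sum_(0 <= k < N) enorm (vcharge (F k)) <= S)%R.
  rewrite -lee_fin /S fineK// -sumEFin; exact: nneseries_lim_ge.
have cvi i : (fun N => \sum_(0 <= k < N) fine (mu i (F k)))%R @ \oo -->
    v ord0 i.
  have := @charge_semi_sigma_additive _ _ _ (mu i) F mF tF mUF.
  rewrite -(fineK (fin_num_measure (mu i) _ mUF)) => /fine_cvg/=.
  rewrite mxE; apply: cvg_trans; apply: near_eq_cvg; near=> N => /=.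
  by rewrite sum_fine// => k _; exact: fin_num_measure.
have cvs : (fun N => \sum_i v ord0 i *
    \sum_(0 <= k < N) fine (mu i (F k)))%R @ \oo --> (s ^+ 2)%R.
  rewrite enorm_sqr; apply: cvg_big => [|i _]; first exact: add_continuous.
  exact: cvgMl_tmp.
suff : (s ^+ 2 <= s * S)%R by rewrite expr2 ler_pM2l.
rewrite -(cvg_lim _ cvs)//; apply: limr_le; first by apply/cvg_ex; exists (s ^+ 2)%R.
near=> N; apply: (@le_trans _ _ (s * \sum_(0 <= k < N) enorm (vcharge (F k)))%R);
  last by rewrite ler_pM2l.
under eq_bigr do rewrite mulr_sumr.
rewrite exchange_big mulr_sumr /=; apply: ler_sum => k _.
apply: le_trans (dot_le_enorm v (vcharge (F k))).
by apply: ler_sum => i _; rewrite [vcharge (F k) _ _]mxE.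
Unshelve. all: by end_near. Qed.

Let tv_superadd A B C : A `&` B = set0 -> A `|` B `<=` C ->
  vector_variation A + vector_variation B <= vector_variation C.
Proof.
move=> AB0 ABC.
have [->|] := eqVneq (vector_variation C) +oo; first by rewrite leey.
rewrite -ltey -ge0_fin_numE// => Cfin.
have FG F G : packing A F -> packing B G ->
    \sum_(0 <= k <oo) nrm (F k) + \sum_(0 <= k <oo) nrm (G k) <= vector_variation C.
  move=> [mF tF FA] [mG tG GB].
  have FN N : \sum_(0 <= k < N) nrm (F k) + \sum_(0 <= k <oo) nrm (G k) <= vector_variation C.
    pose H k := if (k < N)%N then F k else G (k - N)%N.
    have HN : \sum_(0 <= k <oo) nrm (H k) =
        \sum_(0 <= k < N) nrm (F k) + \sum_(0 <= k <oo) nrm (G k).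
      rewrite (nneseries_split 0 N)// add0n; congr (_ + _).
        by apply: eq_big_nat => k /andP[_ kN]; rewrite /H kN.
      rewrite -(@nneseries_addn _ (fun k => nrm (H k)) N)//.
      by apply: eq_eseriesr => k _; rewrite /H ltnNge leq_addl/= addnK.
    rewrite -HN; apply: tv_ge; split.
    - by move=> k; rewrite /H; case: ifP.
    - have FGdisj i j x : F i x -> G j x -> False.
        move=> Fx Gx; suff : (A `&` B) x by rewrite AB0.
        by split; [apply: FA; exists i | apply: GB; exists j].
      move=> i j _ _ [x []]; rewrite /H; case: ifPn => iN; case: ifPn => jN.
      + by move=> Fi Fj; apply: tF => //; exists x.
      + by move=> /FGdisj h /h.
      + by move=> Gi /FGdisj h; have := h _ Gi.
      + move=> Gi Gj; rewrite -leqNgt in iN; rewrite -leqNgt in jN.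
        by rewrite -(subnK iN) -(subnK jN); congr (_ + _)%N; apply: tG => //; exists x.
    - move=> x [k _]; rewrite /H; case: ifP => _ Hx; apply: ABC.
        by left; apply: FA; exists k.
      by right; apply: GB; exists (k - N)%N.
  have Gfin : \sum_(0 <= k <oo) nrm (G k) \is a fin_num.
    rewrite ge0_fin_numE ?nneseries_ge0//.
    have := FN 0%N; rewrite big_nil add0e => /le_lt_trans; apply.
    by rewrite ltey_eq Cfin.
  rewrite -leeBrDr//; apply: lime_le; first exact: is_cvg_nneseries.
  by near=> N; rewrite leeBrDr.
have Afin G : packing B G -> vector_variation A <= vector_variation C - \sum_(0 <= k <oo) nrm (G k).
  move=> BG.
  have Gfin : \sum_(0 <= k <oo) nrm (G k) \is a fin_num.
    rewrite ge0_fin_numE ?nneseries_ge0//.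
    apply: (@le_lt_trans _ _ (vector_variation C)); last by rewrite ltey_eq Cfin.
    apply: le_trans (FG _ _ (packing0 A) BG).
    by rewrite leeDr// nneseries_ge0.
  by apply: ge_ereal_sup => _ [F AF <-]; rewrite leeBrDr// FG.
have tvAfin : vector_variation A \is a fin_num.
  rewrite ge0_fin_numE//.
  apply: (@le_lt_trans _ _ (vector_variation C)); last by rewrite ltey_eq Cfin.
  have := Afin _ (packing0 B); rewrite eseries0 ?sube0// => k _ _; exact: nrm0.
rewrite addeC -leeBrDr//; apply: ge_ereal_sup => _ [G BG <-].
have := Afin _ BG; rewrite leeBrDr ?leeBrDr// 1?addeC//.
rewrite ge0_fin_numE ?nneseries_ge0//.
apply: (@le_lt_trans _ _ (vector_variation C)); last by rewrite ltey_eq Cfin.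
by apply: le_trans (FG _ _ (packing0 A) BG); rewrite leeDr// nneseries_ge0.
Unshelve. all: by end_near. Qed.

Let tv_sigma_additive : semi_sigma_additive vector_variation.
Proof.
move=> A mA tA mUA.
suff -> : vector_variation (\bigcup_k A k) = \sum_(0 <= k <oo) vector_variation (A k).
  exact: is_cvg_nneseries.
apply/eqP; rewrite eq_le; apply/andP; split; last first.
  apply: lime_le; first exact: is_cvg_nneseries.
  near=> N; apply: (@le_trans _ _ (vector_variation (\big[setU/set0]_(k < N) A k))).
    elim: {+}N => [|m ih]; first by rewrite big_nil.
    rewrite big_nat_recr//= big_ord_recr/=; apply: le_trans (leeD2r _ ih) _.
    apply: tv_superadd => //; rewrite big_distrl/= big1// => i _.
    apply/eqP/negPn/negP => /set0P/(tA i m Logic.I Logic.I) im.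
    by have := ltn_ord i; rewrite im ltnn.
  apply: ge_ereal_sup => _ [F [mF tF FA] <-]; apply: tv_ge; split=> //.
  by apply: (subset_trans FA) => x; exact: bigsetU_bigcup.
apply: ge_ereal_sup => _ [F [mF tF FA] <-].
apply: (@le_trans _ _ (\sum_(0 <= k <oo) \sum_(0 <= i <oo) nrm (F k `&` A i))).
  apply: lee_nneseries => // k _.
  rewrite -[X in nrm X](_ : \bigcup_i (F k `&` A i) = _); last first.
    rewrite -setI_bigcupr; apply/setIidPl; apply: subset_trans FA.
    exact: bigcup_sup.
  apply: nrm_subadd => [i|]; first exact: measurableI.
  exact: trivIset_setIl.
rewrite nneseries_interchange//.
apply: lee_nneseries => [i _ _|i _]; first exact: nneseries_ge0.
apply: tv_ge; split=> [k||]; first exact: measurableI.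
- exact: trivIset_setIr.
- by move=> x [k _ []].
Unshelve. all: by end_near. Qed.

HB.instance Definition _ := isMeasure.Build _ _ _ vector_variation
  vector_variation0 tv_ge0 tv_sigma_additive.

End vector_variation.

(* The library integrates against measures only. *)
Definition charge_integral d (T : measurableType d) (R : realType)
    (nu : {charge set T -> \bar R}) (f : T -> \bar R) : \bar R :=
  let P := cid (Hahn_decomposition nu) in
  let nuPN := projT2 (cid (projT2 P)) in
  (\int[jordan_pos nuPN]_x f x - \int[jordan_neg nuPN]_x f x)%E.

Section calculus.
Context {R : realType} {n : nat}.
Local Notation Rn := 'rV[R]_n.+1.

Definition partial {V : normedModType R} (i : 'I_n.+1) (f : Rn -> V) : Rn -> V :=
  'D_(delta_mx 0 i) f.

Definition C1 {V : normedModType R} (f : Rn -> V) := forall i,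
  (forall x, derivable f x (delta_mx 0 i)) /\ continuous (partial i f).

Definition tsupp {V : normedModType R} (f : Rn -> V) : set Rn :=
  closure [set x | f x != 0].

Definition div (xi : Rn -> Rn) (x : Rn) : R := \sum_i (partial i xi x) 0 i.

Definition bdry (F : set Rn) : set Rn := closure F `\` interior F.

Definition bdist (F : set Rn) (x : Rn) : \bar R := dist x (bdry F).

Definition perimeter (E : set Rn) : \bar R :=
  ereal_sup [set (\int[leb]_(x in E) (div xi x)%:E)%E | xi in
    [set xi : Rn -> Rn |
      [/\ C1 xi, compact (tsupp xi) & forall x, enorm (xi x) <= 1]]].

Definition outward_minimizing (delta : R) (E : set Rn) := forall F : set Rn,
  Lmeasurable F -> E `<=` F -> F `<=` [set x | (dist x E < delta%:E)%E] ->
  (perimeter E <= perimeter F)%E.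

(* Dv = mu in the sense of distributions, for a finite vector measure mu on the
   Borel sets. *)
Definition is_gradient (v : Rn -> \bar R)
    (mu : 'I_n.+1 -> {charge set (borel R n) -> \bar R}) :=
  (forall K : set Rn, compact K -> leb.-integrable K v) /\
  forall (phi : Rn -> R) i, C1 phi -> compact (tsupp phi) ->
    (\int[leb]_x (v x * (partial i phi x)%:E))%E =
    (- charge_integral (mu i) (fun x => (phi x)%:E))%E.

Definition reduced_boundary (F : set Rn) : set Rn :=
  [set x | exists mu : 'I_n.+1 -> {charge set (borel R n) -> \bar R},
    [/\ is_gradient (fun y => (\1_F y)%:E) mu,
        forall r, 0 < r -> (0 < vector_variation mu (eball x r))%E
      & exists2 nu : Rn, enorm nu = 1 &
          (fine (vector_variation mu (eball x r)))^-1 *: vcharge mu (eball x r)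
            @[r --> 0^'+] --> nu]].

(* The choice of the representative of a set of finite perimeter.  In
   implicit_scheme it is imposed on the minimizers; E0 is an open set, taken as
   it is given. *)
Definition normalized (F : set Rn) := closure (reduced_boundary F) = bdry F.

Definition step_energy (h : R) (G E : set Rn) : \bar R :=
  (perimeter E + h^-1%:E * \int[leb]_(x in E `+` G) bdist G x)%E.

Definition implicit_scheme (h : R) (E0 : set Rn) (E : nat -> set Rn) :=
  E 0%N = E0 /\ forall k,
    [/\ Lmeasurable (E k.+1), normalized (E k.+1)
      & forall F, Lmeasurable F ->
          (step_energy h (E k) (E k.+1) <= step_energy h (E k) F)%E].

(* A priori +oo at the points that lie in infinitely many of the sets E k. *)
Definition arrival_time (h : R) (E : nat -> set Rn) (x : Rn) : \bar R :=
  (h%:E * \sum_(0 <= k <oo) (\1_(E k) x)%:E)%E.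

(* Weak convergence of measures is tested against continuous functions with
   compact support. *)
Definition weak_cvg (mu_ : nat -> {measure set (borel R n) -> \bar R})
    (mu : {measure set (borel R n) -> \bar R}) :=
  forall phi : Rn -> R, continuous phi -> compact (tsupp phi) ->
    (\int[mu_ j]_x (phi x)%:E)%E @[j --> \oo] --> (\int[mu]_x (phi x)%:E)%E.

Definition weak_cvg_vector
    (mu_ : nat -> 'I_n.+1 -> {charge set (borel R n) -> \bar R})
    (mu : 'I_n.+1 -> {charge set (borel R n) -> \bar R}) :=
  forall (phi : Rn -> R) i, continuous phi -> compact (tsupp phi) ->
    charge_integral (mu_ j i) (fun x => (phi x)%:E) @[j --> \oo] -->
    charge_integral (mu i) (fun x => (phi x)%:E).

End calculus.

(* Main.v *)
From HB Require Import structures.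
Require Import Defs.
From mathcomp Require Import all_boot all_order all_algebra.
From mathcomp Require Import all_classical all_reals all_analysis measurable_realfun.
From mathcomp Require Import ring lra.

Set Implicit Arguments.
Unset Strict Implicit.
Unset Printing Implicit Defensive.

Import Order.TTheory GRing.Theory Num.Theory.
Import numFieldNormedType.Exports.

Local Open Scope classical_set_scope.
Local Open Scope ring_scope.

(** Lower semicontinuity is one half of the matter: a smooth field that almost realizes
    the mass of [Du] is tested against [Du_h], so that the limit of the variation measures
    is at least [|Du|], and it is exactly [|Du|] as soon as no mass is lost in the limit
    ([variation_lsc], [variation_weak_cvg]).  It remains to prove that the total mass of
    [Du_h] exceeds that of [Du] by no more than a quantity that tends to 0 with [h].

    The mass of [Du_h] is at most [h] times the sum of the perimeters of the sets [E_k],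
    as [u_h] is [h] times the sum of their indicators.  Each of these sets is outward
    minimizing in the collar of [E_0]: this passes from [E_k] to [E_(k+1)] because
    intersecting with an outward minimizing set does not increase the perimeter, which is
    submodular, and because the distance term prevents [E_(k+1)] from leaving the closure
    of [E_k] when [h] is small ([tv_submod], [OM_cut], [minimizing_step]).  By the coarea
    inequality an outward minimizing set also minimizes the total variation among the
    functions with values in [0, 1], supported in the collar, that are 1 almost everywhere
    on it ([perimeter_level], [OM_functional]).

    Now let [eps] bound the distance of [u_h] and [u].  If [u >= (k + 1) h - eps] almost
    everywhere on [E_k], then the slice of [u] between the heights [k h - eps] and
    [(k + 1) h - eps], divided by [h], is such a function.  Hence [h P(E_k)] is at most
    the total variation of the slice, and the slices add up to the total variation of [u]
    ([tv_slice], [slice_step]); only the times before [eps] escape, and they cost at most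
    [(eps + h) P(E_0)] ([arrival_variation_le]).

    That [u] is large on [E_k] is not immediate, because the sets [E_k] are known to be
    nested up to their boundaries only, and [u_h] counts the sets to which a point belongs.
    But the complement of an outward minimizing set has positive density at the boundary
    points, by an iteration of De Giorgi's type based on the filling of the complement in
    small cubes ([OM_density]).  The part of [E_k] in its boundary is therefore negligible
    ([OM_bdry_null]), the points that belong to all the sets [E_0], ..., [E_k] come close
    to almost every point of [E_k] ([scheme_nested]), and at these points [u_h] is at least
    [(k + 1) h]; the continuity of [u] concludes ([late]). *)

(** * Lebesgue measure on the Euclidean space *)

Section Rn_measure.
Context {R : realType} {n : nat}.
Local Notation Rn := 'rV[R]_n.+1.
Implicit Types (x y c : Rn) (r : R) (A B U : set Rn).

Lemma normr_rV_lt x (r : R) : 0 < r -> (`|x| < r) = [forall i, `|x 0 i| < r].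
Proof.
move=> r0; rewrite [in LHS]/Num.Def.normr/= mx_normrE.
apply/idP/forallP => [/bigmax_ltP[_ h] i|h]; first exact: (h (ord0, i)).
by apply/bigmax_ltP; split => // -[i j] _ /=; rewrite ord1.
Qed.

Lemma normr_coord_le x i : `|x 0 i| <= `|x|.
Proof.
rewrite [leRHS]/Num.Def.normr/= mx_normrE.
by apply: (@le_bigmax_cond _ _ _ _ (ord0, i) xpredT (fun j => `|x j.1 j.2|)).
Qed.

(** The rational cubes form a countable base of the topology.  Countability makes
    Borel measurability a matter of coordinates. *)
Lemma open_rat_cube U x : open U -> U x -> exists q : 'rV[rat]_n.+1 * nat,
  (forall i, `|x 0 i - ratr (q.1 0 i)| < q.2.+1%:R^-1) /\
  (forall y, (forall i, `|y 0 i - ratr (q.1 0 i)| < q.2.+1%:R^-1) -> U y).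
Proof.
move=> oU Ux; have /nbhs_ballP[e /= e0 eU] := open_nbhs_nbhs (conj oU Ux).
have [k ke] : exists k : nat, k.+1%:R^-1 < e / 2.
  have e20 : 0 < e / 2 by rewrite divr_gt0.
  exists (Num.truncn (e / 2)^-1); rewrite invf_plt ?posrE//.
  by rewrite Num.Theory.truncnS_gt.
have k0 : 0 < (k.+1%:R : R)^-1 by rewrite invr_gt0.
have qi i : {q : rat | `|x 0 i - ratr q| < k.+1%:R^-1}.
  apply: cid; have := @rat_in_itvoo R (x 0 i - k.+1%:R^-1) (x 0 i + k.+1%:R^-1).
  move: k0; set r := _^-1 => r0.
  have -> : x 0 i - r < x 0 i + r by lra.
  move=> /(_ isT)[q]; rewrite in_itv/= => /andP[q1 q2]; exists q.
  by rewrite ltr_distlC; apply/andP; split; lra.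
exists (\row_i sval (qi i), k); split => /= [i|y yq].
  by rewrite mxE; exact: (svalP (qi i)).
apply: eU; rewrite -ball_normE /= normr_rV_lt//; apply/forallP => i.
rewrite !mxE; have := yq i; rewrite mxE.
have := svalP (qi i) => /=; move: (sval _) => q; move: ke; set r := _^-1 => re q1 q2.
rewrite (_ : _ - _ = (x 0 i - ratr q) - (y 0 i - ratr q)); last by ring.
by rewrite (le_lt_trans (ler_normB _ _))//; lra.
Qed.

Lemma open_forall (I : finType) (P : I -> set Rn) :
  (forall i, open (P i)) -> open [set x | forall i, P i x].
Proof.
move=> oP; rewrite openE => x Px; apply: (@filter_forall _ _ P (nbhs x)) => i.
by apply: open_nbhs_nbhs; split; [exact: oP|exact: Px].
Qed.

Lemma open_coord_itv i (c d : R) : open [set x : Rn | c < x 0 i < d].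
Proof.
have := @open_comp _ _ (fun x : Rn => x 0 i) `]c, d[%classic.
rewrite (_ : _ @^-1` _ = [set x : Rn | c < x 0 i < d]).
  by apply; [move=> x _; exact: coord_continuous|exact: interval_open].
by apply/seteqP; split => x /=; rewrite in_itv.
Qed.

Lemma bigcup_countType d (T : measurableType d) (I : countType) (P : set I)
  (F : I -> set T) : (forall i, measurable (F i)) -> measurable (\bigcup_(i in P) F i).
Proof.
move=> mF; rewrite (_ : \bigcup_(i in P) F i = \bigcup_k
   (if @unpickle I k is Some i then if `[< P i >] then F i else set0 else set0)).
  apply: bigcup_measurable => k _; case: (unpickle k) => // i.
  by case: ifPn.
apply/seteqP; split=> [x [i Pi Fx]|x [k _]].
  exists (pickle i) => //; rewrite pickleK; case: asboolP => //.
by case: (unpickle k) => // i; case: asboolP => // Pi Fx; exists i.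
Qed.

Lemma measurable_forall d (T : measurableType d) (I : finType) (P : I -> set T) :
  (forall i, measurable (P i)) -> measurable [set t | forall i, P i t].
Proof.
move=> mP; rewrite -[X in measurable X]setCK; apply: measurableC.
rewrite (_ : ~` _ = \bigcup_(i in setT) ~` P i).
  by apply: bigcup_countType => i; exact: measurableC.
apply/seteqP; split=> [t /existsNP[i]|t [i _ h] /(_ i)//].
by exists i.
Qed.

(** An open set is a countable union of rational cubes, and the preimage of a cube is
    given by conditions on the coordinates. *)
Lemma measurable_fun_coord d (T : measurableType d) (f : T -> borel R n) :
  (forall i, measurable_fun setT (fun t => (f t : Rn) 0 i)) ->
  measurable_fun setT f.
Proof.
move=> mf; apply: (@measurability _ _ T (borel R n) setT f (@open Rn) erefl) => _ [U oU <-].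
rewrite setTI.
pose cube (q : 'rV[rat]_n.+1 * nat) : set Rn :=
  [set y | forall i, `|y 0 i - ratr (q.1 0 i)| < q.2.+1%:R^-1].
rewrite (_ : f @^-1` U = \bigcup_(q in [set q | cube q `<=` U]) (f @^-1` cube q)).
  apply: bigcup_countType => q.
  apply: measurable_forall => i.
  have mg : measurable_fun setT (fun t => `|(f t : Rn) 0 i - ratr (q.1 0 i)|).
    by apply: measurableT_comp => //; exact: measurable_funB.
  have := mg measurableT _ (measurable_itv `]-oo, (q.2.+1%:R^-1)%R[).
  by rewrite setTI; congr (measurable _); apply/seteqP; split => t /=; rewrite in_itv.
apply/seteqP; split=> [t Ut|t [q qU]]; last exact: qU.
by have [q [q1 q2]] := open_rat_cube oU Ut; exists q.
Qed.

Lemma coord_borel_measurable i :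
  measurable_fun setT (fun x : borel R n => (x : Rn) 0 i).
Proof.
apply: (measurability _ (measurable_realfun.RGenOpens.measurableE R)) => _ [_ [a [b ->]] <-].
rewrite setTI; apply: sub_sigma_algebra => /=.
by apply: open_comp; [move=> x _; exact: coord_continuous | exact: interval_open].
Qed.

Lemma open_borel U : open U -> measurable (U : set (borel R n)).
Proof. by move=> oU; exact: sub_sigma_algebra. Qed.

Lemma closed_borel U : closed U -> measurable (U : set (borel R n)).
Proof.
by move=> cU; rewrite -[U]setCK; apply: measurableC; apply: open_borel; exact: closed_openC.
Qed.

Lemma continuous_borel_measurable (f : Rn -> R) :
  continuous f -> measurable_fun setT (f : borel R n -> R).
Proof.
move=> cf; apply: (measurability _ (measurable_realfun.RGenOpens.measurableE R)).
move=> _ [_ [a [b ->]] <-].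
rewrite setTI; apply: open_borel.
by apply: open_comp; [move=> x _; exact: cf | exact: interval_open].
Qed.

Lemma compact_closed_cube c r : compact [set x : Rn | `|x - c| <= r].
Proof.
apply: bounded_closed_compact.
  exists (`|c| + r); split; first exact: num_real.
  move=> s xr y /= yx; rewrite (le_trans _ (ltW xr))//.
  by rewrite -(subrK c y) addrC (le_trans (ler_normD _ _))// lerD2l.
rewrite (_ : [set y | _] = (fun y : Rn => `|y - c|) @^-1` [set s : R | s <= r])//.
apply: closed_comp; last exact: closed_le.
move=> y _; apply: continuous_comp; last exact: norm_continuous.
by apply: continuousB; [exact: cvg_id|exact: cst_continuous].
Qed.

Lemma compact_norm_le r : compact [set x : Rn | `|x| <= r].
Proof. by have := @compact_closed_cube 0 r; under eq_set do rewrite subr0. Qed.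

Lemma compact_tsupp {V : normedModType R} (f : Rn -> V) (M : R) :
  (forall x, M <= `|x| -> f x = 0) -> compact (tsupp f).
Proof.
move=> f0; apply: bounded_closed_compact; last exact: closed_closure.
exists M; split; first exact: num_real.
move=> t Mt x tx /=; apply: (le_trans _ (ltW Mt)).
have cM := compact_closed (@norm_hausdorff _ _) (@compact_norm_le M).
have : closure [set y : Rn | `|y| <= M] x.
  apply: closure_subset tx => y /= fy; rewrite leNgt; apply/negP => /ltW/f0 fy0.
  by rewrite fy0 eqxx in fy.
by rewrite -(closure_id _).1.
Qed.

Lemma tsupp_bounded {V : normedModType R} (f : Rn -> V) : compact (tsupp f) ->
  exists M : R, forall x, M <= `|x| -> f x = 0.
Proof.
move=> /compact_bounded[M [_ BM]]; exists (M + 2) => x xM; apply/eqP/negPn/negP => fx.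
have MM : M < M + 1 by rewrite ltrDl.
have : tsupp f x by exact: subset_closure.
by move/(BM _ MM) => /=; move: xM; set r := `|x|; lra.
Qed.

End Rn_measure.

Section lebesgue_measure_Rn.
Context {R : realType} {n : nat}.
Local Notation Rn := 'rV[R]_n.+1.
Local Notation louter := (@lebesgue_outer R n).
Implicit Types (x y a b : Rn) (A B U : set Rn).
Local Open Scope ereal_scope.

Let vol a b : R := (\prod_i (b 0 i - a 0 i))%R.

Let vol_ge0 a b : (forall i, a 0 i <= b 0 i)%R -> (0 <= vol a b)%R.
Proof. by move=> ab; apply: prodr_ge0 => i _; rewrite subr_ge0. Qed.

Lemma box_borel a b : measurable (box a b : set (borel R n)).
Proof.
apply: measurable_forall => i.
have := @coord_borel_measurable R n i measurableT `]a ord0 i, b ord0 i]%classic.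
rewrite setTI => /(_ (measurable_itv _)); congr measurable.
Qed.

Lemma lebesgue_outer_le_cover A (a b : nat -> Rn) :
  (forall k i, a k 0 i <= b k 0 i)%R -> A `<=` \bigcup_k box (a k) (b k) ->
  louter A <= \sum_(0 <= k <oo) (vol (a k) (b k))%:E.
Proof.
move=> ab Aab; apply: (@le_trans _ _ (\sum_(0 <= k <oo) box_vol (box (a k) (b k)))).
  apply: ereal_inf_lbound; exists (fun k => box (a k) (b k)) => //.
  by split => // k; exact: box_borel.
apply: lee_nneseries => [k _ _|k _ ]; first exact: box_vol_ge0.
by apply: ereal_inf_lbound; exists (a k, b k) => //; split=> // i; exact: ab.
Qed.

Lemma lebesgue_outer_cover A (e : R) : louter A < +oo -> (0 < e)%R ->
  exists a b : nat -> Rn, [/\ (forall k i, a k 0 i <= b k 0 i)%R,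
    A `<=` \bigcup_k box (a k) (b k) &
    \sum_(0 <= k <oo) (vol (a k) (b k))%:E <= louter A + e%:E].
Proof.
move=> Afin e0.
have e20 : (0 < e / 2)%R by rewrite divr_gt0.
have Anum : louter A \is a fin_num by rewrite ge0_fin_numE// outer_measure_ge0.
have [_ [F [mF AF] <-] FA] := lb_ereal_inf_adherent e20 Anum.
have Ffin k : box_vol (F k) < +oo.
  rewrite ltNge leye_eq; apply/negP => /eqP Fk.
  have : \sum_(0 <= k <oo) box_vol (F k) = +oo.
    by apply: (eseries_pinfty _ _ Fk) => // i _; rewrite gt_eqF// (lt_le_trans _ (box_vol_ge0 _))// ltNyr.
  by move=> h; move: FA; rewrite h ltNge leey.
have /choice[ab abP] k : exists ab : Rn * Rn, ((forall i, ab.1 0 i <= ab.2 0 i)%R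
     /\ box ab.1 ab.2 = F k) /\ (vol ab.1 ab.2)%:E <= box_vol (F k) + (e / 2 / (2 ^ k.+1)%:R)%:E.
  have ek : (0 < e / 2 / (2 ^ k.+1)%:R)%R by rewrite divr_gt0// ltr0n expn_gt0.
  have Fnum : box_vol (F k) \is a fin_num by rewrite ge0_fin_numE// box_vol_ge0.
  have [_ [ab h <-] hle] := lb_ereal_inf_adherent ek Fnum.
  by exists ab; split => //; exact: ltW.
exists (fun k => (ab k).1), (fun k => (ab k).2); split.
- by move=> k; exact: (abP k).1.1.
- by move=> x /AF[k _ Fx]; exists k => //; rewrite (abP k).1.2.
- apply: (@le_trans _ _ (\sum_(0 <= k <oo) box_vol (F k) + (e / 2)%:E)).
    apply: le_trans (epsilon_trick _ _ _) => //; last by rewrite ltW.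
      apply: lee_nneseries => [k _ _|k _]; last exact: (abP k).2.
      by rewrite lee_fin vol_ge0//; exact: (abP k).1.1.
    by move=> k; exact: box_vol_ge0.
  rewrite [in leRHS](splitr e) EFinD addeA leeD2r//; exact: ltW.
Qed.

(** A half space cuts a box into two boxes whose volumes add up. *)
Lemma halfspace_measurable i (c : R) : Lmeasurable ([set x | x 0 i <= c]%R : set Rn).
Proof.
apply: le_caratheodory_measurable => X.
set H := (X in _ `&` X); change (louter (X `&` H) + louter (X `&` ~` H) <= louter X); rewrite {}/H.
have [->|] := eqVneq (louter X) +oo; first by rewrite leey.
rewrite -ltey => Xfin; apply/lee_addgt0Pr => e e0.
have [a [b [ab Xab le]]] := lebesgue_outer_cover Xfin e0.
pose b' k : Rn := (\row_j if j == i then Num.max (a k 0 i) (Num.min (b k 0 i) c) else b k 0 j)%R.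
pose a' k : Rn := (\row_j if j == i then Num.min (b k 0 i) (Num.max (a k 0 i) c) else a k 0 j)%R.
have volD k : vol (a k) (b k) = (vol (a k) (b' k) + vol (a' k) (b k))%R.
  rewrite /vol (bigD1 i)//= [X in _ = (X + _)%R](bigD1 i)//= [X in _ = (_ + X)%R](bigD1 i)//= !mxE !eqxx.
  under [X in (_ = _ * X + _)%R]eq_bigr => j ji do rewrite mxE (negbTE ji).
  under [X in (_ = _ + _ * X)%R]eq_bigr => j ji do rewrite mxE (negbTE ji).
  rewrite -mulrDl; congr (_ * _)%R; have := ab k i.
  move: (a k 0%R i) (b k 0%R i) => ai bi abi.
  have [bc|/ltW cb] := leP bi c.
    by rewrite (max_r abi) (max_r (le_trans abi bc)) (min_l bc); lra.
  have [ac|/ltW ca] := leP ai c; first by rewrite (min_r cb); lra.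
  by rewrite (min_r abi); lra.
have ab' k j : (a k 0 j <= b' k 0 j)%R.
  by rewrite mxE; case: eqP => [->|_]; [rewrite le_max lexx|exact: ab].
have a'b k j : (a' k 0 j <= b k 0 j)%R.
  by rewrite mxE; case: eqP => [->|_]; [rewrite ge_min lexx|exact: ab].
apply: le_trans le; under eq_eseriesr do rewrite volD EFinD.
rewrite nneseriesD; last 2 first.
  by move=> k _ _; rewrite lee_fin vol_ge0.
  by move=> k _ _; rewrite lee_fin vol_ge0.
apply: leeD; apply: lebesgue_outer_le_cover => // x [/Xab[k _ xab]] /= xc.
  exists k => // j; rewrite mxE; have /andP[xa xb] := xab j; rewrite xa/=.
  by case: eqP => // ji; move: xa xb; rewrite ji le_max le_min xc => _ ->; rewrite orbT.
exists k => // j; rewrite mxE; have /andP[xa xb] := xab j; rewrite xb andbT.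
case: eqP => // ji; move: xa xb; rewrite ji gt_min gt_max => -> _.
by move/negP: xc; rewrite -ltNge => ->; rewrite orbT.
Qed.

Lemma coord_Lmeasurable i :
  measurable_fun setT (fun x : caratheodory_type louter => (x : Rn) 0%R i).
Proof.
apply: (measurability _ (measurable_realfun.RGenOInfty.measurableE R)).
move=> _ [_ [c ->] <-]; rewrite setTI.
have := measurableC (halfspace_measurable i c); congr (measurable _).
apply/seteqP; split=> x /=; rewrite in_itv/= andbT; first by move/negP; rewrite -ltNge.
by rewrite ltNge => /negP.
Qed.

(** The identity is measurable from the Caratheodory sigma-algebra to the Borel sets
    because its coordinates are, by [halfspace_measurable]. *)
Lemma borel_Lmeasurable A : measurable (A : set (borel R n)) -> Lmeasurable A.
Proof.
move=> mA; have := @measurable_fun_coord R n _ (caratheodory_type louter) id.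
by move=> /(_ coord_Lmeasurable measurableT _ mA); rewrite setTI.
Qed.

Lemma continuous_Lmeasurable (f : Rn -> R) :
  continuous f -> measurable_fun setT (f : caratheodory_type louter -> R).
Proof.
move=> cf _ B mB; apply: borel_Lmeasurable.
exact: continuous_borel_measurable.
Qed.

(** The affine map sends coverings by boxes to coverings by boxes and multiplies the
    volumes by the given factor; the inverse map gives the opposite inequality. *)
Lemma lebesgue_outer_affine (t : R) x A : (0 < t)%R ->
  louter ((fun y => t *: y + x)%R @^-1` A) = (t ^- n.+1)%:E * louter A.
Proof.
have le_affine (s : R) y B : (0 < s)%R ->
    louter ((fun z => s *: z + y)%R @^-1` B) <= (s ^- n.+1)%:E * louter B.
  move=> s0; have si : (0 < s^-1)%R by rewrite invr_gt0.
  have sn : (0 < s ^- n.+1)%R by rewrite invr_gt0 exprn_gt0.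
  have [->|] := eqVneq (louter B) +oo; first by rewrite gt0_muley ?leey// lte_fin.
  rewrite -ltey => Bfin.
  rewrite lee_pdivlMl ?exprn_gt0//; apply/lee_addgt0Pr => e e0.
  have [a [b [ab Bab le]]] := lebesgue_outer_cover Bfin e0.
  apply: le_trans le; rewrite -lee_pdivlMl ?exprn_gt0// -nneseriesZl; last first.
    by move=> k _ ; rewrite lee_fin vol_ge0.
  have -> : \sum_(0 <= k <oo) (s ^- n.+1)%:E * (vol (a k) (b k))%:E =
      \sum_(0 <= k <oo) (vol (s^-1 *: (a k - y)) (s^-1 *: (b k - y)))%:E.
    apply: eq_eseriesr => k _; rewrite -EFinM; congr EFin; rewrite /vol.
    rewrite [RHS](eq_bigr (fun i => s^-1 * (b k 0%R i - a k 0%R i)))%R.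
      by rewrite big_split/= prodr_const card_ord exprVn.
    by move=> i _; rewrite !mxE; ring.
  apply: lebesgue_outer_le_cover => [k i|z /Bab[k _ zab]].
    by rewrite !mxE ler_wpM2l ?(ltW si)// lerB// ab.
  exists k => // i; rewrite !mxE; have := zab i; rewrite !mxE.
  by rewrite -ltrBlDr -lerBrDr ltr_pdivrMl// ler_pdivlMl.
move=> t0; apply/eqP; rewrite eq_le le_affine//=.
have tn : (0 < t ^+ n.+1)%R by rewrite exprn_gt0.
rewrite lee_pdivrMl//.
rewrite [in leLHS](_ : A = (fun y => t^-1 *: y + - (t^-1 *: x))%R @^-1`
    ((fun y => t *: y + x)%R @^-1` A)); last first.
  apply/seteqP; split => y /=;
    by rewrite scalerDr scalerN !scalerA divff ?gt_eqF// !scale1r subrK.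
apply: le_trans (le_affine _ _ _ _) _; first by rewrite invr_gt0.
by rewrite exprVn invrK.
Qed.

Lemma affine_Lmeasurable (t : R) x A : (0 < t)%R -> Lmeasurable A ->
  Lmeasurable ((fun y => t *: y + x)%R @^-1` A).
Proof.
move=> t0 mA; apply: le_caratheodory_measurable => X; set f := (fun y => _).
pose g (y : Rn) := (t^-1 *: y + - (t^-1 *: x))%R.
have fg : X = f @^-1` (g @^-1` X).
  apply/seteqP; split => y /=;
    by rewrite /f/g scalerDr !scalerA mulVf ?gt_eqF// !scale1r addrK.
change (louter (X `&` f @^-1` A) + louter (X `&` ~` (f @^-1` A)) <= louter X).
have -> : X `&` f @^-1` A = f @^-1` (g @^-1` X `&` A).
  by rewrite preimage_setI -fg.
have -> : X `&` ~` (f @^-1` A) = f @^-1` (g @^-1` X `&` ~` A).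
  by rewrite preimage_setI preimage_setC -fg.
have -> : louter X = louter (f @^-1` (g @^-1` X)) by rewrite -fg.
rewrite le_eqVlt; apply/orP; left; apply/eqP/esym; rewrite !(@lebesgue_outer_affine t x _ t0).
have -> : louter (g @^-1` X) = louter (g @^-1` X `&` A) + louter (g @^-1` X `&` ~` A).
  exact: mA.
by rewrite ge0_muleDr// outer_measure_ge0.
Qed.

(** Induction on the dimension: the sections of a covering of the cube cover the cube of
    one dimension less, the section of a box is again a box, and the integral over the
    last coordinate restores the missing side.  The predicate [P] keeps the boxes that
    the section meets. *)
Lemma cover_cube_volume (m : nat) (P : pred nat) (a b : nat -> nat -> R) :
  (forall k i, a k i <= b k i)%R ->
  (forall x : nat -> R, (forall i, 0 < x i <= 1)%R ->
    exists k, P k /\ forall i, (i < m)%N -> (a k i < x i <= b k i)%R) ->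
  1 <= \sum_(0 <= k <oo) ((P k)%:R * \prod_(i < m) (b k i - a k i))%:E.
Proof.
move=> ab; elim: m P => [|m ih] P cov.
  have [|k [Pk _]] := cov (fun=> 1%R); first by move=> i; rewrite ltr01 lexx.
  have P0 i : 0 <= ((P i)%:R * \prod_(j < 0) (b i j - a i j))%:E.
    by rewrite big_ord0 mulr1 lee_fin ler0n.
  apply: le_trans (nneseries_lim_ge k.+1 _) => //=.
  by rewrite big_nat_recr//= Pk big_ord0 mulr1 leeDr// sume_ge0.
pose w k : R := ((P k)%:R * \prod_(i < m) (b k i - a k i))%R.
have w0 k : (0 <= w k)%R.
  by rewrite mulr_ge0// prodr_ge0// => i _; rewrite subr_ge0 ab.
pose J k := `]a k m, b k m]%classic : set R.
have sec t : `]0%R, 1%R]%classic t -> 1 <= \sum_(0 <= k <oo) (w k * \1_(J k) t)%:E.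
  rewrite /= in_itv/= => t01; have := ih (fun k => P k && (t \in J k)).
  rewrite (@eq_eseriesr _ _ (fun k => (w k * \1_(J k) t)%:E)); last first.
    by move=> k _; rewrite /w indicE; case: (P k); case: (t \in J k) => /=;
      rewrite ?mul1r ?mul0r ?mulr0 ?mulr1.
  apply => x x01; have [i|k [Pk xk]] := cov (fun i => if i == m then t else x i).
    by case: ifP.
  exists k; split; last first.
    by move=> i im; have := xk _ (ltnW im); rewrite (ltn_eqF im).
  by rewrite Pk inE /J/= in_itv/=; have := xk _ (ltnSn m); rewrite eqxx.
have mJ k : measurable (J k) by exact: measurable_itv.
have mw k : measurable_fun (`]0%R, 1%R]%classic : set R) (fun t => (w k * \1_(J k) t)%:E).
  apply/measurable_EFinP/measurable_funM; first exact: measurable_cst.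
  exact: measurable_indic.
have wp k t : 0 <= (w k * \1_(J k) t)%:E by rewrite lee_fin mulr_ge0// indicE ler0n.
apply: (@le_trans _ _ (\int[lebesgue_measure]_(t in `]0%R, 1%R]) cst 1 t)).
  rewrite integral_cst//= lebesgue_measure_itv/= lte_fin ltr01.
  by rewrite mul1e -EFinB subr0.
apply: (@le_trans _ _ (\int[lebesgue_measure]_(t in `]0%R, 1%R])
    \sum_(0 <= k <oo) (w k * \1_(J k) t)%:E)).
  apply: ge0_le_integral => //.
    by apply: ge0_emeasurable_sum => // k _; exact: mw.
rewrite integral_nneseries//; apply: lee_nneseries => [k _ _|k _].
  exact: integral_ge0.
apply: (@le_trans _ _ (\int[lebesgue_measure]_t (w k * \1_(J k) t)%:E)).
  apply: ge0_subset_integral => //; apply/measurable_EFinP/measurable_funM => //.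
  by apply/measurable_indicP; exact: mJ.
under eq_integral do rewrite EFinM.
rewrite ge0_integralZl//; last 2 first.
  by apply/measurable_EFinP/measurable_indicP; exact: mJ.
  by rewrite lee_fin w0.
rewrite integral_indic; [|exact: measurableT|exact: mJ].
rewrite setIT /J/= lebesgue_measure_itv/= big_ord_recr/= mulrA -/(w k).
case: ifPn => [_|]; first by rewrite -EFinB -EFinM.
by rewrite mule0 lee_fin mulr_ge0// subr_ge0 ab.
Qed.

Lemma leb_unit_cube : leb (box (const_mx 0%R : Rn) (const_mx 1%R)) = 1.
Proof.
apply/eqP; rewrite eq_le; apply/andP; split.
  pose c (k : nat) : R := (k == 0%N)%:R.
  apply: (@le_trans _ _ (\sum_(0 <= k <oo) (vol (const_mx 0%R : Rn) (const_mx (c k)))%:E)).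
    apply: lebesgue_outer_le_cover => [k i|x x01].
      by rewrite !mxE ler0n.
    by exists 0%N.
  rewrite (nneseries_split 0 1)//; last by move=> k _; rewrite lee_fin vol_ge0// => i; rewrite !mxE ler0n.
  rewrite big_nat1 eseries0 ?adde0; last first.
    by case=> // k _ _; rewrite /vol big_ord_recl !mxE subr0 mul0r.
  by rewrite /vol big1// => i _; rewrite !mxE subr0.
apply/lee_addgt0Pr => e e0; change (1 <= louter (box (const_mx 0%R : Rn) (const_mx 1%R)) + e%:E).
set C := box _ _; have [->|] := eqVneq (louter C) +oo; first by rewrite leey.
rewrite -ltey => Cfin; have [a [b [ab Cab]]] := lebesgue_outer_cover Cfin e0.
apply: le_trans.
apply: (@le_trans _ _ (\sum_(0 <= k <oo) (true%:R * \prod_(i < n.+1) (b k 0%R (inord i) - a k 0%R (inord i)))%:E)).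
  apply: (@cover_cube_volume n.+1 predT (fun k i => a k 0%R (inord i)) (fun k i => b k 0%R (inord i))).
    by move=> k i; exact: ab.
  move=> x x01; have /Cab[k _ xk] : C (\row_i x i) by move=> i; rewrite !mxE; exact: x01.
  by exists k; split => // i iN; have := xk (inord i); rewrite mxE inordK.
apply: lee_nneseries => [k _ _|k _]; rewrite lee_fin mul1r.
  by apply: prodr_ge0 => i _; rewrite subr_ge0.
rewrite le_eqVlt; apply/orP; left; apply/eqP; apply: eq_bigr => i _.
by rewrite inord_val.
Qed.

Lemma leb_ball_le x (r : R) : (0 < r)%R -> leb (ball x r) <= ((2 * r) ^+ n.+1)%:E.
Proof.
move=> r0; pose c (k : nat) : R := (k == 0%N)%:R.
apply: (@le_trans _ _ (\sum_(0 <= k <oo)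
    (vol (x - const_mx (c k * r))%R (x + const_mx (c k * r))%R)%:E)).
  apply: lebesgue_outer_le_cover => [k i|y].
    by rewrite !mxE lerD2l (@le_trans _ _ 0%R)// ?oppr_le0 mulr_ge0// ?ler0n// ltW.
  rewrite -ball_normE/= normr_rV_lt// => /forallP xy; exists 0%N => // i.
  have := xy i; rewrite !mxE /c eqxx mul1r ltr_distlC => /andP[-> ] /=.
  exact: ltW.
rewrite (nneseries_split 0 1)//; last first.
  move=> k _; rewrite lee_fin vol_ge0// => i.
  by rewrite !mxE lerD2l (@le_trans _ _ 0%R)// ?oppr_le0 mulr_ge0// ?ler0n// ltW.
rewrite big_nat1 eseries0 ?adde0; last first.
  by case=> // k _ _; rewrite /vol big_ord_recl !mxE /c/= mul0r oppr0 subrr mul0r.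
rewrite lee_fin /vol (eq_bigr (fun=> 2 * r)%R).
  by rewrite prodr_const card_ord.
by move=> i _; rewrite !mxE /c eqxx mul1r; ring.
Qed.

Lemma leb_ball_ge x (r : R) : (0 < r)%R -> ((r / 2) ^+ n.+1)%:E <= leb (ball x r).
Proof.
move=> r0; have s0 : (0 < r / 2)%R by rewrite divr_gt0.
have si : (0 < (r / 2)^-1)%R by rewrite invr_gt0.
have := leb_unit_cube; set C := box _ _ => C1.
have := @lebesgue_outer_affine _ (- ((r / 2)^-1 *: x))%R C si.
rewrite [louter C]C1 mule1 exprVn invrK => <-; apply: le_outer_measure => y /= Cy.
rewrite -ball_normE/= normr_rV_lt//; apply/forallP => i; have := Cy i.
rewrite !mxE -mulrBr ltr_pdivlMl// ler_pdivrMl// mulr0 mulr1 => /andP[h1 h2].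
by rewrite ltr_distlC; apply/andP; split; lra.
Qed.

(** Enlarging slightly the boxes of a covering makes it open. *)
Lemma lebesgue_outer_open A (e : R) : louter A < +oo -> (0 < e)%R ->
  exists U, [/\ open U, A `<=` U & louter U <= louter A + e%:E].
Proof.
move=> Afin e0; have e20 : (0 < e / 2)%R by rewrite divr_gt0.
have [a [b [ab Aab le]]] := lebesgue_outer_cover Afin e20.
have /choice[z zP] k : exists z, (0 < z)%R /\
    (vol (a k) (b k + const_mx z)%R <= vol (a k) (b k) + e / 2 / (2 ^ k.+1)%:R)%R.
  have ek : (0 < e / 2 / (2 ^ k.+1)%:R)%R by rewrite divr_gt0// ltr0n expn_gt0.
  have cv : vol (a k) (b k + const_mx z)%R @[z --> (0 : R)%R] --> vol (a k) (b k).
    apply: cvg_big; first exact: mul_continuous.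
    move=> i _; rewrite -[X in _ --> (X - _)%R]addr0.
    under eq_fun do rewrite !mxE.
    by apply: cvgB; [apply: cvgD; [exact: cvg_cst|exact: cvg_id]|exact: cvg_cst].
  move/cvgrPdist_lt : cv => /(_ _ ek) /nbhs_ballP[d /= d0 dP].
  exists (d / 2)%R; split; first by rewrite divr_gt0.
  have := dP (d / 2)%R; rewrite /ball/= sub0r normrN gtr0_norm ?divr_gt0//.
  have -> : (d / 2 < d)%R by lra.
  by move=> /(_ isT); rewrite ltr_distlC => /andP[_ /ltW].
pose O k := [set x : Rn | forall i, (a k 0%R i < x 0%R i < (b k + const_mx (z k)) 0%R i)%R].
exists (\bigcup_k O k); split.
- apply: bigcup_open => k _.
  by apply: open_forall => i; exact: open_coord_itv.
- move=> x /Aab[k _ xk]; exists k => // i; have /andP[-> /le_lt_trans] := xk i.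
  by apply; rewrite !mxE ltrDl; exact: (zP k).1.
- apply: (@le_trans _ _ (\sum_(0 <= k <oo) (vol (a k) (b k + const_mx (z k))%R)%:E)).
    apply: lebesgue_outer_le_cover => [k i|x [k _ xk]].
      by rewrite !mxE (le_trans (ab k i))// lerDl ltW//; exact: (zP k).1.
    by exists k => // i; have /andP[-> /ltW] := xk i.
  apply: (@le_trans _ _ (\sum_(0 <= k <oo) (vol (a k) (b k))%:E + (e / 2)%:E)).
    apply: le_trans (epsilon_trick _ _ _) => //; last by rewrite ltW.
      apply: lee_nneseries => [k _ _|k _].
        rewrite lee_fin vol_ge0// => i.
        by rewrite !mxE (le_trans (ab k i))// lerDl ltW//; exact: (zP k).1.
      by rewrite -EFinD lee_fin; exact: (zP k).2.
    by move=> k; rewrite lee_fin vol_ge0.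
  by rewrite [in leRHS](splitr e) EFinD addeA leeD2r.
Qed.

Lemma ball_Lmeasurable x (r : R) : Lmeasurable (ball x r).
Proof. by apply: borel_Lmeasurable; apply: open_borel; exact: (@ball_open R Rn). Qed.

Lemma leb_sigma_finite : sigma_finite setT (@leb R n).
Proof.
exists (fun k => ball (0%R : Rn) k.+1%:R).
  apply/seteqP; split => // x _; exists (Num.truncn `|x|)%R => //.
  by rewrite /= -ball_normE/= sub0r normrN truncnS_gt.
move=> k; split; first exact: ball_Lmeasurable.
by apply: le_lt_trans (leb_ball_le _ _) _ => //; rewrite ltry.
Qed.

End lebesgue_measure_Rn.

(** * Integrals of bounded functions with bounded support *)

HB.instance Definition _ (R : realType) (n : nat) :=
  Measure_isSigmaFinite.Build _ _ _ (@leb R n) (@leb_sigma_finite R n).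

Lemma integrable_le_indic d (T : measurableType d) (R : realType)
    (mu : {measure set T -> \bar R}) (A : set T) (f : T -> R) (M : R) :
  measurable A -> (mu A < +oo)%E -> 0 <= M -> measurable_fun setT f ->
  (forall x, `|f x| <= M * \1_A x) -> mu.-integrable setT (EFin \o f).
Proof.
move=> mA muA M0 mf fM; apply/integrableP; split; first exact/measurable_EFinP.
apply: (@le_lt_trans _ _ (\int[mu]_x (M%:E * (\1_A x)%:E)))%E.
  apply: ge0_le_integral => //.
  - by apply/measurable_EFinP; exact: measurableT_comp.
  - by apply/measurable_EFinP; apply: measurable_funM => //; exact/measurable_indicP.
  - by move=> x _; rewrite /= lee_fin.
rewrite ge0_integralZl//.
- by rewrite integral_indic// setIT lte_mul_pinfty.
- by apply/measurable_EFinP; exact/measurable_indicP.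
Qed.

Section integral_Rn.
Context {R : realType} {n : nat}.
Local Notation Rn := 'rV[R]_n.+1.
Local Notation LT := (caratheodory_type (@lebesgue_outer R n)).
Implicit Types (f g : Rn -> R) (A : set Rn).

Definition Lfun f := measurable_fun setT (f : LT -> R).

Definition lint f : R := fine (\int[leb]_x (f x)%:E)%E.

(** A class stable under the operations below, on which [lint] is the Lebesgue integral, by
    [lintE]; elsewhere [fine] may replace an infinite value by 0. *)
Definition Linfc f := Lfun f /\
  exists M : R, (forall x, `|f x| <= M) /\ (forall x, M <= `|x| -> f x = 0).

Lemma LfunD f g : Lfun f -> Lfun g -> Lfun (fun x => f x + g x).
Proof. exact: measurable_funD. Qed.

Lemma LfunB f g : Lfun f -> Lfun g -> Lfun (fun x => f x - g x).
Proof. exact: measurable_funB. Qed.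

Lemma LfunM f g : Lfun f -> Lfun g -> Lfun (fun x => f x * g x).
Proof. exact: measurable_funM. Qed.

Lemma Lfun_cst (c : R) : Lfun (fun=> c).
Proof. exact: measurable_cst. Qed.

Lemma Lfun_comp (phi : R -> R) f :
  continuous phi -> Lfun f -> Lfun (fun x => phi (f x)).
Proof. by move=> cphi mf; apply: measurableT_comp mf; exact: continuous_measurable_fun. Qed.

Lemma Lfun_norm f : Lfun f -> Lfun (fun x => `|f x|).
Proof. by apply: Lfun_comp; exact: norm_continuous. Qed.

Lemma Lfun_min f g : Lfun f -> Lfun g -> Lfun (fun x => Num.min (f x) (g x)).
Proof. exact: measurable_minr. Qed.

Lemma Lfun_max f g : Lfun f -> Lfun g -> Lfun (fun x => Num.max (f x) (g x)).
Proof. exact: measurable_maxr. Qed.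

Lemma Lfun_continuous f : continuous f -> Lfun f.
Proof. exact: continuous_Lmeasurable. Qed.

Lemma Lfun_sum (I : Type) (s : seq I) (F : I -> Rn -> R) :
  (forall i, Lfun (F i)) -> Lfun (fun x => \sum_(i <- s) F i x).
Proof.
move=> mF; elim: s => [|i s ih].
  by under eq_fun do rewrite big_nil; exact: Lfun_cst.
by under eq_fun do rewrite big_cons; exact: LfunD.
Qed.

Lemma Lfun_indic A : Lmeasurable A -> Lfun \1_A.
Proof. by move=> mA; apply/measurable_indicP. Qed.

Lemma Lfun_gt_measurable f (c : R) : Lfun f -> Lmeasurable [set x | c < f x].
Proof.
move=> mf; have := mf measurableT `]c, +oo[%classic (measurable_itv _).
rewrite setTI; congr (Lmeasurable _).
by apply/seteqP; split => x /=; rewrite in_itv/= andbT.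
Qed.

Lemma Linfc_le f g (C : R) : Linfc f -> Lfun g ->
  (forall x, `|g x| <= C * `|f x|) -> Linfc g.
Proof.
move=> [_ [M [fM f0]]] mg gf; split => //.
exists (Num.max M (`|C| * M)); split => x.
  rewrite le_max; apply/orP; right; apply: le_trans (gf x) _.
  apply: (@le_trans _ _ (`|C| * `|f x|)); first by rewrite ler_wpM2r// ler_norm.
  by rewrite ler_wpM2l.
rewrite ge_max => /andP[Mx _]; apply/eqP; rewrite -normr_eq0 eq_le normr_ge0 andbT.
by apply: le_trans (gf x) _; rewrite f0// normr0 mulr0.
Qed.

Lemma LinfcD f g : Linfc f -> Linfc g -> Linfc (fun x => f x + g x).
Proof.
move=> [mf [M [fM f0]]] [mg [N [gN g0]]]; split; first exact: LfunD.
have M0 : 0 <= M by apply: le_trans (fM 0).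
have N0 : 0 <= N by apply: le_trans (gN 0).
exists (M + N); split => x; first by rewrite (le_trans (ler_normD _ _))// lerD.
by move=> MNx; rewrite f0 ?g0 ?addr0//; apply: le_trans MNx; rewrite ?lerDl ?lerDr.
Qed.

Lemma Linfc0 : Linfc (fun=> 0).
Proof. by split; [exact: Lfun_cst|exists 0; split => x; rewrite ?normr0]. Qed.

Lemma Linfc_sum (I : Type) (s : seq I) (F : I -> Rn -> R) :
  (forall i, Linfc (F i)) -> Linfc (fun x => \sum_(i <- s) F i x).
Proof.
move=> mF; elim: s => [|i s ih].
  by under eq_fun do rewrite big_nil; exact: Linfc0.
by under eq_fun do rewrite big_cons; exact: LinfcD.
Qed.

Lemma LinfcMl f g (C : R) : Linfc f -> Lfun g -> (forall x, `|g x| <= C) ->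
  Linfc (fun x => g x * f x).
Proof.
move=> lf mg gC; apply: (Linfc_le (C := C) lf); first by apply: LfunM => //; exact: lf.1.
by move=> x; rewrite normrM ler_wpM2r.
Qed.

Lemma LinfcM f g : Linfc f -> Linfc g -> Linfc (fun x => f x * g x).
Proof. by move=> [mf [M [fM _]]] lg; exact: (LinfcMl lg mf fM). Qed.

Lemma LinfcZ (c : R) f : Linfc f -> Linfc (fun x => c * f x).
Proof.
by move=> lf; apply: (LinfcMl (C := `|c|) lf) => //; exact: Lfun_cst.
Qed.

Lemma LinfcN f : Linfc f -> Linfc (fun x => - f x).
Proof. by move/(LinfcZ (-1)); under eq_fun do rewrite mulN1r. Qed.

Lemma LinfcB f g : Linfc f -> Linfc g -> Linfc (fun x => f x - g x).
Proof. by move=> lf lg; apply: LinfcD => //; exact: LinfcN. Qed.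

Lemma Linfc_norm f : Linfc f -> Linfc (fun x => `|f x|).
Proof.
move=> lf; apply: (Linfc_le (C := 1) lf); first exact: Lfun_norm lf.1.
by move=> x; rewrite normr_id mul1r.
Qed.

Lemma Linfc_max f g : Linfc f -> Linfc g -> Linfc (fun x => Num.max (f x) (g x)).
Proof.
move=> lf lg; have l := LinfcD (Linfc_norm lf) (Linfc_norm lg).
apply: (Linfc_le (C := 1) l); first exact: Lfun_max lf.1 lg.1.
move=> x; rewrite mul1r [leRHS]ger0_norm ?addr_ge0//.
by case: (leP (f x) (g x)) => _; rewrite ?lerDl ?lerDr normr_ge0.
Qed.

Lemma Linfc_indic A (M : R) : Lmeasurable A -> (forall x, A x -> `|x| < M) ->
  Linfc \1_A.
Proof.
move=> mA AM; split; first exact: Lfun_indic.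
exists (Num.max 1 M); split => x; rewrite indicE.
  by case: (x \in A); rewrite ?normr1 ?normr0 le_max ?lexx ?ler01.
by rewrite ge_max => /andP[_ Mx]; rewrite memNset// => /AM; rewrite ltNge Mx.
Qed.

Lemma Linfc_continuous f (M : R) : continuous f ->
  (forall x, M <= `|x| -> f x = 0) -> Linfc f.
Proof.
move=> cf f0; split; first exact: Lfun_continuous.
have cB := @compact_norm_le R n M.
have [M' [_ fM']] : bounded_set (f @` [set x : Rn | `|x| <= M]).
  apply: compact_bounded; apply: continuous_compact => //.
  exact: continuous_subspaceT.
exists (Num.max M (Num.max 0 (M' + 1))); split => x.
  have [xM|/ltW /f0 ->] := leP `|x| M; last by rewrite normr0 !le_max lexx !orbT.
  have := fM' (M' + 1); rewrite ltrDl ltr01 => /(_ isT (f x)).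
  by move=> h; rewrite !le_max h ?orbT//; exists x.
by rewrite ge_max => /andP[+ _]; exact: f0.
Qed.

Lemma Linfc_integrable f : Linfc f -> leb.-integrable setT (EFin \o f : LT -> \bar R).
Proof.
move=> [mf [M [fM f0]]].
have M0 : 0 <= M by apply: le_trans (fM 0).
apply: (@integrable_le_indic _ _ _ leb (ball (0 : Rn) (M + 1)) f M) => //.
- exact: ball_Lmeasurable.
- by apply: le_lt_trans (leb_ball_le _ _) _; rewrite ?ltry// ltr_wpDl.
- move=> x; rewrite indicE.
  have [xM|xM] := ltP `|x| (M + 1); last first.
    by rewrite f0 ?normr0 ?mulr_ge0// (le_trans _ xM)// lerDl.
  by rewrite mem_set ?mulr1// -ball_normE/= sub0r normrN.
Qed.

Lemma lintE f : Linfc f -> (lint f)%:E = (\int[leb]_x (f x)%:E)%E.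
Proof. by move=> lf; rewrite /lint fineK// integrable_fin_num//; exact: Linfc_integrable. Qed.

Lemma lintD f g : Linfc f -> Linfc g -> lint (fun x => f x + g x) = lint f + lint g.
Proof.
move=> lf lg; apply: EFin_inj; rewrite EFinD !lintE//; last exact: LinfcD.
under eq_integral do rewrite EFinD.
by rewrite integralD//; exact: Linfc_integrable.
Qed.

Lemma lintZ (c : R) f : Linfc f -> lint (fun x => c * f x) = c * lint f.
Proof.
move=> lf; apply: EFin_inj; rewrite EFinM !lintE//; last exact: LinfcZ.
under eq_integral do rewrite EFinM.
by rewrite integralZl//; exact: Linfc_integrable.
Qed.

Lemma lintN f : Linfc f -> lint (fun x => - f x) = - lint f.
Proof.
by move=> lf; rewrite -mulN1r -lintZ//; congr lint; apply/funext => x; rewrite mulN1r.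
Qed.

Lemma lintB f g : Linfc f -> Linfc g -> lint (fun x => f x - g x) = lint f - lint g.
Proof. by move=> lf lg; rewrite lintD ?lintN//; exact: LinfcN. Qed.

Lemma lint0 : lint (fun=> 0) = 0.
Proof. by rewrite /lint integral0. Qed.

Lemma lint_sum (I : Type) (s : seq I) (F : I -> Rn -> R) :
  (forall i, Linfc (F i)) -> lint (fun x => \sum_(i <- s) F i x) = \sum_(i <- s) lint (F i).
Proof.
move=> mF; elim: s => [|i s ih].
  by rewrite big_nil -[RHS]lint0; congr lint; apply/funext => x; rewrite big_nil.
rewrite big_cons -ih -lintD//; last exact: Linfc_sum.
by congr lint; apply/funext => x; rewrite big_cons.
Qed.

Lemma le_lint f g : Linfc f -> Linfc g -> (forall x, f x <= g x) -> lint f <= lint g.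
Proof.
move=> lf lg fg; rewrite -lee_fin !lintE//.
by apply: le_integral => //; [exact: Linfc_integrable..|move=> x _; rewrite lee_fin].
Qed.

Lemma lint_ge0 f : (forall x, 0 <= f x) -> 0 <= lint f.
Proof. by move=> f0; apply: fine_ge0; apply: integral_ge0 => x _; rewrite lee_fin. Qed.

Lemma le_norm_lint f : Linfc f -> `|lint f| <= lint (fun x => `|f x|).
Proof.
move=> lf; have l := Linfc_norm lf; rewrite ler_norml; apply/andP; split.
  by rewrite -lintN//; apply: le_lint => //; [exact: LinfcN|move=> x; rewrite lerNl -normrN ler_norm].
by apply: le_lint => // x; exact: ler_norm.
Qed.

Lemma lint_indic A (M : R) : Lmeasurable A -> (forall x, A x -> `|x| < M) ->
  (lint \1_A)%:E = leb A.
Proof.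
move=> mA AM; rewrite lintE; last exact: Linfc_indic AM.
by rewrite integral_indic// setIT.
Qed.

Lemma null_Lmeasurable A : leb A = 0%E -> Lmeasurable A.
Proof.
move=> A0; apply: le_caratheodory_measurable => X.
rewrite [X in (X + _)%E](_ : _ = 0%E); last first.
  apply/eqP; rewrite eq_le outer_measure_ge0 andbT -A0.
  by apply: le_outer_measure; exact: subIsetr.
by rewrite add0e; apply: le_outer_measure; exact: subIsetl.
Qed.

Lemma lint_ae f g (N : set Rn) : Lfun f -> Lfun g -> leb N = 0%E ->
  (forall x, ~ N x -> f x = g x) -> lint f = lint g.
Proof.
move=> mf mg N0 fg; congr fine.
apply: (@ae_eq_integral _ _ _ leb setT); [exact: measurableT|exact/measurable_EFinP..|].
exists N; split => //; first exact: null_Lmeasurable.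
by move=> x /= nfg; apply: contrapT => Nx; apply: nfg => _; rewrite fg.
Qed.

Lemma lint_cvg (f_ : nat -> Rn -> R) f g : (forall k, Lfun (f_ k)) -> Linfc g ->
  (forall k x, `|f_ k x| <= g x) -> (forall x, f_ ^~ x @ \oo --> f x) ->
  Linfc f /\ lint (f_ k) @[k --> \oo] --> lint f.
Proof.
move=> mf_ lg fg cf.
have mf : Lfun f by apply: (measurable_fun_cvg mf_) => x _; exact: cf.
have fgx x : `|f x| <= g x.
  apply: (@closed_cvg _ _ \oo _ (fun k => `|f_ k x|) [set r : R | r <= g x]).
  - exact: closed_le.
  - by apply: nearW => k; exact: fg.
  - by apply: cvg_norm; exact: cf.
have lf : Linfc f.
  apply: (Linfc_le (C := 1) lg) => // x; rewrite mul1r (le_trans (fgx x))//.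
  exact: ler_norm.
split => //.
have lfk k : Linfc (f_ k).
  apply: (Linfc_le (C := 1) lg) => // x; rewrite mul1r (le_trans (fg k x))//.
  exact: ler_norm.
have := @dominated_convergence _ _ _ leb setT measurableT
  (fun k x => (f_ k x)%:E : \bar R) (EFin \o f : LT -> \bar R) (EFin \o g).
case.
- by move=> k; exact/measurable_EFinP/mf_.
- exact/measurable_EFinP.
- by apply: aeW => x _; apply/cvg_EFin; [exact: nearW|exact: cf].
- exact: Linfc_integrable.
- by apply: aeW => x k _; rewrite lee_fin.
move=> _ _; rewrite -lintE// => cv; apply/fine_cvg.
exact: cv.
Qed.

Lemma LinfcP f : Lfun f -> forall M N : R, (forall x, `|f x| <= M) ->
  (forall x, N <= `|x| -> f x = 0) -> Linfc f.
Proof.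
move=> mf M N fM f0; split => //; exists (Num.max M N); split => x.
  by rewrite le_max fM.
by rewrite ge_max => /andP[_]; exact: f0.
Qed.

Let affine_fun (t : R) (v : Rn) (x : LT) : LT := (t *: (x : Rn) + v).

Let measurable_affine (t : R) (v : Rn) : 0 < t -> measurable_fun setT (affine_fun t v).
Proof. by move=> t0 _ A mA; rewrite setTI; exact: affine_Lmeasurable. Qed.

Let ge0_integral_affine (t : R) (v : Rn) (g : LT -> \bar R) : 0 < t ->
  measurable_fun setT g -> (forall x, 0 <= g x)%E ->
  (\int[leb]_x g (affine_fun t v x) = (t ^- n.+1)%:E * \int[leb]_x g x)%E.
Proof.
move=> t0 mg g0; have mphi := measurable_affine v t0.
have := @ge0_integral_pushforward _ _ _ _ _ _ mphi leb setT g measurableT mg (fun y _ => g0 y).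
rewrite preimage_setT => <-.
have tn : 0 <= t ^- n.+1 by rewrite invr_ge0 exprn_ge0// ltW.
rewrite -(@ge0_integral_mscale _ _ _ leb setT measurableT (NngNum tn))//.
apply: eq_measure_integral => A mA _.
exact: lebesgue_outer_affine.
Qed.

Lemma Linfc_affine (t : R) (v : Rn) f : 0 < t -> Linfc f ->
  Linfc (fun x => f (t *: x + v)).
Proof.
move=> t0 [mf [M [fM f0]]].
apply: (@LinfcP _ _ M ((M + `|v|) / t)) => //.
  exact: (measurableT_comp mf (measurable_affine v t0)).
move=> x; rewrite ler_pdivrMr// => h; apply: f0.
have := ler_normB (t *: x + v) v; rewrite addrK normrZ (gtr0_norm t0) => h2.
by rewrite -(lerD2r `|v|) (le_trans h)// mulrC.
Qed.

Lemma lint_affine (t : R) (v : Rn) f : 0 < t -> Linfc f ->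
  lint (fun x => f (t *: x + v)) = t ^- n.+1 * lint f.
Proof.
move=> t0; have pos g : Linfc g -> (forall x, 0 <= g x) ->
    lint (fun x => g (t *: x + v)) = t ^- n.+1 * lint g.
  move=> lg g0; rewrite /lint -[RHS](fineM (x := (t ^- n.+1)%:E))//; last first.
    by rewrite -lintE.
  congr fine; have mg : measurable_fun setT (fun x : LT => (g x)%:E).
    exact/measurable_EFinP/lg.1.
  by have := ge0_integral_affine v t0 mg (fun x => g0 x).
move=> lf; pose p x := Num.max (f x) 0; pose q x := Num.max (- f x) 0.
have lp : Linfc p by apply: Linfc_max => //; exact: Linfc0.
have lq : Linfc q by apply: Linfc_max => //; [exact: LinfcN|exact: Linfc0].
have fpq : f = fun x => p x - q x.
  by apply/funext => x; rewrite /p /q; case: (leP (f x) 0) => f0;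
    case: (leP (- f x) 0) => f1; lra.
rewrite [in RHS]fpq lintB// mulrBr -!pos//; [|by move=> x; rewrite le_max lexx orbT..].
by rewrite -lintB//; [rewrite {1}fpq|exact: Linfc_affine..].
Qed.

Lemma Linfc_shift (v : Rn) f : Linfc f -> Linfc (fun x => f (x + v)).
Proof. by move/(Linfc_affine v ltr01); under eq_fun do rewrite scale1r. Qed.

Lemma lint_shift (v : Rn) f : Linfc f -> lint (fun x => f (x + v)) = lint f.
Proof.
move/(lint_affine v ltr01); under eq_fun do rewrite scale1r.
by rewrite expr1n invr1 mul1r.
Qed.

Definition Linfc2 (F : Rn -> Rn -> R) :=
  measurable_fun setT (fun z : LT * LT => F z.1 z.2) /\
  exists M : R, (forall x y, `|F x y| <= M) /\
    (forall x y, M <= `|x| \/ M <= `|y| -> F x y = 0).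

Lemma Linfc2_swap F : Linfc2 F -> Linfc2 (fun x y => F y x).
Proof.
move=> [mF [M [FM F0]]]; split.
  exact: (measurableT_comp mF (@measurable_swap _ _ LT LT)).
by exists M; split => // x y [] ?; apply: F0; [right|left].
Qed.

Lemma Linfc2_section F x : Linfc2 F -> Linfc (F x).
Proof.
move=> [mF [M [FM F0]]]; split.
  exact: (measurable_fun_pair2 (x : LT) mF).
by exists M; split => // y My; apply: F0; right.
Qed.

Lemma Linfc2_integrable F : Linfc2 F ->
  (leb \x leb)%E.-integrable setT (fun z : LT * LT => (F z.1 z.2)%:E).
Proof.
move=> [mF [M [FM F0]]]; have M0 : 0 <= M by apply: le_trans (FM 0 0).
have mB : measurable (ball (0 : Rn) (M + 1) : set LT) by exact: ball_Lmeasurable.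
have Bfin : (leb (ball (0%R : Rn) (M + 1)%R) < +oo)%E.
  by apply: le_lt_trans (leb_ball_le _ _) _; rewrite ?ltry// ltr_wpDl.
set B := ball _ _ in mB Bfin.
apply: (@integrable_le_indic _ _ _ (leb \x leb)%E ((B : set LT) `*` (B : set LT))
  (fun z : LT * LT => F z.1 z.2) M) => //.
- exact: measurableX.
- rewrite [X in (X < _)%E](_ : _ = (leb B * leb B)%E).
    by rewrite lte_mul_pinfty// ge0_fin_numE.
  exact: product_measure1E.
- move=> [x y]; rewrite indicE/=.
  have [[Bx By]|nB] := pselect ((B `*` B) (x, y)).
    by rewrite mem_set ?mulr1.
  rewrite F0 ?normr0 ?mulr_ge0//; apply: contrapT => /not_orP[/negP + /negP].
  rewrite -!ltNge => xM yM; apply: nB; split; rewrite /B -ball_normE/= sub0r normrN.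
    by rewrite (lt_le_trans xM)// lerDl.
  by rewrite (lt_le_trans yM)// lerDl.
Qed.

Lemma Linfc2_lint F : Linfc2 F -> Linfc (fun x => lint (F x)).
Proof.
move=> lF; have lx := fun x => Linfc2_section x lF.
have [mF [M [FM F0]]] := lF; have M0 : 0 <= M by apply: le_trans (FM 0 0).
apply: (@LinfcP _ _ (M * lint \1_(ball (0 : Rn) (M + 1))) M).
- apply/measurable_EFinP.
  have := measurable_fubini_F (Linfc2_integrable lF).
  by congr measurable_fun; apply/funext => x; rewrite /= lintE.
- have lB : Linfc (\1_(ball (0 : Rn) (M + 1))).
    apply: (Linfc_indic (M := M + 1)); first exact: ball_Lmeasurable.
    by move=> x; rewrite -ball_normE/= sub0r normrN.
  move=> x; apply: le_trans (le_norm_lint (lx x)) _.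
  rewrite -lintZ//; apply: le_lint => [||y].
  + exact: Linfc_norm.
  + exact: LinfcZ.
  rewrite indicE; have [yM|yM] := ltP `|y| (M + 1); last first.
    by rewrite F0 ?normr0 ?mulr_ge0//; right; rewrite (le_trans _ yM)// lerDl.
  by rewrite mem_set ?mulr1// -ball_normE/= sub0r normrN.
- move=> x Mx; rewrite -[RHS]lint0; congr lint; apply/funext => y.
  by apply: F0; left.
Qed.

Lemma lint_exchange F : Linfc2 F ->
  lint (fun x => lint (F x)) = lint (fun y => lint (F^~ y)).
Proof.
move=> lF; have lF' := Linfc2_swap lF.
apply: EFin_inj; rewrite !lintE; [|exact: Linfc2_lint..].
rewrite (eq_integral (fun x : LT => \int[leb]_y (F x y)%:E)%E); last first.
  by move=> x _; rewrite lintE//; exact: Linfc2_section.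
rewrite [RHS](eq_integral (fun y : LT => \int[leb]_x (F x y)%:E)%E); last first.
  by move=> x _; rewrite lintE//; exact: (Linfc2_section _ lF').
exact: (Fubini (Linfc2_integrable lF)).
Qed.

End integral_Rn.

(** * Continuous differentiability and integration by parts *)

Section continuous_functions.
Context {R : realType} {T : topologicalType}.
Implicit Types f g : T -> R.

Lemma continuous_add f g : continuous f -> continuous g -> continuous (fun x => f x + g x).
Proof. by move=> cf cg x; apply: cvgD; [exact: cf|exact: cg]. Qed.

Lemma continuous_mul f g : continuous f -> continuous g -> continuous (fun x => f x * g x).
Proof. by move=> cf cg x; apply: cvgM; [exact: cf|exact: cg]. Qed.

Lemma continuous_compR (phi : R -> R) f :
  continuous phi -> continuous f -> continuous (fun x => phi (f x)).
Proof. by move=> cphi cf x; apply: continuous_comp; [exact: cf|exact: cphi]. Qed.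

Lemma continuous_sum (I : Type) (s : seq I) (F : I -> T -> R) :
  (forall i, continuous (F i)) -> continuous (fun x => \sum_(i <- s) F i x).
Proof.
move=> cF; elim: s => [|i s ih].
  by under eq_fun do rewrite big_nil; exact: cst_continuous.
by under eq_fun do rewrite big_cons; exact: continuous_add.
Qed.

Lemma continuous_scale (c : R) f : continuous f -> continuous (fun x => c * f x).
Proof. by apply: continuous_mul; exact: cst_continuous. Qed.

End continuous_functions.

Section partial_derivatives.
Context {R : realType} {n : nat}.
Local Notation Rn := 'rV[R]_n.+1.
Implicit Types (f g : Rn -> R) (x v : Rn) (i : 'I_n.+1).
Local Notation e_ i := (delta_mx 0 i : Rn).

Let line_quotient f x v (t : R) :
  (fun h : R => h^-1 *: (((fun s : R => f (x + s *: v)) \o shift t) (h *: (1 : R)) - f (x + t *: v))) =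
  (fun h : R => h^-1 *: ((f \o shift (x + t *: v)) (h *: v) - f (x + t *: v))).
Proof.
apply/funext => h /=; congr (_ *: (f _ - _)).
by rewrite [h *: (1 : R)]mulr1 scalerDl addrCA addrC.
Qed.

Lemma is_derive_line f x v t (d : R) :
  is_derive (x + t *: v) v f d <-> is_derive t 1 (fun s : R => f (x + s *: v)) d.
Proof.
split=> -[df fd]; split.
- by rewrite /derivable line_quotient.
- by rewrite /derive line_quotient.
- by rewrite /derivable -line_quotient.
- by rewrite /derive -line_quotient.
Qed.

Lemma is_derive_line0 f x v (d : R) :
  is_derive x v f d <-> is_derive (0 : R) (1 : R) (fun s : R => f (x + s *: v)) d.
Proof. by rewrite -is_derive_line scale0r addr0. Qed.

Lemma C1_is_derive f i x : C1 f -> is_derive x (e_ i) f (partial i f x).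
Proof. by move=> /(_ i)[+ _] => /(_ x) df; split. Qed.

Lemma partialE f i x (d : R) : is_derive x (e_ i) f d -> partial i f x = d.
Proof. by move=> h; rewrite /partial derive_val. Qed.

(** The form in which continuous differentiability is established below. *)
Lemma C1I f (f' : 'I_n.+1 -> Rn -> R) :
  (forall i x, is_derive x (e_ i) f (f' i x)) -> (forall i, continuous (f' i)) ->
  C1 f /\ forall i, partial i f = f' i.
Proof.
move=> ff' cf'; have pf i : partial i f = f' i.
  by apply/funext => x; exact: partialE.
split=> // i; split; last by rewrite pf.
by move=> x; exact: ex_derive.
Qed.

Lemma mean_value_le f i x (t M : R) : (forall y, derivable f y (e_ i)) ->
  (forall s, `|s| <= `|t| -> `|partial i f (x + s *: e_ i)| <= M) ->
  `|f (x + t *: e_ i) - f x| <= M * `|t|.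
Proof.
move=> df fM; pose g s := f (x + s *: e_ i).
have dg (s : R) : is_derive s (1 : R) g (partial i f (x + s *: e_ i)).
  by apply/is_derive_line; split => //; exact: df.
have cg : continuous g.
  by move=> s; apply/differentiable_continuous/derivable1_diffP; exact: ex_derive.
have -> : f x = g 0 by rewrite /g scale0r addr0.
rewrite -/(g t).
have [t0|t0|<-] := ltgtP 0 t; last by rewrite subrr !normr0 mulr0.
- have [s st ->] := MVT t0 (fun s _ => dg s) (continuous_subspaceT cg).
  rewrite subr0 normrM ler_wpM2r// fM// !ger0_norm ?ltW//.
    by move: st; rewrite in_itv/= => /andP[_].
  by move: st; rewrite in_itv/= => /andP[].
- have [s st] := MVT t0 (fun s _ => dg s) (continuous_subspaceT cg).
  rewrite distrC => ->; rewrite sub0r normrM normrN ler_wpM2r// fM//.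
  move: st; rewrite in_itv/= => /andP[ts s0].
  by rewrite !ltr0_norm// lerN2 ltW.
Qed.

(** Going from [x] to [y] by changing the coordinates one at a time stays in a cube
    around [x], where the partial derivatives are bounded. *)
Lemma C1_continuous f : C1 f -> continuous f.
Proof.
move=> cf x; apply/(@cvgrPdist_le _ _ _ (nbhs (x : Rn))) => e e0.
have [M M0 fM] : exists2 M : R, 0 < M & forall i y, `|y - x| <= 1 -> `|partial i f y| <= M.
  have cB := @compact_closed_cube R n x 1.
  have bM i : exists2 M : R, 0 < M & forall y, `|y - x| <= 1 -> `|partial i f y| <= M.
    have [M [_ fM]] : bounded_set (partial i f @` [set y : Rn | `|y - x| <= 1]).
      apply: compact_bounded; apply: continuous_compact => //.
      by apply: continuous_subspaceT; exact: (cf i).2.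
    exists (Num.max 1 (M + 1)); first by rewrite lt_max ltr01.
    move=> y yx; rewrite le_max; apply/orP; right.
    by apply: (fM (M + 1)); rewrite ?ltrDl ?ltr01//; exists y.
  have [M_ M_P] := choice (fun i => let: ex_intro2 M h1 h2 := bM i in ex_intro (fun M => 0 < M /\ forall y, `|y - x| <= 1 -> `|partial i f y| <= M) M (conj h1 h2)).
  exists (\sum_i M_ i) => [|i y yx].
    rewrite (bigD1 ord0)//= ltr_wpDr//; last exact: (M_P ord0).1.
    by apply: sumr_ge0 => i _; rewrite ltW//; exact: (M_P i).1.
  rewrite (le_trans ((M_P i).2 y yx))// (bigD1 i)//= lerDl sumr_ge0// => j _.
  by rewrite ltW//; exact: (M_P j).1.
have dM : 0 < Num.min 1 (e / (M * n.+1%:R)) by rewrite lt_min ltr01 divr_gt0// mulr_gt0.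
near=> y.
have : `|x - y| < Num.min 1 (e / (M * n.+1%:R)) by near: y; exact: cvgr_dist_lt.
rewrite distrC lt_min => /andP[xy1 xye].
pose z (k : nat) : Rn := \row_j if (j < k)%N then y 0 j else x 0 j.
have zx k : `|z k - x| <= `|y - x|.
  rewrite [leLHS]/Num.Def.normr/= mx_normrE; apply: bigmax_le => // -[i j] _ /=.
  rewrite ord1 !mxE; case: ifP => _; last by rewrite subrr normr0.
  by have := normr_coord_le (y - x) j; rewrite !mxE.
have -> : x = z 0 by apply/rowP => j; rewrite mxE.
have -> : y = z n.+1 by apply/rowP => j; rewrite mxE ltn_ord.
rewrite distrC -(telescope_sumr (fun k => f (z k)))//.
rewrite (le_trans (ler_norm_sum _ _ _))//.
rewrite big_mkord.
apply: (@le_trans _ _ (\sum_(k < n.+1) M * `|y - x|)); last first.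
  rewrite sumr_const card_ord -mulr_natr -mulrA (mulrC `|_|) mulrA.
  by rewrite -ler_pdivlMl ?mulr_gt0// mulrC ltW.
apply: ler_sum => k _; have zS : z k.+1 = z k + (y 0 k - x 0 k) *: e_ k.
  apply/rowP => j; rewrite !mxE eqxx/= ltnS leq_eqVlt.
  have [jk|jk] := eqVneq j k; first by rewrite jk eqxx ltnn/= mulr1 addrC subrK.
  by rewrite (_ : (j == k :> nat) = false) ?(negbTE jk) ?mulr0 ?addr0//; exact/negbTE.
rewrite zS; apply: le_trans (mean_value_le (M := M) _ _) _.
- by move=> w; exact: (cf k).1.
- move=> s sk; apply: fM.
  rewrite [leLHS]/Num.Def.normr/= mx_normrE; apply: bigmax_le => // -[i j] _ /=.
  rewrite ord1 !mxE/=; have [->|jk] := eqVneq j k.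
    rewrite ltnn mulr1 addrC addKr (le_trans sk)// ltW// (le_lt_trans _ xy1)//.
    by have := normr_coord_le (y - x) k; rewrite !mxE.
  rewrite mulr0 addr0; have := zx k; have := normr_coord_le (z k - x) j.
  by rewrite !mxE => h1 h2; rewrite (le_trans h1)// (le_trans h2)// ltW.
- apply: ler_wpM2l; first exact: ltW.
  by have := normr_coord_le (y - x) k; rewrite !mxE.
Unshelve. all: by end_near. Qed.

Lemma C1_cst (c : R) :
  C1 (fun _ : Rn => c) /\ forall i, partial i (fun _ : Rn => c) = fun=> 0.
Proof. by apply: C1I => i; exact: cst_continuous. Qed.

Lemma C1D f g : C1 f -> C1 g -> C1 (fun x => f x + g x) /\
  forall i, partial i (fun x => f x + g x) = fun x => partial i f x + partial i g x.
Proof.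
move=> cf cg; apply: C1I => [i x|i].
  by apply: is_deriveD; exact: C1_is_derive.
by apply: continuous_add; [exact: (cf i).2|exact: (cg i).2].
Qed.

Lemma C1M f g : C1 f -> C1 g -> C1 (fun x => f x * g x) /\
  forall i, partial i (fun x => f x * g x) =
    fun x => f x * partial i g x + partial i f x * g x.
Proof.
move=> cf cg; apply: C1I => [i x|i].
  have := is_deriveM (C1_is_derive i x cf) (C1_is_derive i x cg).
  by move=> h; apply: is_derive_eq h _; rewrite [_ *: _]mulrC [g x *: _]mulrC [partial i g x * _]mulrC.
apply: continuous_add; apply: continuous_mul.
- exact: C1_continuous.
- exact: (cg i).2.
- exact: (cf i).2.
- exact: C1_continuous.
Qed.

Lemma C1_comp (phi phi' : R -> R) f : (forall r : R, is_derive r (1 : R) phi (phi' r)) ->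
  continuous phi' -> C1 f -> C1 (fun x => phi (f x)) /\
  forall i, partial i (fun x => phi (f x)) = fun x => phi' (f x) * partial i f x.
Proof.
move=> dphi cphi' cf; apply: C1I => [i x|i].
  apply/is_derive_line0.
  have := @is_derive1_comp _ phi (fun s : R => f (x + s *: e_ i)) 0 (phi' (f x)) (partial i f x).
  rewrite /comp => h; apply: h; last by apply/is_derive_line0; exact: C1_is_derive.
  by rewrite scale0r addr0.
apply: continuous_mul; last exact: (cf i).2.
by apply: continuous_compR; [exact: cphi'|exact: C1_continuous].
Qed.

Lemma C1Z (c : R) f : C1 f -> C1 (fun x => c * f x) /\
  forall i, partial i (fun x => c * f x) = fun x => c * partial i f x.
Proof.
move=> cf; have [c1 pc] := C1M (C1_cst c).1 cf; split => // i.
by apply/funext => x; rewrite pc (C1_cst c).2 mul0r addr0.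
Qed.

Lemma C1N f : C1 f -> C1 (fun x => - f x) /\
  forall i, partial i (fun x => - f x) = fun x => - partial i f x.
Proof.
move=> /(C1Z (-1))[c1 p1]; split => [|i].
  by move: c1; under eq_fun do rewrite mulN1r.
rewrite -[RHS](_ : (fun x => -1 * partial i f x) = _); last first.
  by apply/funext => x; rewrite mulN1r.
by rewrite -p1; congr partial; apply/funext => x; rewrite mulN1r.
Qed.

Lemma C1B f g : C1 f -> C1 g -> C1 (fun x => f x - g x) /\
  forall i, partial i (fun x => f x - g x) = fun x => partial i f x - partial i g x.
Proof.
move=> cf cg; have [cN pN] := C1N cg; have [cD pD] := C1D cf cN.
by split => // i; apply/funext => x; rewrite pD pN.
Qed.

Definition C1c f := C1 f /\ exists M : R, forall x, M <= `|x| -> f x = 0.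

Lemma partial_eq0 f i x (U : set Rn) : open U -> U x -> (forall y, U y -> f y = 0) ->
  partial i f x = 0.
Proof.
move=> oU Ux f0; rewrite /partial /derive (_ : f x = 0) ?f0//.
apply: cvg_lim => //; apply: cvg_near_cst.
have cl : {for (0 : R), continuous (fun h : R => h *: e_ i + x)}.
  move=> /=; apply: cvgD; last exact: cvg_cst.
  by apply: cvgZr_tmp; exact: cvg_id.
have /= := cl _ (open_nbhs_nbhs (conj oU _)).
rewrite scale0r add0r => /(_ Ux) h.
have h' : \forall t \near (0 : R)^', U (t *: e_ i + x) by apply: cvg_within; exact: h.
by apply: filterS h' => t /= /f0 ->; rewrite subr0 scaler0.
Qed.

Lemma C1c_partial_supp f i : C1c f -> exists M : R, forall x, M <= `|x| -> partial i f x = 0.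
Proof.
move=> [_ [M f0]]; exists (M + 1) => x Mx.
apply: (@partial_eq0 _ _ _ [set y : Rn | M < `|y|]).
- rewrite (_ : [set y | _] = (fun y : Rn => `|y|) @^-1` [set r : R | M < r])//.
  by apply: open_comp; [move=> y _; exact: norm_continuous|exact: open_gt].
- by rewrite /= (lt_le_trans _ Mx)// ltrDl.
- by move=> y /ltW /f0.
Qed.

Lemma C1c_Linfc f : C1c f -> Linfc f.
Proof. by move=> [cf [M f0]]; apply: Linfc_continuous f0; exact: C1_continuous. Qed.

Lemma C1c_partial_Linfc f i : C1c f -> Linfc (partial i f).
Proof.
move=> cf; have [M f0] := C1c_partial_supp i cf.
by apply: Linfc_continuous f0; exact: (cf.1 i).2.
Qed.

Lemma C1cD f g : C1c f -> C1c g -> C1c (fun x => f x + g x).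
Proof.
move=> [cf [M f0]] [cg [N g0]]; split; first exact: (C1D cf cg).1.
exists (Num.max M N) => x; rewrite ge_max => /andP[Mx Nx].
by rewrite f0// g0// addr0.
Qed.

Lemma C1cM f g : C1c f -> C1 g -> C1c (fun x => f x * g x).
Proof.
move=> [cf [M f0]] cg; split; first exact: (C1M cf cg).1.
by exists M => x /f0 ->; rewrite mul0r.
Qed.

Lemma C1cMr f g : C1 f -> C1c g -> C1c (fun x => f x * g x).
Proof. by move=> cf cg; under eq_fun do rewrite mulrC; exact: C1cM. Qed.

Lemma C1cZ (c : R) f : C1c f -> C1c (fun x => c * f x).
Proof. by apply: C1cMr; exact: (C1_cst c).1. Qed.

Lemma C1cN f : C1c f -> C1c (fun x => - f x).
Proof. by move=> /(C1cZ (-1)); under eq_fun do rewrite mulN1r. Qed.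

Lemma C1c0 : C1c (fun=> 0).
Proof. by split; [exact: (C1_cst 0).1|exists 0]. Qed.

Let inv0 (k : nat) : 0 < (k.+1%:R : R)^-1.
Proof. by rewrite invr_gt0. Qed.

Lemma normr_delta i (t : R) : `|t *: e_ i| <= `|t|.
Proof.
rewrite [leLHS]/Num.Def.normr/= mx_normrE; apply: bigmax_le => // -[a j] _ /=.
rewrite ord1 !mxE eqxx/=; case: (j == i); rewrite ?mulr1// mulr0 normr0.
exact: normr_ge0.
Qed.

(** The mean value theorem dominates the difference quotients, so that the derivative
    can be replaced by them under the integral sign. *)
Lemma quotient_cvg f i (t : R) : C1c f -> exists g : Rn -> R, [/\ Linfc g,
  forall k x, `|k.+1%:R * (f (x + (t / k.+1%:R) *: e_ i) - f x)| <= g x &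
  forall x, k.+1%:R * (f (x + (t / k.+1%:R) *: e_ i) - f x) @[k --> \oo] -->
    t * partial i f x].
Proof.
move=> cf; have [_ [C [fC _]]] := C1c_partial_Linfc i cf.
have [M f0] := cf.2.
have C0 : 0 <= C by apply: le_trans (fC 0).
pose B : set Rn := ball (0 : Rn) (M + `|t| + 1).
exists (fun x => C * `|t| * \1_B x); split.
- apply: LinfcZ; apply: (Linfc_indic (M := M + `|t| + 1)); first exact: ball_Lmeasurable.
  by move=> x; rewrite /B -ball_normE/= sub0r normrN.
- move=> k x; rewrite indicE; have k0 : (0 : R) < k.+1%:R by [].
  have [Bx|nBx] := boolP (x \in B).
    rewrite mulr1 normrM (gtr0_norm k0) -ler_pdivlMl//.
    apply: le_trans (mean_value_le (M := C) _ _) _.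
    + by move=> y; exact: (cf.1 i).1.
    + by move=> s _; exact: fC.
    + by rewrite normrM (gtr0_norm (inv0 k)) mulrA mulrC.
  rewrite !mulr0; have Mx : M + `|t| + 1 <= `|x|.
    move: nBx; rewrite notin_setE /B -ball_normE/= sub0r normrN => /negP.
    by rewrite -leNgt.
  have tk : `|t / k.+1%:R| <= `|t|.
    rewrite normrM (gtr0_norm (inv0 k)) ler_piMr// invf_le1// ler1n//.
  rewrite [f x]f0; last by rewrite (le_trans _ Mx)// -addrA lerDl addr_ge0.
  rewrite f0 ?subrr ?mulr0 ?normr0//.
  have := ler_normB (x + (t / k.+1%:R) *: e_ i) ((t / k.+1%:R) *: e_ i).
  rewrite addrK => h; have h2 := normr_delta i (t / k.+1%:R).
  rewrite -(lerD2r `|(t / k.+1%:R) *: e_ i|) (le_trans _ h)// (le_trans _ Mx)//.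
  rewrite -addrA lerD2l (le_trans h2)// (le_trans tk)// lerDl//.
- move=> x; have [->|tN0] := eqVneq t 0.
    under eq_fun do rewrite mul0r scale0r addr0 subrr mulr0.
    by rewrite mul0r; exact: cvg_cst.
  have dx : derivable f x (e_ i) := (cf.1 i).1 x.
  have cv : (fun h : R => h^-1 *: (f (h *: e_ i + x) - f x)) @ 0^' --> partial i f x.
    exact: dx.
  have tk : (fun k => t / k.+1%:R) @ \oo --> 0^'.
    move=> A [e /= e0 eA].
    have : (fun k => t / k.+1%:R) @ \oo --> (0 : R).
      rewrite -[X in _ --> X](mulr0 t); apply: cvgM; first exact: cvg_cst.
      exact: cvg_harmonic.
    move/cvgrPdist_lt => /(_ _ e0); apply: filterS => k /= ke.
    by apply: eA => //; rewrite mulf_neq0// gt_eqF.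
  have := cvg_comp _ _ tk cv; rewrite /comp => cv2.
  have -> : (fun k : nat => k.+1%:R * (f (x + (t / k.+1%:R) *: e_ i) - f x)) =
     (fun k => t * ((t / k.+1%:R)^-1 *: (f ((t / k.+1%:R) *: e_ i + x) - f x))).
    apply/funext => k; rewrite [x + _]addrC.
    transitivity (t * ((t / k.+1%:R)^-1 * (f ((t / k.+1%:R) *: e_ i + x) - f x))); last by [].
    rewrite mulrA; congr (_ * _).
    by rewrite invf_div mulrCA divff ?mulr1.
  by apply: cvgM; [exact: cvg_cst|exact: cv2].
Qed.

Let quotient_Lfun f i (t : R) (k : nat) : Linfc f ->
  Linfc (fun x => k.+1%:R * (f (x + (t / k.+1%:R) *: e_ i) - f x)).
Proof. by move=> lf; apply: LinfcZ; apply: LinfcB => //; exact: Linfc_shift. Qed.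

(** Integration by parts without boundary term: the integral of a difference
    quotient vanishes, by translation invariance. *)
Lemma lint_partial f i : C1c f -> lint (partial i f) = 0.
Proof.
move=> cf; have lf := C1c_Linfc cf; have [g [lg qg qf]] := quotient_cvg i 1 cf.
have [_] := lint_cvg (fun k => (quotient_Lfun i 1 k lf).1) lg qg qf.
rewrite (_ : (fun k : nat => _) = fun=> 0); last first.
  apply/funext => k; rewrite lintZ; last by apply: LinfcB => //; exact: Linfc_shift.
  by rewrite lintB ?lint_shift ?subrr ?mulr0//; exact: Linfc_shift.
under [in X in _ --> X]eq_fun do rewrite mul1r.
by move=> h; have := cvg_lim (@Rhausdorff R) h; rewrite lim_cst// => <-.
Qed.

Lemma Linfc_mul_continuous f g : continuous f ->
  (exists M : R, forall x, M <= `|x| -> f x = 0) -> continuous g ->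
  Linfc (fun x => f x * g x).
Proof.
move=> cf [M f0] cg; apply: (Linfc_continuous (M := M)); first exact: continuous_mul.
by move=> x /f0 ->; rewrite mul0r.
Qed.

Lemma lint_by_parts f g i : C1c f -> C1 g ->
  lint (fun x => g x * partial i f x) = - lint (fun x => f x * partial i g x).
Proof.
move=> cf cg; have cfg := C1cM cf cg.
have := lint_partial i cfg; rewrite (C1M cf.1 cg).2.
have l1 : Linfc (fun x => f x * partial i g x).
  by apply: Linfc_mul_continuous cf.2 _; [exact: C1_continuous cf.1|exact: (cg i).2].
have l2 : Linfc (fun x => partial i f x * g x).
  apply: Linfc_mul_continuous; [exact: (cf.1 i).2|exact: C1c_partial_supp|].
  exact: C1_continuous.
rewrite lintD// => /eqP; rewrite addr_eq0 => /eqP ->; rewrite opprK.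
by congr lint; apply/funext => x; rewrite mulrC.
Qed.

(** The translation is cut into [k] equal steps, each of the same cost; [k] times the
    cost of one step tends to the right-hand side. *)
Lemma lint_translate_le f i (t : R) : C1c f ->
  lint (fun x => `|f (x + t *: e_ i) - f x|) <= `|t| * lint (fun x => `|partial i f x|).
Proof.
move=> cf; have lf := C1c_Linfc cf; have [g [lg qg qf]] := quotient_cvg i t cf.
have lq k := quotient_Lfun i t k lf.
have [||_] := lint_cvg (f := fun x => `|t * partial i f x|) (fun k => (Linfc_norm (lq k)).1) lg.
- by move=> k x; rewrite normr_id; exact: qg.
- by move=> x; apply: cvg_norm; exact: qf.
rewrite (_ : (fun x => `|t * partial i f x|) = fun x => `|t| * `|partial i f x|); last first.
  by apply/funext => x; rewrite normrM.
rewrite lintZ; last by apply: Linfc_norm; exact: C1c_partial_Linfc.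
pose D s := lint (fun x => `|f (x + s *: e_ i) - f x|).
have lD s : Linfc (fun x => `|f (x + s *: e_ i) - f x|).
  by apply: Linfc_norm; apply: LinfcB => //; exact: Linfc_shift.
have step s m : D (m%:R * s) <= m%:R * D s.
  elim: m => [|m ih].
    rewrite !mul0r /D; under [X in lint X]eq_fun do rewrite scale0r addr0 subrr normr0.
    by rewrite lint0.
  rewrite -natr1 [leRHS]mulrDl mul1r; apply: le_trans (lerD ih (lexx _)).
  rewrite [X in _ <= _ + X](_ : _ = lint (fun x => `|f (x + m%:R * s *: e_ i + s *: e_ i) - f (x + m%:R * s *: e_ i)|)); last first.
    by rewrite /D -(lint_shift (m%:R * s *: e_ i))//.
  rewrite /D -lintD//; last exact: (Linfc_shift (m%:R * s *: e_ i) (lD s)).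
  apply: le_lint => //.
    by apply: LinfcD => //; exact: (Linfc_shift (m%:R * s *: e_ i) (lD s)).
  by move=> x; rewrite mulrDl mul1r scalerDl addrA [leRHS]addrC; exact: ler_distD.
apply: (@closed_cvg _ _ \oo _ _ [set r : R | D t <= r]); first exact: closed_ge.
apply: nearW => k /=; have k0 : (0 : R) < k.+1%:R by [].
have := step (t / k.+1%:R) k.+1; rewrite mulrCA divff ?mulr1 ?gt_eqF// => /le_trans; apply.
rewrite /D -lintZ//; apply: le_lint; [exact: LinfcZ|exact: Linfc_norm|].
by move=> x; rewrite normrM gtr0_norm.
Qed.

End partial_derivatives.

(** * Cutoff functions *)

Section bump.
Context {R : realType}.
Implicit Types (r t : R).

Let p r : R := Num.max 0 r ^+ 2.
Let p' r : R := 2 * Num.max 0 r.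

Let p_taylor r t : `|p (r + t) - p r - t * p' r| <= t ^+ 2.
Proof.
rewrite /p /p'; have [r0|/ltW r0] := leP 0 r; have [rt|/ltW rt] := leP 0 (r + t).
- rewrite (_ : _ - _ = t ^+ 2); last by ring.
  by rewrite ger0_norm// sqr_ge0.
- by rewrite ler_norml; apply/andP; split; nra.
- by rewrite ler_norml; apply/andP; split; nra.
- by rewrite expr0n/= mulr0 mulr0 !subr0 normr0 sqr_ge0.
Qed.

Let p'_continuous : continuous p'.
Proof.
apply: continuous_scale => r; apply: (@continuous_max _ _ (fun=> 0) id).
  exact: cst_continuous.
exact: cvg_id.
Qed.

(** The second derivative of [bump] is 4 on [-2, -3/2], -4 on [-3/2, -1], 0 on [-1, 1],
    and even: two arcs of parabola join the heights 0 and 1. *)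
Definition bump_coef : seq (R * R) :=
  [:: (2, 2); (- 4, 3 / 2); (2, 1); (- 2, -1); (4, - (3 / 2)); (- 2, - 2)].

(** A C^1 function of the real line with Lipschitz derivative, equal to 1 on
    [-1, 1] and to 0 off [-2, 2]: a combination of translates of the square of
    the positive part. *)
Definition bump r : R := \sum_(c <- bump_coef) c.1 * p (r + c.2).

Definition bump' r : R := \sum_(c <- bump_coef) c.1 * p' (r + c.2).

Let bumpE r : bump r = 2 * p (r + 2) - 4 * p (r + 3 / 2) + 2 * p (r + 1)
  - 2 * p (r - 1) + 4 * p (r - 3 / 2) - 2 * p (r - 2).
Proof.
by rewrite /bump /bump_coef !big_cons big_nil /=; ring.
Qed.

Lemma bump_even r : bump (- r) = bump r.
Proof.
rewrite !bumpE /p.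
have e (a : R) : Num.max 0 (- r + a) ^+ 2 = (r - a) ^+ 2 - Num.max 0 (r - a) ^+ 2.
  have -> : - r + a = - (r - a) by ring.
  by case: (leP 0 (- (r - a))) => h1; case: (leP 0 (r - a)) => h2; nra.
have e' (a : R) : Num.max 0 (- r - a) ^+ 2 = (r + a) ^+ 2 - Num.max 0 (r + a) ^+ 2.
  by rewrite e opprK.
by rewrite !(e', e); field.
Qed.

Lemma bump1 r : `|r| <= 1 -> bump r = 1.
Proof.
rewrite ler_norml => /andP[r1 r2]; rewrite bumpE /p.
rewrite (max_r (_ : 0 <= r + 2)) ?(max_r (_ : 0 <= r + 3/2)) ?(max_r (_ : 0 <= r + 1)); [|lra..].
rewrite (max_l (_ : r - 1 <= 0)) ?(max_l (_ : r - 3/2 <= 0)) ?(max_l (_ : r - 2 <= 0)); [|lra..].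
by field.
Qed.

Lemma bump0 r : 2 <= `|r| -> bump r = 0.
Proof.
wlog r0 : r / 0 <= r => [h|].
  have [r0|/ltW r0] := leP 0 r; first exact: h.
  by rewrite -normrN -bump_even; apply: h; rewrite oppr_ge0.
rewrite ger0_norm// => r2; rewrite bumpE /p.
have m (a : R) : 0 <= a -> Num.max 0 a = a by move=> a0; rewrite max_r.
by rewrite !m; [field|lra..].
Qed.

Lemma bump_itv r : 0 <= bump r <= 1.
Proof.
wlog r0 : r / 0 <= r => [h|].
  have [r0|/ltW r0] := leP 0 r; first exact: h.
  by rewrite -bump_even; apply: h; rewrite oppr_ge0.
have [r1|r1] := leP r 1; first by rewrite bump1 ?ler01 ?lexx// ger0_norm.
have [r2|r2] := leP 2 r; first by rewrite bump0 ?ler01 ?lexx// ger0_norm.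
rewrite bumpE /p (max_r (_ : 0 <= r + 2)) ?(max_r (_ : 0 <= r + 3/2)) ?(max_r (_ : 0 <= r + 1)); [|lra..].
rewrite (max_r (_ : 0 <= r - 1)) ?(max_l (_ : r - 2 <= 0)); [|lra..].
by case: (leP 0 (r - 3 / 2)) => h; apply/andP; split; nra.
Qed.

(** The constant is the sum of the absolute values of the coefficients. *)
Lemma bump_taylor r t : `|bump (r + t) - bump r - t * bump' r| <= 16 * t ^+ 2.
Proof.
rewrite /bump /bump' mulr_sumr -sumrB -sumrB.
rewrite (le_trans (ler_norm_sum _ _ _))//.
apply: (@le_trans _ _ (\sum_(c <- bump_coef) `|c.1| * t ^+ 2)).
  apply: ler_sum => c _.
  rewrite (_ : _ - _ = c.1 * (p (r + c.2 + t) - p (r + c.2) - t * p' (r + c.2))).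
    by rewrite normrM ler_wpM2l//; exact: p_taylor.
  by rewrite [r + t + _]addrAC; ring.
rewrite -mulr_suml ler_wpM2r ?sqr_ge0// /bump_coef !big_cons big_nil/= !normrN !ger0_norm//; lra.
Qed.

(** A quadratic bound on the remainder is easier to carry through products and integrals
    than the existence of a limit. *)
Lemma taylor_is_derive (f : R -> R) (r d C : R) :
  (forall t, `|f (r + t) - f r - t * d| <= C * t ^+ 2) -> is_derive r (1 : R) f d.
Proof.
move=> fC; suff cv : (fun h : R => h^-1 *: (f (h *: (1 : R) + r) - f r)) @ 0^' --> d.
  split; first by apply/cvg_ex; exists d.
  exact: cvg_lim.
apply/cvgrPdist_le => e e0.
have C0 : 0 <= C.
  by have := le_trans (normr_ge0 _) (fC 1); rewrite expr1n mulr1.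
have d0 : 0 < e / (C + 1) by rewrite divr_gt0// ltr_wpDl.
near=> h.
have hN0 : h != 0 by near: h; exact: nbhs_dnbhs_neq.
have he : `|h| < e / (C + 1) by near: h; exact: dnbhs0_lt.
rewrite distrC.
have -> : h^-1 *: (f (h *: (1 : R) + r) - f r) - d = h^-1 * (f (r + h) - f r - h * d).
  by rewrite mulrBr mulKf// [h *: _]mulr1 addrC [r + h]addrC addrC.
rewrite normrM normfV ler_pdivrMl ?normr_gt0// (le_trans (fC h))//.
have h2 : h ^+ 2 = `|h| * `|h| by rewrite -expr2 real_normK// num_real.
rewrite h2 mulrCA ler_wpM2l//.
by move: he; rewrite ltr_pdivlMr ?ltr_wpDl// => he; have := normr_ge0 h; nra.
Unshelve. all: by end_near. Qed.

Lemma bump_is_derive r : is_derive r (1 : R) bump (bump' r).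
Proof. by apply: (@taylor_is_derive _ _ _ 16) => t; exact: bump_taylor. Qed.

Lemma bump'_continuous : continuous bump'.
Proof.
apply: continuous_sum => c; apply: continuous_scale.
move=> r; apply: (@continuous_comp _ _ _ (fun r => r + c.2) p'); last exact: p'_continuous.
by apply: cvgD; [exact: cvg_id|exact: cvg_cst].
Qed.

Lemma bump_continuous : continuous bump.
Proof.
move=> r; apply/differentiable_continuous/derivable1_diffP.
by have [] := bump_is_derive r.
Qed.

End bump.

Section cube_bump.
Context {R : realType} {n : nat}.
Local Notation Rn := 'rV[R]_n.+1.
Implicit Types (c x : Rn) (r t : R) (i : 'I_n.+1).
Local Notation e_ i := (delta_mx 0 i : Rn).

Definition cube_bump c r x : R := \prod_i bump (r^-1 * (x 0 i - c 0 i)).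

Let cube_bump' c r i x : R :=
  r^-1 * bump' (r^-1 * (x 0 i - c 0 i)) *
  \prod_(j | j != i) bump (r^-1 * (x 0 j - c 0 j)).

Lemma taylor_is_partial (f : Rn -> R) i x (d C : R) :
  (forall t, `|f (x + t *: e_ i) - f x - t * d| <= C * t ^+ 2) ->
  is_derive x (e_ i) f d.
Proof.
move=> fC; apply/is_derive_line0; apply: (@taylor_is_derive _ _ _ _ C) => t.
by rewrite add0r scale0r addr0.
Qed.

Lemma cube_bump_itv c r x : 0 <= cube_bump c r x <= 1.
Proof.
apply/andP; split; first by apply: prodr_ge0 => i _; have /andP[] := bump_itv (r^-1 * (x 0 i - c 0 i)).
by apply: prodr_ile1 => i _; exact: bump_itv.
Qed.

Let cube_bump_taylor0 c r i x t : 0 < r ->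
  `|cube_bump c r (x + t *: e_ i) - cube_bump c r x - t * cube_bump' c r i x|
  <= 16 / r ^+ 2 * t ^+ 2.
Proof.
move=> r0; rewrite /cube_bump /cube_bump' (bigD1 i)//= [X in _ - X - _](bigD1 i)//=.
rewrite (eq_bigr (fun j => bump (r^-1 * (x 0 j - c 0 j)))); last first.
  by move=> j ji; rewrite !mxE eqxx (negbTE ji) mulr0 addr0.
rewrite !mxE !eqxx mulr1; set P := \prod_(_ | _) _.
have P01 : `|P| <= 1.
  rewrite ger0_norm; first by apply: prodr_ile1 => j _; exact: bump_itv.
  by apply: prodr_ge0 => j _; have /andP[] := bump_itv (r^-1 * (x 0 j - c 0 j)).
set y := r^-1 * (x 0 i - c 0 i).
have -> : r^-1 * (x 0 i + t - c 0 i) = y + r^-1 * t by rewrite /y; ring.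
rewrite [X in `|X|](_ : _ = (bump (y + r^-1 * t) - bump y - (r^-1 * t) * bump' y) * P); last by ring.
rewrite normrM (le_trans (ler_piMr _ P01))// (le_trans (bump_taylor _ _))//.
by rewrite exprMn exprVn mulrA.
Qed.

Lemma cube_bump_partial c r i x : 0 < r -> partial i (cube_bump c r) x = cube_bump' c r i x.
Proof.
move=> r0; apply: partialE; apply: taylor_is_partial => t.
exact: cube_bump_taylor0.
Qed.

Lemma cube_bump_taylor c r i x t : 0 < r ->
  `|cube_bump c r (x + t *: e_ i) - cube_bump c r x - t * partial i (cube_bump c r) x|
  <= 16 / r ^+ 2 * t ^+ 2.
Proof. by move=> r0; rewrite cube_bump_partial//; exact: cube_bump_taylor0. Qed.

Lemma continuous_prod (T : topologicalType) (I : Type) (s : seq I) (P : pred I) (F : I -> T -> R) :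
  (forall k : I, continuous (F k)) ->
  continuous (fun x : T => \prod_(k <- s | P k) F k x).
Proof.
move=> cF; elim: s => [|k s ih].
  by under eq_fun do rewrite big_nil; exact: cst_continuous.
under eq_fun do rewrite big_cons; case: (P k) => //.
exact: continuous_mul.
Qed.

Let coord_affine_continuous c r i : continuous (fun x : Rn => r^-1 * (x 0 i - c 0 i)).
Proof.
apply: continuous_scale; apply: continuous_add; last exact: cst_continuous.
exact: (@coord_continuous R 1 n.+1 0 i).
Qed.

Lemma cube_bump0 c r x : 0 < r -> 2 * r <= `|x - c| -> cube_bump c r x = 0.
Proof.
move=> r0 xc; have [i xci] : exists i, 2 * r <= `|(x - c) 0 i|.
  apply: contrapT => /forallNP h; move: xc; apply/negP; rewrite -ltNge.
  rewrite normr_rV_lt ?mulr_gt0//; apply/forallP => i.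
  by rewrite ltNge; apply/negP; exact: h.
rewrite /cube_bump (bigD1 i)//= bump0 ?mul0r//.
by rewrite normrM normfV (gtr0_norm r0) ler_pdivlMl// mulrC; move: xci; rewrite !mxE.
Qed.

Lemma cube_bump1 c r x : 0 < r -> `|x - c| <= r -> cube_bump c r x = 1.
Proof.
move=> r0 xc; rewrite /cube_bump big1// => i _; rewrite bump1//.
rewrite normrM normfV (gtr0_norm r0) ler_pdivrMl// mulr1 (le_trans _ xc)//.
by have := normr_coord_le (x - c) i; rewrite !mxE.
Qed.

Lemma cube_bump_C1c c r : 0 < r -> C1c (cube_bump c r).
Proof.
move=> r0; split.
  have [] // := @C1I _ _ (cube_bump c r) (cube_bump' c r).
    by move=> i x; apply: taylor_is_partial => t; exact: cube_bump_taylor0.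
  move=> i; apply: continuous_mul.
    by apply: continuous_scale; apply: continuous_compR; [exact: bump'_continuous|exact: coord_affine_continuous].
  apply: continuous_prod => j; apply: continuous_compR; first exact: bump_continuous.
  exact: coord_affine_continuous.
exists (`|c| + 2 * r) => x cx; apply: cube_bump0 => //.
have := ler_normB (x - c) (- c); rewrite opprK subrK normrN => h.
by rewrite -(lerD2r `|c|) addrC (le_trans cx).
Qed.

(** Cover [K] by finitely many cubes whose doubles lie in [V] and combine their bumps by
    [a + b - a * b], which keeps the values in [0, 1]. *)
Lemma C1_cutoff (K V : set Rn) : compact K -> open V -> K `<=` V ->
  exists eta : Rn -> R, exists K' : set Rn, [/\ C1c eta, forall x, 0 <= eta x <= 1,
    forall x, K x -> eta x = 1, compact K' /\ K' `<=` V & forall x, ~ K' x -> eta x = 0].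
Proof.
move=> cK oV KV.
have rV (x : Rn) : exists r : R, 0 < r /\ (K x -> [set y | `|y - x| <= 2 * r] `<=` V).
  have [Kx|nKx] := pselect (K x); last by exists 1.
  have /nbhs_ballP[e /= e0 eV] := open_nbhs_nbhs (conj oV (KV _ Kx)).
  exists (e / 4); split; first by rewrite divr_gt0.
  move=> _ y /= yx; apply: eV; rewrite -ball_normE/= distrC (le_lt_trans yx)//.
  by rewrite mulrCA gtr_pMr// ltr_pdivrMr// mul1r ltr_nat.
have {}rV := choice rV; have [r rP] := rV.
have : cover_compact K by rewrite -compact_cover.
move=> /(_ Rn K (fun x => ball x (r x)))[x Kx||D DK KD].
- exact: (@ball_open R Rn).
- by move=> x Kx; exists x => //; apply: ballxx; exact: (rP x).1.
suff [eta [K' [h1 h2 h3 h4 h5]]] : exists eta : Rn -> R, exists K' : set Rn, [/\ C1c eta,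
    forall x, 0 <= eta x <= 1,
    forall x, (exists2 y, y \in (finmap.enum_fset D) & ball y (r y) x) -> eta x = 1,
    compact K' /\ K' `<=` V & forall x, ~ K' x -> eta x = 0].
  exists eta, K'; split => // x /KD[y Dy yx]; apply: h3; exists y => //.
have {DK} : forall y, y \in (finmap.enum_fset D) -> K y by move=> y /DK; rewrite inE.
elim: (finmap.enum_fset D) => [|y s ih] sK.
  exists (fun=> 0), set0; split => //.
  - exact: C1c0.
  - by move=> x; rewrite lexx ler01.
  - by move=> x [].
  - by split => //; exact: compact0.
have [|eta [K' [h1 h2 h3 [h4 h4'] h5]]] := ih.
  by move=> z zs; apply: sK; rewrite inE zs orbT.
have Ky : K y by apply: sK; rewrite inE eqxx.
pose a := cube_bump y (r y); have r0 := (rP y).1.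
have a01 := cube_bump_itv y (r y).
exists (fun x => a x + eta x * (1 - a x)), (K' `|` [set x | `|x - y| <= 2 * r y]); split.
- apply: C1cD; first exact: cube_bump_C1c.
  apply: C1cM => //; apply: (C1B _ _).1; first exact: (C1_cst 1).1.
  exact: (cube_bump_C1c _ _).1.
- move=> x; have /andP[a0 a1] := a01 x; have /andP[e0 e1] := h2 x.
  by rewrite /a; apply/andP; split; nra.
- move=> x [z]; rewrite inE => /orP[/eqP ->|zs] xz.
    rewrite /a cube_bump1 ?subrr ?mulr0 ?addr0//.
    by move: xz; rewrite -ball_normE/= distrC => /ltW.
  by rewrite h3; [rewrite mul1r addrC subrK|exists z].
- split; first by apply: compactU => //; exact: compact_closed_cube.
  by move=> x [/h4'//|]; exact: (rP y).2.
- move=> x /not_orP[/h5 ->]; rewrite mul0r addr0 => /negP; rewrite -ltNge => /ltW.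
  exact: cube_bump0.
Qed.

End cube_bump.

(** * Density of smooth functions in mean *)

Section L1_density.
Context {R : realType} {n : nat}.
Local Notation Rn := 'rV[R]_n.+1.
Implicit Types (f g : Rn -> R) (A : set Rn).

Lemma cont_supp_Linfc f : continuous f ->
  (exists M : R, forall x, M <= `|x| -> f x = 0) -> Linfc f.
Proof. by move=> cf [M]; exact: Linfc_continuous. Qed.

Lemma lint_ball_le (c : Rn) (r : R) : 0 < r -> lint \1_(ball c r) <= (2 * r) ^+ n.+1.
Proof.
move=> r0; rewrite -lee_fin (@lint_indic _ _ _ (`|c| + r)).
- exact: leb_ball_le.
- exact: ball_Lmeasurable.
- move=> x; rewrite -ball_normE/= => cx.
  rewrite -(subrK c x) addrC (le_lt_trans (ler_normD _ _))// ltrD2l.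
  by rewrite -opprB normrN.
Qed.

Lemma leb_fin A (M : R) : Lmeasurable A -> (forall x, A x -> `|x| < M) -> (leb A < +oo)%E.
Proof. by move=> mA AM; rewrite -(lint_indic mA AM) ltry. Qed.

Let lt_norm_B (M : R) x : `|x| < M -> ball (0 : Rn) M x.
Proof. by rewrite -ball_normE/= sub0r normrN. Qed.

(** A cutoff between a compact subset and an open superset of almost the same measure. *)
Let indicator_approx A (M e : R) : Lmeasurable A -> (forall x, A x -> `|x| < M) -> 0 < e ->
  exists g, C1c g /\ lint (fun x => `|\1_A x - g x|) <= e.
Proof.
move=> mA AM e0; have e20 : 0 < e / 2 by rewrite divr_gt0.
have [U [oU AU Ue]] := lebesgue_outer_open (leb_fin mA AM) e20.
pose B : set Rn := [set x | `|x - 0| <= M].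
have cB : compact B by exact: compact_closed_cube.
have clB : closed B by exact: compact_closed (@norm_hausdorff _ _) cB.
have mB : Lmeasurable B by apply: borel_Lmeasurable; exact: closed_borel.
have AB : A `<=` B by move=> x /AM; rewrite /B/= subr0; exact: ltW.
have BM x : B x -> `|x| < M + 1.
  by rewrite /B/= subr0 => /le_lt_trans; apply; rewrite ltrDl.
have mBA : Lmeasurable (B `\` A) by apply: measurableD.
have [W [oW BW We]] := lebesgue_outer_open (leb_fin mBA (fun x h => BM x h.1)) e20.
pose V := U `&` ball (0 : Rn) (M + 1).
have oV : open V by apply: openI => //; exact: (@ball_open R Rn).
pose K := B `\` W.
have KA : K `<=` A by move=> x [Bx nW]; apply: contrapT => nA; apply: nW; apply: BW.
have cK : compact K.
  apply: (subclosed_compact _ cB); last exact: subDsetl.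
  by apply: closedI => //; exact: open_closedC.
have AV : A `<=` V.
  by move=> x Ax; split; [exact: AU|apply: lt_norm_B; rewrite (lt_trans (AM _ Ax))// ltrDl].
have [eta [K' [h1 h2 h3 [_ h4] h5]]] := C1_cutoff cK oV (subset_trans KA AV).
exists eta; split => //.
have mV : Lmeasurable V by apply: borel_Lmeasurable; exact: open_borel.
have mK : Lmeasurable K by apply: borel_Lmeasurable; apply: closed_borel; exact: compact_closed (@norm_hausdorff _ _) cK.
have VM x : V x -> `|x| < M + 1.
  by move=> [_]; rewrite -ball_normE/= sub0r normrN.
have mVA : Lmeasurable (V `\` A) by exact: measurableD.
have mAK : Lmeasurable (A `\` K) by exact: measurableD.
have lVA : Linfc (\1_(V `\` A) : Rn -> R) by apply: (Linfc_indic (M := M + 1)) => // x [/VM].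
have lAK : Linfc (\1_(A `\` K) : Rn -> R) by apply: (Linfc_indic (M := M)) => // x [/AM].
have lA : Linfc (\1_A : Rn -> R) by apply: Linfc_indic AM.
apply: (@le_trans _ _ (lint (fun x => \1_(V `\` A) x + \1_(A `\` K) x))).
  apply: le_lint => [||x].
  - by apply: Linfc_norm; apply: LinfcB => //; exact: C1c_Linfc.
  - exact: LinfcD.
  have /andP[e1 e2] := h2 x; have inD (X Y : set Rn) : (x \in X `\` Y) = (x \in X) && (x \notin Y) by exact: in_setD.
  rewrite !indicE (inD V A) (inD A K).
  have [xA|xA] := boolP (x \in A).
    have xV : x \in V by rewrite inE; apply: AV; rewrite inE in xA.
    rewrite xV/=; have [xK|xK] := boolP (x \in K).
      by rewrite h3 ?subrr ?normr0 ?add0r// -inE.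
    by rewrite ger0_norm ?subr_ge0//= add0r gerBl.
  have -> /= : (x \in K) = false.
    by apply/negP; rewrite inE => /KA xA'; move/negP: xA; apply; rewrite inE.
  have [xV|xV] := boolP (x \in V) => /=.
    by rewrite sub0r normrN ger0_norm//; lra.
  rewrite h5 ?subrr ?normr0 ?addr0// => /h4 xV'.
  by move/negP: xV; apply; rewrite inE.
rewrite lintD// [leRHS]splitr.
have subset_le (X Y Z : set Rn) (N : R) : Lmeasurable X -> Lmeasurable Y -> Lmeasurable Z ->
    (forall x, Z x -> `|x| < N) -> (leb X < +oo)%E ->
    Z `<=` Y `\` X -> X `<=` Y -> (leb Y <= leb X + (e / 2)%:E)%E ->
    lint (\1_Z : Rn -> R) <= e / 2.
  move=> mX mY mZ ZN Xfin ZYX XY YX; rewrite -lee_fin (lint_indic mZ ZN).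
  apply: (@le_trans _ _ (leb (Y `\` X))).
    by apply: le_measure; rewrite ?inE//; exact: measurableD.
  rewrite measureD//; last first.
    by apply: le_lt_trans YX _; rewrite lte_add_pinfty// ltry.
  have -> : Y `&` X = X by rewrite setIC; apply/setIidPl.
  by rewrite leeBlDl// ge0_fin_numE.
apply: lerD.
- apply: (subset_le A (U : set Rn) _ (M + 1)) => //.
  + by apply: borel_Lmeasurable; exact: open_borel.
  + by move=> x [/VM].
  + exact: leb_fin AM.
  + by move=> x [[Ux _] nA].
- apply: (subset_le (B `\` A) W _ M) => //.
  + by apply: borel_Lmeasurable; exact: open_borel.
  + by move=> x [/AM].
  + by apply: (leb_fin (M := M + 1) mBA) => x [/BM].
  + move=> x [Ax nK]; split => [|[]//]; apply: contrapT => nW.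
    by apply: nK; split => //; exact: AB.
Qed.

(** Subtracting half of the bound on the set where [f] exceeds it halves the range; after
    [k] rounds the remainder is small in mean. *)
Let dyadic_approx k : forall f (M D e : R), Lfun f -> (forall x, 0 <= f x <= M) ->
  (forall x, D <= `|x| -> f x = 0) -> 0 < e -> 0 < D ->
  exists g, C1c g /\ lint (fun x => `|f x - g x|) <= e + M / 2 ^+ k * (2 * D) ^+ n.+1.
Proof.
elim: k => [|k ih] f M D e mf fM f0 e0 D0.
  have M0 : 0 <= M by have /andP[] := fM 0; exact: le_trans.
  exists (fun=> 0); split; first exact: C1c0.
  have lf : Linfc f.
    by apply: (LinfcP mf (M := M)) f0 => x; have /andP[h1 h2] := fM x; rewrite ger0_norm.
  have lB : Linfc (\1_(ball (0 : Rn) D) : Rn -> R).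
    apply: (Linfc_indic (M := D)); first exact: ball_Lmeasurable.
    by move=> x; rewrite -ball_normE/= sub0r normrN.
  apply: (@le_trans _ _ (lint (fun x => M * \1_(ball (0 : Rn) D) x))).
    apply: le_lint => [||x].
    - by apply: Linfc_norm; apply: LinfcB => //; exact: Linfc0.
    - exact: LinfcZ.
    rewrite subr0 indicE; have /andP[h1 h2] := fM x.
    have [xD|xD] := ltP `|x| D; last by rewrite f0// normr0 mulr_ge0.
    by rewrite mem_set ?mulr1 ?ger0_norm//; exact: lt_norm_B.
  rewrite lintZ// expr0 divr1; apply: ler_wpDl; first exact: ltW.
  by rewrite ler_wpM2l// lint_ball_le.
pose A := [set x | M / 2 < f x].
have mA : Lmeasurable A by exact: Lfun_gt_measurable.
have M0 : 0 <= M by have /andP[] := fM 0; exact: le_trans.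
have AD x : A x -> `|x| < D.
  rewrite /A/= ltNge => fx; rewrite ltNge; apply/negP => /f0 f0x; move/negP: fx; apply.
  by rewrite f0x divr_ge0.
have e20 : 0 < e / 2 by rewrite divr_gt0.
have [g1 [cg1 hg1]] := indicator_approx mA AD (divr_gt0 e20 (ltr_wpDl M0 ltr01 : 0 < M + 1)).
pose f1 x := f x - M / 2 * \1_A x.
have mf1 : Lfun f1.
  by apply: LfunB => //; apply: LfunM; [exact: Lfun_cst|exact: Lfun_indic].
have f1M x : 0 <= f1 x <= M / 2.
  rewrite /f1 indicE; have /andP[h1 h2] := fM x.
  have [xA|xA] := boolP (x \in A); rewrite ?mulr1 ?mulr0 ?subr0.
    by rewrite inE /A/= in xA; lra.
  move/negP: xA; rewrite inE /A/= => /negP; rewrite -leNgt => h; lra.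
have f10 x : D <= `|x| -> f1 x = 0.
  move=> Dx; rewrite /f1 f0// indicE memNset ?mulr0 ?subrr// => /AD.
  by rewrite ltNge Dx.
have [g2 [cg2 hg2]] := ih f1 (M / 2) D (e / 2) mf1 f1M f10 e20 D0.
exists (fun x => M / 2 * g1 x + g2 x); split.
  by apply: C1cD => //; exact: C1cZ.
have lA : Linfc (\1_A : Rn -> R) by exact: Linfc_indic AD.
have lf1 : Linfc f1.
  by apply: (LinfcP mf1 (M := M / 2)) f10 => x; have /andP[h1 h2] := f1M x; rewrite ger0_norm.
have l1 : Linfc (fun x => `|\1_A x - g1 x|).
  by apply: Linfc_norm; apply: LinfcB => //; exact: C1c_Linfc.
have l2 : Linfc (fun x => `|f1 x - g2 x|).
  by apply: Linfc_norm; apply: LinfcB => //; exact: C1c_Linfc.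
apply: (@le_trans _ _ (lint (fun x => M / 2 * `|\1_A x - g1 x| + `|f1 x - g2 x|))).
  apply: le_lint => [||x].
  - apply: Linfc_norm; apply: LinfcB => //.
      by apply: (LinfcP mf (M := M)) f0 => x; have /andP[h1 h2] := fM x; rewrite ger0_norm.
    by apply: LinfcD; [apply: LinfcZ|]; exact: C1c_Linfc.
  - by apply: LinfcD => //; exact: LinfcZ.
  have -> : f x - (M / 2 * g1 x + g2 x) = M / 2 * (\1_A x - g1 x) + (f1 x - g2 x).
    by rewrite /f1; ring.
  by rewrite (le_trans (ler_normD _ _))// normrM ger0_norm// divr_ge0.
rewrite lintD//; last exact: LinfcZ.
rewrite lintZ// [e in leRHS]splitr -addrA lerD//; last first.
  by rewrite (_ : M / 2 ^+ k.+1 = M / 2 / 2 ^+ k)// [2 ^+ k.+1]exprS invfM mulrA.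
have M1 : 0 < M + 1 by rewrite ltr_wpDl.
apply: (@le_trans _ _ (M / 2 * (e / 2 / (M + 1)))).
  by rewrite ler_wpM2l// divr_ge0.
rewrite mulrCA ger_pMr//.
by rewrite ler_pdivrMr// mul1r; lra.
Qed.

(** The ranges of the positive and negative parts are halved until they are negligible. *)
Lemma C1c_dense f (e : R) : Linfc f -> 0 < e ->
  exists g, C1c g /\ lint (fun x => `|f x - g x|) <= e.
Proof.
move=> lf e0; have [mf [M [fM f0]]] := lf.
have M0 : 0 <= M by apply: le_trans (fM 0).
pose D := M + 1; have D0 : 0 < D by rewrite ltr_wpDl.
pose p x := Num.max (f x) 0; pose q x := Num.max (- f x) 0.
have lp : Linfc p by apply: Linfc_max => //; exact: Linfc0.
have lq : Linfc q by apply: Linfc_max => //; [exact: LinfcN|exact: Linfc0].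
have fD x : D <= `|x| -> f x = 0 by move=> Dx; apply: f0; rewrite (le_trans _ Dx)// lerDl.
have [k ke] : exists k, M / 2 ^+ k * (2 * D) ^+ n.+1 <= e / 4.
  have cv : M * (2 * D) ^+ n.+1 * (2^-1) ^+ k @[k --> \oo] --> (0 : R).
    rewrite -[X in _ --> X](mulr0 (M * (2 * D) ^+ n.+1)); apply: cvgM; first exact: cvg_cst.
    by apply: cvg_expr; rewrite ger0_norm// invf_lt1// ltr1n.
  have e40 : 0 < e / 4 by rewrite divr_gt0.
  move/cvgrPdist_le : cv => /(_ _ e40)[k _ /(_ k (leqnn k))] /= h.
  exists k; rewrite mulrAC -exprVn (le_trans _ h)// sub0r normrN; exact: ler_norm.
have e40 : 0 < e / 4 by rewrite divr_gt0.
have approx h : Linfc h -> (forall x, 0 <= h x <= M) -> (forall x, D <= `|x| -> h x = 0) ->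
    exists g, C1c g /\ lint (fun x => `|h x - g x|) <= e / 2.
  move=> lh hM h0; have [g [cg hg]] := dyadic_approx k lh.1 hM h0 e40 D0.
  by exists g; split => //; rewrite (le_trans hg)//; lra.
have [||g1 [cg1 hg1]] := approx p lp.
- move=> x; rewrite /p le_max lexx orbT ge_max M0 andbT.
  by rewrite (le_trans (ler_norm _)).
- by move=> x /fD fx; rewrite /p fx maxxx.
have [||g2 [cg2 hg2]] := approx q lq.
- move=> x; rewrite /q le_max lexx orbT ge_max M0 andbT.
  by rewrite (le_trans (ler_norm _))// normrN.
- by move=> x /fD fx; rewrite /q fx oppr0 maxxx.
exists (fun x => g1 x - g2 x); split.
  by apply: C1cD => //; exact: C1cN.
have l1 : Linfc (fun x => `|p x - g1 x|).
  by apply: Linfc_norm; apply: LinfcB => //; exact: C1c_Linfc.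
have l2 : Linfc (fun x => `|q x - g2 x|).
  by apply: Linfc_norm; apply: LinfcB => //; exact: C1c_Linfc.
apply: (@le_trans _ _ (lint (fun x => `|p x - g1 x| + `|q x - g2 x|))).
  apply: le_lint => [||x].
  - by apply: Linfc_norm; apply: LinfcB => //; apply: LinfcB; exact: C1c_Linfc.
  - exact: LinfcD.
  have -> : f x - (g1 x - g2 x) = (p x - g1 x) - (q x - g2 x).
    rewrite /p /q; case: (leP (f x) 0) => f1; case: (leP (- f x) 0) => f2; lra.
  exact: ler_normB.
by rewrite lintD// [leRHS]splitr lerD.
Qed.

End L1_density.

(** * Convolution *)

Section mollifier.
Context {R : realType} {n : nat}.
Local Notation Rn := 'rV[R]_n.+1.
Local Notation LT := (caratheodory_type (@lebesgue_outer R n)).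
Implicit Types (f g k : Rn -> R) (s t : R) (x y : Rn) (i : 'I_n.+1).
Local Notation e_ i := (delta_mx 0 i : Rn).

(** The form in which dominated convergence yields the continuity of an integral with
    a parameter. *)
Lemma seq_continuous g : (forall (x : Rn) (x_ : nat -> Rn),
  (forall m, `|x_ m - x| <= m.+1%:R^-1) -> g (x_ m) @[m --> \oo] --> g x) -> continuous g.
Proof.
move=> gs x; apply/(@cvgrPdist_lt _ _ _ (nbhs (x : Rn))) => e e0.
apply: contrapT => nnear.
have /choice[x_ xP] (m : nat) : exists y : Rn, `|y - x| <= m.+1%:R^-1 /\ e <= `|g x - g y|.
  apply: contrapT => /forallNP h; apply: nnear.
  have m0 : 0 < (m.+1%:R : R)^-1 by rewrite invr_gt0.
  apply/nbhs_ballP; exists m.+1%:R^-1 => //= y.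
  rewrite -ball_normE/= distrC => yx; rewrite ltNge; apply/negP => h2.
  by apply: (h y); split => //; exact: ltW.
have /cvgrPdist_lt/(_ _ e0)[m _ /(_ m (leqnn m))/=] := gs x x_ (fun m => (xP m).1).
by rewrite ltNge (xP m).2.
Qed.

Let coord_sub_measurable i :
  measurable_fun setT (fun z : LT * LT => ((z.1 : Rn) - (z.2 : Rn)) 0 i).
Proof.
rewrite (_ : (fun z => _) = fun z : LT * LT => (z.1 : Rn) 0 i - (z.2 : Rn) 0 i).
  by apply: measurable_funB;
    [apply: (measurableT_comp (@coord_Lmeasurable R n i)); exact: measurable_fst
    |apply: (measurableT_comp (@coord_Lmeasurable R n i)); exact: measurable_snd].
by apply/funext => z; rewrite !mxE.
Qed.

Lemma Linfc2_kernel f k : Linfc f -> continuous k ->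
  (exists M : R, forall x, M <= `|x| -> k x = 0) ->
  Linfc2 (fun x y => f y * k (x - y)).
Proof.
move=> lf ck k0; have [_ [Mk [kM _]]] := cont_supp_Linfc ck k0.
have [mf [M [fM f0]]] := lf; have [N {}k0] := k0; split.
  apply: measurable_funM; first by apply: (measurableT_comp mf); exact: measurable_snd.
  have := @measurable_fun_coord R n _ (LT * LT)%type (fun z => (z.1 : Rn) - (z.2 : Rn)) coord_sub_measurable.
  exact: (measurableT_comp (continuous_borel_measurable ck)).
have M0 : 0 <= M by apply: le_trans (fM 0).
have Mk0 : 0 <= Mk by apply: le_trans (kM 0).
exists (Num.max (M * Mk) (M + Num.max 0 N)); split=> x y.
  by rewrite le_max normrM ler_pM.
rewrite !ge_max => -[/andP[_ h]|/andP[_ h]]; last first.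
  by rewrite f0 ?mul0r// (le_trans _ h)// lerDl le_max lexx.
have [yM|yM] := ltP `|y| M; last by rewrite f0 ?mul0r.
rewrite k0 ?mulr0//; have := ler_normB (x - y) (- y); rewrite opprK subrK normrN => h2.
have : N <= Num.max 0 N by rewrite le_max lexx orbT.
by move: h h2 yM; move: `|x| `|y| `|x - y| (Num.max 0 N) => a b c d; lra.
Qed.

Definition convol f k x : R := lint (fun y => f y * k (x - y)).

Lemma convol_Linfc f k : Linfc f -> continuous k ->
  (exists M : R, forall x, M <= `|x| -> k x = 0) -> Linfc (convol f k).
Proof. by move=> lf ck k0; exact: Linfc2_lint (Linfc2_kernel lf ck k0). Qed.

Lemma convol_continuous f k : Linfc f -> continuous k ->
  (exists M : R, forall x, M <= `|x| -> k x = 0) -> continuous (convol f k).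
Proof.
move=> lf ck k0; have l2 := Linfc2_kernel lf ck k0.
have [_ [Mk [kM _]]] := cont_supp_Linfc ck k0.
apply: seq_continuous => x x_ xx.
have cx : x_ @ \oo --> x.
  apply/cvgrPdist_lt => e e0; have := near_infty_natSinv_lt (PosNum e0).
  by apply: filterS => m me; rewrite distrC (le_lt_trans (xx m)).
have [||||_] // := @lint_cvg _ _ (fun m y => f y * k (x_ m - y)) (fun y => f y * k (x - y))
  (fun y => Mk * `|f y|).
- by move=> m; exact: (Linfc2_section (x_ m) l2).1.
- by apply: LinfcZ; exact: Linfc_norm.
- by move=> m y; rewrite normrM mulrC ler_wpM2r.
- move=> y; apply: cvgM; first exact: cvg_cst.
  apply: (@cvg_comp _ _ _ (fun m => x_ m - y) k); last exact: ck.
  by apply: cvgB => //; exact: cvg_cst.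
Qed.

(** The convolution inherits the quadratic Taylor estimate of the kernel. *)
Lemma convol_C1 f k (C : R) : Linfc f -> C1c k ->
  (forall x i t, `|k (x + t *: e_ i) - k x - t * partial i k x| <= C * t ^+ 2) ->
  C1c (convol f k) /\ forall i, partial i (convol f k) = convol f (partial i k).
Proof.
move=> lf ck kC; have cK := C1_continuous ck.1.
have l2 := Linfc2_kernel lf cK ck.2.
have l2' i := Linfc2_kernel lf (ck.1 i).2 (C1c_partial_supp i ck).
have [c1 pc] : C1 (convol f k) /\ forall i, partial i (convol f k) = convol f (partial i k).
  apply: C1I => [i x|i]; last first.
    by apply: convol_continuous => //; [exact: (ck.1 i).2|exact: C1c_partial_supp].
  apply: (@taylor_is_partial _ _ _ _ _ _ (C * lint (fun y => `|f y|))) => t.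
  have s1 y := Linfc2_section y l2; have s2 y := Linfc2_section y (l2' i).
  rewrite /convol -lintB// -lintZ// -lintB//; [|exact: LinfcB|exact: LinfcZ].
  have l3 : Linfc (fun y => f y * k (x + t *: e_ i - y) - f y * k (x - y)
      - t * (f y * partial i k (x - y))).
    by apply: LinfcB; [exact: LinfcB|exact: LinfcZ].
  apply: le_trans (le_norm_lint l3) _.
  rewrite mulrAC -lintZ; last exact: Linfc_norm.
  apply: le_lint => [||y].
  - exact: Linfc_norm.
  - by apply: LinfcZ; exact: Linfc_norm.
  rewrite (_ : _ - _ = f y * (k (x - y + t *: e_ i) - k (x - y) - t * partial i k (x - y))).
    by rewrite normrM mulrC ler_wpM2r.
  by rewrite (addrAC x); ring.
split=> //; split => //.
by have [_ [M [_ h]]] := convol_Linfc lf cK ck.2; exists M.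
Qed.

Lemma lint_convol f g k : Linfc f -> Linfc g -> continuous k ->
  (exists M : R, forall x, M <= `|x| -> k x = 0) ->
  lint (fun x => g x * convol f k x) = lint (fun y => f y * convol g (fun z => k (- z)) y).
Proof.
move=> lf lg ck k0.
have [mg [M [gM g0]]] := lg.
pose F x y := g x * (f y * k (x - y)).
have l2 := Linfc2_kernel lf ck k0.
have M0 : 0 <= M by apply: le_trans (gM 0).
have lF : Linfc2 F.
  have [m2 [N [N1 N2]]] := l2; split.
    by apply: measurable_funM => //; apply: (measurableT_comp mg); exact: measurable_fst.
  exists (Num.max (M * N) N); split => x y.
    by rewrite le_max normrM ler_pM.
  by rewrite !ge_max => -[/andP[_ h]|/andP[_ h]]; rewrite /F N2 ?mulr0//; [left|right].
transitivity (lint (fun x => lint (F x))).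
  congr lint; apply/funext => x; rewrite /F lintZ//; exact: (Linfc2_section x l2).
rewrite lint_exchange//; congr lint; apply/funext => y.
rewrite /convol -lintZ.
  by congr lint; apply/funext => x; rewrite /F opprB; ring.
have cm : continuous (fun z : Rn => k (- z)).
  by move=> z; apply: (@continuous_comp _ _ _ (fun z : Rn => - z) k); [exact: opp_continuous|exact: ck].
have k0' : exists N : R, forall z, N <= `|z| -> k (- z) = 0.
  by have [N h] := k0; exists N => z Nz; apply: h; rewrite normrN.
exact: (Linfc2_section y (Linfc2_kernel lg cm k0')).
Qed.

(** The half width makes the support lie in the cube of radius [s]. *)
Definition moll s x : R := cube_bump 0 (s / 2) x / lint (cube_bump (0 : Rn) (s / 2)).

Let s2 s : 0 < s -> 0 < s / 2. Proof. by move=> s0; rewrite divr_gt0. Qed.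

Let mass_ge s : 0 < s -> (s / 2 / 2) ^+ n.+1 <= lint (cube_bump (0 : Rn) (s / 2)).
Proof.
move=> /s2 s0; have BM x : ball (0 : Rn) (s / 2) x -> `|x| < s / 2.
  by rewrite -ball_normE/= sub0r normrN.
apply: (@le_trans _ _ (lint \1_(ball (0 : Rn) (s / 2)))).
  by rewrite -lee_fin (lint_indic (ball_Lmeasurable _ _) BM); exact: leb_ball_ge.
apply: le_lint => [||x].
- by apply: Linfc_indic BM; exact: ball_Lmeasurable.
- by apply: C1c_Linfc; exact: cube_bump_C1c.
rewrite indicE; have [|_] := boolP (x \in _); last by have /andP[] := cube_bump_itv 0 (s / 2) x.
by rewrite inE => /BM /ltW h; rewrite cube_bump1// subr0.
Qed.

Let mass_le s : 0 < s -> lint (cube_bump (0 : Rn) (s / 2)) <= (2 * s) ^+ n.+1.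
Proof.
move=> s0; have BM x : ball (0 : Rn) s x -> `|x| < s.
  by rewrite -ball_normE/= sub0r normrN.
apply: le_trans (lint_ball_le 0 s0); apply: le_lint => [||x].
- by apply: C1c_Linfc; apply: cube_bump_C1c; exact: s2.
- by apply: Linfc_indic BM; exact: ball_Lmeasurable.
rewrite indicE; have [xs|xs] := ltP `|x| s.
  rewrite mem_set; last by rewrite -ball_normE/= sub0r normrN.
  by have /andP[] := cube_bump_itv 0 (s / 2) x.
by rewrite cube_bump0 ?s2// subr0 mulrC divfK.
Qed.

Let mass_gt0 s : 0 < s -> 0 < lint (cube_bump (0 : Rn) (s / 2)).
Proof.
by move=> s0; apply: lt_le_trans (mass_ge s0); rewrite exprn_gt0// !divr_gt0.
Qed.

Lemma moll_C1c s : 0 < s -> C1c (moll s).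
Proof.
move=> s0; rewrite /moll; under eq_fun do rewrite mulrC.
by apply: C1cZ; apply: cube_bump_C1c; exact: s2.
Qed.

Lemma moll_taylor s : 0 < s -> exists C : R, forall x i t,
  `|moll s (x + t *: e_ i) - moll s x - t * partial i (moll s) x| <= C * t ^+ 2.
Proof.
move=> s0; have b1 := cube_bump_C1c (0 : Rn) (s2 s0).
set I := lint (cube_bump (0 : Rn) (s / 2)).
exists (I^-1 * (16 / (s / 2) ^+ 2)) => x i t.
have -> : partial i (moll s) x = I^-1 * partial i (cube_bump 0 (s / 2)) x.
  rewrite -[RHS]/((fun x => I^-1 * partial i (cube_bump 0 (s / 2)) x) x).
  rewrite -(C1Z I^-1 b1.1).2; congr (partial i _ x).
  by apply/funext => z; rewrite mulrC.
rewrite /moll -/I.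
rewrite (_ : _ - _ = I^-1 * (cube_bump 0 (s / 2) (x + t *: e_ i) - cube_bump 0 (s / 2) x
   - t * partial i (cube_bump 0 (s / 2)) x)); last by ring.
rewrite normrM gtr0_norm ?invr_gt0 ?mass_gt0// -mulrA ler_pM2l ?invr_gt0 ?mass_gt0//.
by apply: cube_bump_taylor; exact: s2.
Qed.

Lemma moll_ge0 s x : 0 < s -> 0 <= moll s x.
Proof.
move=> s0; apply: divr_ge0; last exact: ltW (mass_gt0 s0).
by have /andP[] := cube_bump_itv 0 (s / 2) x.
Qed.

Lemma moll_even s x : moll s (- x) = moll s x.
Proof.
rewrite /moll; congr (_ / _); rewrite /cube_bump; apply: eq_bigr => i _.
by rewrite !mxE !subr0 mulrN bump_even.
Qed.

Lemma moll_supp s x : 0 < s -> s <= `|x| -> moll s x = 0.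
Proof.
move=> s0 sx; rewrite /moll cube_bump0 ?mul0r ?s2// subr0.
by rewrite mulrC divfK.
Qed.

Lemma moll_suppE s : 0 < s -> exists M : R, forall x, M <= `|x| -> moll s x = 0.
Proof. by move=> s0; exists s => x; exact: moll_supp. Qed.

Lemma moll_continuous s : 0 < s -> continuous (moll s).
Proof. by move=> s0; exact: C1_continuous (moll_C1c s0).1. Qed.

Lemma moll_Linfc s : 0 < s -> Linfc (moll s).
Proof. by move=> s0; exact: C1c_Linfc (moll_C1c s0). Qed.

Lemma lint_moll s : 0 < s -> lint (moll s) = 1.
Proof.
move=> s0; rewrite /moll; under [X in lint X]eq_fun do rewrite mulrC.
rewrite lintZ ?mulVf ?gt_eqF ?mass_gt0//.
by apply: C1c_Linfc; apply: cube_bump_C1c; exact: s2.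
Qed.

Lemma moll_le s x : 0 < s -> moll s x <= (4 / s) ^+ n.+1.
Proof.
move=> s0; rewrite /moll ler_pdivrMr ?mass_gt0//.
have /andP[_ b1] := cube_bump_itv 0 (s / 2) x; apply: le_trans b1 _.
have h : 0 <= (4 / s) ^+ n.+1 by rewrite exprn_ge0// divr_ge0// ltW.
apply: le_trans (ler_wpM2l h (mass_ge s0)); rewrite -exprMn.
by rewrite (_ : 4 / s * _ = 1) ?expr1n//; field; rewrite gt_eqF.
Qed.

Lemma moll_ge s x : 0 < s -> `|x| <= s / 2 -> (2 * s) ^- n.+1 <= moll s x.
Proof.
move=> s0 xs; rewrite /moll cube_bump1 ?s2 ?subr0// mul1r.
by rewrite lef_pV2 ?posrE ?exprn_gt0 ?mulr_gt0 ?mass_gt0//; exact: mass_le.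
Qed.

Definition conv s f := convol f (moll s).

Lemma conv_C1c s f : 0 < s -> Linfc f -> C1c (conv s f).
Proof.
move=> s0 lf; have [C kC] := moll_taylor s0.
by have [] := convol_C1 lf (moll_C1c s0) kC.
Qed.

Lemma conv_partial s f i : 0 < s -> Linfc f ->
  partial i (conv s f) = convol f (partial i (moll s)).
Proof.
move=> s0 lf; have [C kC] := moll_taylor s0.
by have [_] := convol_C1 lf (moll_C1c s0) kC.
Qed.

Lemma conv_Linfc s f : 0 < s -> Linfc f -> Linfc (conv s f).
Proof. by move=> s0 lf; exact: C1c_Linfc (conv_C1c s0 lf). Qed.

Lemma conv_section s f x : 0 < s -> Linfc f -> Linfc (fun y => f y * moll s (x - y)).
Proof.
move=> s0 lf; exact: (Linfc2_section x (Linfc2_kernel lf (moll_continuous s0) (moll_suppE s0))).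
Qed.

Lemma convE s f x : 0 < s -> Linfc f -> conv s f x = lint (fun y => f (x + y) * moll s y).
Proof.
move=> s0 lf; have l := conv_section x s0 lf.
rewrite /conv /convol -(lint_shift x l); congr lint; apply/funext => y.
by rewrite addrC opprD addrA subrr add0r moll_even.
Qed.

Lemma conv_cst_section s (c : R) x : 0 < s -> lint (fun y => c * moll s (x - y)) = c.
Proof.
move=> s0; have l := moll_Linfc s0.
have -> : (fun y => c * moll s (x - y)) = (fun y => c * moll s (y + - x)).
  by apply/funext => y; rewrite -opprB moll_even.
by rewrite lintZ ?lint_shift ?lint_moll ?mulr1//; exact: Linfc_shift.
Qed.

Lemma convD s f g x : 0 < s -> Linfc f -> Linfc g ->
  conv s (fun y => f y + g y) x = conv s f x + conv s g x.
Proof.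
move=> s0 lf lg; rewrite /conv /convol -lintD//; [|exact: conv_section..].
by congr lint; apply/funext => y; rewrite mulrDl.
Qed.

Lemma convZ s (c : R) f x : 0 < s -> Linfc f ->
  conv s (fun y => c * f y) x = c * conv s f x.
Proof.
move=> s0 lf; rewrite /conv /convol -lintZ//; last exact: conv_section.
by congr lint; apply/funext => y; rewrite mulrA.
Qed.

Lemma convB s f g x : 0 < s -> Linfc f -> Linfc g ->
  conv s (fun y => f y - g y) x = conv s f x - conv s g x.
Proof.
move=> s0 lf lg; rewrite -[X in _ + X]mulN1r -convZ// -convD//; last exact: LinfcZ.
by congr (conv _ _ x); apply/funext => y; rewrite mulN1r.
Qed.

Lemma moll_partial_odd s i x : 0 < s -> partial i (moll s) (- x) = - partial i (moll s) x.
Proof.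
move=> s0; have [C kC] := moll_taylor s0.
apply: partialE; apply: (@taylor_is_partial _ _ _ _ _ _ C) => t.
have := kC x i (- t); rewrite sqrrN mulNr mulrN !opprK; congr (`|_| <= _).
by rewrite moll_even -(moll_even s (- x + _)) opprD opprK scaleNr.
Qed.

(** The mollifier is even, hence its derivatives are odd. *)
Lemma conv_partial_adjoint s f g i : 0 < s -> Linfc f -> Linfc g ->
  lint (fun x => g x * partial i (conv s f) x) =
  - lint (fun y => f y * partial i (conv s g) y).
Proof.
move=> s0 lf lg.
have cp : continuous (partial i (moll s)) by exact: ((moll_C1c s0).1 i).2.
have sp := C1c_partial_supp i (moll_C1c s0).
rewrite !conv_partial// (lint_convol lf lg cp sp) -lintN; last first.
  by apply: LinfcM => //; exact: convol_Linfc.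
congr lint; apply/funext => y; rewrite -mulrN; congr (_ * _).
rewrite /convol -lintN; last first.
  exact: (Linfc2_section y (Linfc2_kernel lg cp sp)).
by congr lint; apply/funext => z; rewrite moll_partial_odd// mulrN.
Qed.

Lemma conv_norm_le s f x : 0 < s -> Linfc f -> `|conv s f x| <= conv s (fun y => `|f y|) x.
Proof.
move=> s0 lf; apply: le_trans (le_norm_lint (conv_section x s0 lf)) _.
rewrite /conv /convol; under eq_fun do rewrite normrM (ger0_norm (moll_ge0 _ s0)).
exact: lexx.
Qed.

Lemma conv_ge0 s f x : 0 < s -> (forall y, 0 <= f y) -> 0 <= conv s f x.
Proof. by move=> s0 f0; apply: lint_ge0 => y; rewrite mulr_ge0// moll_ge0. Qed.

Lemma le_conv s f g x : 0 < s -> Linfc f -> Linfc g -> (forall y, f y <= g y) ->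
  conv s f x <= conv s g x.
Proof.
move=> s0 lf lg fg; apply: le_lint => [||y]; [exact: conv_section..|].
by rewrite ler_wpM2r// moll_ge0.
Qed.

Lemma conv_le_cst s f (c : R) x : 0 < s -> Linfc f -> (forall y, f y <= c) -> conv s f x <= c.
Proof.
move=> s0 lf fc; rewrite -[leRHS](conv_cst_section c x s0); apply: le_lint => [||y].
- exact: conv_section.
- apply: LinfcZ; rewrite (_ : (fun y => _) = fun y => moll s (y + - x)).
    by apply: Linfc_shift; exact: moll_Linfc.
  by apply/funext => y; rewrite -opprB moll_even.
- by rewrite ler_wpM2r// moll_ge0.
Qed.

Lemma conv_le_lint s f x : 0 < s -> Linfc f -> (forall y, 0 <= f y) ->
  conv s f x <= (4 / s) ^+ n.+1 * lint f.
Proof.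
move=> s0 lf f0; rewrite -lintZ//; apply: le_lint => [||y].
- exact: conv_section.
- exact: LinfcZ.
- by rewrite mulrC ler_wpM2r// moll_le.
Qed.

(** On the cube of half the width the mollifier is bounded below. *)
Lemma conv_ge_lint s f x : 0 < s -> Linfc f -> (forall y, 0 <= f y) ->
  (forall y, s / 2 < `|x - y| -> f y = 0) -> (2 * s) ^- n.+1 * lint f <= conv s f x.
Proof.
move=> s0 lf f0 fs; rewrite -lintZ//; apply: le_lint => [||y].
- exact: LinfcZ.
- exact: conv_section.
- rewrite mulrC; have [xy|xy] := leP `|x - y| (s / 2); last by rewrite fs// !mul0r.
  by rewrite ler_wpM2l// moll_ge.
Qed.

Lemma lint_conv s f : 0 < s -> Linfc f -> lint (conv s f) = lint f.
Proof.
move=> s0 lf; have [mf [M [fM f0]]] := lf.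
have l2 := Linfc2_kernel lf (moll_continuous s0) (moll_suppE s0).
rewrite /conv /convol (lint_exchange l2); congr lint; apply/funext => y.
rewrite lintZ; last by exact: (Linfc_shift (- y) (moll_Linfc s0)).
by rewrite (lint_shift (- y) (moll_Linfc s0)) lint_moll// mulr1.
Qed.

Lemma lint_norm_conv_le s f : 0 < s -> Linfc f ->
  lint (fun x => `|conv s f x|) <= lint (fun x => `|f x|).
Proof.
move=> s0 lf; rewrite -(lint_conv s0 (Linfc_norm lf)); apply: le_lint => [||x].
- by apply: Linfc_norm; exact: conv_Linfc.
- by apply: conv_Linfc => //; exact: Linfc_norm.
- exact: conv_norm_le.
Qed.

Lemma conv_supp s f (M : R) x : 0 < s -> (forall y, M <= `|y| -> f y = 0) ->
  M + s <= `|x| -> conv s f x = 0.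
Proof.
move=> s0 f0 xM; rewrite /conv /convol (_ : (fun y => _) = fun=> 0); first exact: lint0.
apply/funext => y; have [yM|yM] := leP M `|y|; first by rewrite f0// mul0r.
rewrite moll_supp ?mulr0//; have := ler_normB (x - y) (- y); rewrite opprK subrK normrN.
by move: xM yM; move: `|x| `|y| `|x - y| => a b c; lra.
Qed.

End mollifier.

Section mollifier_limit.
Context {R : realType} {n : nat}.
Local Notation Rn := 'rV[R]_n.+1.
Implicit Types (f g : Rn -> R) (x y : Rn).

Lemma conv_cvg_pointwise (s_ : nat -> R) g x : (forall k, 0 < s_ k) ->
  s_ k @[k --> \oo] --> (0 : R) -> C1c g -> conv (s_ k) g x @[k --> \oo] --> g x.
Proof.
move=> s0 sc cg; apply/cvgrPdist_le => e e0.
have cx : continuous g := C1_continuous cg.1.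
move: (cx x) => /(@cvgrPdist_le _ _ _ (nbhs (x : Rn)))/(_ _ e0)/nbhs_ballP[d/= d0 gd].
have /cvgrPdist_lt/(_ _ d0) := sc; apply: filterS => k.
rewrite sub0r normrN (gtr0_norm (s0 k)) => skd.
have lg := C1c_Linfc cg.
have h := conv_cst_section (g x) x (s0 k).
have lm : Linfc (fun y => moll (s_ k) (x - y)).
  rewrite (_ : (fun y => _) = fun y => moll (s_ k) (y + - x)).
    by apply: Linfc_shift; exact: moll_Linfc.
  by apply/funext => y; rewrite -opprB moll_even.
rewrite -h /conv /convol -lintB; [|exact: LinfcZ|exact: conv_section].
have l3 : Linfc (fun y => g x * moll (s_ k) (x - y) - g y * moll (s_ k) (x - y)).
  by apply: LinfcB; [exact: LinfcZ|exact: conv_section].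
apply: le_trans (le_norm_lint l3) _.
rewrite -[leRHS](conv_cst_section e x (s0 k)); apply: le_lint => [||y].
- exact: Linfc_norm.
- exact: LinfcZ.
rewrite -mulrBl normrM (ger0_norm (moll_ge0 _ (s0 k))).
have [xy|xy] := ltP `|x - y| d; last first.
  by rewrite moll_supp ?mulr0// (le_trans (ltW skd)).
by rewrite ler_wpM2r ?moll_ge0//; apply: gd; rewrite -ball_normE.
Qed.

(** Smoothing is a contraction in mean, so that it is enough to treat a dense class, on
    which the convergence is pointwise and dominated. *)
Lemma conv_cvg (s_ : nat -> R) f : (forall k, 0 < s_ k) -> s_ k @[k --> \oo] --> (0 : R) ->
  Linfc f -> lint (fun x => `|conv (s_ k) f x - f x|) @[k --> \oo] --> (0 : R).
Proof.
move=> s0 sc lf; apply/cvgrPdist_le => e e0.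
have e3 : 0 < e / 3 by rewrite divr_gt0.
have [g [cg fg]] := C1c_dense lf e3; have lg := C1c_Linfc cg.
have [_ [M [gM g0]]] := lg.
have gc : lint (fun x => `|conv (s_ k) g x - g x|) @[k --> \oo] --> (0 : R).
  have M0 : 0 <= M by apply: le_trans (gM 0).
  have [S [S0 sS]] : exists S : R, 0 < S /\ forall k, s_ k <= S.
    have [S [_ hS]] := cvg_seq_bounded (cvgP _ sc).
    exists (Num.max 1 (S + 1)); split; first by rewrite lt_max ltr01.
    move=> k; rewrite le_max; apply/orP; right.
    by rewrite (le_trans (ler_norm _))// hS// ltrDl.
  have lB : Linfc (\1_(ball (0 : Rn) (M + S)) : Rn -> R).
    apply: (Linfc_indic (M := M + S)); first exact: ball_Lmeasurable.
    by move=> x; rewrite -ball_normE/= sub0r normrN.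
  have [||||_] // := @lint_cvg _ _ (fun k x => `|conv (s_ k) g x - g x|) (fun=> 0)
    (fun x => (M + M) * \1_(ball (0 : Rn) (M + S)) x).
  - by move=> k; apply: (Linfc_norm (LinfcB (conv_Linfc (s0 k) lg) lg)).1.
  - exact: LinfcZ.
  - move=> k x; rewrite normr_id indicE; have [xM|xM] := ltP `|x| (M + S).
      rewrite mem_set ?mulr1; last by rewrite -ball_normE/= sub0r normrN.
      apply: le_trans (ler_normB _ _) _; apply: lerD => //.
      apply: le_trans (conv_norm_le _ (s0 k) lg) _.
      by apply: conv_le_cst => //; exact: Linfc_norm.
    rewrite (conv_supp (s0 k) g0) ?(le_trans _ xM) ?lerD2l//.
    by rewrite g0 ?subrr ?normr0 ?mulr_ge0 ?addr_ge0// (le_trans _ xM)// lerDl ltW.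
  - move=> x; rewrite -(normr0 R); apply: cvg_norm.
    rewrite -(subrr (g x)); apply: cvgB; last exact: cvg_cst.
    exact: conv_cvg_pointwise.
  by rewrite lint0.
have /cvgrPdist_le/(_ _ e3) := gc; apply: filterS => k.
rewrite !sub0r !normrN; have lk := s0 k.
have L (a b : Rn -> R) : Linfc a -> Linfc b -> Linfc (fun x => `|a x - b x|).
  by move=> la lb; apply: Linfc_norm; exact: LinfcB.
have cfl := conv_Linfc lk lf; have cgl := conv_Linfc lk lg.
rewrite !ger0_norm; [move=> h|by apply: lint_ge0..].
apply: (@le_trans _ _ (lint (fun x => `|conv (s_ k) (fun y => f y - g y) x| +
   `|conv (s_ k) g x - g x| + `|f x - g x|))).
  apply: le_lint => [||x].
  - exact: L.
  - apply: LinfcD; last exact: L.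
    apply: LinfcD; last exact: L.
    by apply: Linfc_norm; apply: conv_Linfc => //; exact: LinfcB.
  rewrite convB// [in leRHS](distrC (f x)).
  rewrite (_ : conv _ f x - f x = (conv (s_ k) f x - conv (s_ k) g x) + (conv (s_ k) g x - g x) + (g x - f x)); last by ring.
  by apply: le_trans (ler_normD _ _) _; rewrite lerD2r ler_normD.
rewrite lintD; last 2 first.
- apply: LinfcD; last exact: L.
  by apply: Linfc_norm; apply: conv_Linfc => //; exact: LinfcB.
- exact: L.
rewrite lintD; [|by apply: Linfc_norm; apply: conv_Linfc => //; exact: LinfcB|exact: L].
have h2 := lint_norm_conv_le lk (LinfcB lf lg).
move: h h2 fg; set a := lint _; set b := lint _; set c := lint _ => h h2 fg.
have fg' : c <= e / 3 by [].
lra.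
Qed.

End mollifier_limit.

(** * Total variation and perimeter *)

Section total_variation.
Context {R : realType} {n : nat}.
Local Notation Rn := 'rV[R]_n.+1.
Local Notation LT := (caratheodory_type (@lebesgue_outer R n)).
Implicit Types (f g : Rn -> R) (s t : R) (x y : Rn) (i j : 'I_n.+1) (A B : set Rn)
  (xi zeta : 'I_n.+1 -> Rn -> R).
Local Notation e_ i := (delta_mx 0 i : Rn).

(** Test fields are families of coordinates, so that they can be built from
    scalar functions. *)
Definition dv xi x : R := \sum_i partial i (xi i) x.

Definition C1c_field xi := forall i, C1c (xi i).

Definition admissible xi := C1c_field xi /\ forall x, \sum_i xi i x ^+ 2 <= 1.

Definition tv f : \bar R :=
  ereal_sup [set (lint (fun x => f x * dv xi x))%:E | xi in admissible].

Definition bdd_meas f := Lfun f /\ exists M : R, forall x, `|f x| <= M.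

Lemma Linfc_bdd_meas f : Linfc f -> bdd_meas f.
Proof. by move=> [mf [M [fM _]]]; split => //; exists M. Qed.

Lemma bdd_meas_indic A : Lmeasurable A -> bdd_meas \1_A.
Proof.
move=> mA; split; first exact: Lfun_indic.
by exists 1 => x; rewrite indicE; case: (x \in A); rewrite ?normr1// normr0.
Qed.

Lemma bdd_meas_mul f g : bdd_meas f -> Linfc g -> Linfc (fun x => f x * g x).
Proof. by move=> [mf [M fM]] lg; exact: LinfcMl fM. Qed.

Lemma dv_Linfc xi : C1c_field xi -> Linfc (dv xi).
Proof. by move=> cxi; apply: Linfc_sum => i; exact: C1c_partial_Linfc. Qed.

Lemma admissible0 : admissible (fun _ _ => 0).
Proof. by split=> [i|x]; [exact: C1c0|rewrite big1// => i _; rewrite expr0n]. Qed.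

Lemma dv0 x : dv (fun _ _ => 0) x = 0.
Proof. by rewrite /dv big1// => i _; rewrite (C1_cst 0).2. Qed.

Lemma tv_ge0 f : (0 <= tv f)%E.
Proof.
apply: ereal_sup_ubound; exists (fun _ _ => 0); first exact: admissible0.
congr EFin; rewrite -[RHS](@lint0 R n); congr lint.
by apply/funext => x; rewrite dv0 mulr0.
Qed.

Lemma tv_leP f (c : R) :
  (forall xi, admissible xi -> lint (fun x => f x * dv xi x) <= c) <-> (tv f <= c%:E)%E.
Proof.
split=> [h|h xi axi]; first by apply: ge_ereal_sup => _ [xi axi <-]; rewrite lee_fin h.
by rewrite -lee_fin; apply: le_trans h; apply: ereal_sup_ubound; exists xi.
Qed.

Lemma tv_add_le f g (c : R) : (forall xi zeta, admissible xi -> admissible zeta ->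
    lint (fun x => f x * dv xi x) + lint (fun x => g x * dv zeta x) <= c) ->
  (tv f + tv g <= c%:E)%E.
Proof.
move=> key; have gfin : tv g \is a fin_num.
  rewrite ge0_fin_numE ?tv_ge0//; apply: (@le_lt_trans _ _ c%:E); last by rewrite ltry.
  apply/tv_leP => z az; have := key _ _ admissible0 az.
  rewrite (_ : (fun x => f x * _) = fun=> 0) ?lint0 ?add0r//.
  by apply/funext => x; rewrite dv0 mulr0.
rewrite -leeBrDr// -(fineK gfin); apply/tv_leP => xi axi.
rewrite lerBrDl -lerBrDr -lee_fin fineK//.
apply/tv_leP => zeta azeta; rewrite lerBrDl; exact: key.
Qed.

Lemma dvZ (c : R) xi x : C1c_field xi -> dv (fun i x => c * xi i x) x = c * dv xi x.
Proof.
by move=> cxi; rewrite /dv mulr_sumr; apply: eq_bigr => i _; rewrite (C1Z c (cxi i).1).2.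
Qed.

Lemma dvD xi zeta x : C1c_field xi -> C1c_field zeta ->
  dv (fun i x => xi i x + zeta i x) x = dv xi x + dv zeta x.
Proof.
by move=> c1 c2; rewrite /dv -big_split; apply: eq_bigr => i _; rewrite (C1D (c1 i).1 (c2 i).1).2.
Qed.

Lemma lint_dv xi g : C1c_field xi -> C1 g ->
  lint (fun x => g x * dv xi x) = - lint (fun x => \sum_i xi i x * partial i g x).
Proof.
move=> cxi cg; rewrite lint_sum; last first.
  move=> i; apply: Linfc_mul_continuous; [exact: C1_continuous (cxi i).1|exact: (cxi i).2|].
  exact: (cg i).2.
rewrite -sumrN; under eq_bigr do rewrite -lint_by_parts//.
rewrite -lint_sum.
  by congr lint; apply/funext => x; rewrite /dv mulr_sumr.
move=> i; rewrite (_ : (fun x => _) = fun x => partial i (xi i) x * g x).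
  apply: Linfc_mul_continuous; [exact: ((cxi i).1 i).2|exact: C1c_partial_supp|].
  exact: C1_continuous.
by apply/funext => x; rewrite mulrC.
Qed.

Lemma tv_ae f g N : Lfun f -> Lfun g -> leb N = 0%E -> (forall x, ~ N x -> f x = g x) ->
  tv f = tv g.
Proof.
move=> mf mg N0 fg; rewrite /tv; congr ereal_sup; apply/seteqP.
have h xi : admissible xi -> lint (fun x => f x * dv xi x) = lint (fun x => g x * dv xi x).
  move=> [cxi _]; have [mxi _] := dv_Linfc cxi.
  by apply: (lint_ae (LfunM mf mxi) (LfunM mg mxi) N0) => x /fg ->.
by split=> _ [xi axi <-]; exists xi => //; rewrite h.
Qed.

Lemma tvZ_le (a c : R) f : bdd_meas f -> 0 <= a -> (tv f <= c%:E)%E ->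
  (tv (fun x => (a * f x)%R) <= (a * c)%:E)%E.
Proof.
move=> bf a0 /tv_leP fc; apply/tv_leP => xi axi.
rewrite (_ : (fun x => _) = fun x => a * (f x * dv xi x)).
  by rewrite lintZ ?ler_wpM2l ?fc//; apply: bdd_meas_mul => //; apply: dv_Linfc axi.1.
by apply/funext => x; rewrite mulrA.
Qed.

(** A supremum of functionals that are continuous for the convergence in mean. *)
Lemma tv_lsc f (c : R) : Linfc f ->
  (forall e : R, 0 < e -> exists g, [/\ Linfc g, lint (fun x => `|f x - g x|) <= e &
    (tv g <= (c + e)%:E)%E]) -> (tv f <= c%:E)%E.
Proof.
move=> lf fc; apply/tv_leP => xi axi; have lxi := dv_Linfc axi.1.
have [mxi [D [xiD _]]] := lxi; have D0 : 0 <= D by apply: le_trans (xiD 0).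
apply/ler_addgt0Pr => e e0.
have e1 : 0 < e / (1 + D) by rewrite divr_gt0// ltr_pwDl.
have [g [lg fg /tv_leP/(_ _ axi) gc]] := fc _ e1.
have lfg : Linfc (fun x => `|f x - g x|) by apply: Linfc_norm; exact: LinfcB.
have : lint (fun x => f x * dv xi x) - lint (fun x => g x * dv xi x) <=
    D * (e / (1 + D)).
  rewrite -lintB; [|exact: LinfcM..].
  apply: le_trans (ler_wpM2l D0 fg); rewrite -lintZ//; apply: le_lint => [||x].
  - by apply: LinfcB; exact: LinfcM.
  - exact: LinfcZ.
  - rewrite -mulrBl (le_trans (ler_norm _))// normrM mulrC.
    by apply: ler_wpM2r.
have eE : e / (1 + D) + D * (e / (1 + D)) = e by field; rewrite gt_eqF// ltr_pwDl.
by move: gc; rewrite -[in c + e]eE; lra.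
Qed.

Lemma continuous_row (F : 'I_n.+1 -> Rn -> R) : (forall i, continuous (F i)) ->
  continuous (fun x => \row_i F i x : Rn).
Proof.
move=> cF x; apply/(@cvgrPdist_lt _ _ _ (nbhs (x : Rn))) => e e0.
have : \forall y \near (nbhs (x : Rn)), forall i, `|F i x - F i y| < e.
  apply: filter_forall => i; move: (cF i x).
  by move=> /(@cvgrPdist_lt _ _ _ (nbhs (x : Rn)))/(_ _ e0).
apply: filterS => y h; rewrite normr_rV_lt//; apply/forallP => i.
by rewrite !mxE.
Qed.

(** The coordinates of the vector fields of the one side are the families of the other. *)
Lemma perimeterE A : Lmeasurable A -> perimeter A = tv \1_A.
Proof.
move=> mA; rewrite /perimeter /tv; congr ereal_sup.
have intE (w : Rn -> R) : Linfc w ->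
    (\int[leb]_(x in (A : set LT)) (w x)%:E)%E = (lint (fun x => \1_A x * w x))%:E.
  move=> lw; rewrite lintE; last by apply: bdd_meas_mul => //; exact: bdd_meas_indic.
  rewrite integral_mkcond epatch_indic; apply: eq_integral => x _ /=.
  by rewrite -EFinM mulrC.
apply/seteqP; split => _ [xi axi <-].
- have [cxi kxi xi1] := axi.
  pose z i x : R := xi x 0 i.
  have pz i j x : is_derive x (e_ i) (z j) ((partial i xi x) 0 j).
    have d := (cxi i).1 x; split; first by move/derivable_mxP: d => /(_ 0 j).
    by rewrite /partial (derive_mx d) mxE.
  have cz j : C1 (z j) /\ forall i, partial i (z j) = fun x => (partial i xi x) 0 j.
    apply: (@C1I _ _ (z j) (fun i x => (partial i xi x) 0 j)) => i x.
    apply: (@continuous_comp _ _ _ (partial i xi) (fun M : Rn => M 0 j)).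
      exact: (cxi i).2.
    exact: coord_continuous.
  have [M xiM] := tsupp_bounded kxi.
  have sz : C1c_field z.
    by move=> i; split; [exact: (cz i).1|exists M => x /xiM; rewrite /z => ->; rewrite mxE].
  exists z; first split => // x.
    have := xi1 x; rewrite -(@ler_pXn2r _ 2)// ?nnegrE ?enorm_ge0// expr1n enorm_sqr.
    by under eq_bigr do rewrite -expr2.
  rewrite -intE; last exact: dv_Linfc.
  by apply: eq_integral => x _; congr EFin; apply: eq_bigr => i _; rewrite (cz i).2.
- have [cxi xi1] := axi; pose z x : Rn := \row_i xi i x.
  have dz i x : derivable z x (e_ i).
    apply/derivable_mxP => a j; rewrite (_ : (fun _ => _) = xi j).
      exact: ((cxi j).1 i).1.
    by apply/funext => y; rewrite mxE.
  have pz i x : partial i z x = \row_j partial i (xi j) x.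
    rewrite /partial (derive_mx (dz i x)); apply/rowP => j; rewrite !mxE.
    have -> : (fun y : Rn => z y 0 j) = xi j by apply/funext => y; rewrite mxE.
    by [].
  exists z; last first.
    rewrite -intE; last exact: dv_Linfc.
    apply: eq_integral => x _; congr EFin; apply: eq_bigr => i _.
    by rewrite pz mxE.
  split => [i||x].
  + split => //; rewrite (_ : partial i z = fun x => \row_j partial i (xi j) x).
      by apply: continuous_row => j; exact: ((cxi j).1 i).2.
    by apply/funext => x; exact: pz.
  + have /choice[M MP] i := (cxi i).2.
    apply: (@compact_tsupp _ _ _ _ (\big[Num.max/0]_i M i)) => x xM; apply/rowP => i.
    by rewrite !mxE MP// (le_trans _ xM)// le_bigmax.
  + rewrite -(@ler_pXn2r _ 2)// ?nnegrE ?enorm_ge0// expr1n enorm_sqr.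
    by under eq_bigr do rewrite mxE -expr2.
Qed.

End total_variation.

(** * Total variation of smoothings *)

Lemma ler_addgt0_scaled (R : realFieldType) (a b W : R) : 0 <= W ->
  (forall e, 0 < e -> a <= b + e * W) -> a <= b.
Proof.
move=> W0 h; apply/ler_addgt0Pr => e e0.
have /h : 0 < e / (1 + W) by rewrite divr_gt0// ltr_pwDl.
move/le_trans; apply; rewrite lerD2l -mulrA ler_piMr ?(ltW e0)//.
by rewrite mulrC ler_pdivrMr ?mul1r ?lerDr// ltr_pwDl.
Qed.

Section smoothing.
Context {R : realType} {n : nat}.
Local Notation Rn := 'rV[R]_n.+1.
Implicit Types (f g : Rn -> R) (s t : R) (x y : Rn) (i j : 'I_n.+1) (A B : set Rn)
  (xi zeta : 'I_n.+1 -> Rn -> R).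

Definition gnorm g x : R := Num.sqrt (\sum_i partial i g x ^+ 2).

Lemma dot_le_sqrt (a b : 'I_n.+1 -> R) : \sum_i a i ^+ 2 <= 1 ->
  \sum_i a i * b i <= Num.sqrt (\sum_i b i ^+ 2).
Proof.
move=> a1; have := dot_le_enorm (\row_i a i : Rn) (\row_i b i).
rewrite /enorm; do ! under eq_bigr do rewrite !mxE.
rewrite [in X in _ <= _ * X](eq_bigr (fun i => b i ^+ 2)); last by move=> i _; rewrite mxE.
move/le_trans; apply; rewrite ler_piMl ?sqrtr_ge0//.
rewrite -[leRHS]sqrtr1 ler_sqrt//.
by under eq_bigr do rewrite mxE.
Qed.

Lemma gnorm_le_sum g x : gnorm g x <= \sum_i `|partial i g x|.
Proof.
have s0 : 0 <= \sum_i `|partial i g x| by apply: sumr_ge0.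
rewrite -[leRHS](ger0_norm s0) -sqrtr_sqr ler_sqrt ?sqr_ge0//.
have H (r : seq 'I_n.+1) : \sum_(i <- r) partial i g x ^+ 2 <= (\sum_(i <- r) `|partial i g x|) ^+ 2.
  elim: r => [|i r ih]; first by rewrite !big_nil expr0n.
  rewrite !big_cons sqrrD real_normK ?num_real// -addrA lerD2l.
  by rewrite (le_trans ih)// lerDr mulrn_wge0// mulr_ge0// sumr_ge0.
exact: H.
Qed.

Lemma gnorm_ge0 g x : 0 <= gnorm g x. Proof. exact: sqrtr_ge0. Qed.

Lemma partial_le_gnorm g i x : `|partial i g x| <= gnorm g x.
Proof.
rewrite -sqrtr_sqr ler_sqrt; last by apply: sumr_ge0 => j _; rewrite sqr_ge0.
by rewrite (bigD1 i)//= lerDl sumr_ge0// => j _; rewrite sqr_ge0.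
Qed.

Lemma gnorm_Linfc g : C1c g -> Linfc (gnorm g).
Proof.
move=> cg; have lp i := C1c_partial_Linfc i cg.
have l : Linfc (fun x => \sum_i `|partial i g x|).
  by apply: Linfc_sum => i; exact: Linfc_norm.
apply: (Linfc_le (C := 1) l).
  apply: Lfun_comp; first exact: sqrt_continuous.
  by apply: Lfun_sum => i; apply: LfunM; exact: (lp i).1.
move=> x; rewrite mul1r ger0_norm ?gnorm_ge0// ger0_norm; last by apply: sumr_ge0.
exact: gnorm_le_sum.
Qed.

Lemma tv_le_gnorm g : C1c g -> (tv g <= (lint (gnorm g))%:E)%E.
Proof.
move=> cg; apply/tv_leP => xi [cxi xi1]; rewrite lint_dv//; last exact: cg.1.
have lx i : Linfc (fun x => xi i x * partial i g x).
  by apply: LinfcM; [exact: C1c_Linfc|exact: C1c_partial_Linfc].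
rewrite -lintN; last exact: Linfc_sum.
apply: le_lint => [||x].
- by apply: LinfcN; exact: Linfc_sum.
- exact: gnorm_Linfc.
- rewrite -sumrN; under eq_bigr do rewrite -mulNr.
  by apply: dot_le_sqrt; under eq_bigr do rewrite sqrrN.
Qed.

(** Jensen's inequality: if [a i] are the coordinates of the smoothed field at [x] and [S]
    is the sum of their squares, then bounding [a i * phi i] by the half sum of the
    squares under the integral gives [S <= (S + 1) / 2]. *)
Lemma conv_admissible s (phi : 'I_n.+1 -> Rn -> R) : 0 < s -> (forall i, Linfc (phi i)) ->
  (forall x, \sum_i phi i x ^+ 2 <= 1) -> admissible (fun i => conv s (phi i)).
Proof.
move=> s0 lphi phi1; split=> [i|x]; first exact: conv_C1c.
pose a i := conv s (phi i) x; rewrite -[leLHS]/(\sum_i a i ^+ 2).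
have l i : Linfc (fun y => a i * phi i y) by exact: LinfcZ.
have : \sum_i a i ^+ 2 <= (\sum_i a i ^+ 2 + 1) / 2.
  have aE : \sum_i a i ^+ 2 = conv s (fun y => \sum_i a i * phi i y) x.
    rewrite /conv /convol (_ : (fun y => _) = fun y => \sum_i a i * (phi i y * moll s (x - y))).
      rewrite lint_sum => [|i]; last by apply: LinfcZ; exact: conv_section.
      by apply: eq_bigr => i _; rewrite lintZ ?expr2//; exact: conv_section.
    by apply/funext => y; rewrite mulr_suml; apply: eq_bigr => i _; rewrite mulrA.
  rewrite [leLHS]aE.
  apply: conv_le_cst => //; first exact: Linfc_sum.
  move=> y; rewrite ler_pdivlMr//; have := phi1 y.
  rewrite -(lerD2l (\sum_i a i ^+ 2)); apply: le_trans.
  rewrite -big_split mulr_suml; apply: ler_sum => i _ /=.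
  by rewrite -subr_ge0 (_ : _ - _ = (a i - phi i y) ^+ 2) ?sqr_ge0//; ring.
set S := \sum_i _; lra.
Qed.

(** With [g] the smoothing of [f] and [q = sqrt (|grad g| ^ 2 + e ^ 2)], test [f] against
    the smoothing of the field [- grad g / q].  As the mollifier is even, the pairing is
    the integral of [|grad g| ^ 2 / q], which tends to that of [|grad g|] with [e]. *)
Lemma gnorm_conv_le s f (c : R) : 0 < s -> Linfc f -> (tv f <= c%:E)%E ->
  lint (gnorm (conv s f)) <= c.
Proof.
move=> s0 lf /tv_leP fc; pose g := conv s f; have cg : C1c g := conv_C1c s0 lf.
have lg := gnorm_Linfc cg; have [mg [M [gM g0]]] := lg.
have M0 : 0 <= M by apply: le_trans (gM 0).
pose M1 := Num.max 1 M.
have M10 : 0 < M1 by rewrite lt_max ltr01.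
have BM x : ball (0 : Rn) M1 x -> `|x| < M1 by rewrite -ball_normE/= sub0r normrN.
have lB : Linfc (\1_(ball (0 : Rn) M1) : Rn -> R).
  by apply: Linfc_indic BM; exact: ball_Lmeasurable.
have L0 : 0 <= lint (\1_(ball (0 : Rn) M1) : Rn -> R).
  by apply: lint_ge0 => x; rewrite indicE.
suff h (e : R) : 0 < e -> lint (gnorm g) <= c + e * lint (\1_(ball (0 : Rn) M1) : Rn -> R).
  exact: ler_addgt0_scaled L0 h.
move=> e0.
pose q x := Num.sqrt (gnorm g x ^+ 2 + e ^+ 2).
have q0 x : 0 < q x by rewrite sqrtr_gt0 ltr_wpDl ?sqr_ge0// exprn_gt0.
have q2 x : q x ^+ 2 = gnorm g x ^+ 2 + e ^+ 2.
  by rewrite sqr_sqrtr// addr_ge0 ?sqr_ge0.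
have gq x : gnorm g x <= q x.
  by rewrite -(@ler_pXn2r _ 2)// ?nnegrE ?gnorm_ge0 ?(ltW (q0 x))// q2 lerDl sqr_ge0.
have eq_ x : e <= q x.
  by rewrite -(@ler_pXn2r _ 2)// ?nnegrE ?(ltW e0) ?(ltW (q0 x))// q2 lerDr sqr_ge0.
have mq : Lfun (fun x => (q x)^-1).
  have mq' : Lfun (fun x => gnorm g x ^+ 2 + e ^+ 2).
    by apply: LfunD; [exact: LfunM|exact: Lfun_cst].
  pose k (r : R) : R := (Num.sqrt (Num.max (e ^+ 2) r))^-1.
  rewrite (_ : (fun x => _) = fun x => k (gnorm g x ^+ 2 + e ^+ 2)).
    apply: Lfun_comp mq' => r; apply: cvgV.
      by rewrite gt_eqF// sqrtr_gt0 lt_max exprn_gt0.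
    apply: (@continuous_comp _ _ _ (fun r : R => Num.max (e ^+ 2) r) Num.sqrt).
      by apply: continuous_max => ?; [exact: cvg_cst|exact: cvg_id].
    exact: sqrt_continuous.
  by apply/funext => x; rewrite /k max_r// lerDr sqr_ge0.
have gn2 x : gnorm g x ^+ 2 = \sum_i partial i g x ^+ 2.
  by rewrite sqr_sqrtr// sumr_ge0// => i _; rewrite sqr_ge0.
pose phi i x := - ((q x)^-1 * partial i g x).
have lphi i : Linfc (phi i).
  apply: LinfcN; apply: (LinfcMl (C := e^-1)) => //; first exact: C1c_partial_Linfc.
  by move=> x; rewrite gtr0_norm ?invr_gt0// lef_pV2 ?posrE.
have phi1 x : \sum_i phi i x ^+ 2 <= 1.
  under eq_bigr do rewrite sqrrN exprMn.
  rewrite -mulr_sumr -gn2 exprVn ler_pdivrMl ?exprn_gt0// mulr1 q2 lerDl sqr_ge0//.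
have axi := conv_admissible s0 lphi phi1.
have := fc _ axi.
have -> : lint (fun x => f x * dv (fun i => conv s (phi i)) x) =
    lint (fun x => (q x)^-1 * gnorm g x ^+ 2).
  have l1 i : Linfc (fun x => f x * partial i (conv s (phi i)) x).
    by apply: LinfcM => //; apply: C1c_partial_Linfc; exact: conv_C1c.
  have l2 i : Linfc (fun x => phi i x * partial i g x).
    by apply: LinfcM => //; exact: C1c_partial_Linfc.
  transitivity (\sum_i - lint (fun x => phi i x * partial i g x)).
    rewrite (_ : (fun x => _) = fun x => \sum_i f x * partial i (conv s (phi i)) x).
      rewrite lint_sum//; apply: eq_bigr => i _.
      exact: (conv_partial_adjoint i s0 (lphi i) lf).
    by apply/funext => x; rewrite /dv mulr_sumr.
  rewrite sumrN -lint_sum// -lintN; last exact: Linfc_sum.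
  congr lint; apply/funext => x; rewrite gn2 mulr_sumr -sumrN; apply: eq_bigr => i _.
  by rewrite /phi; ring.
have l3 : Linfc (fun x => (q x)^-1 * gnorm g x ^+ 2).
  apply: (LinfcMl (C := e^-1)) => //; first exact: LinfcM.
  by move=> x; rewrite gtr0_norm ?invr_gt0// lef_pV2 ?posrE.
move=> h; rewrite -lerBlDr; apply: le_trans h.
rewrite -lintZ// -lintB//; last exact: LinfcZ.
apply: le_lint => [||x] //; first by apply: LinfcB => //; exact: LinfcZ.
rewrite indicE; have [xM|xM] := ltP `|x| M1; last first.
  rewrite memNset; last by move/BM; rewrite ltNge xM.
  rewrite mulr0 subr0 g0; last by rewrite (le_trans _ xM)// le_max lexx orbT.
  by rewrite expr0n mulr0.
rewrite mem_set ?mulr1; last by rewrite -ball_normE/= sub0r normrN.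
rewrite ler_pdivlMl//.
have := gq x; have := q2 x; have := q0 x; have := eq_ x.
move: (gnorm g x) (q x) => G Q eQ Q0 Q2 GQ.
have h1 : Q * G <= Q * Q by rewrite ler_pM2l.
have h2 : e * e <= Q * e by rewrite ler_pM2r.
by rewrite mulrBr; move: Q2; rewrite !expr2; lra.
Qed.

End smoothing.

(** * Submodularity of the total variation *)

Section submodularity.
Context {R : realType} {n : nat}.
Local Notation Rn := 'rV[R]_n.+1.
Implicit Types (f g : Rn -> R) (s t : R) (x y : Rn) (i j : 'I_n.+1) (A B : set Rn)
  (xi zeta : 'I_n.+1 -> Rn -> R).

(** A smooth approximation of [fun r => `|r - t| - `|t|] that vanishes at 0. *)
Definition sabs (e t r : R) : R := Num.sqrt ((r - t) ^+ 2 + e ^+ 2) - Num.sqrt (t ^+ 2 + e ^+ 2).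

Definition sabs' (e t r : R) : R := (r - t) / Num.sqrt ((r - t) ^+ 2 + e ^+ 2).

Section sabs.
Variables (e t : R).
Hypothesis e0 : 0 < e.

Let q0 r : 0 < (r - t) ^+ 2 + e ^+ 2.
Proof. by rewrite ltr_wpDl ?sqr_ge0// exprn_gt0. Qed.

Lemma sabs_is_derive r : is_derive r (1 : R) (sabs e t) (sabs' e t r).
Proof.
pose p (r : R) : R := (r - t) ^+ 2 + e ^+ 2.
have dp : is_derive r (1 : R) p (2 * (r - t)).
  rewrite /p; apply: is_derive_eq; rewrite /GRing.scale/=; ring.
have ds : is_derive (p r) (1 : R) Num.sqrt (2 * Num.sqrt (p r))^-1.
  exact: is_derive1_sqrt (q0 r).
have dc := is_derive1_comp ds dp.
rewrite (_ : sabs e t = fun r => (Num.sqrt \o p) r - Num.sqrt (t ^+ 2 + e ^+ 2))//.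
apply: is_derive_eq; rewrite subr0 /sabs' /GRing.scale/= -/(p r).
have : Num.sqrt (p r) != 0 by rewrite gt_eqF// sqrtr_gt0 q0.
by move: (Num.sqrt (p r)) => a a0; field.
Qed.

Lemma sabs'_continuous : continuous (sabs' e t).
Proof.
move=> r; apply: cvgM; first by apply: cvgB; [exact: cvg_id|exact: cvg_cst].
apply: cvgV; first by rewrite gt_eqF// sqrtr_gt0 q0.
apply: (@continuous_comp _ _ _ (fun r : R => (r - t) ^+ 2 + e ^+ 2) Num.sqrt).
  apply: cvgD; last exact: cvg_cst.
  by apply: cvgM; apply: cvgB; [exact: cvg_id|exact: cvg_cst|exact: cvg_id|exact: cvg_cst].
exact: sqrt_continuous.
Qed.

Lemma sabs'_le r : `|sabs' e t r| <= 1.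
Proof.
rewrite /sabs' normrM normfV (ger0_norm (sqrtr_ge0 _)) ler_pdivrMr ?sqrtr_gt0 ?q0// mul1r.
by rewrite -sqrtr_sqr ler_sqrt ?lerDl ?sqr_ge0//; exact: ltW (q0 r).
Qed.

Lemma sabs0 : sabs e t 0 = 0.
Proof. by rewrite /sabs sub0r sqrrN subrr. Qed.

Lemma sabs_approx r : `|sabs e t r - (`|r - t| - `|t|)| <= e.
Proof.
have h (a : R) : `|a| <= Num.sqrt (a ^+ 2 + e ^+ 2) <= `|a| + e.
  rewrite -{1}sqrtr_sqr ler_sqrt ?lerDl ?sqr_ge0 ?addr_ge0 ?sqr_ge0//=.
  have a0 : 0 <= `|a| + e by rewrite addr_ge0// ltW.
  rewrite -(ger0_norm a0) -sqrtr_sqr ler_sqrt ?sqr_ge0// sqrrD real_normK ?num_real//.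
  by rewrite lerD2r lerDl mulrn_wge0// mulr_ge0// ltW.
have /andP[h1 h2] := h (r - t); have /andP[h3 h4] := h t.
by rewrite /sabs ler_norml; apply/andP; split; lra.
Qed.

End sabs.

Lemma near_mean f g (e : R) : Linfc f -> Linfc g -> 0 < e ->
  exists s : R, [/\ 0 < s, lint (fun x => `|f x - conv s f x|) <= e &
    lint (fun x => `|g x - conv s g x|) <= e].
Proof.
move=> lf lg e0.
have s0 k : 0 < (k.+1%:R : R)^-1 by rewrite invr_gt0.
have sc : (k.+1%:R : R)^-1 @[k --> \oo] --> (0 : R).
  exact: cvg_harmonic.
have /cvgrPdist_le/(_ _ e0) h1 := conv_cvg s0 sc lf.
have /cvgrPdist_le/(_ _ e0) h2 := conv_cvg s0 sc lg.
have [k _ /(_ k (leqnn k))[]] := filterI h1 h2.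
rewrite !sub0r !normrN !ger0_norm ?lint_ge0// => k1 k2.
exists k.+1%:R^-1; split => //.
  by move: k1; under eq_fun do rewrite distrC.
by move: k2; under eq_fun do rewrite distrC.
Qed.

Let convex_pair (w p q a b : R) : `|w| <= 1 -> - q <= b -> - p <= a ->
  - ((1 + w) / 2 * p + (1 - w) / 2 * q) <= 2^-1 * (a + b + (w * a - w * b)).
Proof.
rewrite ler_norml => /andP[w1 w2] qb pa.
have h1 : (1 + w) * (- p) <= (1 + w) * a by apply: ler_wpM2l => //; lra.
have h2 : (1 - w) * (- q) <= (1 - w) * b by apply: ler_wpM2l => //; lra.
lra.
Qed.

Let sum3_le (a b c a' b' e : R) : `|a + b| <= a' + b' -> `|c| <= a' + b' + e ->
  2^-1 * `|a + b + c| <= a' + b' + e / 2.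
Proof. by move=> h1 h2; have := ler_normD (a + b) c; lra. Qed.

Let final_arith (x y X Y a b e L1 L2 U V D1 D2 : R) :
  x <= X + e * (L1 + 2 * D1) -> y <= Y + e * (L2 + 2 * D2) -> X <= U -> Y <= V ->
  U + V <= a + b -> x + y <= a + b + e * (L1 + L2 + 2 * (D1 + D2)).
Proof. by rewrite !mulrDr; lra. Qed.

(** For smooth functions [|grad M| + |grad m| <= |grad f| + |grad g|] pointwise, where [M]
    and [m] are the two functions on the left: both gradients are convex combinations of
    those of [f] and [g], with complementary weights.  For [t = 0] they are the maximum
    and the minimum; for [g = 0] they are the parts of [f] above and below the height
    [t], and this common generalization spares a second proof. *)
Lemma tv_submod t f g : Linfc f -> Linfc g ->
  (tv (fun x => ((f x + g x + (`|f x - g x - t| - `|t|)) / 2)%R) +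
   tv (fun x => ((f x + g x - (`|f x - g x - t| - `|t|)) / 2)%R) <= tv f + tv g)%E.
Proof.
move=> lf lg; set M := fun x => _; set m := fun x => _.
have [->|fN] := eqVneq (tv f) +oo%E; first by rewrite addye ?leey// gt_eqF// (lt_le_trans _ (tv_ge0 _)).
have [->|gN] := eqVneq (tv g) +oo%E; first by rewrite addey ?leey// gt_eqF// (lt_le_trans _ (tv_ge0 _)).
have ffin : tv f \is a fin_num by rewrite ge0_fin_numE ?tv_ge0// ltey.
have gfin : tv g \is a fin_num by rewrite ge0_fin_numE ?tv_ge0// ltey.
set a := fine (tv f); set b := fine (tv g).
have fa : tv f = a%:E by rewrite fineK.
have gb : tv g = b%:E by rewrite fineK.
rewrite fa gb.
pose w x := `|f x - g x - t| - `|t|.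
have lw : Linfc w.
  apply: (Linfc_le (C := 1) (LinfcB lf lg)).
    apply: LfunB; last exact: Lfun_cst.
    apply: Lfun_norm; apply: LfunB; last exact: Lfun_cst.
    exact: (LinfcB lf lg).1.
  move=> x; rewrite mul1r /w; have := ler_dist_dist (f x - g x - t) (- t).
  by rewrite opprK subrK normrN.
have lM : Linfc M.
  rewrite (_ : M = fun x => 2^-1 * (f x + g x + w x)).
    by apply: LinfcZ; apply: LinfcD => //; exact: LinfcD.
  by apply/funext => x; rewrite mulrC.
have lm : Linfc m.
  rewrite (_ : m = fun x => 2^-1 * (f x + g x - w x)).
    by apply: LinfcZ; apply: LinfcB => //; exact: LinfcD.
  by apply/funext => x; rewrite mulrC.
rewrite -EFinD; apply: tv_add_le => xi zeta axi azeta.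
have lxi := dv_Linfc axi.1; have lze := dv_Linfc azeta.1.
have [_ [D1 [xD _]]] := lxi; have [_ [D2 [zD _]]] := lze.
have D10 : 0 <= D1 by apply: le_trans (xD 0).
have D20 : 0 <= D2 by apply: le_trans (zD 0).
pose S := lint (fun x => `|dv xi x|) + lint (fun x => `|dv zeta x|).
have S0 : 0 <= S by apply: addr_ge0; exact: lint_ge0.
suff app (e : R) : 0 < e ->
    lint (fun x => M x * dv xi x) + lint (fun x => m x * dv zeta x) <=
    a + b + e * (S + 2 * (D1 + D2)).
  by apply: ler_addgt0_scaled app; rewrite addr_ge0// mulr_ge0// addr_ge0.
move=> e0; have [s [s0 fs gs]] := near_mean lf lg e0.
pose F := conv s f; pose G := conv s g.
have cF : C1c F by exact: conv_C1c.
have cG : C1c G by exact: conv_C1c.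
have gFa : lint (gnorm F) <= a by apply: gnorm_conv_le => //; rewrite fa.
have gGb : lint (gnorm G) <= b by apply: gnorm_conv_le => //; rewrite gb.
rewrite -/F in fs; rewrite -/G in gs.
clearbody F G.
have lF := C1c_Linfc cF; have lG := C1c_Linfc cG.
have [cD pD] := C1D cF.1 cG.1; have [cB pB] := C1B cF.1 cG.1.
have cFG : C1c (fun x => F x - G x) by exact: C1cD cF (C1cN cG).
have [cW pW] := C1_comp (fun r => sabs_is_derive t e0 r) (@sabs'_continuous e t e0) cB.
pose W x := sabs e t (F x - G x).
pose W' x := sabs' e t (F x - G x).
have cW1 : C1c W.
  split=> //; have [N N0] := cFG.2; exists N => x /N0; rewrite /W => ->; exact: sabs0.
have [cM pM] := C1D cD cW; have [cm pm] := C1B cD cW.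
have [cM2 pM2] := C1Z 2^-1 cM; have [cm2 pm2] := C1Z 2^-1 cm.
have W'1 x : `|W' x| <= 1 by exact: sabs'_le.
have mW' : Lfun W'.
  by apply: Lfun_comp; [exact: sabs'_continuous|exact: (C1c_Linfc cFG).1].
have lgF := gnorm_Linfc cF; have lgG := gnorm_Linfc cG.
have lWF : Linfc (fun x => W' x * gnorm F x) by exact: LinfcMl W'1.
have lWG : Linfc (fun x => W' x * gnorm G x) by exact: LinfcMl W'1.
pose U x := 2^-1 * (gnorm F x + gnorm G x + (W' x * gnorm F x - W' x * gnorm G x)).
pose V x := 2^-1 * (gnorm F x + gnorm G x - (W' x * gnorm F x - W' x * gnorm G x)).
have lU : Linfc U by apply: LinfcZ; apply: LinfcD; [exact: LinfcD|exact: LinfcB].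
have lV : Linfc V by apply: LinfcZ; apply: LinfcB; [exact: LinfcD|exact: LinfcB].
have dotF z x (H : Rn -> R) : admissible z -> - (\sum_i z i x * partial i H x) <= gnorm H x.
  move=> [_ z1]; rewrite -sumrN; under eq_bigr do rewrite -mulNr.
  by apply: dot_le_sqrt; under eq_bigr do rewrite sqrrN.
have partz z i (H : Rn -> R) : admissible z -> C1c H -> Linfc (fun x => z i x * partial i H x).
  by move=> [cz _] cH; apply: LinfcM; [exact: C1c_Linfc|exact: C1c_partial_Linfc].
have cMs : C1c (fun x => 2^-1 * (F x + G x + W x)).
  by apply: C1cZ; apply: C1cD => //; exact: C1cD.
have cms : C1c (fun x => 2^-1 * (F x + G x - W x)).
  by apply: C1cZ; apply: C1cD; [exact: C1cD|exact: C1cN].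
have h1 : lint (fun x => 2^-1 * (F x + G x + W x) * dv xi x) <= lint U.
  rewrite (lint_dv axi.1 cMs.1).
  rewrite -lintN; last by apply: Linfc_sum => i; exact: partz.
  apply: le_lint => // [|x]; first by apply: LinfcN; apply: Linfc_sum => i; exact: partz.
  have := dotF _ x F axi; have := dotF _ x G axi.
  have -> : \sum_i xi i x * partial i (fun x => 2^-1 * (F x + G x + W x)) x =
      (1 + W' x) / 2 * (\sum_i xi i x * partial i F x) +
      (1 - W' x) / 2 * (\sum_i xi i x * partial i G x).
    rewrite !mulr_sumr -big_split; apply: eq_bigr => i _ /=.
    by rewrite pM2 pM pD pW pB -/(W' x); field.
  by move=> h1 h2; exact: convex_pair.
have h2 : lint (fun x => 2^-1 * (F x + G x - W x) * dv zeta x) <= lint V.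
  rewrite (lint_dv azeta.1 cms.1).
  rewrite -lintN; last by apply: Linfc_sum => i; exact: partz.
  apply: le_lint => // [|x]; first by apply: LinfcN; apply: Linfc_sum => i; exact: partz.
  have := dotF _ x F azeta; have := dotF _ x G azeta.
  have -> : \sum_i zeta i x * partial i (fun x => 2^-1 * (F x + G x - W x)) x =
      (1 - W' x) / 2 * (\sum_i zeta i x * partial i F x) +
      (1 + W' x) / 2 * (\sum_i zeta i x * partial i G x).
    rewrite !mulr_sumr -big_split; apply: eq_bigr => i _ /=.
    by rewrite pm2 pm pD pW pB -/(W' x); field.
  have W'2 : `|- W' x| <= 1 by rewrite normrN.
  move=> h2 h3; have := convex_pair W'2 h2 h3.
  by rewrite opprK; congr (_ <= _); rewrite /V; ring.
have h3 : lint U + lint V <= a + b.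
  rewrite -lintD//; have -> : (fun x => U x + V x) = fun x => gnorm F x + gnorm G x.
    by apply/funext => x; rewrite /U /V; field.
  by rewrite lintD//; exact: lerD.
have approx (c : R) z D : `|c| <= 1 -> admissible z -> (forall x, `|dv z x| <= D) ->
    lint (fun x => 2^-1 * (f x + g x + c * w x) * dv z x) <=
    lint (fun x => 2^-1 * (F x + G x + c * W x) * dv z x) +
    e * (lint (fun x => `|dv z x|) + 2 * D).
  move=> c1 az zDD; have lz := dv_Linfc az.1; have lzn := Linfc_norm lz.
  have DD0 : 0 <= D by apply: le_trans (zDD 0).
  have lfF : Linfc (fun x => `|f x - F x|) by apply: Linfc_norm; exact: LinfcB.
  have lgG' : Linfc (fun x => `|g x - G x|) by apply: Linfc_norm; exact: LinfcB.
  have l1 : Linfc (fun x => 2^-1 * (F x + G x + c * W x) * dv z x).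
    apply: LinfcM => //; apply: LinfcZ; apply: LinfcD; first exact: LinfcD.
    by apply: LinfcZ; exact: C1c_Linfc.
  have l2 : Linfc (fun x => 2^-1 * (f x + g x + c * w x) * dv z x).
    apply: LinfcM => //; apply: LinfcZ; apply: LinfcD; first exact: LinfcD.
    exact: LinfcZ.
  have l3 : Linfc (fun x => e * `|dv z x| + D * (`|f x - F x| + `|g x - G x|)).
    by apply: LinfcD; [exact: LinfcZ|apply: LinfcZ; exact: LinfcD].
  apply: (@le_trans _ _ (lint (fun x => 2^-1 * (F x + G x + c * W x) * dv z x +
     (e * `|dv z x| + D * (`|f x - F x| + `|g x - G x|))))).
    apply: le_lint => // [|x]; first exact: LinfcD.
    rewrite -lerBlDl -mulrBl -mulrBr; apply: le_trans (ler_norm _) _.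
    have hw : `|w x - W x| <= `|f x - F x| + `|g x - G x| + e.
      pose p := `|F x - G x - t| - `|t|.
      have hA : `|w x - p| <= `|f x - F x| + `|g x - G x|.
        rewrite /w /p (_ : _ - _ - _ = `|f x - g x - t| - `|F x - G x - t|); last by ring.
        apply: le_trans (ler_dist_dist _ _) _.
        rewrite (_ : f x - g x - t - _ = (f x - F x) - (g x - G x)); last by ring.
        exact: ler_normB.
      have hB : `|W x - p| <= e by exact: sabs_approx.
      rewrite (_ : w x - W x = (w x - p) - (W x - p)); last by ring.
      by apply: le_trans (ler_normB _ _) _; exact: lerD.
    have hc : `|c * (w x - W x)| <= `|w x - W x| by rewrite normrM ler_piMl.
    rewrite (_ : f x + g x + c * w x - _ = (f x - F x) + (g x - G x) + c * (w x - W x)); last by ring.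
    have hn := sum3_le (ler_normD (f x - F x) (g x - G x)) (le_trans hc hw).
    rewrite normrM normrM ger0_norm ?invr_ge0//.
    apply: (@le_trans _ _ ((`|f x - F x| + `|g x - G x| + e) * `|dv z x|)).
      apply: ler_wpM2r => //; apply: le_trans hn _; rewrite lerD2l ler_pdivrMr//.
      by rewrite ler_peMr ?(ltW e0)// ler1n.
    rewrite mulrDl addrC lerD2l mulrC; exact: ler_wpM2r.
  rewrite lintD// lerD2l lintD//; [|exact: LinfcZ|by apply: LinfcZ; exact: LinfcD].
  rewrite !lintZ// ?lintD//; last exact: LinfcD.
  rewrite (mulrDr e) lerD2l (mulrC 2 D) mulrA (mulrC e D) -mulrA ler_wpM2l// mulr_natr mulr2n.
  exact: lerD.
have n1 : `|(1 : R)| <= 1 by rewrite normr1.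
have n2 : `|(- 1 : R)| <= 1 by rewrite normrN1.
have a1 := approx 1 xi D1 n1 axi xD.
have a2 := approx (-1) zeta D2 n2 azeta zD.
have eM : (fun x => M x * dv xi x) = fun x => 2^-1 * (f x + g x + 1 * w x) * dv xi x.
  by apply/funext => x; rewrite /M /w; field.
have em : (fun x => m x * dv zeta x) = fun x => 2^-1 * (f x + g x + -1 * w x) * dv zeta x.
  by apply/funext => x; rewrite /m /w; field.
rewrite eM em.
have eM2 : (fun x => 2^-1 * (F x + G x + 1 * W x) * dv xi x) =
    fun x => 2^-1 * (F x + G x + W x) * dv xi x.
  by apply/funext => x; rewrite mul1r.
have em2 : (fun x => 2^-1 * (F x + G x + -1 * W x) * dv zeta x) =
    fun x => 2^-1 * (F x + G x - W x) * dv zeta x.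
  by apply/funext => x; rewrite mulN1r.
rewrite eM2 in a1; rewrite em2 in a2.
exact: final_arith a1 a2 h1 h2 h3.
Qed.

End submodularity.

(** * Superlevel sets *)

Section level_sets.
Context {R : realType} {n : nat}.
Local Notation Rn := 'rV[R]_n.+1.
Implicit Types (f g : Rn -> R) (s t : R) (x y : Rn) (A B : set Rn).

Lemma tv_max_min f g : Linfc f -> Linfc g ->
  (tv (fun x => Num.max (f x) (g x)) + tv (fun x => Num.min (f x) (g x)) <= tv f + tv g)%E.
Proof.
move=> lf lg; have := tv_submod 0 lf lg.
have -> : (fun x => (f x + g x + (`|f x - g x - 0| - `|0 : R|)) / 2) =
    fun x => Num.max (f x) (g x).
  by apply/funext => x; rewrite maxr_absE normr0 !subr0.
have -> // : (fun x => (f x + g x - (`|f x - g x - 0| - `|0 : R|)) / 2) =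
    fun x => Num.min (f x) (g x).
by apply/funext => x; rewrite minr_absE normr0 !subr0.
Qed.

Lemma tv0 : tv (fun _ : Rn => 0) = 0%E :> \bar R.
Proof.
apply/eqP; rewrite eq_le tv_ge0 andbT; apply/tv_leP => xi _.
by under eq_fun do rewrite mul0r; rewrite lint0.
Qed.

Lemma tv_cut t f : 0 <= t -> Linfc f -> (forall x, 0 <= f x) ->
  (tv (fun x => Num.max (f x - t) 0)%R + tv (fun x => Num.min (f x) t) <= tv f)%E.
Proof.
move=> t0 lf f0; have := tv_submod t lf (@Linfc0 R n); rewrite tv0 adde0.
have -> : (fun x => (f x + 0 + (`|f x - 0 - t| - `|t|)) / 2) =
    fun x => Num.max (f x - t) 0.
  by apply/funext => x; rewrite maxr_absE !subr0 !addr0 (ger0_norm t0); congr (_ / _); ring.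
have -> // : (fun x => (f x + 0 - (`|f x - 0 - t| - `|t|)) / 2) =
    fun x => Num.min (f x) t.
by apply/funext => x; rewrite minr_absE !subr0 addr0 (ger0_norm t0); congr (_ / _); ring.
Qed.

Lemma Linfc_cut t f : 0 <= t -> Linfc f -> Linfc (fun x => Num.max (f x - t) 0).
Proof.
move=> t0 lf; apply: (Linfc_le (C := 1) lf).
  apply: Lfun_max; last exact: Lfun_cst.
  by apply: LfunB; [exact: lf.1|exact: Lfun_cst].
move=> x; rewrite mul1r ger0_norm ?le_max ?lexx ?orbT// ge_max normr_ge0 andbT.
by rewrite lerBlDr (le_trans (ler_norm _))// lerDl.
Qed.

Lemma Linfc_trunc t f : 0 <= t -> Linfc f -> (forall x, 0 <= f x) ->
  Linfc (fun x => Num.min (f x) t).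
Proof.
move=> t0 lf f0; apply: (Linfc_le (C := 1) lf).
  by apply: Lfun_min; [exact: lf.1|exact: Lfun_cst].
by move=> x; rewrite mul1r !ger0_norm ?le_min ?f0// ge_min lexx.
Qed.

Definition slice s t f x : R := Num.min (Num.max (f x - s) 0) (t - s).

Lemma slice_Linfc s t f : 0 <= s <= t -> Linfc f -> Linfc (slice s t f).
Proof.
move=> /andP[s0 st] lf; apply: Linfc_trunc; first by rewrite subr_ge0.
  exact: Linfc_cut.
by move=> x; rewrite le_max lexx orbT.
Qed.

Lemma tv_slice s t f : 0 <= s <= t -> Linfc f -> (forall x, 0 <= f x) ->
  (tv (fun x => Num.min (f x) s)%R + tv (slice s t f) <= tv (fun x => Num.min (f x) t))%E.
Proof.
move=> /andP[s0 st] lf f0; have t0 := le_trans s0 st.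
have h0 x : 0 <= Num.min (f x) t by rewrite le_min f0.
have := tv_cut s0 (Linfc_trunc t0 lf f0) h0; rewrite addeC.
have -> : (fun x => Num.min (Num.min (f x) t) s) = fun x => Num.min (f x) s.
  by apply/funext => x; rewrite -minA (min_r st).
have -> // : (fun x => Num.max (Num.min (f x) t - s) 0) = slice s t f.
apply/funext => x; rewrite /slice; have [h1|h1] := leP (f x) t.
  rewrite [RHS]min_l// ge_max subr_ge0 st andbT lerB//.
by rewrite !max_l ?subr_ge0 ?(le_trans st (ltW h1))// min_r// lerB// ltW.
Qed.

(** A weak coarea formula.  If every superlevel set had perimeter more than [c], then the
    total variation [W t] of [min f t] would satisfy [W t >= c * t], by induction along
    the interval, and this fails at [t = 1]. *)
Lemma perimeter_level f (c : R) : Linfc f -> (forall x, 0 <= f x <= 1) ->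
  (tv f < c%:E)%E -> exists s : R, [/\ 0 <= s, s < 1 &
    (perimeter [set x | (s < f x)%R] <= c%:E)%E].
Proof.
move=> lf f01 fc; apply: contrapT => H.
have f0 x : 0 <= f x by have /andP[] := f01 x.
have c0 : 0 < c by rewrite -lte_fin (le_lt_trans (tv_ge0 _) fc).
pose W t := tv (fun x => Num.min (f x) t).
have ext s : 0 <= s -> s < 1 -> exists t, [/\ s < t, t <= 1 & (W s + (c * (t - s))%:E <= W t)%E].
  move=> s0 s1; apply: contrapT => hn; apply: H; exists s; split => //.
  rewrite perimeterE; last by apply: Lfun_gt_measurable; exact: lf.1.
  (* The slices just above [s], scaled to height 1, have variation at most [c]; they
     converge in mean to the indicator of the superlevel set. *)
  pose t_ k : R := s + (1 - s) / k.+1%:R.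
  have t1 k : s < t_ k <= 1.
    rewrite /t_ ltrDl divr_gt0 ?subr_gt0//= -lerBrDl ler_pdivrMr//.
    by rewrite ler_peMr ?subr_ge0 ?(ltW s1)// ler1n.
  have ts k : 0 < t_ k - s by have /andP[h _] := t1 k; rewrite subr_gt0.
  have st k : 0 <= s <= t_ k by rewrite s0; have /andP[/ltW] := t1 k.
  pose q k x := (t_ k - s)^-1 * slice s (t_ k) f x.
  have lq k : Linfc (q k) by apply: LinfcZ; apply: slice_Linfc.
  have Wfin t : 0 <= t -> W t \is a fin_num.
    move=> t0; rewrite ge0_fin_numE ?tv_ge0//; apply: le_lt_trans (lt_trans fc (ltry _)).
    apply: le_trans (tv_cut t0 lf f0); rewrite leeDr// tv_ge0//.
  have tq k : (tv (q k) <= c%:E)%E.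
    have sl : (tv (slice s (t_ k) f) <= ((t_ k - s) * c)%:E)%E.
      rewrite leNgt; apply/negP => h; apply: hn; exists (t_ k).
      have /andP[h1 h2] := t1 k; split => //.
      apply: (le_trans _ (tv_slice (st k) lf f0)); rewrite leeD2l// mulrC.
      exact: ltW.
    have := tvZ_le (Linfc_bdd_meas (slice_Linfc (st k) lf)) (ltW _) sl.
    move/(_ (t_ k - s)^-1); rewrite invr_gt0 => /(_ (ts k)).
    by rewrite mulrA mulVf ?mul1r// gt_eqF.
  have t_c : t_ k - s @[k --> \oo] --> (0 : R).
    rewrite (_ : (fun k => _) = fun k => (1 - s) * (k.+1%:R)^-1); last first.
      by apply/funext => k; rewrite /t_ addrC addKr.
    by rewrite -(mulr0 (1 - s)); apply: cvgMr; exact: cvg_harmonic.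
  have q01 k x : 0 <= q k x <= 1.
    rewrite /q /slice; have := ts k => tsk; apply/andP; split.
      by rewrite mulr_ge0 ?invr_ge0 ?(ltW tsk)// le_min le_max lexx orbT (ltW tsk).
    by rewrite ler_pdivrMl// mulr1 ge_min lexx orbT.
  pose L := [set x | s < f x].
  have q0 k x : ~ L x -> q k x = 0.
    move=> /negP; rewrite -leNgt => fs; rewrite /q /slice max_r ?subr_le0//.
    by rewrite min_l ?mulr0// ltW.
  have qc x : q k x @[k --> \oo] --> (\1_L x : R).
    rewrite indicE; have [xL|xL] := boolP (x \in L); last first.
      rewrite (_ : (fun k => _) = fun=> 0); first exact: cvg_cst.
      by apply/funext => k; rewrite q0//; move/negP: xL; rewrite inE.
    apply: cvg_near_cst; rewrite inE /L/= in xL.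
    have fs : 0 < f x - s by rewrite subr_gt0.
    have /cvgrPdist_lt/(_ _ fs) := t_c; apply: filterS => k.
    rewrite sub0r normrN gtr0_norm// => h.
    by rewrite /q /slice max_l ?(ltW fs)// min_r ?(ltW h)// mulVf// gt_eqF.
  have mL : Lmeasurable L by apply: Lfun_gt_measurable; exact: lf.1.
  have lL : Linfc (\1_L : Rn -> R).
    have [_ [M [_ M0]]] := lf; apply: (Linfc_indic (M := M)) => // x Lx.
    by rewrite ltNge; apply/negP => /M0 fx; move: Lx; rewrite /L/= fx ltNge s0.
  have [mL' [M [LM L0]]] := lL.
  apply: tv_lsc => // e e0.
  have [||||_ cq] // := @lint_cvg _ _ (fun k x => `|\1_L x - q k x|) (fun=> 0)
    (fun x => 2 * \1_L x).
  - by move=> k; apply: (Linfc_norm (LinfcB lL (lq k))).1.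
  - exact: LinfcZ.
  - move=> k x; rewrite normr_id; have /andP[k0 k1] := q01 k x; rewrite indicE.
    have [xL|xL] := boolP (x \in L).
      by rewrite ger0_norm ?subr_ge0//; rewrite /=; lra.
    rewrite q0; last by move/negP: xL; rewrite inE.
    by rewrite subr0 normr0 mulr0.
  - move=> x; rewrite -(normr0 R) -(subrr (\1_L x)); apply: cvg_norm; apply: cvgB => //.
    exact: cvg_cst.
  move: cq; rewrite lint0 => /cvgrPdist_le/(_ _ e0)[k _ /(_ k (leqnn k))].
  rewrite /= sub0r normrN ger0_norm ?lint_ge0// => kq.
  exists (q k); split => //; apply: le_trans (tq k) _.
  by rewrite lee_fin lerDl ltW.
pose S := [set t : R | 0 <= t <= 1 /\ ((c * t)%:E <= W t)%E].
have S0 : S 0 by split; rewrite ?lexx ?ler01// mulr0 tv_ge0.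
have Wmono s t : 0 <= s -> s <= t -> (W s <= W t)%E.
  move=> s0 st; have hst : 0 <= s <= t by rewrite s0.
  by apply: le_trans (tv_slice hst lf f0); rewrite leeDl// tv_ge0.
have hS : has_sup S by split; [exists 0|exists 1 => t [/andP[]]].
have T0 : 0 <= sup S by apply: sup_upper_bound.
have T1 : sup S <= 1 by apply: ge_sup; [exists 0|move=> t [/andP[]]].
have ST : S (sup S).
  split; first by rewrite T0.
  apply/lee_addgt0Pr => e e0; have ec : 0 < e / c by rewrite divr_gt0.
  have [t [/andP[t0 t1] tW] tT] := sup_adherent ec hS.
  have tS : t <= sup S by apply: sup_upper_bound => //; split; rewrite ?t0.
  apply: (@le_trans _ _ (W t + e%:E)%E); last by rewrite leeD2r// Wmono.
  apply: (@le_trans _ _ ((c * t)%:E + e%:E)%E); last by rewrite leeD2r.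
  rewrite -EFinD lee_fin; have : e = c * (e / c) by field; rewrite gt_eqF.
  move: tT; set r := e / c => tT ->; rewrite -mulrDr ler_pM2l//.
  by rewrite -lerBlDr ltW.
have [TS1|TS1] := ltP (sup S) 1.
  have [t [Tt t1 h]] := ext _ T0 TS1.
  have : S t.
    split; first by rewrite t1 (le_trans T0)// ltW.
    apply: le_trans h; apply: (@le_trans _ _ ((c * sup S)%:E + (c * (t - sup S))%:E)%E).
      by rewrite -EFinD lee_fin -mulrDr addrC subrK.
    by rewrite leeD2r//; exact: ST.2.
  by move=> /(sup_upper_bound hS); rewrite leNgt Tt.
have E1 : sup S = 1 by apply/eqP; rewrite eq_le T1.
have := ST.2; rewrite E1 mulr1 /W (_ : (fun x => _) = f); first by rewrite leNgt fc.
by apply/funext => x; rewrite min_l//; have /andP[] := f01 x.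
Qed.

End level_sets.

(** * Cutting and filling *)

Section cutting.
Context {R : realType} {n : nat}.
Local Notation Rn := 'rV[R]_n.+1.
Implicit Types (f g psi : Rn -> R) (s t : R) (x y : Rn) (i : 'I_n.+1) (A E : set Rn)
  (xi zeta : 'I_n.+1 -> Rn -> R).

Lemma dvM psi xi : C1 psi -> C1c_field xi -> C1c_field (fun i x => psi x * xi i x) /\
  forall x, dv (fun i x => psi x * xi i x) x = psi x * dv xi x + \sum_i xi i x * partial i psi x.
Proof.
move=> cp cxi; split=> [i|x]; first exact: C1cMr.
rewrite /dv mulr_sumr -big_split; apply: eq_bigr => i _ /=.
by rewrite (C1M cp (cxi i).1).2; ring.
Qed.

Lemma dot_gnorm_le psi xi x : admissible xi -> `|\sum_i xi i x * partial i psi x| <= gnorm psi x.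
Proof.
move=> [_ xi1]; rewrite ler_norml lerNl; apply/andP; split; last exact: dot_le_sqrt.
rewrite -sumrN; under eq_bigr do rewrite -mulNr.
by apply: dot_le_sqrt; under eq_bigr do rewrite sqrrN.
Qed.

Let dot_Linfc psi xi : C1c psi -> C1c_field xi ->
  Linfc (fun x => \sum_i xi i x * partial i psi x).
Proof.
move=> cp cxi; apply: Linfc_sum => i; apply: LinfcM; first exact: C1c_Linfc.
exact: C1c_partial_Linfc.
Qed.

(** The field [psi * xi] is admissible; the product rule leaves an error that the
    gradient of [psi] controls. *)
Lemma tv_indic_mul psi E (c : R) : C1c psi -> (forall x, 0 <= psi x <= 1) -> Lmeasurable E ->
  (tv \1_E <= c%:E)%E ->
  (tv (fun x => (\1_E x * psi x)%R) <= (c + lint (fun x => \1_E x * gnorm psi x))%:E)%E.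
Proof.
move=> cp p01 mE /tv_leP Ec; apply/tv_leP => xi axi.
have bE := bdd_meas_indic mE.
have [cpx dpx] := dvM cp.1 axi.1.
have apx : admissible (fun i x => psi x * xi i x).
  split => // x; apply: le_trans (axi.2 x); apply: ler_sum => i _.
  have /andP[p0 p1] := p01 x; rewrite exprMn ler_piMl ?sqr_ge0//.
  by rewrite expr_le1.
have lg := gnorm_Linfc cp.
apply: (@le_trans _ _ (lint (fun x => \1_E x * dv (fun i x => psi x * xi i x) x) +
   lint (fun x => \1_E x * gnorm psi x))); last by rewrite lerD2r; exact: Ec.
rewrite -lintD; [|by apply: bdd_meas_mul => //; exact: dv_Linfc|exact: bdd_meas_mul].
apply: le_lint => [||x].
- rewrite (_ : (fun x => _) = fun x => \1_E x * (psi x * dv xi x)).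
    apply: bdd_meas_mul => //; apply: LinfcM; first exact: C1c_Linfc.
    exact: dv_Linfc axi.1.
  by apply/funext => x; rewrite mulrA.
- by apply: LinfcD; apply: bdd_meas_mul => //; exact: dv_Linfc.
- rewrite dpx -mulrDr -mulrA ler_wpM2l ?indicE// -addrA lerDl -lerBlDl sub0r.
  by have := dot_gnorm_le psi x axi; rewrite ler_norml lerNl => /andP[].
Qed.

Let lint_combine (a b c d e f g p q : Rn -> R) : Linfc a -> Linfc b -> Linfc c ->
  Linfc d -> Linfc e -> Linfc f -> Linfc g -> Linfc p -> Linfc q ->
  (forall x, a x + b x = c x + (d x + e x) + (f x + g x) - (p x + q x)) ->
  lint a + lint b = lint c + (lint d + lint e) + (lint f + lint g) - (lint p + lint q).
Proof.
move=> la lb lc ld le lf lg lp lq h.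
have l1 := LinfcD ld le; have l2 := LinfcD lf lg; have l3 := LinfcD lp lq.
rewrite -(lintD la lb) -(lintD ld le) -(lintD lf lg) -(lintD lp lq).
rewrite -(lintD lc l1) -(lintD (LinfcD lc l1) l2) -(lintB (LinfcD (LinfcD lc l1) l2) l3).
by congr lint; apply/funext => x; exact: h.
Qed.

(** Filling part of the complement of [E]: the boundary of [E] is shared between
    the two functions on the left, with weights [psi] and [1 - psi]. *)
Lemma tv_fill psi E : C1c psi -> (forall x, 0 <= psi x <= 1) -> Lmeasurable E ->
  (tv (fun x => (\1_(~` E) x * psi x)%R) + tv (fun x => (\1_E x + \1_(~` E) x * psi x)%R) <=
   tv \1_E + (2 * lint (fun x => \1_(~` E) x * gnorm psi x))%:E)%E.
Proof.
move=> cp p01 mE; have mA : Lmeasurable (~` E) by exact: measurableC.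
have bE := bdd_meas_indic mE; have bA := bdd_meas_indic mA.
have lp := C1c_Linfc cp; have lg := gnorm_Linfc cp.
set U := fun x => _; set V := fun x => _; set I := lint _.
have [->|EN] := eqVneq (tv \1_E) +oo%E.
  by rewrite addye ?leey// gt_eqF// ltNyr.
have Efin : tv \1_E \is a fin_num by rewrite ge0_fin_numE ?tv_ge0// ltey.
set c := fine (tv \1_E); have Ec : tv \1_E = c%:E by rewrite fineK.
have /tv_leP cE : (tv \1_E <= c%:E)%E by rewrite Ec.
rewrite Ec -EFinD.
have AE x : \1_(~` E) x = 1 - \1_E x :> R.
  by rewrite !indicE in_setC; case: (x \in E); rewrite ?subrr ?subr0.
apply: tv_add_le => xi zeta axi aze; have lxi := dv_Linfc axi.1; have lze := dv_Linfc aze.1.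
pose N x := 1 - psi x.
have [cN pN] : C1 N /\ forall i, partial i N = fun x => - partial i psi x.
  have [h1 h2] := C1B (C1_cst 1).1 cp.1; split => // i.
  by rewrite h2; apply/funext => x; rewrite (C1_cst 1).2 sub0r.
have [cNz dNz] := dvM cN aze.1; have [cpx dpx] := dvM cp.1 axi.1.
(* A single admissible field for the indicator of E, by convexity of the squared norm:
   on the left E is seen by zeta with weight 1 - psi and, from outside, by xi with
   weight psi. *)
pose w i x := N x * zeta i x + - (psi x * xi i x).
have cpxN : C1c_field (fun i x => - (psi x * xi i x)) by move=> i; exact: C1cN.
have aw : admissible w.
  split=> [i|x]; first by apply: C1cD => //; exact: cNz.
  have /andP[p0 p1] := p01 x.
  apply: (@le_trans _ _ (\sum_i (N x * zeta i x ^+ 2 + psi x * xi i x ^+ 2))).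
    apply: ler_sum => i _; rewrite /w /N -subr_ge0.
    rewrite (_ : _ - _ = psi x * (1 - psi x) * (zeta i x + xi i x) ^+ 2); last by ring.
    by rewrite mulr_ge0 ?sqr_ge0// mulr_ge0// subr_ge0.
  rewrite big_split -!mulr_sumr /=; have := axi.2 x; have := aze.2 x.
  set S := \sum_i _; set T := \sum_i _ => S1 T1.
  have h1 : N x * S <= N x * 1 by rewrite ler_wpM2l// subr_ge0.
  have h2 : psi x * T <= psi x * 1 by rewrite ler_wpM2l.
  by apply: le_trans (lerD h1 h2) _; rewrite /N !mulr1 subrK.
have dw x : dv w x = N x * dv zeta x - \sum_i zeta i x * partial i psi x
    - (psi x * dv xi x + \sum_i xi i x * partial i psi x).
  have h : dv (fun i x => - (psi x * xi i x)) x = - dv (fun i x => psi x * xi i x) x.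
    have := dvZ (-1) x cpx; rewrite mulN1r => <-.
    by rewrite /dv; apply: eq_bigr => i _; congr (partial i _ x); apply/funext => y; rewrite mulN1r.
  rewrite (dvD x cNz cpxN) dNz h dpx; congr (_ + _ - _).
  by rewrite -sumrN; apply: eq_bigr => i _; rewrite pN mulrN.
pose D1 x := \sum_i xi i x * partial i psi x.
pose D2 x := \sum_i zeta i x * partial i psi x.
have lD1 : Linfc D1 by exact: dot_Linfc cp axi.1.
have lD2 : Linfc D2 by exact: dot_Linfc cp aze.1.
have [lpz lpx] := (LinfcM lp lze, LinfcM lp lxi).
have i1 : lint (fun x => psi x * dv xi x) = - lint D1 by exact: lint_dv axi.1 cp.1.
have i2 : lint (fun x => psi x * dv zeta x) = - lint D2 by exact: lint_dv aze.1 cp.1.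
have lw := dv_Linfc aw.1.
have lEw : Linfc (fun x => \1_E x * dv w x) by exact: bdd_meas_mul bE lw.
have lAD1 : Linfc (fun x => \1_(~` E) x * D1 x) by exact: bdd_meas_mul bA lD1.
have lAD2 : Linfc (fun x => \1_(~` E) x * D2 x) by exact: bdd_meas_mul bA lD2.
have lU : Linfc (fun x => U x * dv xi x).
  rewrite (_ : (fun x => _) = fun x => \1_(~` E) x * (psi x * dv xi x)); first exact: bdd_meas_mul.
  by apply/funext => x; rewrite mulrA.
have lV : Linfc (fun x => V x * dv zeta x).
  rewrite (_ : (fun x => _) = fun x => \1_E x * dv zeta x + \1_(~` E) x * (psi x * dv zeta x)).
    exact: LinfcD (bdd_meas_mul bE lze) (bdd_meas_mul bA lpz).
  by apply/funext => x; rewrite /V; ring.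
have eq1 : lint (fun x => U x * dv xi x) + lint (fun x => V x * dv zeta x) =
    lint (fun x => \1_E x * dv w x) +
    (lint (fun x => psi x * dv xi x) + lint D1) +
    (lint (fun x => psi x * dv zeta x) + lint D2) -
    (lint (fun x => \1_(~` E) x * D1 x) + lint (fun x => \1_(~` E) x * D2 x)).
  apply: lint_combine => // x.
  rewrite /U /V dw !AE /N -/(D1 x) -/(D2 x); ring.
rewrite eq1 i1 i2 !addNr !addr0; apply: lerD; first exact: cE.
have gb (D : Rn -> R) : Linfc D -> (forall x, `|D x| <= gnorm psi x) ->
    - lint (fun x => \1_(~` E) x * D x) <= I.
  move=> lD DD; have lAD := bdd_meas_mul bA lD; rewrite -(lintN lAD).
  apply: (le_lint (LinfcN lAD) (bdd_meas_mul bA lg)) => x.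
  rewrite -mulrN ler_wpM2l ?indicE//.
  by have := DD x; rewrite ler_norml lerNl => /andP[].
have g1 := gb _ lD1 (fun x => dot_gnorm_le psi x axi).
have g2 := gb _ lD2 (fun x => dot_gnorm_le psi x aze).
by rewrite opprD mulr_natl mulr2n lerD.
Qed.

End cutting.

(** * Rate of approximation by smoothings *)

Section rates.
Context {R : realType} {n : nat}.
Local Notation Rn := 'rV[R]_n.+1.
Local Notation LT := (caratheodory_type (@lebesgue_outer R n)).
Implicit Types (f g : Rn -> R) (s t : R) (x y v : Rn) (i j : 'I_n.+1) (A : set Rn).
Local Notation e_ i := (delta_mx 0 i : Rn).

(** Taylor's estimate for the increment [r], as the bump takes its values in [0, 1]. *)
Lemma cube_bump_partial_le (c : Rn) r i x : 0 < r -> `|partial i (cube_bump c r) x| <= 17 / r.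
Proof.
move=> r0; have := cube_bump_taylor c i x r r0.
have /andP[a0 a1] := cube_bump_itv c r x.
have /andP[b0 b1] := cube_bump_itv c r (x + r *: e_ i).
rewrite (_ : 16 / r ^+ 2 * r ^+ 2 = 16); last by field; rewrite gt_eqF.
move: (partial _ _ _) a0 a1 b0 b1 => d; move: (cube_bump _ _ _) (cube_bump _ _ _) => a b.
move=> a0 a1 b0 b1; rewrite ler_pdivlMr//.
have -> : `|d| * r = `|r * d| by rewrite normrM (gtr0_norm r0) mulrC.
by rewrite !ler_norml => /andP[h1 h2]; apply/andP; split; lra.
Qed.

(** The derivative is of order [s ^- (n + 2)] on a cube of volume of order [s ^+ (n + 1)]. *)
Lemma moll_partial_mass : exists2 C : R, 0 < C & forall s i, 0 < s ->
  lint (fun x => `|partial i (moll s : Rn -> R) x|) <= C / s.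
Proof.
exists (34 * 16 ^+ n.+1) => [|s i s0]; first by rewrite mulr_gt0// exprn_gt0.
have c1 := moll_C1c (n := n) s0; have lm := C1c_partial_Linfc i c1.
have s2 : 0 < s / 2 by rewrite divr_gt0.
pose I := lint (cube_bump (0 : Rn) (s / 2)).
have I0 : (s / 4) ^+ n.+1 <= I.
  have := moll_le (0 : Rn) s0; rewrite /moll cube_bump1 ?subr0 ?normr0 ?(ltW s2)// -/I mul1r.
  rewrite -[leRHS]invrK -exprVn invf_div lef_pV2 ?posrE//; last first.
    by rewrite exprn_gt0// divr_gt0.
  have := moll_ge (x := 0 : Rn) s0; rewrite normr0 => /(_ (ltW s2)).
  rewrite /moll cube_bump1 ?subr0 ?normr0 ?(ltW s2)// -/I mul1r.
  have p : 0 < ((2 * s) ^+ n.+1)^-1 by rewrite invr_gt0 exprn_gt0 ?mulr_gt0.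
  by move/(lt_le_trans p); rewrite invr_gt0.
have I1 : 0 < I by apply: lt_le_trans I0; rewrite exprn_gt0// divr_gt0.
have BM x : ball (0 : Rn) (2 * s) x -> `|x| < 2 * s.
  by rewrite -ball_normE/= sub0r normrN.
have lB : Linfc (\1_(ball (0 : Rn) (2 * s)) : Rn -> R).
  by apply: Linfc_indic BM; exact: ball_Lmeasurable.
have pm x : partial i (moll s) x = I^-1 * partial i (cube_bump (0 : Rn) (s / 2)) x.
  rewrite -[RHS]/((fun x => I^-1 * partial i (cube_bump 0 (s / 2)) x) x).
  rewrite -(C1Z I^-1 (cube_bump_C1c (0 : Rn) s2).1).2; congr (partial i _ x).
  by apply/funext => z; rewrite mulrC.
have pb x : `|partial i (moll s) x| <= ((4 / s) ^+ n.+1 * (34 / s)) * \1_(ball (0 : Rn) (2 * s)) x.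
  rewrite indicE; have [xs|xs] := ltP `|x| (2 * s).
    rewrite mem_set ?mulr1; last by rewrite -ball_normE/= sub0r normrN.
    rewrite pm normrM ger0_norm ?invr_ge0 ?(ltW I1)//; apply: ler_pM => //.
    - by rewrite invr_ge0 ltW.
    - rewrite -[leRHS]invrK -exprVn invf_div lef_pV2 ?posrE//.
      by rewrite exprn_gt0// divr_gt0.
    - apply: le_trans (cube_bump_partial_le _ i x s2) _.
      by rewrite le_eqVlt; apply/orP; left; apply/eqP; field; rewrite gt_eqF.
  rewrite (@partial_eq0 _ _ (moll s) i x [set y : Rn | s < `|y|]).
  - by rewrite normr0 mulr_ge0// mulr_ge0 ?exprn_ge0 ?divr_ge0// ltW.
  - rewrite (_ : [set y | _] = (fun y : Rn => `|y|) @^-1` [set r : R | s < r])//.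
    by apply: open_comp; [move=> y _; exact: norm_continuous|exact: open_gt].
  - by apply: lt_le_trans xs; rewrite mulrC; lra.
  - by move=> y /ltW; exact: moll_supp.
apply: (@le_trans _ _ (lint (fun x => ((4 / s) ^+ n.+1 * (34 / s)) * \1_(ball (0 : Rn) (2 * s)) x))).
  by apply: le_lint => //; [exact: Linfc_norm|exact: LinfcZ].
rewrite lintZ//.
have h0 : 0 <= (4 / s) ^+ n.+1 * (34 / s) by rewrite mulr_ge0 ?exprn_ge0 ?divr_ge0// ltW.
have hs : 0 < 2 * s by rewrite mulr_gt0.
apply: le_trans (ler_wpM2l h0 (lint_ball_le (0 : Rn) hs)) _.
rewrite mulrAC -exprMn (_ : 4 / s * (2 * (2 * s)) = 16); last by field; rewrite gt_eqF.
by rewrite mulrA (mulrC _ 34).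
Qed.

Lemma conv_partial_le s f i x : 0 < s -> Linfc f -> (forall y, `|f y| <= 1) ->
  `|partial i (conv s f) x| <= lint (fun y => `|partial i (moll s) y|).
Proof.
move=> s0 lf f1; have c1 := moll_C1c (n := n) s0; have lm := C1c_partial_Linfc i c1.
rewrite conv_partial// /convol.
have odd z : partial i (moll s) (- z) = - partial i (moll s) z := moll_partial_odd i z s0.
have E : (fun y => f y * partial i (moll s) (x - y)) =
    fun y => - (f y * partial i (moll s) (y + - x)).
  by apply/funext => y; rewrite -opprB odd mulrN.
have l1 := Linfc_shift (- x) lm.
have lf' : Linfc (fun y => f y * partial i (moll s) (y + - x)) by exact: LinfcM.
rewrite E (lintN lf') normrN; apply: le_trans (le_norm_lint lf') _.
rewrite -(lint_shift (- x) (Linfc_norm lm)).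
apply: (le_lint (Linfc_norm lf') (Linfc_norm l1)) => y.
by rewrite normrM ler_piMl.
Qed.

(** The smoothing of the indicator of [A] at scale [s]. *)
Lemma smooth_indic : exists2 C : R, 0 < C & forall A (M s : R), Lmeasurable A ->
  (forall x, A x -> `|x| < M) -> 0 < s -> exists psi : Rn -> R, [/\ C1c psi,
    forall x, 0 <= psi x <= 1,
    forall x, (forall y, `|x - y| < s -> A y) -> psi x = 1,
    forall x, (forall y, `|x - y| < s -> ~ A y) -> psi x = 0 &
    forall x, gnorm psi x <= C / s].
Proof.
have [C C0 HC] := moll_partial_mass; exists (C *+ n.+1); first by rewrite mulrn_wgt0.
move=> A M s mA AM s0; have lA : Linfc (\1_A : Rn -> R) := Linfc_indic mA AM.
have A01 x : 0 <= (\1_A x : R) <= 1 by rewrite indicE; case: (x \in A); rewrite ?lexx ?ler01.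
exists (conv s \1_A); split.
- exact: conv_C1c.
- move=> x; apply/andP; split.
    by apply: conv_ge0 => // y; have /andP[] := A01 y.
  by apply: conv_le_cst => // y; have /andP[] := A01 y.
- move=> x xA; rewrite -[RHS](conv_cst_section 1 x s0); congr lint; apply/funext => y.
  have [xy|xy] := ltP `|x - y| s; last by rewrite moll_supp// !mulr0.
  by rewrite indicE mem_set//; exact: xA.
- move=> x xA; rewrite /conv /convol (_ : (fun y => _) = fun=> 0); first exact: lint0.
  apply/funext => y; have [xy|xy] := ltP `|x - y| s; last by rewrite moll_supp// !mulr0.
  by rewrite indicE memNset ?mul0r//; exact: xA.
- move=> x; apply: le_trans (gnorm_le_sum _ _) _.
  have -> : C *+ n.+1 / s = \sum_(i < n.+1) C / s.
    by rewrite sumr_const card_ord mulrnAl.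
  apply: ler_sum => i _; apply: le_trans (HC s i s0); apply: conv_partial_le => // y.
  by have /andP[a0 a1] := A01 y; rewrite ger0_norm.
Qed.

Lemma lint_translate_vec_le g v : C1c g ->
  lint (fun x => `|g (x + v) - g x|) <= \sum_i `|v 0 i| * lint (fun x => `|partial i g x|).
Proof.
move=> cg; have lg := C1c_Linfc cg.
have vE : v = \sum_i v 0 i *: e_ i.
  by rewrite {1}[v]row_sum_delta.
have H (r : seq 'I_n.+1) : lint (fun x => `|g (x + \sum_(i <- r) v 0 i *: e_ i) - g x|) <=
    \sum_(i <- r) `|v 0 i| * lint (fun x => `|partial i g x|).
  elim: r => [|i r ih].
    rewrite !big_nil (_ : (fun x => _) = fun=> 0) ?lint0//.
    by apply/funext => x; rewrite addr0 subrr normr0.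
  rewrite big_cons; set w := \sum_(i <- r) v 0 i *: e_ i in ih.
  have la : Linfc (fun x => `|g (x + v 0 i *: e_ i) - g x|).
    by apply: Linfc_norm; apply: LinfcB => //; exact: Linfc_shift.
  have lb := Linfc_shift w la.
  have lc : Linfc (fun x => `|g (x + w) - g x|).
    by apply: Linfc_norm; apply: LinfcB => //; exact: Linfc_shift.
  apply: (@le_trans _ _ (lint (fun x => `|g (x + w + v 0 i *: e_ i) - g (x + w)| + `|g (x + w) - g x|))).
    apply: le_lint; [|exact: LinfcD|move=> x].
      by apply: Linfc_norm; apply: LinfcB => //; exact: Linfc_shift.
    rewrite -/w (addrC (_ *: _)) addrA -[X in `|X| <= _](subrKA (g (x + w))).
    exact: ler_normD.
  rewrite (lintD lb lc) big_cons; apply: lerD => //.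
  by rewrite (lint_shift w la); exact: lint_translate_le.
by rewrite {1}vE; exact: H.
Qed.

Let coord_add_measurable i :
  measurable_fun setT (fun z : LT * LT => ((z.1 : Rn) + (z.2 : Rn)) 0 i).
Proof.
rewrite (_ : (fun z => _) = fun z : LT * LT => (z.1 : Rn) 0 i + (z.2 : Rn) 0 i).
  by apply: measurable_funD;
    [apply: (measurableT_comp (@coord_Lmeasurable R n i)); exact: measurable_fst
    |apply: (measurableT_comp (@coord_Lmeasurable R n i)); exact: measurable_snd].
by apply/funext => z; rewrite !mxE.
Qed.

(** The convolution averages the translates by vectors of norm less than [s]. *)
Lemma conv_rate_C1 s g (c : R) : 0 < s -> C1c g -> lint (gnorm g) <= c ->
  lint (fun x => `|conv s g x - g x|) <= (s * c) *+ n.+1.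
Proof.
move=> s0 cg gc; have lg := C1c_Linfc cg; have [mg [M [gM g0]]] := lg.
have lm := moll_Linfc (n := n) s0; have [_ [Mk [kM _]]] := lm.
have M0 : 0 <= M by apply: le_trans (gM 0).
have Mk0 : 0 <= Mk by apply: le_trans (kM 0).
pose F x y := `|g (x + y) - g x| * moll s y.
have lF : Linfc2 F.
  split.
    apply: measurable_funM; last first.
      by apply: (measurableT_comp lm.1); exact: measurable_snd.
    apply: (measurableT_comp (continuous_measurable_fun (@norm_continuous _ R))).
    apply: measurable_funB; last by apply: (measurableT_comp mg); exact: measurable_fst.
    have := @measurable_fun_coord R n _ (LT * LT)%type (fun z => (z.1 : Rn) + (z.2 : Rn)) coord_add_measurable.
    exact: (measurableT_comp (continuous_borel_measurable (C1_continuous cg.1))).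
  exists (Num.max ((M + M) * Mk) (M + s)); split=> x y.
    rewrite le_max /F normrM normr_id ler_pM//.
    by apply: le_trans (ler_normB _ _) _; exact: lerD.
  have [ys|ys] := leP s `|y|; first by rewrite /F moll_supp// mulr0.
  rewrite !ge_max => -[|]/andP[_ h]; last first.
    by move: ys; rewrite ltNge (le_trans _ h)// lerDr.
  rewrite /F (g0 x) ?(g0 (x + y)) ?subrr ?normr0 ?mul0r//.
    have := ler_normB (x + y) y; rewrite addrK.
    by move: h ys; move: `|x| `|y| `|x + y| => a b d; lra.
  by rewrite (le_trans _ h)// lerDl ltW.
have l2 x := Linfc2_section x lF.
have lcv := conv_Linfc s0 lg.
apply: (@le_trans _ _ (lint (fun x => lint (F x)))).
  apply: le_lint => [||x].
  - by apply: Linfc_norm; exact: LinfcB.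
  - exact: Linfc2_lint.
  - have lx : Linfc (fun y => g (x + y) * moll s y).
      have := Linfc_shift x lg; under eq_fun do rewrite addrC.
      by move=> h; exact: LinfcM.
    have <- : lint (fun y => g x * moll s y) = g x by rewrite lintZ// lint_moll// mulr1.
    rewrite convE// -lintB//; last exact: LinfcZ.
    have l3 : Linfc (fun y => g (x + y) * moll s y - g x * moll s y).
      by apply: LinfcB => //; exact: LinfcZ.
    apply: le_trans (le_norm_lint l3) _.
    apply: le_lint => // [|y]; first exact: Linfc_norm.
    by rewrite -mulrBl normrM (ger0_norm (moll_ge0 y s0)).
rewrite lint_exchange//.
have -> : (s * c) *+ n.+1 = lint (fun y => (s * c) *+ n.+1 * moll s y).
  by rewrite lintZ// lint_moll// mulr1.
apply: le_lint => [||y].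
- exact: Linfc2_lint (Linfc2_swap lF).
- exact: LinfcZ.
rewrite (_ : (fun x => F x y) = fun x => moll s y * `|g (x + y) - g x|); last first.
  by apply/funext => x; rewrite mulrC.
rewrite lintZ; last by apply: Linfc_norm; apply: LinfcB => //; exact: Linfc_shift.
rewrite mulrC; have [ys|ys] := leP s `|y|; first by rewrite moll_supp// !mulr0.
apply: ler_wpM2r; first exact: moll_ge0.
apply: le_trans (lint_translate_vec_le y cg) _.
have -> : (s * c) *+ n.+1 = \sum_(i < n.+1) s * c by rewrite sumr_const card_ord.
apply: ler_sum => i _; apply: ler_pM => //; first exact: lint_ge0.
  by apply: le_trans (normr_coord_le y i) _; exact: ltW.
apply: le_trans gc; apply: le_lint => [||x].
- by apply: Linfc_norm; exact: C1c_partial_Linfc.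
- exact: gnorm_Linfc.
- exact: partial_le_gnorm.
Qed.

(** Apply [conv_rate_C1] to a fine smoothing of [f], whose gradient has no more mass than
    the variation of [f]. *)
Lemma conv_rate s f (c : R) : 0 < s -> Linfc f -> (tv f <= c%:E)%E ->
  lint (fun x => `|conv s f x - f x|) <= (s * c) *+ n.+1.
Proof.
move=> s0 lf fc; apply/ler_addgt0Pr => e e0.
have e2 : 0 < e / 2 by rewrite divr_gt0.
have [r [r0 fr _]] := near_mean lf lf e2.
pose g := conv r f; have cg : C1c g by exact: conv_C1c.
have gc : lint (gnorm g) <= c by exact: gnorm_conv_le.
rewrite -/g in fr; clearbody g; have lg := C1c_Linfc cg.
have h := conv_rate_C1 s0 cg gc.
have cfl := conv_Linfc s0 lf; have cgl := conv_Linfc s0 lg.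
have lgf : Linfc (fun x => g x - f x) by exact: LinfcB.
have lcgf := conv_Linfc s0 lgf.
have ln1 := Linfc_norm lcgf; have ln2 := Linfc_norm (LinfcB cgl lg); have ln3 := Linfc_norm lgf.
apply: (@le_trans _ _ (lint (fun x => `|conv s (fun y => g y - f y) x| + `|conv s g x - g x| + `|g x - f x|))).
  apply: le_lint => [||x].
  - by apply: Linfc_norm; exact: LinfcB.
  - exact: LinfcD (LinfcD ln1 ln2) ln3.
  - rewrite (convB x s0 lg lf).
    rewrite (_ : conv s f x - f x = - (conv s g x - conv s f x) + (conv s g x - g x) + (g x - f x)); last by ring.
    apply: le_trans (ler_normD _ _) _; rewrite lerD2r.
    by apply: le_trans (ler_normD _ _) _; rewrite normrN.
rewrite (lintD (LinfcD ln1 ln2) ln3) (lintD ln1 ln2).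
have h2 := lint_norm_conv_le s0 lgf.
have h3 : lint (fun x => `|g x - f x|) <= e / 2.
  by move: fr; under eq_fun do rewrite distrC.
move: h h2 h3; set a := lint _; set b := lint _; set d := lint _ => h h2 h3.
have hb : b <= e / 2 by apply: le_trans h2 h3.
move: h h2 h3 hb; lra.
Qed.

End rates.

(** * Regularity of finite Borel measures *)

Section regularity.
Context {R : realType} {n : nat}.
Local Notation Rn := 'rV[R]_n.+1.
Local Notation T := (borel R n).
Implicit Types (A U : set Rn).
Variable m : {measure set T -> \bar R}.
Hypothesis mfin : (m setT < +oo)%E.

Let m_lty A : measurable (A : set T) -> (m A < +oo)%E.
Proof.
by move=> mA; apply: le_lt_trans mfin; apply: le_measure; rewrite ?inE.
Qed.

Let regular (A : set T) := measurable A /\ forall e : R, 0 < e -> exists C G : set Rn,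
  [/\ closed C, open G, C `<=` A, A `<=` G & (m (G `\` C) <= e%:E)%E].

Let regular_open (U : set Rn) : open U -> regular U.
Proof.
move=> oU; split; first exact: open_borel.
move=> e e0.
pose C k : set Rn := \bigcap_(y in ~` U) [set x : Rn | k.+1%:R^-1 <= `|x - y|].
have cC k : closed (C k).
  apply: closed_bigI => y _.
  rewrite (_ : [set x | _] = (fun x : Rn => `|x - y|) @^-1` [set r : R | k.+1%:R^-1 <= r])//.
  apply: closed_comp; last exact: closed_ge.
  move=> x _; apply: continuous_comp; last exact: norm_continuous.
  by apply: continuousB; [exact: cvg_id|exact: cst_continuous].
have CU k : C k `<=` U.
  move=> x Cx; apply: contrapT => nUx; have := Cx _ nUx.
  by rewrite /= subrr normr0 leNgt invr_gt0 ltr0n.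
pose D k : set T := U `\` C k.
have mU : measurable (U : set T) by exact: open_borel.
have mD k : measurable (D k) by apply: measurableD => //; exact: closed_borel.
have D0 : \bigcap_k D k = set0.
  rewrite -subset0 => x Dx; have [Ux _] := Dx 0%N I.
  have /nbhs_ballP[r /= r0 rU] := open_nbhs_nbhs (conj oU Ux).
  have [k] := ltr_add_invr r0; rewrite add0r => kr.
  have [_] := Dx k I; apply => y /= nUy; rewrite leNgt; apply/negP => xy.
  by apply: nUy; apply: rU; rewrite -ball_normE/=; apply: lt_trans kr.
have D0m : m (\bigcap_k D k) = 0%E by rewrite D0 measure0.
have : (m \o D) k @[k --> \oo] --> m (\bigcap_k D k).
  apply: nonincreasing_cvg_mu => //.
  - exact: m_lty.
  - by rewrite D0.
  - move=> k l kl; apply/subsetPset => x [Ux nC]; split => // Ck; apply: nC => y nUy /=.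
    apply: le_trans (Ck y nUy); rewrite lef_pV2 ?posrE//.
    by rewrite ler_nat ltnS.
rewrite D0m => /fine_cvgP[_ /cvgrPdist_lt/(_ _ e0)[k _ /(_ k (leqnn k))]] /=.
rewrite sub0r normrN ger0_norm ?fine_ge0// => h.
exists (C k), U; split => //.
by rewrite -(fineK (_ : m (D k) \is a fin_num)) ?lee_fin ?(ltW h)// ge0_fin_numE// m_lty.
Qed.

Let regular_setC A : regular A -> regular (~` A).
Proof.
move=> [mA rA]; split; first exact: measurableC.
move=> e e0; have [C [G [cC oG CA AG h]]] := rA e e0.
exists (~` G), (~` C); split.
- exact: open_closedC.
- exact: closed_openC.
- exact: subsetC.
- exact: subsetC.
- rewrite (_ : ~` C `\` ~` G = G `\` C)//.
  by apply/seteqP; split => x; [move=> [nC /contrapT]|move=> [Ox nC]; split => //; exact].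
Qed.

Let regular_bigcup (F : (set T)^nat) : (forall k, regular (F k)) -> regular (\bigcup_k F k).
Proof.
move=> rF; have mF k : measurable (F k) := (rF k).1.
split; first exact: bigcup_measurable.
move=> e e0; have e2 : 0 < e / 2 by rewrite divr_gt0.
have ek k : 0 < e / 2 / (2 ^ k.+1)%:R by rewrite divr_gt0// ltr0n expn_gt0.
have /choice[CO COP] k : exists CO : set Rn * set Rn, [/\ closed CO.1, open CO.2, CO.1 `<=` F k,
    F k `<=` CO.2 & (m (CO.2 `\` CO.1) <= (e / 2 / (2 ^ k.+1)%:R)%:E)%E].
  by have [C [G h]] := (rF k).2 _ (ek k); exists (C, G).
pose C k := (CO k).1; pose G k := (CO k).2.
have mC k : measurable (C k : set T) by apply: closed_borel; have [] := COP k.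
have mO k : measurable (G k : set T) by apply: open_borel; have [] := COP k.
pose Oo : set T := \bigcup_k G k.
have oG : open (Oo : set Rn) by apply: bigcup_open => k _; have [] := COP k.
have mOo : measurable Oo by exact: open_borel.
pose D (N : nat) : set T := Oo `\` \big[setU/set0]_(k < N) C k.
have mCN N : measurable (\big[setU/set0]_(k < N) C k : set T) by apply: bigsetU_measurable.
have mD N : measurable (D N) by exact: measurableD.
have Dinf : \bigcap_N D N = Oo `\` \bigcup_k C k.
  apply/seteqP; split=> [x Dx|x [Ox nC] N _].
    split; first by have [] := Dx 0%N I.
    by move=> [k _ Cx]; have [_] := Dx k.+1 I; apply; rewrite big_ord_recr/=; right.
  by split=> // /(@bigsetU_bigcup _ C); exact: nC.
have mDinf : measurable (\bigcap_N D N) by rewrite Dinf; apply: measurableD => //; exact: bigcup_measurable.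
have Dle : (m (\bigcap_N D N) <= (e / 2)%:E)%E.
  rewrite Dinf; apply: (@le_trans _ _ (\sum_(0 <= k <oo) m (G k `\` C k))%E).
    apply: measure_sigma_subadditive.
    - by move=> k; exact: measurableD.
    - by rewrite -Dinf.
    - by move=> x [[k _ Ox] nC]; exists k => //; split => // Cx; apply: nC; exists k.
  apply: le_trans (epsilon_trick0 xpredT (ltW e2)).
  by apply: lee_nneseries => k _ //; have [] := COP k.
have : (m \o D) N @[N --> \oo] --> m (\bigcap_N D N).
  apply: nonincreasing_cvg_mu => //; first exact: m_lty.
  move=> k l kl; apply/subsetPset => x [Ux nC]; split => // Ck; apply: nC.
  exact: (subset_bigsetU kl Ck).
have mDf : m (\bigcap_N D N) \is a fin_num by rewrite ge0_fin_numE// m_lty.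
rewrite -(fineK mDf) => /fine_cvgP[_ /cvgrPdist_lt/(_ _ e2)[N _ /(_ N (leqnn N))]] /=.
move=> h; exists (\big[setU/set0]_(k < N) C k), Oo; split => //.
- elim: {h} N => [|N ih]; first by rewrite big_ord0; exact: closed0.
  by rewrite big_ord_recr/=; apply: closedU => //; have [] := COP N.
- apply: subset_trans (@bigsetU_bigcup _ C N) _ => x [k _ Cx]; exists k => //.
  by have [_ _ h1 _ _] := COP k; exact: h1.
- by move=> x [k _ Fx]; exists k => //; have [_ _ _ h1 _] := COP k; exact: h1.
- have mDN : m (D N) \is a fin_num by rewrite ge0_fin_numE// m_lty.
  rewrite -[m _]/(m (D N)) -(fineK mDN) lee_fin.
  have : fine (m (\bigcap_N D N)) <= e / 2 by rewrite -lee_fin fineK.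
  by move: h; rewrite ltr_norml => /andP[]; set a := fine _; set b := fine _; lra.
Qed.

(** The sets that are squeezed, up to a small measure, between a closed and an open set
    form a sigma-algebra that contains the open sets; the closed sets are then exhausted
    by compact ones. *)
Lemma borel_regular (A : set T) (e : R) : measurable A -> 0 < e -> exists C G : set Rn,
  [/\ compact C, open G, C `<=` A, A `<=` G & (m (G `\` C) <= e%:E)%E].
Proof.
move=> mA e0; have e2 : 0 < e / 2 by rewrite divr_gt0.
have [_ /(_ _ e2)[C [G [cC oG CA AG h]]]] : regular A.
  apply: (@smallest_sub _ (sigma_algebra setT) (@open Rn) regular); last exact: mA.
    split.
    - by split=> // e' e'0; exists set0, set0; split => //;
        [exact: closed0|rewrite setD0 measure0 lee_fin ltW].
    - by move=> B rB; rewrite setTD; exact: regular_setC.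
    - by move=> F rF; exact: regular_bigcup.
  by move=> U oU; exact: regular_open.
have mC : measurable (C : set T) by exact: closed_borel.
have mO : measurable (G : set T) by exact: open_borel.
pose B k : set Rn := C `&` [set x | `|x - 0| <= k%:R].
have cB k : compact (B k).
  rewrite /B setIC; apply: compact_closedI => //; exact: compact_closed_cube.
have mB k : measurable (B k : set T).
  by apply: closed_borel; exact: compact_closed (@norm_hausdorff _ _) (cB k).
have BC : \bigcup_k B k = C.
  apply/seteqP; split=> [x [k _ []]//|x Cx]; exists (Num.truncn `|x|).+1 => //; split => //=.
  by rewrite subr0 ltW// truncnS_gt.
have : (m \o (B : nat -> set T)) k @[k --> \oo] --> m (\bigcup_k B k).
  apply: nondecreasing_cvg_mu => //; first by rewrite BC.
  move=> k l kl; apply/subsetPset => x [Cx xk]; split => //=.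
  by apply: le_trans xk _; rewrite ler_nat.
rewrite BC; have mCf : m C \is a fin_num by rewrite ge0_fin_numE// m_lty.
rewrite -(fineK mCf) => /fine_cvgP[_ /cvgrPdist_lt/(_ _ e2)[k _ /(_ k (leqnn k))]] /=.
move=> hk; exists (B k), G; split => //; first by move=> x [/CA].
have BkC : B k `<=` C by move=> x [].
have mBf : m (B k) \is a fin_num by rewrite ge0_fin_numE// m_lty.
apply: (@le_trans _ _ (m ((G `\` C) `|` (C `\` B k)))).
  apply: le_measure; rewrite ?inE; [exact: measurableD| |].
    by apply: measurableU; exact: measurableD.
  by move=> x [Ox nB]; have [Cx|nC] := pselect (C x); [right|left].
apply: le_trans (measureU2 _ _ _) _; [exact: measurableD..|].
have -> : e = e / 2 + e / 2 by lra.
have CB : C `&` B k = B k by apply/setIidr.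
rewrite EFinD leeD// measureD ?m_lty// CB.
rewrite -[X in (X - _)%E](fineK mCf) -[X in (_ - X)%E](fineK mBf) -EFinB lee_fin.
by move: hk; rewrite ltr_norml => /andP[]; set a := fine _; set b := fine _; lra.
Qed.

End regularity.

(** * Integrals against charges *)

Section bounded_integral.
Context d (T : measurableType d) {R : realType}.
Implicit Types (f g : T -> R) (A : set T) (m : {measure set T -> \bar R}).

Definition Bfun f := measurable_fun setT f /\ exists M : R, forall x, `|f x| <= M.

Definition mint m f : R := fine (\int[m]_x (f x)%:E)%E.

Lemma BfunD f g : Bfun f -> Bfun g -> Bfun (fun x => f x + g x).
Proof.
move=> [mf [M fM]] [mg [N gN]]; split; first exact: measurable_funD.
by exists (M + N) => x; apply: le_trans (ler_normD _ _) _; exact: lerD.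
Qed.

Lemma BfunM f g : Bfun f -> Bfun g -> Bfun (fun x => f x * g x).
Proof.
move=> [mf [M fM]] [mg [N gN]]; split; first exact: measurable_funM.
by exists (M * N) => x; rewrite normrM ler_pM.
Qed.

Lemma Bfun_cst (c : R) : Bfun (fun=> c).
Proof. by split; [exact: measurable_cst|exists `|c|]. Qed.

Lemma BfunZ (c : R) f : Bfun f -> Bfun (fun x => c * f x).
Proof. by apply: BfunM; exact: Bfun_cst. Qed.

Lemma BfunN f : Bfun f -> Bfun (fun x => - f x).
Proof. by move=> /(BfunZ (-1)); under eq_fun do rewrite mulN1r. Qed.

Lemma BfunB f g : Bfun f -> Bfun g -> Bfun (fun x => f x - g x).
Proof. by move=> bf bg; apply: BfunD => //; exact: BfunN. Qed.

Lemma Bfun_indic A : measurable A -> Bfun \1_A.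
Proof.
move=> mA; split; first exact/measurable_indicP.
by exists 1 => x; rewrite indicE; case: (x \in A); rewrite ?normr1// normr0.
Qed.

Lemma Bfun_sum (I : Type) (s : seq I) (F : I -> T -> R) :
  (forall i, Bfun (F i)) -> Bfun (fun x => \sum_(i <- s) F i x).
Proof.
move=> mF; elim: s => [|i s ih].
  by under eq_fun do rewrite big_nil; exact: Bfun_cst.
by under eq_fun do rewrite big_cons; exact: BfunD.
Qed.

Section finite_measure.
Variable m : {measure set T -> \bar R}.
Hypothesis mfin : (m setT < +oo)%E.

Lemma Bfun_integrable f : Bfun f -> m.-integrable setT (EFin \o f).
Proof.
move=> [mf [M fM]]; apply: (@integrable_le_indic _ _ _ m setT f `|M|) => // x.
by rewrite indicT mulr1 (le_trans (fM x))// ler_norm.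
Qed.

Lemma mintE f : Bfun f -> (mint m f)%:E = (\int[m]_x (f x)%:E)%E.
Proof. by move=> bf; rewrite /mint fineK// integrable_fin_num//; exact: Bfun_integrable. Qed.

Lemma mintD f g : Bfun f -> Bfun g -> mint m (fun x => f x + g x) = mint m f + mint m g.
Proof.
move=> bf bg; apply: EFin_inj; rewrite EFinD !mintE//; last exact: BfunD.
under eq_integral do rewrite EFinD.
by rewrite integralD//; exact: Bfun_integrable.
Qed.

Lemma mintZ (c : R) f : Bfun f -> mint m (fun x => c * f x) = c * mint m f.
Proof.
move=> bf; apply: EFin_inj; rewrite EFinM !mintE//; last exact: BfunZ.
under eq_integral do rewrite EFinM.
by rewrite integralZl//; exact: Bfun_integrable.
Qed.

Lemma le_mint f g : Bfun f -> Bfun g -> (forall x, f x <= g x) -> mint m f <= mint m g.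
Proof.
move=> bf bg fg; rewrite -lee_fin !mintE//.
by apply: le_integral => //; [exact: Bfun_integrable..|move=> x _; rewrite lee_fin].
Qed.

Lemma mint_indic A : measurable A -> mint m \1_A = fine (m A).
Proof. by move=> mA; rewrite /mint integral_indic// setIT. Qed.

Lemma mint_abs_le f A (e : R) : measurable A -> Bfun f -> (forall x, `|f x| <= e * \1_A x) ->
  `|mint m f| <= e * fine (m A).
Proof.
move=> mA bf fe; have b1 := BfunZ e (Bfun_indic mA).
rewrite -(mint_indic mA) -mintZ; last exact: Bfun_indic.
rewrite ler_norml lerNl; apply/andP; split.
  rewrite -mulN1r -mintZ//; apply: le_mint => // [|x]; first exact: BfunZ.
  by rewrite mulN1r (le_trans _ (fe x))// -normrN ler_norm.
by apply: le_mint => // x; rewrite (le_trans _ (fe x))// ler_norm.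
Qed.

End finite_measure.

Section charge.
Variable nu : {charge set T -> \bar R}.

Let hahn := projT2 (cid (projT2 (cid (Hahn_decomposition nu)))).
Definition cpos := jordan_pos hahn.
Definition cneg := jordan_neg hahn.
Definition cvar := charge_variation hahn.

HB.instance Definition _ := Measure.on cvar.

(** The real form of [charge_integral], see [charge_integralE]. *)
Definition CI f : R := mint cpos f - mint cneg f.

Let pfin : (cpos setT < +oo)%E.
Proof. by rewrite ltey_eq fin_num_measure. Qed.

Let nfin : (cneg setT < +oo)%E.
Proof. by rewrite ltey_eq fin_num_measure. Qed.

Lemma cvarE A : measurable A -> fine (cvar A) = fine (cpos A) + fine (cneg A).
Proof. by move=> mA; rewrite /cvar /charge_variation fineD//; exact: fin_num_measure. Qed.

Lemma cvar_fin : (cvar setT < +oo)%E.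
Proof.
rewrite /cvar /charge_variation ltey_eq; apply/orP; left.
by rewrite fin_numD; apply/andP; split; exact: fin_num_measure.
Qed.

Lemma charge_integralE f : Bfun f -> charge_integral nu (fun x => (f x)%:E) = (CI f)%:E.
Proof.
move=> bf; have h1 := mintE pfin bf; have h2 := mintE nfin bf.
by rewrite /CI EFinB h1 h2.
Qed.

Lemma CID f g : Bfun f -> Bfun g -> CI (fun x => f x + g x) = CI f + CI g.
Proof. by move=> bf bg; rewrite /CI (mintD pfin bf bg) (mintD nfin bf bg); ring. Qed.

Lemma CIZ (c : R) f : Bfun f -> CI (fun x => c * f x) = c * CI f.
Proof. by move=> bf; rewrite /CI (mintZ pfin c bf) (mintZ nfin c bf); ring. Qed.

Lemma CI0 : CI (fun=> 0) = 0.
Proof. by rewrite /CI /mint !integral0 subrr. Qed.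

Lemma CI_sum (I : Type) (s : seq I) (F : I -> T -> R) : (forall i, Bfun (F i)) ->
  CI (fun x => \sum_(i <- s) F i x) = \sum_(i <- s) CI (F i).
Proof.
move=> bF; elim: s => [|i s ih].
  by rewrite big_nil -[RHS]CI0; congr CI; apply/funext => x; rewrite big_nil.
rewrite big_cons -ih -(CID (bF i) (Bfun_sum s bF)).
by congr CI; apply/funext => x; rewrite big_cons.
Qed.

Lemma CI_indic A : measurable A -> CI \1_A = fine (nu A).
Proof.
move=> mA; rewrite /CI (mint_indic _ mA) (mint_indic _ mA).
rewrite (jordan_decomp hahn mA) /cadd/= cscaleN1 fineB//; exact: fin_num_measure.
Qed.

Lemma CI_abs_le f A (e : R) : measurable A -> Bfun f -> (forall x, `|f x| <= e * \1_A x) ->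
  `|CI f| <= e * fine (cvar A).
Proof.
move=> mA bf fe; rewrite (cvarE mA) mulrDr; apply: le_trans (ler_normB _ _) _.
by apply: lerD; [exact: (mint_abs_le pfin)|exact: (mint_abs_le nfin)].
Qed.

Lemma charge_abs_le A : measurable A -> `|fine (nu A)| <= fine (cvar A).
Proof.
move=> mA; rewrite -(CI_indic mA) -[leRHS]mul1r; apply: (CI_abs_le mA (Bfun_indic mA)) => x.
by rewrite mul1r ger0_norm// indicE.
Qed.

End charge.

End bounded_integral.

Section enorm_theory.
Context {R : realType} {n : nat}.
Implicit Types x y : 'rV[R]_n.+1.

Lemma enormD x y : enorm (x + y) <= enorm x + enorm y.
Proof.
rewrite -(@ler_pXn2r _ 2)// ?nnegrE ?addr_ge0 ?enorm_ge0// sqrrD !enorm_sqr.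
have -> : \sum_i (x + y) 0 i * (x + y) 0 i =
    \sum_i x 0 i * x 0 i + (\sum_i x 0 i * y 0 i) *+ 2 + \sum_i y 0 i * y 0 i.
  by rewrite -sumrMnl -!big_split; apply: eq_bigr => i _; rewrite /= mxE; ring.
by rewrite lerD2r lerD2l lerMn2r dot_le_enorm orbT.
Qed.

Lemma enorm_le_sum x : enorm x <= \sum_i `|x 0 i|.
Proof.
have s0 : 0 <= \sum_i `|x 0 i| by apply: sumr_ge0.
rewrite -[leRHS](ger0_norm s0) -sqrtr_sqr /enorm ler_sqrt ?sqr_ge0//.
have H (r : seq 'I_n.+1) : \sum_(i <- r) x 0 i ^+ 2 <= (\sum_(i <- r) `|x 0 i|) ^+ 2.
  elim: r => [|i r ih]; first by rewrite !big_nil expr0n.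
  rewrite !big_cons sqrrD real_normK ?num_real// -addrA lerD2l.
  by rewrite (le_trans ih)// lerDr mulrn_wge0// mulr_ge0// sumr_ge0.
exact: H.
Qed.

Lemma normr_le_enorm x : `|x| <= enorm x.
Proof.
rewrite leNgt; apply/negP => h; have x0 := le_lt_trans (enorm_ge0 x) h.
move: (ltxx `|x|); rewrite normr_rV_lt// => /negP; apply; apply/forallP => i.
apply: le_lt_trans h; rewrite -sqrtr_sqr /enorm ler_sqrt; last first.
  by apply: sumr_ge0 => j _; rewrite sqr_ge0.
by rewrite (bigD1 i)//= lerDl sumr_ge0// => j _; rewrite sqr_ge0.
Qed.

End enorm_theory.

Section vector_charge.
Context {R : realType} {n : nat}.
Local Notation Rn := 'rV[R]_n.+1.
Local Notation T := (borel R n).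
Variable mu : 'I_n.+1 -> {charge set T -> \bar R}.
Implicit Types (A U : set Rn) (f g : Rn -> R) (xi : 'I_n.+1 -> Rn -> R).

(** A finite measure that dominates all the coordinates of [mu]. *)
Definition lam : set T -> \bar R := msum (fun k => cvar (mu (inord k))) n.+1.

HB.instance Definition _ := Measure.on lam.

Lemma lamE (A : set T) : lam A = (\sum_i cvar (mu i) A)%E.
Proof. by rewrite /lam /msum; apply: eq_bigr => i _; rewrite inord_val. Qed.

Let cvar_fin_num i (A : set T) : measurable A -> cvar (mu i) A \is a fin_num.
Proof.
move=> mA; rewrite ge0_fin_numE//; apply: le_lt_trans (cvar_fin (mu i)).
by apply: le_measure; rewrite ?inE.
Qed.

Lemma lam_fin : (lam setT < +oo)%E.
Proof.
rewrite lamE; apply: lte_sum_pinfty => i _; exact: cvar_fin.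
Qed.

Lemma lam_fin_num (A : set T) : measurable A -> lam A \is a fin_num.
Proof.
move=> mA; rewrite ge0_fin_numE//; apply: le_lt_trans lam_fin.
by apply: le_measure; rewrite ?inE.
Qed.

Lemma fine_lamE (A : set T) : measurable A -> fine (lam A) = \sum_i fine (cvar (mu i) A).
Proof. by move=> mA; rewrite lamE sum_fine// => i _; exact: cvar_fin_num. Qed.

Lemma vcharge_le_lam (A : set T) : measurable A -> enorm (vcharge mu A) <= fine (lam A).
Proof.
move=> mA; apply: le_trans (enorm_le_sum _) _; rewrite fine_lamE//.
by apply: ler_sum => i _; rewrite mxE; exact: charge_abs_le.
Qed.

Lemma vector_variation_fin : (vector_variation mu setT < +oo)%E.
Proof.
apply: le_lt_trans lam_fin; apply: ge_ereal_sup => _ [F [mF tF _] <-].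
apply: (@le_trans _ _ (\sum_(0 <= k <oo) lam (F k))%E).
  apply: lee_nneseries => [k _ _|k _]; first by rewrite lee_fin enorm_ge0.
  by rewrite -(fineK (lam_fin_num (mF k))) lee_fin vcharge_le_lam.
have mU : measurable (\bigcup_k F k) by exact: bigcup_measurable.
rewrite -(measure_semi_bigcup lam mF tF mU).
by apply: le_measure; rewrite ?inE.
Qed.

Lemma vcharge_le_variation (A : set T) : measurable A ->
  enorm (vcharge mu A) <= fine (vector_variation mu A).
Proof.
move=> mA; rewrite -lee_fin fineK; last first.
  rewrite ge0_fin_numE//; apply: le_lt_trans vector_variation_fin.
  by apply: le_measure; rewrite ?inE.
pose F k : set T := if k is 0%N then A else set0.
have pF : packing A F.
  split.
  - by case=> [|k]; [exact: mA|exact: measurable0].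
  - by move=> [|i] [|j] _ _ [x []].
  - by move=> x [[|k] _].
apply: le_trans (ereal_sup_ubound (ex_intro2 _ _ F pF erefl)).
rewrite (nneseries_split 0 1) => [|k _]; last by rewrite lee_fin enorm_ge0.
by rewrite big_nat1/= leeDl// nneseries_ge0// => k _ _; rewrite lee_fin enorm_ge0.
Qed.

End vector_charge.

(** * The variation measure bounds the pairing with fields *)

Section duality.
Context {R : realType} {n : nat}.
Local Notation Rn := 'rV[R]_n.+1.
Local Notation T := (borel R n).
Variable mu : 'I_n.+1 -> {charge set T -> \bar R}.
Implicit Types (A U : set Rn) (f g : Rn -> R) (xi : 'I_n.+1 -> Rn -> R).
Local Notation vv := (vector_variation mu).

(** The joint level sets of the functions for a grid of mesh [e]. *)
Lemma grid_partition (I : finType) (F : I -> T -> R) (e : R) :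
  (forall i, Bfun (F i)) -> 0 < e -> exists (J : finType) (label : T -> J) (rep : J -> T),
  (forall j, measurable [set x | label x = j]) /\
  (forall i x, `|F i x - F i (rep (label x))| <= e).
Proof.
move=> bF e0.
have /choice[M0 M0P] i := (bF i).2.
pose M := \big[Num.max/0]_i M0 i.
have FM i x : `|F i x| <= M by apply: le_trans (M0P i x) _; exact: le_bigmax.
pose K := Num.truncn ((M + M) / e).
have F0 i x : 0 <= (F i x + M) / e.
  by rewrite divr_ge0 ?(ltW e0)//; have := FM i x; rewrite ler_norml => /andP[]; lra.
pose label x : {ffun I -> 'I_K.+1} := [ffun i => inord (Num.truncn ((F i x + M) / e))].
have labelK i x : (label x i : nat) = Num.truncn ((F i x + M) / e).
  rewrite ffunE inordK// ltnS /K; apply: le_truncn.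
  rewrite ler_pM2r ?invr_gt0// lerD2r; have := FM i x; rewrite ler_norml => /andP[]//.
have labelP i x : (label x i)%:R * e <= F i x + M < (label x i).+1%:R * e.
  by rewrite labelK -ler_pdivlMr// -ltr_pdivrMr//; exact: truncn_itv.
exists {ffun I -> 'I_K.+1}, label, (fun j => xget 0 [set x | label x = j]); split.
  move=> j; rewrite (_ : [set x | _] = [set x : T | forall i, label x i = j i]).
    apply: measurable_forall => i.
    rewrite [X in measurable X](_ : _ = F i @^-1` `[(j i)%:R * e - M, (j i).+1%:R * e - M[%classic).
      by rewrite -[X in measurable X]setTI; apply: (bF i).1.
    apply/seteqP; split => x /=; rewrite in_itv/= lerBlDr ltrBrDr.
      by move=> <-; exact: labelP.
    have /andP[h1 h2] := labelP i x => /andP[h3 h4]; apply: val_inj; apply/eqP.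
    have := le_lt_trans h1 h4; have := le_lt_trans h3 h2.
    by rewrite !ltr_pM2r// !ltr_nat !ltnS eqn_leq => -> ->.
  by apply/seteqP; split => x /=; [move=> ->|move=> h; apply/ffunP].
move=> i x; set y := xget 0 _.
have /= xy : label y = label x by apply: (@xgetPex _ 0 [set z | label z = label x]); exists x.
have /andP[h1 h2] := labelP i x; have /andP[h3 h4] := labelP i y.
rewrite xy in h3 h4; move: h1 h2 h3 h4; rewrite -natr1 mulrDl mul1r.
set a := _%:R * e; rewrite ler_norml => h1 h2 h3 h4; apply/andP; split; lra.
Qed.

Lemma vv_fin_num (A : set T) : measurable A -> vv A \is a fin_num.
Proof.
move=> mA; rewrite ge0_fin_numE//; apply: le_lt_trans (vector_variation_fin mu).
by apply: le_measure; rewrite ?inE.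
Qed.

(** On the cells of a fine partition the fields are almost constant, and there the
    inequality is that of Cauchy and Schwarz. *)
Lemma charge_dot_le (zeta : 'I_n.+1 -> T -> R) (g : T -> R) :
  (forall i, Bfun (zeta i)) -> Bfun g -> (forall x, 0 <= g x) ->
  (forall x, \sum_i zeta i x ^+ 2 <= g x ^+ 2) ->
  \sum_i CI (mu i) (zeta i) <= mint vv g.
Proof.
move=> bz bg g0 zg; set V := fine (vv setT).
have V0 : 0 <= V by exact: fine_ge0.
have L0 : 0 <= fine (lam mu setT) by exact: fine_ge0.
suff main (e : R) : 0 < e ->
    \sum_i CI (mu i) (zeta i) <= mint vv g + e * (V + fine (lam mu setT)).
  exact: ler_addgt0_scaled (addr_ge0 V0 L0) main.
move=> e0; pose F (o : option 'I_n.+1) := if o is Some i then zeta i else g.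
have bF o : Bfun (F o) by case: o.
have [J [label [rep [mJ FJ]]]] := grid_partition bF e0.
pose Q (j : J) : set T := [set x | label x = j].
have mQ j : measurable (Q j) by exact: mJ.
have bQ j : Bfun (\1_(Q j) : T -> R) := Bfun_indic (mQ j).
pose s o x := \sum_j F o (rep j) * \1_(Q j) x.
have sE o x : s o x = F o (rep (label x)).
  rewrite /s (bigD1 (label x))//= indicE mem_set// mulr1 big1 ?addr0// => j jx.
  by rewrite indicE memNset ?mulr0// /Q/= => h; rewrite h eqxx in jx.
have bs o : Bfun (s o) by apply: Bfun_sum => j; exact: BfunZ.
have step1 : \sum_i CI (mu i) (zeta i) <= \sum_i CI (mu i) (s (Some i)) + e * fine (lam mu setT).
  rewrite fine_lamE// mulr_sumr -big_split; apply: ler_sum => i _ /=.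
  have bd : Bfun (fun x => zeta i x + -1 * s (Some i) x) by apply: BfunD => //; exact: BfunZ.
  rewrite -lerBlDl -mulN1r -CIZ// -CID//; last exact: BfunZ.
  apply: le_trans (ler_norm _) _.
  apply: (@CI_abs_le _ _ _ (mu i) _ setT e measurableT bd) => x.
  by rewrite indicT mulr1 mulN1r sE; exact: FJ (Some i) x.
apply: le_trans step1 _; rewrite mulrDr addrA lerD2r.
have vfin := vector_variation_fin mu.
have step2 : mint vv (s None) <= mint vv g + e * V.
  have -> : mint vv g + e * V = mint vv (fun x => g x + e * \1_setT x).
    rewrite mintD//; last by apply: BfunZ; exact: Bfun_indic.
    by rewrite mintZ ?mint_indic//; exact: Bfun_indic.
  apply: le_mint => // [|x].
    by apply: BfunD => //; apply: BfunZ; exact: Bfun_indic.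
  rewrite indicT mulr1 sE; have := FJ None x; rewrite ler_norml /= => /andP[].
  by move: (g _) (g x) => a b; lra.
apply: le_trans step2.
have -> : mint vv (s None) = \sum_j g (rep j) * fine (vv (Q j)).
  rewrite /s /mint; under eq_integral do rewrite -sumEFin.
  rewrite integral_sum//=; last first.
    by move=> j; apply: (Bfun_integrable vfin); exact: BfunZ.
  rewrite -sum_fine => [|j _]; last first.
    by apply: integrable_fin_num => //; apply: (Bfun_integrable vfin); exact: BfunZ.
  apply: eq_bigr => j _; rewrite -[LHS]/(mint vv (fun x => g (rep j) * \1_(Q j) x)).
  by rewrite mintZ// mint_indic.
rewrite (eq_bigr (fun i => \sum_j zeta i (rep j) * fine (mu i (Q j)))); last first.
  move=> i _; rewrite /s (CI_sum _ _ (fun j => BfunZ (F (Some i) (rep j)) (bQ j))).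
  by apply: eq_bigr => j _; rewrite (CIZ _ _ (bQ j)) (CI_indic _ (mQ j)).
rewrite exchange_big/=; apply: ler_sum => j _.
apply: (@le_trans _ _ (g (rep j) * enorm (vcharge mu (Q j)))); last first.
  by apply: ler_wpM2l => //; exact: vcharge_le_variation.
have -> : \sum_i zeta i (rep j) * fine (mu i (Q j)) =
    \sum_i (\row_k zeta k (rep j) : Rn) 0 i * (vcharge mu (Q j)) 0 i.
  by apply: eq_bigr => i _; rewrite !mxE.
apply: le_trans (dot_le_enorm _ _) _; apply: ler_wpM2r; first exact: enorm_ge0.
rewrite -(@ler_pXn2r _ 2)// ?nnegrE ?enorm_ge0// enorm_sqr.
by apply: le_trans (zg (rep j)); apply: ler_sum => i _; rewrite mxE expr2.
Qed.

End duality.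

(** * The pairing with fields determines the variation measure *)

Section variation_by_duality.
Context {R : realType} {n : nat}.
Local Notation Rn := 'rV[R]_n.+1.
Local Notation T := (borel R n).
Variable mu : 'I_n.+1 -> {charge set T -> \bar R}.
Implicit Types (A U : set Rn) (f g : Rn -> R) (xi : 'I_n.+1 -> Rn -> R).
Local Notation vv := (vector_variation mu).

Definition pairing xi : R := \sum_i CI (mu i) (xi i : T -> R).

Lemma Linfc_Bfun f : continuous f -> Linfc f -> Bfun (f : T -> R).
Proof.
move=> cf [_ [M [fM _]]]; split; last by exists M.
exact: continuous_borel_measurable.
Qed.

Lemma C1c_Bfun f : C1c f -> Bfun (f : T -> R).
Proof. by move=> cf; apply: Linfc_Bfun; [exact: C1_continuous cf.1|exact: C1c_Linfc]. Qed.

Definition supported_in U xi := exists2 K : set Rn, compact K /\ K `<=` U &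
  forall i x, ~ K x -> xi i x = 0.

Let C1_prod (eta : nat -> Rn -> R) k : (forall l, C1 (eta l)) ->
  C1 (fun x => \prod_(l < k) (1 - eta l x)).
Proof.
move=> ce; elim: k => [|k ih].
  by under eq_fun do rewrite big_ord0; exact: (C1_cst 1).1.
under eq_fun do rewrite big_ord_recr/=.
by apply: (C1M ih _).1; exact: (C1B (C1_cst 1).1 (ce k)).1.
Qed.

Let C1c_sum_ord (F : nat -> Rn -> R) N : (forall k, C1c (F k)) ->
  C1c (fun x => \sum_(k < N) F k x).
Proof.
move=> cF; elim: N => [|N ih].
  by under eq_fun do rewrite big_ord0; exact: C1c0.
by under eq_fun do rewrite big_ord_recr/=; exact: C1cD.
Qed.

Let compact_bigsetU_ord (K : nat -> set Rn) N : (forall k, (k < N)%N -> compact (K k)) ->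
  compact (\big[setU/set0]_(k < N) K k).
Proof.
elim: N => [_|N ih cK]; first by rewrite big_ord0; exact: compact0.
rewrite big_ord_recr/=; apply: compactU; last exact: cK.
by apply: ih => k kN; apply: cK; rewrite ltnS ltnW.
Qed.

Let sum_prod (a : nat -> R) N :
  \sum_(k < N) a k * \prod_(l < k) (1 - a l) = 1 - \prod_(l < N) (1 - a l).
Proof.
elim: N => [|N ih]; first by rewrite !big_ord0 subrr.
by rewrite !big_ord_recr/= ih; ring.
Qed.

Let unit_vec (A : set T) (i : 'I_n.+1) : R := (vcharge mu A) 0 i / enorm (vcharge mu A).

Let unit_vec_dot A : \sum_i unit_vec A i * fine (mu i A) = enorm (vcharge mu A).
Proof.
rewrite /unit_vec; set a := enorm _.
under eq_bigr do rewrite mulrAC.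
rewrite -mulr_suml (_ : \sum_i _ = a ^+ 2); last first.
  by rewrite enorm_sqr; apply: eq_bigr => i _; rewrite mxE.
by have [->|a0] := eqVneq a 0; [rewrite expr0n mul0r|rewrite expr2 mulfK].
Qed.

Let unit_vec_le1 A : \sum_i unit_vec A i ^+ 2 <= 1.
Proof.
under eq_bigr do rewrite exprMn exprVn; rewrite -mulr_suml.
rewrite (_ : \sum_i _ = enorm (vcharge mu A) ^+ 2); last first.
  by rewrite enorm_sqr; apply: eq_bigr => i _; rewrite expr2.
have [->|a0] := eqVneq (enorm (vcharge mu A)) 0; first by rewrite expr0n mul0r ler01.
by rewrite divff// expf_neq0.
Qed.

(** Jensen's inequality for the squared norm, with the same trick as for smoothed fields. *)
Let convex_sum_sq N (c : nat -> R) (v : nat -> 'I_n.+1 -> R) :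
  (forall k, 0 <= c k) -> \sum_(k < N) c k <= 1 -> (forall k, \sum_i v k i ^+ 2 <= 1) ->
  \sum_i (\sum_(k < N) c k * v k i) ^+ 2 <= 1.
Proof.
move=> c0 c1 v1; pose x i := \sum_(k < N) c k * v k i.
rewrite -[leLHS]/(\sum_i x i ^+ 2); set S := \sum_i x i ^+ 2.
have S0 : 0 <= S by apply: sumr_ge0 => i _; rewrite sqr_ge0.
suff : S <= (S + 1) / 2 by lra.
have SE : S = \sum_(k < N) c k * \sum_i x i * v k i.
  under [RHS]eq_bigr do rewrite mulr_sumr.
  rewrite exchange_big/=; apply: eq_bigr => i _.
  rewrite expr2 {2}/x mulr_sumr; apply: eq_bigr => k _; ring.
rewrite [leLHS]SE; apply: (@le_trans _ _ (\sum_(k < N) c k * ((S + 1) / 2))).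
  apply: ler_sum => k _; apply: ler_wpM2l => //; rewrite ler_pdivlMr//.
  have := v1 k; rewrite -(lerD2l S); apply: le_trans.
  rewrite /S -big_split mulr_suml; apply: ler_sum => i _ /=.
  by rewrite -subr_ge0 (_ : _ - _ = (x i - v k i) ^+ 2) ?sqr_ge0//; ring.
rewrite -mulr_suml ler_piMl//; lra.
Qed.

(** Finitely many disjoint Borel sets contain compact sets [K k] of almost the same charge.
    Cutoff functions with sum at most 1 that are 1 on the [K k] glue the directions of the
    charges of the [K k] into a single admissible field, which almost realizes the sum of their norms. *)
Lemma variation_le U (c : R) : open U -> 0 <= c ->
  (forall xi, admissible xi -> supported_in U xi -> pairing xi <= c) ->
  (vv (U : set T) <= c%:E)%E.
Proof.
move=> oU c0 H; apply: ge_ereal_sup => _ [F [mF tF FU] <-].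
apply: lime_le; first by apply: is_cvg_nneseries => k _ _; rewrite lee_fin enorm_ge0.
apply: nearW => N; rewrite sumEFin lee_fin big_mkord.
suff main (e : R) : 0 < e -> \sum_(k < N) enorm (vcharge mu (F k)) <= c + e * (N%:R * 2).
  by apply: ler_addgt0_scaled main; rewrite mulr_ge0.
move=> e0.
have /choice[CG CGP] k : exists CG : set Rn * set Rn, [/\ compact CG.1, open CG.2,
    CG.1 `<=` F k, F k `<=` CG.2 & (lam mu (CG.2 `\` CG.1 : set T) <= e%:E)%E].
  by have [C [G h]] := borel_regular (lam_fin mu) (mF k) e0; exists (C, G).
pose K k := (CG k).1; pose G k := (CG k).2.
have cK k : compact (K k) by have [] := CGP k.
have KF k : K k `<=` F k by have [] := CGP k.
have FG k : F k `<=` G k by have [] := CGP k.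
have oG k : open (G k) by have [] := CGP k.
have clK k : closed (K k) := compact_closed (@norm_hausdorff _ _) (cK k).
have mK k : measurable (K k : set T) by exact: closed_borel.
have mG k : measurable (G k : set T) by exact: open_borel.
have mGK k : measurable (G k `\` K k : set T) by exact: measurableD.
have GKe k : fine (lam mu (G k `\` K k : set T)) <= e.
  by rewrite -lee_fin fineK; [have [] := CGP k|exact: lam_fin_num].
(* The neighbourhood V k of K k meets none of the other compact sets. *)
pose V k : set Rn := [set x | U x /\ G k x] `&`
  [set x | forall l : 'I_N, (l : nat) != k -> ~ K l x].
have oV k : open (V k).
  apply: openI; first by apply: openI.
  apply: (@open_forall _ _ _ (fun l : 'I_N => [set x | (l : nat) != k -> ~ K l x])) => l.
  have [lk|lk] := eqVneq (l : nat) k.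
    rewrite (_ : [set x | _] = setT); first exact: openT.
    by apply/seteqP; split.
  rewrite (_ : [set x | _] = ~` (K l)); first exact: closed_openC.
  by apply/seteqP; split => x /=; [exact|].
have KV k : (k < N)%N -> K k `<=` V k.
  move=> kN x Kx; split; first by split; [apply: FU; exists k => //; exact: KF|apply: FG; exact: KF].
  move=> l lk Kl; move/eqP: lk; apply; apply: (tF l k) => //.
  by exists x; split; exact: KF.
have /choice[eta etaP] (k : nat) : exists eta : Rn -> R, (k < N)%N -> exists K', [/\ C1c eta,
    forall x, 0 <= eta x <= 1, forall x, K k x -> eta x = 1, compact K' /\ K' `<=` V k &
    forall x, ~ K' x -> eta x = 0].
  have [kN|kN] := ltnP k N; last by exists (fun=> 0).
  by have [eta h] := C1_cutoff (cK k) (oV k) (KV k kN); exists eta => _.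
pose eta' k := if (k < N)%N then eta k else fun=> 0.
have ceta k : C1c (eta' k).
  rewrite /eta'; case: ifPn => [kN|_]; last exact: C1c0.
  by have [K' []] := etaP k kN.
have eta01 k x : 0 <= eta' k x <= 1.
  rewrite /eta'; case: ifPn => [kN|_]; last by rewrite lexx ler01.
  by have [K' []] := etaP k kN.
have eta1 k x : (k < N)%N -> K k x -> eta' k x = 1.
  by move=> kN Kx; rewrite /eta' kN; have [K' [_ _ h _ _]] := etaP k kN; exact: h.
have eta0 k x : ~ V k x -> eta' k x = 0.
  move=> nV; rewrite /eta'; case: ifPn => [kN|//].
  by have [K' [_ _ _ [_ K'V] h]] := etaP k kN; apply: h => /K'V.
(* The cutoffs may overlap; what each of them leaves to the next ones makes the sum at
   most 1, without changing the values on the compact sets. *)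
pose co k x := eta' k x * \prod_(l < k) (1 - eta' l x).
have cco k : C1c (co k).
  by apply: C1cM => //; apply: C1_prod => l; exact: (ceta l).1.
have pr01 k x : 0 <= \prod_(l < k) (1 - eta' l x) <= 1.
  apply/andP; split.
    by apply: prodr_ge0 => l _; rewrite subr_ge0; have /andP[] := eta01 l x.
  apply: prodr_ile1 => l _; have /andP[h1 h2] := eta01 l x.
  by rewrite subr_ge0 h2 gerBl h1.
have co0 k x : 0 <= co k x.
  by have /andP[h1 _] := eta01 k x; have /andP[h2 _] := pr01 k x; rewrite mulr_ge0.
have coeta k x : co k x <= eta' k x.
  by have /andP[h1 _] := eta01 k x; have /andP[_ h2] := pr01 k x; rewrite ler_piMr.
have co1 k x : (k < N)%N -> K k x -> co k x = 1.
  move=> kN Kx; rewrite /co eta1// mul1r big1// => l _.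
  have lN : (l < N)%N := ltn_trans (ltn_ord l) kN.
  rewrite eta0 ?subr0// => -[_ /(_ (Ordinal kN))]; apply => //=.
  by rewrite eq_sym neq_ltn (ltn_ord l).
have cosum x : \sum_(k < N) co k x <= 1.
  rewrite (@sum_prod (fun k => eta' k x)) gerBl.
  by have /andP[] := pr01 N x.
pose v k := unit_vec (K k).
pose xi i x := \sum_(k < N) v k i * co k x.
have cxi : C1c_field xi.
  by move=> i; apply: (C1c_sum_ord (F := fun k x => v k i * co k x)) => k; exact: C1cZ.
have axi : admissible xi.
  split=> // x; rewrite /xi; under eq_bigr do under eq_bigr do rewrite mulrC.
  apply: (@convex_sum_sq N (fun k => co k x) v) => // k.
  exact: unit_vec_le1.
have sxi : supported_in U xi.
  have /choice[K' K'P] (k : nat) : exists K', (k < N)%N -> [/\ compact K', K' `<=` V k &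
      forall x, ~ K' x -> eta k x = 0].
    have [kN|kN] := ltnP k N; last by exists set0.
    by have [K' [_ _ _ [h1 h2] h3]] := etaP k kN; exists K' => _.
  exists (\big[setU/set0]_(k < N) K' k).
    split.
      by apply: compact_bigsetU_ord => k /K'P[].
    by move=> x; rewrite -bigcup_mkord => -[k /= kN]; have [_ h _] := K'P k kN => /h [[]].
  move=> i x; rewrite -bigcup_mkord => nK; rewrite /xi big1// => k _.
  have [_ _ h] := K'P k (ltn_ord k).
  rewrite /co /eta' ltn_ord h ?mul0r ?mulr0// => Kx.
  by apply: nK; exists k => //=.
have := H xi axi sxi.
have pE : pairing xi = \sum_(k < N) \sum_i v k i * CI (mu i) (co k : T -> R).
  rewrite /pairing exchange_big/=; apply: eq_bigr => i _.
  rewrite /xi CI_sum => [|k]; last by apply: BfunZ; exact: C1c_Bfun.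
  by apply: eq_bigr => k _; rewrite CIZ//; exact: C1c_Bfun.
have vle k i : `|v k i| <= 1.
  rewrite -sqrtr_sqr -[leRHS]sqrtr1 ler_sqrt//; apply: le_trans (unit_vec_le1 (K k)).
  by rewrite (bigD1 i)//= lerDl sumr_ge0// => j _; rewrite sqr_ge0.
have term k : (k < N)%N -> enorm (vcharge mu (F k)) - 2 * e <=
    \sum_i v k i * CI (mu i) (co k : T -> R).
  move=> kN.
  have mFK : measurable (F k `\` K k) by exact: measurableD.
  have h1 : enorm (vcharge mu (F k)) <= enorm (vcharge mu (K k : set T)) + e.
    have -> : vcharge mu (F k) = vcharge mu (K k : set T) + vcharge mu (F k `\` K k).
      apply/rowP => i; rewrite !mxE -fineD; [|exact: fin_num_measure..].
      rewrite -chargeU//; last by rewrite setDIK.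
      by rewrite setDUK//; exact: KF.
    apply: le_trans (enormD _ _) _; rewrite lerD2l.
    apply: le_trans (vcharge_le_lam mu mFK) _; apply: le_trans (GKe k).
    apply: fine_le; [exact: lam_fin_num|exact: lam_fin_num|].
    by apply: le_measure; rewrite ?inE// => x [Fx nK]; split => //; exact: FG.
  have h2 : enorm (vcharge mu (K k : set T)) - e <= \sum_i v k i * CI (mu i) (co k : T -> R).
    rewrite -unit_vec_dot lerBlDr -lerBlDl -sumrB.
    apply: le_trans (GKe k); rewrite fine_lamE//; apply: ler_sum => i _.
    have bco := C1c_Bfun (cco k).
    have bd : Bfun (fun x : T => co k x + -1 * \1_(K k) x).
      by apply: BfunD => //; apply: BfunZ; exact: Bfun_indic.
    have : `|CI (mu i) (fun x : T => co k x + -1 * \1_(K k) x)| <= 1 * fine (cvar (mu i) (G k `\` K k : set T)).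
      apply: (@CI_abs_le _ _ _ (mu i) _ (G k `\` K k) 1 (mGK k) bd) => x; rewrite mulN1r mul1r !indicE.
      have [xK|xK] := boolP (x \in K k).
        rewrite co1 ?subrr ?normr0//; last by rewrite inE in xK.
      rewrite subr0; have [xG|xG] := boolP (x \in G k `\` K k).
        rewrite ger0_norm//; apply: le_trans (coeta k x) _; by have /andP[] := eta01 k x.
      have nV : ~ V k x.
        move=> [[_ Gx] _]; move/negP: xG; apply; rewrite inE; split => // Kx.
        by move/negP: xK; apply; rewrite inE.
      by rewrite /co eta0// mul0r normr0.
    rewrite (CID _ bco); last by apply: BfunZ; exact: Bfun_indic.
    rewrite (CIZ _ _ (Bfun_indic (mK k))) (CI_indic _ (mK k)) mulN1r mul1r.
    rewrite -[unit_vec _ i]/(v k i) -mulrBr => h.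
    apply: le_trans (ler_norm _) _; rewrite normrM distrC.
    by apply: le_trans h; rewrite ler_piMl.
  by move: h1 h2; lra.
rewrite pE => h.
have : \sum_(k < N) (enorm (vcharge mu (F k)) - 2 * e) <= c.
  by apply: le_trans h; apply: ler_sum => k _; apply: term.
by rewrite sumrB sumr_const card_ord -mulr_natl; lra.
Qed.

End variation_by_duality.

(** * Weak convergence of the variation measures *)

Section weak_convergence.
Context {R : realType} {n : nat}.
Local Notation Rn := 'rV[R]_n.+1.
Local Notation T := (borel R n).
Implicit Types (mu : 'I_n.+1 -> {charge set T -> \bar R}) (U : set Rn) (f g : Rn -> R)
  (xi : 'I_n.+1 -> Rn -> R).

(** [variation_le] for the whole space, by contraposition. *)
Lemma near_optimal_field mu (e : R) : 0 < e -> exists2 xi, admissible xi &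
  fine (vector_variation mu setT) - e <= pairing mu xi.
Proof.
move=> e0; apply: contrapT => H; set V := fine _ in H.
have pair0 : pairing mu (fun _ _ => 0) = 0 by rewrite /pairing big1// => i _; exact: CI0.
have Ve : 0 <= V - e.
  rewrite leNgt; apply/negP => h; apply: H; exists (fun _ _ => 0); first exact: admissible0.
  by rewrite pair0 ltW.
have : (vector_variation mu setT <= (V - e)%:E)%E.
  apply: variation_le => //; first exact: openT.
  move=> xi axi _; rewrite leNgt; apply/negP => h; apply: H; exists xi => //.
  exact: ltW.
rewrite -(fineK (vv_fin_num mu measurableT)) lee_fin -/V; move: e0; lra.
Qed.

Lemma pairing_le_variation mu xi (g : Rn -> R) : continuous g -> Bfun (g : T -> R) ->
  (forall x, 0 <= g x) -> admissible xi ->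
  pairing mu (fun i x => g x * xi i x) <= mint (vector_variation mu) (g : T -> R).
Proof.
move=> cg bg g0 [cxi xi1]; apply: charge_dot_le => // [i|x].
  by apply: BfunM => //; exact: C1c_Bfun.
under eq_bigr do rewrite exprMn.
by rewrite -mulr_sumr ler_piMr ?sqr_ge0.
Qed.

Variables (mu_ : nat -> 'I_n.+1 -> {charge set T -> \bar R}) (mu : 'I_n.+1 -> {charge set T -> \bar R}).
Hypothesis mu_cvg : weak_cvg_vector mu_ mu.
Local Notation nu j := (vector_variation (mu_ j)).
Local Notation nu0 := (vector_variation mu).

Let dist_le (a b e : R) : a <= b + e -> b - e <= a -> `|b - a| <= e.
Proof. by move=> h1 h2; rewrite ler_norml; apply/andP; split; lra. Qed.

Let lower_arith (m p q r e : R) : m - e / 2 <= p -> p - q <= e / 2 -> q <= r -> m - e <= r.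
Proof. by lra. Qed.

Let sandwich (a b p q e : R) : a + p - e / 2 <= b + q -> a - p - e / 2 <= b - q ->
  `|a - b| <= e / 2 -> `|p - q| <= e.
Proof. by rewrite !ler_norml => h1 h2 /andP[h3 h4]; apply/andP; split; lra. Qed.

Let CI_cvg f i : continuous f -> Linfc f ->
  CI (mu_ j i) (f : T -> R) @[j --> \oo] --> CI (mu i) (f : T -> R).
Proof.
move=> cf lf; have bf := Linfc_Bfun cf lf; have [_ [M [_ f0]]] := lf.
have := @mu_cvg f i cf (compact_tsupp f0); rewrite (charge_integralE _ bf).
rewrite (_ : (fun j => charge_integral _ _) = fun j => (CI (mu_ j i) (f : T -> R))%:E).
  by move/fine_cvg.
by apply/funext => j; exact: charge_integralE.
Qed.

(** A field [xi] that almost realizes the total mass also almost realizes the integral of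
    [g] as [g * xi], because [(C - g) * xi] cannot yield more than the integral of [C - g].
    The pairing of [g * xi] is weakly continuous and bounds the integrals of [g] from below. *)
Lemma variation_lsc (g : Rn -> R) (C : R) : continuous g -> (forall x, 0 <= g x <= C) ->
  forall e : R, 0 < e -> \forall j \near \oo,
    mint nu0 (g : T -> R) - e <= mint (nu j) (g : T -> R).
Proof.
move=> cg gC e e0.
have g0 x : 0 <= g x by have /andP[] := gC x.
have C0 : 0 <= C by have /andP[h] := gC 0; exact: le_trans.
have bg : Bfun (g : T -> R).
  split; first exact: continuous_borel_measurable.
  by exists C => x; have /andP[h1 h2] := gC x; rewrite ger0_norm.
have e2 : 0 < e / 2 / (1 + C) by rewrite !divr_gt0// ltr_pwDl.
have [xi axi xiV] := near_optimal_field mu e2.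
have cCg : continuous (fun x => C - g x).
  have -> : (fun x => C - g x) = fun x => C + -1 * g x.
    by apply/funext => x; rewrite mulN1r.
  by apply: continuous_add; [exact: cst_continuous|exact: continuous_scale].
have bC : Bfun (fun=> C : R) := @Bfun_cst _ T R C.
have bCg : Bfun ((fun x => C - g x) : T -> R) by exact: BfunB.
have vfin := vector_variation_fin mu.
have bxi i : Bfun (xi i : T -> R) by exact: C1c_Bfun (axi.1 i).
have bgxi i : Bfun ((fun x => g x * xi i x) : T -> R) by exact: BfunM.
have h1 : pairing mu (fun i x => (C - g x) * xi i x) <= C * fine (nu0 setT) - mint nu0 (g : T -> R).
  apply: le_trans (pairing_le_variation mu cCg bCg _ axi) _.
    by move=> x; rewrite subr_ge0; have /andP[] := gC x.
  rewrite (_ : (fun x => C - g x) = fun x : T => C * \1_setT x + -1 * g x); last first.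
    by apply/funext => x; rewrite indicT mulr1 mulN1r.
  rewrite mintD//; [|by apply: BfunZ; exact: Bfun_indic|exact: BfunZ].
  by rewrite !mintZ ?mint_indic ?mulN1r//; exact: Bfun_indic.
have h2 : pairing mu (fun i x => (C - g x) * xi i x) =
    C * pairing mu xi - pairing mu (fun i x => g x * xi i x).
  rewrite /pairing mulr_sumr -sumrB; apply: eq_bigr => i _.
  rewrite (_ : (fun x => _) = fun x : T => C * xi i x + -1 * (g x * xi i x)); last first.
    by apply/funext => x; ring.
  by rewrite CID ?CIZ ?mulN1r//; exact: BfunZ.
have h3 : mint nu0 (g : T -> R) - e / 2 <= pairing mu (fun i x => g x * xi i x).
  have : C * (fine (nu0 setT) - e / 2 / (1 + C)) <= C * pairing mu xi by exact: ler_wpM2l.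
  have : C * (e / 2 / (1 + C)) <= e / 2.
    by rewrite mulrCA ler_piMr ?divr_ge0 ?(ltW e0)// ler_pdivrMr ?mul1r ?lerDr// ltr_pwDl.
  by rewrite h2 in h1; move: h1; rewrite mulrBr; lra.
have cv : pairing (mu_ j) (fun i x => g x * xi i x) @[j --> \oo] -->
    pairing mu (fun i x => g x * xi i x).
  apply: cvg_big => [|i _]; first exact: add_continuous.
  have cxi := axi.1 i; apply: CI_cvg.
    by apply: continuous_mul => //; exact: C1_continuous cxi.1.
  have := Linfc_mul_continuous (C1_continuous cxi.1) cxi.2 cg.
  by under eq_fun do rewrite mulrC.
have e22 : 0 < e / 2 by rewrite divr_gt0.
have /cvgrPdist_le/(_ _ e22) := cv; apply: filterS => j.
rewrite ler_norml => /andP[_ h4].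
exact: lower_arith h3 h4 (pairing_le_variation (mu_ j) cg bg g0 axi).
Qed.

(** With the convergence of the masses, lower semicontinuity applied to [M + phi]
    and to [M - phi] gives the convergence of the integrals of [phi]. *)
Lemma variation_weak_cvg :
  (forall e : R, 0 < e -> \forall j \near \oo, fine (nu j setT) <= fine (nu0 setT) + e) ->
  weak_cvg (fun j => nu j) nu0 /\ nu j setT @[j --> \oo] --> nu0 setT.
Proof.
move=> usc.
have mass : fine (nu j setT) @[j --> \oo] --> fine (nu0 setT).
  apply/cvgrPdist_le => e e0.
  have c1 : continuous (fun _ : Rn => 1 : R) by exact: cst_continuous.
  have b1 (x : Rn) : 0 <= (1 : R) <= 1 by rewrite ler01 lexx.
  have := variation_lsc c1 b1 e0; apply: filter_app; have := usc _ e0; apply: filterS => j h1.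
  have E (m : {measure set T -> \bar R}) : mint m (fun=> 1 : R) = fine (m setT).
    by rewrite -(mint_indic m measurableT) indicT.
  rewrite !E; move: h1; set a := fine _; set b := fine _ => h1 h2.
  exact: dist_le.
split; last first.
  have -> : (fun j => nu j setT) = fun j => (fine (nu j setT))%:E.
    by apply/funext => j; rewrite fineK//; exact: vv_fin_num.
  by rewrite -(fineK (vv_fin_num mu measurableT)); apply: cvg_EFin => //; exact: nearW.
move=> phi cphi kphi; have [N phi0] := tsupp_bounded kphi.
have lphi := Linfc_continuous cphi phi0; have [_ [M [phiM _]]] := lphi.
have bphi : Bfun (phi : T -> R) := Linfc_Bfun cphi lphi.
have M0 : 0 <= M by apply: le_trans (phiM 0).
have vfin k := vector_variation_fin (mu_ k); have vfin0 := vector_variation_fin mu.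
have -> : (fun j => \int[nu j]_x (phi x)%:E)%E = fun j => (mint (nu j) (phi : T -> R))%:E.
  by apply/funext => j; rewrite (mintE (vfin j) bphi).
rewrite -(mintE vfin0 bphi); apply: cvg_EFin; first exact: nearW.
have bcst : Bfun ((fun=> M) : T -> R) := @Bfun_cst _ T R M.
have E (c : R) (m : {measure set T -> \bar R}) : (m setT < +oo)%E ->
    mint m ((fun x => M + c * phi x) : T -> R) = M * fine (m setT) + c * mint m (phi : T -> R).
  move=> mf; rewrite mintD//; last exact: BfunZ.
  rewrite mintZ//; congr (_ + _).
  rewrite -(mint_indic m measurableT) -(mintZ mf M (Bfun_indic measurableT)).
  by congr (mint m _); apply/funext => x; rewrite indicT mulr1.
have Ep (m : {measure set T -> \bar R}) : (m setT < +oo)%E ->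
    mint m ((fun x => M + 1 * phi x) : T -> R) = M * fine (m setT) + mint m (phi : T -> R).
  by move=> mf; rewrite E// mul1r.
have En (m : {measure set T -> \bar R}) : (m setT < +oo)%E ->
    mint m ((fun x => M + -1 * phi x) : T -> R) = M * fine (m setT) - mint m (phi : T -> R).
  by move=> mf; rewrite E// mulN1r.
have cc (c : R) : continuous (fun x => M + c * phi x).
  by apply: continuous_add; [exact: cst_continuous|exact: continuous_scale].
have bb (c : R) x : `|c| <= 1 -> 0 <= M + c * phi x <= M + M.
  move=> c1; have : `|c * phi x| <= M.
    by apply: le_trans (phiM x); rewrite normrM ler_piMl.
  by rewrite ler_norml => /andP[h1 h2]; apply/andP; split; lra.
apply/cvgrPdist_le => e e0.
have e2 : 0 < e / 2 by rewrite divr_gt0.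
have eM : 0 < e / 2 / (1 + M) by rewrite divr_gt0// ltr_pwDl.
have n1 : `|1 : R| <= 1 by rewrite normr1.
have n2 : `|-1 : R| <= 1 by rewrite normrN1.
have p1 := variation_lsc (cc 1) (fun x => bb 1 x n1) e2.
have p2 := variation_lsc (cc (-1)) (fun x => bb (-1) x n2) e2.
have /cvgrPdist_le/(_ _ eM) p3 := mass.
have := p1; apply: filter_app; have := p2; apply: filter_app.
move: p3; apply: filterS => j h3 h2 h1.
have {}h1 : M * fine (nu0 setT) + mint nu0 (phi : T -> R) - e / 2 <=
    M * fine (nu j setT) + mint (nu j) (phi : T -> R).
  by move: (Ep _ vfin0) (Ep _ (vfin j)) => <- <-; exact: h1.
have {}h2 : M * fine (nu0 setT) - mint nu0 (phi : T -> R) - e / 2 <=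
    M * fine (nu j setT) - mint (nu j) (phi : T -> R).
  by move: (En _ vfin0) (En _ (vfin j)) => <- <-; exact: h2.
have h4 : M * `|fine (nu0 setT) - fine (nu j setT)| <= e / 2.
  apply: (@le_trans _ _ (M * (e / 2 / (1 + M)))); first exact: ler_wpM2l.
  by rewrite mulrCA ler_piMr ?divr_ge0 ?(ltW e0)// ler_pdivrMr ?mul1r ?lerDr// ltr_pwDl.
have : `|M * fine (nu0 setT) - M * fine (nu j setT)| <= e / 2.
  by rewrite -mulrBr normrM (ger0_norm M0).
exact: sandwich h1 h2.
Qed.

End weak_convergence.

(** * Euclidean distances *)

Section distance.
Context {R : realType} {n : nat}.
Local Notation Rn := 'rV[R]_n.+1.
Implicit Types (x y z : Rn) (A : set Rn) (r : R).

Lemma enormN x : enorm (- x) = enorm x.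
Proof. by rewrite /enorm; congr Num.sqrt; apply: eq_bigr => i _; rewrite mxE sqrrN. Qed.

Lemma enormBC x y : enorm (x - y) = enorm (y - x).
Proof. by rewrite -enormN opprB. Qed.

Lemma enorm_triangle z x y : enorm (x - y) <= enorm (x - z) + enorm (z - y).
Proof. by have := enormD (x - z) (z - y); rewrite addrA subrK. Qed.

Lemma enorm_le_norm x : enorm x <= n.+1%:R * `|x|.
Proof.
apply: le_trans (enorm_le_sum x) _.
have -> : n.+1%:R * `|x| = \sum_(i < n.+1) `|x|.
  by rewrite sumr_const card_ord mulr_natl.
by apply: ler_sum => i _; exact: normr_coord_le.
Qed.

Lemma dist_ltP x A r : (dist x A < r%:E)%E <-> exists2 y, A y & enorm (x - y) < r.
Proof.
split=> [/ereal_inf_lt[_ [y Ay <-]]|[y Ay xy]]; first by rewrite lte_fin; exists y.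
by apply: le_lt_trans (_ : _ <= (enorm (x - y))%:E)%E _;
  [apply: ereal_inf_lbound; exists y|rewrite lte_fin].
Qed.

Lemma dist_ge0 x A : (0 <= dist x A)%E.
Proof. by apply: le_ereal_inf_tmp => _ [y _ <-]; rewrite lee_fin enorm_ge0. Qed.

Lemma dist_geP x A r : (forall y, A y -> r <= enorm (x - y)) -> (r%:E <= dist x A)%E.
Proof. by move=> h; apply: le_ereal_inf_tmp => _ [y Ay <-]; rewrite lee_fin h. Qed.

Lemma dist_lt_near x y A r s : (dist x A < r%:E)%E -> enorm (x - y) < s ->
  (dist y A < (r + s)%:E)%E.
Proof.
move=> /dist_ltP[z Az xz] xy; apply/dist_ltP; exists z => //.
by apply: le_lt_trans (enorm_triangle x _ _) _; rewrite addrC enormBC ltrD// enormBC.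
Qed.

Lemma open_eball x r : open (eball x r : set Rn).
Proof.
rewrite openE => y yr; apply/nbhs_ballP.
have d0 : 0 < (r - enorm (y - x)) / n.+1%:R by rewrite divr_gt0// subr_gt0.
exists ((r - enorm (y - x)) / n.+1%:R) => //= z.
rewrite -ball_normE/= ltr_pdivlMr// => yz; rewrite /eball/=.
apply: le_lt_trans (enorm_triangle y _ _) _; rewrite -ltrBrDr enormBC.
by apply: le_lt_trans (enorm_le_norm _) _; rewrite mulrC.
Qed.

Lemma open_dist_lt A r : open [set x : Rn | (dist x A < r%:E)%E].
Proof.
rewrite (_ : [set x | _] = \bigcup_(y in A) eball y r).
  by apply: bigcup_open => y _; exact: open_eball.
apply/seteqP; split => x /=; first by move=> /dist_ltP[y Ay xy]; exists y.
by move=> [y Ay xy]; apply/dist_ltP; exists y.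
Qed.

Lemma closure_enorm A x r : closure A x -> 0 < r -> exists2 y, A y & enorm (x - y) < r.
Proof.
move=> cA r0; have [|y [Ay yx]] := cA (eball x r).
  apply: open_nbhs_nbhs; split; first exact: open_eball.
  by rewrite /eball/= subrr enorm0.
by exists y => //; rewrite enormBC.
Qed.

Lemma dist_closure A x r : closure A x -> 0 < r -> (dist x A < r%:E)%E.
Proof. by move=> cA r0; apply/dist_ltP; exact: closure_enorm. Qed.

Lemma dist_lt_bounded A r : bounded_set A -> exists M : R, forall x,
  (dist x A < r%:E)%E -> `|x| < M.
Proof.
move=> [M [_ AM]]; exists (M + 1 + r) => x /dist_ltP[y Ay xy].
have yM : `|y| <= M + 1 by apply: AM Ay; rewrite ltrDl.
rewrite -(subrK y x); apply: le_lt_trans (ler_normD _ _) _.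
by rewrite addrC ler_ltD// (le_lt_trans (normr_le_enorm _)).
Qed.

Lemma dist_measurable A :
  measurable_fun setT (fun x : caratheodory_type (@lebesgue_outer R n) => dist (x : Rn) A).
Proof.
apply: (measurability _ (ErealGenInftyO.measurableE R)) => _ [_ [r ->] <-].
rewrite setTI (_ : _ @^-1` _ = [set x : Rn | (dist x A < r%:E)%E]).
  by apply: borel_Lmeasurable; apply: open_borel; exact: open_dist_lt.
by apply/seteqP; split => x /=; rewrite in_itv.
Qed.

End distance.

(** * Outward minimizing sets *)

Section outward_minimizing.
Context {R : realType} {n : nat}.
Local Notation Rn := 'rV[R]_n.+1.
Implicit Types (f g psi : Rn -> R) (x y : Rn) (E F G : set Rn).
Variables (E0 : set Rn) (delta : R).
Hypotheses (bE0 : bounded_set E0) (oE0 : open E0) (d0 : 0 < delta)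
  (E0min : outward_minimizing delta E0).

Definition collar : set Rn := [set x | (dist x E0 < delta%:E)%E].

Lemma collar_bounded : exists M : R, forall x, collar x -> `|x| < M.
Proof. exact: dist_lt_bounded. Qed.

Lemma open_collar : open collar. Proof. exact: open_dist_lt. Qed.

Lemma closure_collar : closure E0 `<=` collar.
Proof. by move=> x cx; exact: dist_closure. Qed.

(** The gradient vanishes near [E0], so that it is at most a multiple of the distance to the
    boundary of any subset of the closure of [E0]. *)
Lemma collar_cutoff : exists (psi : Rn -> R) (C : R), [/\ C1c psi /\ 0 < C,
  forall x, 0 <= psi x <= 1,
  forall x, (dist x E0 < (delta / 4)%:E)%E -> psi x = 1 /\ gnorm psi x = 0,
  forall x, ~ collar x -> psi x = 0 &
  forall x, gnorm psi x <= C].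
Proof.
have [C C0 HC] := @smooth_indic R n.
pose A : set Rn := [set x | (dist x E0 < (delta / 2)%:E)%E].
have mA : Lmeasurable A by apply: borel_Lmeasurable; apply: open_borel; exact: open_dist_lt.
have [M AM] := dist_lt_bounded (delta / 2) bE0.
pose s := delta / 4 / n.+1%:R.
have s0 : 0 < s by rewrite !divr_gt0.
have small x y : `|x - y| < s -> enorm (x - y) < delta / 4.
  move=> h; apply: le_lt_trans (enorm_le_norm _) _.
  by rewrite mulrC -ltr_pdivlMr.
have [psi [h1 h2 h3 h4 h5]] := HC A M s mA AM s0.
have psi1 x : (dist x E0 < (delta / 4)%:E)%E -> psi x = 1.
  move=> xd; apply: h3 => y /small xy; have := dist_lt_near xd xy.
  by rewrite /A/= (_ : delta / 4 + delta / 4 = delta / 2)//; field.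
exists psi, (C / s); split => //; first by split => //; rewrite divr_gt0.
- move=> x xd; split; first exact: psi1.
  rewrite /gnorm big1 ?sqrtr0// => i _.
  have [c1 p1] := C1B h1.1 (C1_cst 1).1.
  have <- : partial i (fun x => psi x - 1) x = partial i psi x.
    by rewrite p1 (C1_cst 1).2 subr0.
  rewrite (@partial_eq0 _ _ _ i x [set x : Rn | (dist x E0 < (delta / 4)%:E)%E]) ?expr0n//.
    exact: open_dist_lt.
  by move=> y /psi1 ->; rewrite subrr.
- move=> x nx; apply: h4 => y /small xy Ay; apply: nx.
  have yx : enorm (y - x) < delta / 4 by rewrite enormBC.
  have := dist_lt_near Ay yx; rewrite /collar/=; move/lt_trans; apply.
  by rewrite lte_fin; move: d0; lra.
Qed.

(** Outward minimality in the form that a minimizing step transmits.  A competitor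
    contains [E] up to a null set only, as the energy of a step does not see null sets,
    and it lies in the collar of [E0], which does not shrink with [E]. *)
Definition OM E := [/\ Lmeasurable E, E `<=` closure E0, (tv \1_E < +oo)%E &
  forall F, Lmeasurable F -> F `<=` collar -> leb (E `\` F) = 0%E -> (tv \1_E <= tv \1_F)%E].

Lemma OM_Linfc E : OM E -> Linfc (\1_E : Rn -> R).
Proof.
move=> [mE cE _ _]; have [M MP] := collar_bounded.
by apply: (Linfc_indic (M := M)) => // x /cE/closure_collar/MP.
Qed.

Lemma sub_collar_Linfc F : Lmeasurable F -> F `<=` collar -> Linfc (\1_F : Rn -> R).
Proof.
by move=> mF Fc; have [M MP] := collar_bounded; apply: (Linfc_indic (M := M)) => // x /Fc/MP.
Qed.

Lemma tv_finite_level f (c : R) : Linfc f -> (forall x, 0 <= f x <= 1) ->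
  (forall x, ~ collar x -> f x = 0) -> (tv f < c%:E)%E ->
  exists F, [/\ Lmeasurable F, F `<=` collar, (tv \1_F <= c%:E)%E & forall x, f x = 1 -> F x].
Proof.
move=> lf f01 f0 fc; have [s [s0 s1 Ps]] := perimeter_level lf f01 fc.
have mF : Lmeasurable [set x | s < f x] by apply: Lfun_gt_measurable; exact: lf.1.
exists [set x | s < f x]; split => //.
- move=> x /= fx; apply: contrapT => /f0 h; move: fx; rewrite h; move: s0; rewrite leNgt.
  by move/negP.
- by rewrite -perimeterE.
- by move=> x /= ->.
Qed.

(** By [perimeter_level] some superlevel set of [f], which is a competitor of [E], has
    hardly more perimeter than [f] has variation. *)
Lemma OM_functional E f (N : set Rn) : OM E -> Linfc f -> (forall x, 0 <= f x <= 1) ->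
  (forall x, ~ collar x -> f x = 0) -> leb N = 0%E -> (forall x, E x -> ~ N x -> f x = 1) ->
  (tv \1_E <= tv f)%E.
Proof.
move=> [mE cE fE minE] lf f01 f0 N0 fE1.
have [->|fN] := eqVneq (tv f) +oo%E; first by rewrite leey.
have ffin : tv f \is a fin_num by rewrite ge0_fin_numE ?tv_ge0// ltey.
apply/lee_addgt0Pr => e e0; rewrite -(fineK ffin) -EFinD.
have [|F [mF Fc PF F1]] := @tv_finite_level f (fine (tv f) + e) lf f01 f0.
  by rewrite -[ltLHS](fineK ffin) lte_fin ltrDl.
apply: le_trans (minE F mF Fc _) PF.
apply/eqP; rewrite eq_le measure_ge0 andbT -N0.
apply: le_measure; rewrite ?inE.
- exact: measurableD.
- exact: null_Lmeasurable.
- by move=> x [Ex nF]; apply: contrapT => nN; apply: nF; apply: F1; exact: fE1.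
Qed.

(** The perimeter is finite because the cutoff function has a superlevel set of finite
    perimeter, which is a competitor. *)
Lemma OM_E0 : OM E0.
Proof.
have mE : Lmeasurable E0 by apply: borel_Lmeasurable; exact: open_borel.
have [psi [C [[cpsi C0] p01 p1 p0 pC]]] := collar_cutoff.
have E0psi x : E0 x -> psi x = 1.
  move=> Ex; apply: (p1 x _).1; apply: dist_closure; first exact: subset_closure.
  by rewrite divr_gt0.
have minE F : Lmeasurable F -> F `<=` collar -> leb (E0 `\` F) = 0%E -> (tv \1_E0 <= tv \1_F)%E.
  move=> mF Fc EF0.
  have mU : Lmeasurable (E0 `|` F) by exact: measurableU.
  rewrite -(perimeterE mE); apply: (@le_trans _ _ (perimeter (E0 `|` F))).
    by apply: E0min => // x [/subset_closure/closure_collar|/Fc].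
  rewrite (perimeterE mU) (tv_ae (f := \1_(E0 `|` F)) (g := \1_F) _ _ EF0)//; [exact: Lfun_indic..|].
  move=> x nEF; rewrite !indicE; congr (_%:R); congr nat_of_bool; apply/idP/idP; rewrite !inE.
    by move=> [Ex|//]; apply: contrapT => nF; apply: nEF.
  by right.
split => //; first exact: subset_closure.
have lpsi := C1c_Linfc cpsi.
have pfin : (tv psi < (lint (gnorm psi) + 1)%:E)%E.
  by apply: le_lt_trans (tv_le_gnorm cpsi) _; rewrite lte_fin ltrDl.
have [F [mF Fc PF F1]] := tv_finite_level lpsi p01 p0 pfin.
apply: le_lt_trans (minE F mF Fc _) (le_lt_trans PF (ltry _)).
rewrite (_ : E0 `\` F = set0) ?measure0// -subset0 => x [/E0psi/F1 Fx]; exact.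
Qed.

Lemma indic_min F G x : Num.min (\1_F x) (\1_G x) = \1_(F `&` G) x :> R.
Proof.
rewrite !indicE in_setI; case: (x \in F); case: (x \in G); rewrite /= ?minxx//.
- by rewrite min_r.
- by rewrite min_l.
Qed.

(** By submodularity, as the maximum of [f] and the indicator of [E] is a competitor. *)
Lemma OM_cut f E : OM E -> Linfc f -> (forall x, 0 <= f x <= 1) -> (forall x, ~ collar x -> f x = 0) ->
  (tv (fun x => Num.min (f x) (\1_E x)) <= tv f)%E.
Proof.
move=> oE lf f01 f0; have lE := OM_Linfc oE; have [mE cE fE minE] := oE.
have := tv_max_min lf lE.
have h : (tv \1_E <= tv (fun x => Num.max (f x) (\1_E x)))%E.
  have E01 x : 0 <= (\1_E x : R) <= 1 by rewrite indicE; case: (_ \in _); rewrite ?lexx ?ler01.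
  apply: (OM_functional oE (N := set0)) => //.
  - exact: Linfc_max.
  - move=> x; have /andP[h1 h2] := f01 x; have /andP[h3 h4] := E01 x.
    by rewrite le_max h1/= ge_max h2.
  - move=> x nc; rewrite f0// indicE memNset ?maxxx// => /cE/closure_collar; exact: nc.
  - move=> x Ex _; rewrite indicE mem_set// max_r//; by have /andP[] := f01 x.
have Efin : tv \1_E \is a fin_num by rewrite ge0_fin_numE ?tv_ge0.
rewrite addeC => h2; have := leeD2l (tv (fun x => Num.min (f x) (\1_E x))) h.
by move=> /le_trans/(_ h2); rewrite leeD2rE.
Qed.

End outward_minimizing.

(** * The minimizing step *)

Section minimizing_step.
Context {R : realType} {n : nat}.
Local Notation Rn := 'rV[R]_n.+1.
Local Notation LT := (caratheodory_type (@lebesgue_outer R n)).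
Implicit Types (x y : Rn) (A B E F G : set Rn).
Variables (E0 : set Rn) (delta : R).
Hypotheses (bE0 : bounded_set E0) (oE0 : open E0) (d0 : 0 < delta)
  (E0min : outward_minimizing delta E0).
Local Notation OM := (OM E0 delta).
Local Notation collar := (collar E0 delta).

Let D G A : \bar R := (\int[leb]_(x in (A : set LT)) bdist G x)%E.

Let mb G A : measurable_fun (A : set LT) (fun x : LT => bdist G (x : Rn)).
Proof. by apply: measurable_funTS; exact: dist_measurable. Qed.

Let D_ge0 G A : (0 <= D G A)%E.
Proof. by apply: integral_ge0 => x _; exact: dist_ge0. Qed.

Let D_sub G A B : Lmeasurable A -> Lmeasurable B -> A `<=` B -> (D G A <= D G B)%E.
Proof. by move=> mA mB AB; apply: ge0_subset_integral => // x _; exact: dist_ge0. Qed.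

Let D_U G A B : Lmeasurable A -> Lmeasurable B -> [disjoint A & B] ->
  D G (A `|` B) = (D G A + D G B)%E.
Proof. by move=> mA mB AB; apply: ge0_integral_setU => // x _; exact: dist_ge0. Qed.

Let D_null G A : leb A = 0%E -> D G A = 0%E.
Proof. by move=> A0; apply: null_set_integral => //; exact: null_Lmeasurable. Qed.

Let energyE h G E : Lmeasurable E ->
  step_energy h G E = (tv \1_E + h^-1%:E * D G (E `+` G))%E.
Proof. by move=> mE; rewrite /step_energy perimeterE. Qed.

Let symdiffE A B : A `+` B = (A `\` B) `|` (B `\` A).
Proof. by []. Qed.

Let symdiff_cut F G : (F `&` G) `+` G = G `\` F.
Proof.
apply/seteqP; split => x.
  by move=> [[[_ Gx] []//]|[Gx nFG]]; split => // Fx; apply: nFG.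
by move=> [Gx nF]; right; split => // -[].
Qed.

Let bdist_gt0 G x : ~ closure G x -> bdist G x != 0%E.
Proof.
move=> nc; have : open (~` closure G) by apply: closed_openC; exact: closed_closure.
rewrite openE => /(_ x nc) /nbhs_ballP[r /= r0 rG].
rewrite gt_eqF//; apply: lt_le_trans (_ : (r%:E <= _)%E); first by rewrite lte_fin.
apply: dist_geP => y [cy _]; apply: le_trans (normr_le_enorm _).
rewrite leNgt; apply/negP => xy; apply: (rG y) cy.
by rewrite -ball_normE.
Qed.

(** Compare [E] with its intersection with [G].  By [OM_cut] the intersection costs no
    perimeter once [E] has been cut off outside the collar, and for small [h] the cost of
    the cutoff is less than what the distance term saves.  Hence [E] has no points at a
    positive distance from the boundary of [G] outside [G], up to a null set.  The
    comparison with the intersections of [G] and the sets [F] then gives the minimality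
    of [E], as replacing [E] by such an intersection does not increase the distance term. *)
Lemma minimizing_step : exists2 h0 : R, 0 < h0 & forall (h : R) G E, 0 < h -> h < h0 -> OM G ->
  Lmeasurable E -> (forall F, Lmeasurable F -> (step_energy h G E <= step_energy h G F)%E) ->
  [/\ (tv \1_E <= tv \1_G)%E, leb (E `\` closure G) = 0%E & forall F, Lmeasurable F ->
    F `<=` collar -> leb (E `\` F) = 0%E -> (tv \1_E <= tv \1_F)%E].
Proof.
have [psi [C [[cpsi C0] p01 p1 p0 pC]]] := collar_cutoff bE0 d0.
pose c := 4 * C / delta.
have c0 : 0 < c by rewrite !mulr_gt0// invr_gt0.
exists c^-1; first by rewrite invr_gt0.
move=> h G E h0 hc oG mE minE.
have [mG cG fG minG] := oG.
have hi0 : 0 < h^-1 by rewrite invr_gt0.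
have chi : c < h^-1 by rewrite -(invrK c) ltf_pV2 ?posrE ?invr_gt0.
have Gclose x : G x -> (dist x E0 < (delta / 4)%:E)%E.
  by move=> /cG cx; apply: dist_closure => //; rewrite divr_gt0.
(* Where the gradient of the cutoff does not vanish, the distance to E0 is at least
   delta / 4, and the boundary of G lies in the closure of E0. *)
have gb x : ((gnorm psi x)%:E <= c%:E * bdist G x)%E.
  have [xd|xd] := ltP (dist x E0) (delta / 4)%:E.
    by rewrite (p1 x xd).2 mule_ge0 ?dist_ge0// lee_fin ltW.
  apply: (@le_trans _ _ (c%:E * (delta / 4)%:E)%E).
    rewrite -EFinM lee_fin; apply: le_trans (pC x) _.
    by rewrite le_eqVlt /c; apply/orP; left; apply/eqP; field; rewrite gt_eqF.
  rewrite lee_pmul2l ?lte_fin//; apply: dist_geP => y [cy _].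
  have {}cy : closure E0 y.
    have := closure_subset cG cy; rewrite -(closure_id _).1//; exact: closed_closure.
  rewrite leNgt; apply/negP => xy; move: xd; rewrite leNgt => /negP; apply.
  have [z Ez yz] : exists2 z, E0 z & enorm (y - z) < delta / 4 - enorm (x - y).
    by apply: closure_enorm => //; rewrite subr_gt0.
  apply/dist_ltP; exists z => //; apply: le_lt_trans (enorm_triangle y _ _) _.
  by rewrite -ltrBrDl.
have mEG : Lmeasurable (E `\` G) by exact: measurableD.
have mGE : Lmeasurable (G `\` E) by exact: measurableD.
have disj A B : [disjoint A `\` B & B `\` A].
  by apply/disj_setPS => x [[Ax _] [_ nA]].
have enG : (step_energy h G E <= tv \1_G)%E.
  apply: le_trans (minE G mG) _; rewrite energyE// symdiffE setDv setU0.
  by rewrite /D integral_set0 mule0 adde0.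
rewrite energyE// symdiffE (D_U _ mEG mGE (disj _ _)) in enG.
have lehG : (tv \1_E <= tv \1_G)%E.
  apply: le_trans enG; rewrite leeDl//; apply: mule_ge0.
    by rewrite lee_fin ltW.
  by apply: adde_ge0; exact: D_ge0.
have Efin : tv \1_E \is a fin_num.
  by rewrite ge0_fin_numE ?tv_ge0//; exact: le_lt_trans lehG fG.
have abfin : (D G (E `\` G) + D G (G `\` E))%E \is a fin_num.
  rewrite ge0_fin_numE; last by apply: adde_ge0; exact: D_ge0.
  have : (h^-1%:E * (D G (E `\` G) + D G (G `\` E)) < +oo)%E.
    apply: le_lt_trans fG; apply: le_trans enG; rewrite leeDr// tv_ge0//.
  rewrite !ltey; apply: contra_neq => ->; rewrite gt0_muley// lte_fin//.
have [afin bfin] : D G (E `\` G) \is a fin_num /\ D G (G `\` E) \is a fin_num.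
  by apply/andP; rewrite -fin_numD.
set a := fine (D G (E `\` G)); set b := fine (D G (G `\` E)); set pe := fine (tv \1_E).
have aE : D G (E `\` G) = a%:E by rewrite fineK.
have bE : D G (G `\` E) = b%:E by rewrite fineK.
have peE : tv \1_E = pe%:E by rewrite fineK.
have a0 : 0 <= a by apply: fine_ge0; exact: D_ge0.
have enE : step_energy h G E = (pe + h^-1 * (a + b))%:E.
  by rewrite energyE// symdiffE (D_U _ mEG mGE (disj _ _)) peE aE bE.
pose I := lint (fun x => \1_E x * gnorm psi x).
have bdE := bdd_meas_indic mE; have lg := gnorm_Linfc cpsi.
have lI : Linfc (fun x => \1_E x * gnorm psi x) := bdd_meas_mul bdE lg.
have Ia : I <= c * a.
  rewrite -lee_fin EFinM -aE /I lintE//.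
  rewrite (_ : (\int[leb]_x _)%E = (\int[leb]_(x in (E `\` G : set LT)) (gnorm psi x)%:E)%E); last first.
    rewrite [RHS]integral_mkcond epatch_indic; apply: eq_integral => x _ /=.
    rewrite -EFinM mulrC; congr EFin.
    have [xG|xG] := pselect (G x); first by rewrite (p1 x (Gclose x xG)).2 !mul0r.
    rewrite !indicE; congr (_ * _%:R); congr nat_of_bool.
    by apply/idP/idP; rewrite !inE => // -[].
  rewrite -ge0_integralZl//; last 2 first.
  - by move=> x _; exact: dist_ge0.
  - by rewrite lee_fin ltW.
  apply: (@ge0_le_integral _ _ _ leb (E `\` G : set LT) mEG) => [x _|||x _].
  - by rewrite lee_fin gnorm_ge0.
  - by apply: measurable_funTS; apply/measurable_EFinP; exact: lg.1.
  - by apply: measurable_funeM; exact: mb.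
  - exact: gb.
have lpsi := C1c_Linfc cpsi.
have E01 A x : 0 <= (\1_A x : R) <= 1 by rewrite indicE; case: (_ \in _); rewrite ?lexx ?ler01.
have cutI : (tv \1_(E `&` G) <= (pe + I)%:E)%E.
  have Epsi := bdd_meas_mul bdE lpsi.
  have Epsi01 x : 0 <= \1_E x * psi x <= 1.
    have /andP[h1 h2] := E01 E x; have /andP[h3 h4] := p01 x.
    by rewrite mulr_ge0//= mulr_ile1.
  have Epsi0 x : ~ collar x -> \1_E x * psi x = 0 by move=> /p0 ->; rewrite mulr0.
  have := OM_cut bE0 d0 oG Epsi Epsi01 Epsi0.
  rewrite (_ : (fun x => Num.min _ _) = \1_(E `&` G)); last first.
    apply/funext => x; rewrite -indic_min [\1_G x]indicE.
    have [xG|xG] := boolP (x \in G).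
      by rewrite (p1 x _).1 ?mulr1//; apply: Gclose; rewrite inE in xG.
    have /andP[h1 _] := E01 E x; have /andP[h2 _] := Epsi01 x.
    by rewrite (min_r h1) (min_r h2).
  move/le_trans; apply; apply: tv_indic_mul => //.
  by rewrite peE.
have mEIG : Lmeasurable (E `&` G) by exact: measurableI.
(* The comparison gives a / h <= c * a, whereas c < 1 / h. *)
have ha : a = 0.
  have := minE _ mEIG; rewrite enE energyE// symdiff_cut bE => h1.
  have : ((pe + h^-1 * (a + b))%:E <= (pe + I)%:E + (h^-1 * b)%:E)%E.
    by apply: le_trans h1 _; rewrite -EFinM leeD2r.
  rewrite -EFinD lee_fin mulrDr => h2.
  have h3 : h^-1 * a <= c * a by apply: le_trans Ia; lra.
  apply/eqP; rewrite eq_le a0 andbT leNgt; apply/negP => a1.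
  by move: h3; rewrite ler_pM2r// leNgt chi.
split => //.
- have := aE; rewrite ha.
  rewrite /D (_ : (\int[leb]_(x in _) _)%E = (\int[leb]_(x in (E `\` G : set LT)) `|bdist G x|)%E); last first.
    by apply: eq_integral => x _; rewrite gee0_abs// dist_ge0.
  move/(ae_eq_integral_abs leb mEG (@mb G _)) => [N [mN N0 EN]].
  apply/eqP; rewrite eq_le measure_ge0 andbT -N0; apply: le_measure; rewrite ?inE//.
    by apply: measurableD => //; apply: borel_Lmeasurable; apply: closed_borel; exact: closed_closure.
  move=> x [Ex ncx]; apply: EN => /= h1.
  have nGx : ~ G x by move=> /subset_closure.
  by have /eqP := bdist_gt0 ncx; apply; apply: h1.
- move=> F mF Fc EF0.
  have mFG : Lmeasurable (F `&` G) by exact: measurableI.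
  have mGF : Lmeasurable (G `\` F) by exact: measurableD.
  have mEF : Lmeasurable (E `\` F) by exact: measurableD.
  have cutF : (tv \1_(F `&` G) <= tv \1_F)%E.
    have F0 x : ~ collar x -> (\1_F x : R) = 0.
      by move=> nc; rewrite indicE memNset// => /Fc.
    have := OM_cut bE0 d0 oG (sub_collar_Linfc bE0 mF Fc) (E01 F) F0.
    by congr (tv _ <= _)%E; apply/funext => x; rewrite indic_min.
  apply: le_trans cutF.
  have GF : (D G (G `\` F) <= b%:E)%E.
    have mU : Lmeasurable ((G `\` E) `|` ((E `\` F) `\` (G `\` E))) by apply: measurableU => //; exact: measurableD.
    apply: (@le_trans _ _ (D G ((G `\` E) `|` ((E `\` F) `\` (G `\` E))))).
      apply: D_sub => // x [Gx nF]; have [Ex|nE] := pselect (E x); last by left.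
      by right; split => // -[].
    rewrite D_U//; last 2 first.
    + exact: measurableD.
    + by apply/disj_setPS => x [? []].
    rewrite (@D_null G ((E `\` F) `\` (G `\` E))) ?adde0 ?bE//.
    apply/eqP; rewrite eq_le measure_ge0 andbT -EF0; apply: le_measure; rewrite ?inE//.
    exact: measurableD.
  have := minE _ mFG; rewrite enE energyE// symdiff_cut ha add0r.
  have GFfin : D G (G `\` F) \is a fin_num.
    by rewrite ge0_fin_numE//; exact: le_lt_trans GF (ltry _).
  move=> h1; have : (pe%:E + (h^-1 * b)%:E <= tv \1_(F `&` G) + (h^-1 * b)%:E)%E.
    rewrite -EFinD; apply: le_trans h1 _; rewrite leeD2l// EFinM.
    by apply: lee_wpmul2l => //; rewrite lee_fin ltW.
  by rewrite leeD2rE// peE.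
Qed.

End minimizing_step.

(** * Boundaries of outward minimizing sets *)

Section boundary.
Context {R : realType} {n : nat}.
Local Notation Rn := 'rV[R]_n.+1.
Implicit Types (x y : Rn) (A B E F G V K : set Rn) (v : Rn -> R) (xi : 'I_n.+1 -> Rn -> R).

Lemma gradient_pairing v mu xi : bdd_meas v -> is_gradient (fun x => (v x)%:E) mu ->
  C1c_field xi -> pairing mu xi = - lint (fun x => v x * dv xi x).
Proof.
move=> bv [_ gv] cxi.
have lp i : Linfc (fun x => v x * partial i (xi i) x).
  by apply: bdd_meas_mul => //; exact: C1c_partial_Linfc.
have H i : CI (mu i) (xi i : borel R n -> R) = - lint (fun x => v x * partial i (xi i) x).
  have [M M0] := (cxi i).2.
  have := gv (xi i) i (cxi i).1 (compact_tsupp M0).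
  rewrite (charge_integralE _ (C1c_Bfun (cxi i))) => e.
  apply: (can_inj opprK); rewrite opprK; apply: EFin_inj; rewrite EFinN -e (lintE (lp i)).
  by apply: eq_integral => x _; rewrite EFinM.
rewrite /pairing; under eq_bigr do rewrite H.
rewrite sumrN -lint_sum//; congr (- lint _); apply/funext => x.
by rewrite /dv mulr_sumr.
Qed.

Lemma dv_eq0 xi U x : (exists2 K, compact K /\ K `<=` U & forall i y, ~ K y -> xi i y = 0) ->
  ~ U x -> dv xi x = 0.
Proof.
move=> [K [cK KU] K0] nU; rewrite /dv big1// => i _.
apply: (@partial_eq0 _ _ _ i x (~` K)).
- by apply: closed_openC; exact: compact_closed (@norm_hausdorff _ _) cK.
- by move/KU.
- by move=> y; exact: K0.
Qed.

(** Otherwise the gradient of the indicator would vanish around a nearby point of the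
    reduced boundary. *)
Lemma normalized_bdry E V x : Lmeasurable E -> normalized E -> bdry E x -> open V -> V x ->
  leb (E `&` V) != 0%E /\ leb (V `\` E) != 0%E.
Proof.
move=> mE nE bx oV Vx.
have mV : Lmeasurable V by apply: borel_Lmeasurable; exact: open_borel.
have [y [ry Vy]] : exists y, reduced_boundary E y /\ V y.
  have : closure (reduced_boundary E) x by rewrite nE.
  by move=> /(_ V (open_nbhs_nbhs (conj oV Vx))) [y [h1 h2]]; exists y.
have [mu [gmu pos _]] := ry.
have /nbhs_ballP[r /= r0 rV] := open_nbhs_nbhs (conj oV Vy).
have BV : eball y r `<=` V.
  move=> z zr; apply: rV; rewrite -ball_normE/= distrC.
  exact: le_lt_trans (normr_le_enorm _) zr.
have bE := bdd_meas_indic mE.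
have key : (forall xi, admissible xi -> supported_in (eball y r) xi ->
    lint (fun z => \1_E z * dv xi z) = 0) -> False.
  move=> h; have : (vector_variation mu (eball y r : set (borel R n)) <= 0%:E)%E.
    apply: variation_le => // [|xi axi sxi]; first exact: open_eball.
    by rewrite (gradient_pairing bE gmu axi.1) h// oppr0.
  by rewrite leNgt (pos r r0).
have lxi xi : admissible xi -> Linfc (fun z => \1_E z * dv xi z).
  by move=> axi; apply: bdd_meas_mul => //; apply: dv_Linfc axi.1.
split; apply/negP => /eqP N0; apply: key => xi axi sxi.
- rewrite -[RHS](@lint0 R n); apply: (lint_ae (lxi xi axi).1 (Lfun_cst 0) N0) => z nz.
  have [Vz|nVz] := pselect (V z); last by rewrite (dv_eq0 sxi) ?mulr0// => /BV.
  by rewrite indicE memNset ?mul0r// => Ez; apply: nz.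
- have -> : 0 = lint (dv xi) :> R.
    rewrite lint_sum => [|i]; last by apply: C1c_partial_Linfc; exact: axi.1.
    by rewrite big1// => i _; rewrite lint_partial//; exact: axi.1.
  apply: (lint_ae (lxi xi axi).1 (dv_Linfc axi.1).1 N0) => z nz.
  have [Vz|nVz] := pselect (V z); last by rewrite (dv_eq0 sxi) ?mulr0// => /BV.
  rewrite indicE mem_set ?mul1r//; apply: contrapT => nE'; exact: nz.
Qed.

Variables (E0 : set Rn) (delta : R).
Hypotheses (bE0 : bounded_set E0) (oE0 : open E0) (d0 : 0 < delta).
Local Notation OM := (OM E0 delta).
Local Notation collar := (collar E0 delta).

Let gap E x r : R := lint (\1_(ball x r `\` E) : Rn -> R).

Let ball_bound x r y : ball x r y -> `|y| < `|x| + r.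
Proof.
rewrite -ball_normE/= => xy; rewrite -(subrK x y) addrC.
by apply: le_lt_trans (ler_normD _ _) _; rewrite ltrD2l distrC.
Qed.

Let gap_meas E x r : Lmeasurable E -> Lmeasurable (ball x r `\` E).
Proof. by move=> mE; apply: measurableD => //; exact: ball_Lmeasurable. Qed.

Let gap_Linfc E x r : Lmeasurable E -> Linfc (\1_(ball x r `\` E) : Rn -> R).
Proof.
move=> mE; apply: (Linfc_indic (M := `|x| + r)); first exact: gap_meas.
by move=> y [/ball_bound].
Qed.

Let gapE E x r : Lmeasurable E -> (gap E x r)%:E = leb (ball x r `\` E).
Proof.
move=> mE; apply: (lint_indic (M := `|x| + r)); first exact: gap_meas.
by move=> y [/ball_bound].
Qed.

Let indic_le A B x : A `<=` B -> \1_A x <= \1_B x :> R.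
Proof.
move=> AB; rewrite !indicE; have [xA|xA] := boolP (x \in A); last by case: (x \in B).
by rewrite mem_set//; apply: AB; rewrite inE in xA.
Qed.

Let gap_mono E x r s : Lmeasurable E -> r <= s -> gap E x r <= gap E x s.
Proof.
move=> mE rs; apply: le_lint; [exact: gap_Linfc..|move=> y].
by apply: indic_le => z [xz nE]; split => //; exact: le_ball xz.
Qed.

Let gap_ge0 E x r : 0 <= gap E x r.
Proof. by apply: lint_ge0 => y; rewrite indicE. Qed.

Let I01 A x : 0 <= (\1_A x : R) <= 1.
Proof. by rewrite indicE; case: (_ \in _); rewrite ?lexx ?ler01. Qed.

Let absorb (g l t u : R) : l <= u -> g <= l + t -> t <= 2^-1 * g -> g <= 2 * u.
Proof. by lra. Qed.

Let norm_gap (z w : R) : z <= w -> 1 <= `|z - 1| + w.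
Proof. by move=> zw; have := ler_norm (1 - z); rewrite (distrC 1); lra. Qed.

(** Filling the complement of [E] inside the cube of radius [r] shows, by [tv_fill], that
    the filled part has small variation compared with its volume.  By [conv_rate] its
    smoothing at scale [rho] is then close to it in mean, but the smoothing is at most 1/2
    since the filled part has small volume; so the filled part is even smaller. *)
Let gap_decay : exists2 K : R, 0 < K & forall E x (r r' rho : R), OM E -> 0 < r -> r < r' ->
  0 < rho -> ball x r' `<=` collar -> K * gap E x r' <= rho ^+ n.+1 ->
  gap E x r * (r' - r) <= K * rho * gap E x r'.
Proof.
have [C C0 HC] := @smooth_indic R n.
have Q0 : 0 < 2 * 4 ^+ n.+1 :> R by rewrite mulr_gt0// exprn_gt0.
have P0 : 0 <= 16 * C * n.+1%:R :> R by rewrite !mulr_ge0// ltW.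
exists (2 * 4 ^+ n.+1 + 16 * C * n.+1%:R); first by rewrite ltr_pwDl.
set K := _ + _; move=> E x r r' rho oE r0 rr' rho0 xc Kg.
have [mE cE fE minE] := oE; have mA : Lmeasurable (~` E) by exact: measurableC.
pose s := (r' - r) / 4; have s0 : 0 < s by rewrite divr_gt0// subr_gt0.
pose m := (r + r') / 2.
have mB : Lmeasurable (ball x m) by exact: ball_Lmeasurable.
have [psi [cpsi p01 p1 p0 pC]] := HC (ball x m) (`|x| + m) s mB (@ball_bound x m) s0.
have psi1 y : ball x r y -> psi y = 1.
  rewrite -ball_normE/= => xy; apply: p1 => z yz; rewrite -ball_normE/=.
  have := ler_distD y x z; move: xy yz; rewrite /s /m.
  by move: `|x - y| `|y - z| `|x - z| rr' => a b c; lra.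
have psi0 y : m + s < `|x - y| -> psi y = 0.
  move=> xy; apply: p0 => z yz; rewrite -ball_normE/= => xz.
  have := ler_distD z x y; rewrite (distrC z y); move: xy yz xz.
  by move: `|x - y| `|y - z| `|x - z| => a b c; lra.
have gpsi0 y : ~ ball x r' y -> gnorm psi y = 0.
  rewrite -ball_normE/= => /negP; rewrite -leNgt => xy.
  rewrite /gnorm big1 ?sqrtr0// => i _.
  rewrite (@partial_eq0 _ _ psi i y [set z : Rn | m + s < `|x - z|]) ?expr0n//.
  - rewrite (_ : [set z | _] = (fun z : Rn => `|x - z|) @^-1` [set t : R | m + s < t])//.
    apply: open_comp; last exact: open_gt.
    move=> z _; apply: continuous_comp; last exact: norm_continuous.
    by apply: continuousB; [exact: cst_continuous|exact: cvg_id].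
  - by apply: lt_le_trans xy; rewrite /m /s; move: rr'; lra.
have psi0' y : ~ ball x r' y -> psi y = 0.
  rewrite -ball_normE/= => /negP; rewrite -leNgt => xy; apply: psi0.
  by apply: lt_le_trans xy; rewrite /m /s; move: rr'; lra.
have lpsi := C1c_Linfc cpsi; have lg := gnorm_Linfc cpsi.
have bA := bdd_meas_indic mA.
pose f y : R := \1_(~` E) y * psi y.
have lf : Linfc f by exact: bdd_meas_mul bA lpsi.
have lG := gap_Linfc x r mE; have lG' := gap_Linfc x r' mE.
have AG y : ball x r' y -> \1_(~` E) y = \1_(ball x r' `\` E) y :> R.
  move=> xy; rewrite !indicE; congr (_%:R); congr nat_of_bool.
  by apply/idP/idP; rewrite !inE => // -[].
have f0 y : 0 <= f y by rewrite mulr_ge0 ?indicE//; have /andP[] := p01 y.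
have fle y : f y <= \1_(ball x r' `\` E) y.
  have [xy|xy] := pselect (ball x r' y); last by rewrite /f psi0'// mulr0 indicE.
  by rewrite /f AG// ler_piMr ?indicE//; have /andP[] := p01 y.
have If : lint f <= gap E x r' by exact: le_lint.
pose c := C / s * gap E x r'.
have Ig : lint (fun y => \1_(~` E) y * gnorm psi y) <= c.
  rewrite /c /gap -lintZ//; apply: le_lint => [||y].
  - exact: bdd_meas_mul bA lg.
  - exact: LinfcZ.
  have [xy|xy] := pselect (ball x r' y); last first.
    by rewrite gpsi0// mulr0 mulr_ge0 ?indicE// divr_ge0// ltW.
  by rewrite AG// mulrC ler_wpM2r ?indicE.
have tvf : (tv f <= (2 * c)%:E)%E.
  have h := tv_fill cpsi p01 mE.
  have hE : (tv \1_E <= tv (fun y => (\1_E y + \1_(~` E) y * psi y)%R))%E.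
    have AE y : \1_(~` E) y = 1 - \1_E y :> R.
      by rewrite !indicE in_setC; case: (y \in E); rewrite ?subrr ?subr0.
    apply: (OM_functional oE (N := set0)) => //.
    - by apply: LinfcD; [exact: (OM_Linfc bE0 d0 oE)|exact: bdd_meas_mul bA lpsi].
    - move=> y; have /andP[h1 h2] := I01 E y; have /andP[h3 h4] := p01 y; rewrite AE.
      have h5 : 0 <= (1 - \1_E y) * psi y by rewrite mulr_ge0// subr_ge0.
      have h6 : (1 - \1_E y) * psi y <= 1 - \1_E y by rewrite ler_piMr// subr_ge0.
      by apply/andP; split; lra.
    - move=> y nc; rewrite psi0' ?mulr0 ?addr0; last by move/xc.
      by rewrite indicE memNset// => /cE/(closure_collar d0).
    - by move=> y Ey _; rewrite AE indicE mem_set// subrr mul0r addr0.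
  have Efin : tv \1_E \is a fin_num by rewrite ge0_fin_numE ?tv_ge0.
  have h2 := le_trans (leeD2l (tv f) hE) h.
  rewrite [leRHS]addeC leeD2rE// in h2; apply: le_trans h2 _.
  by rewrite lee_fin ler_pM2l.
have h1 := conv_rate rho0 lf tvf.
have lcf := conv_Linfc rho0 lf.
have ld : Linfc (fun y => `|conv rho f y - f y|) by apply: Linfc_norm; exact: LinfcB.
pose b := (4 / rho) ^+ n.+1 * gap E x r'.
have b2 : b <= 2^-1.
  rewrite /b expr_div_n mulrAC ler_pdivrMr ?exprn_gt0//.
  have : 2 * 4 ^+ n.+1 * gap E x r' <= rho ^+ n.+1.
    by apply: le_trans Kg; rewrite ler_wpM2r ?gap_ge0// lerDl.
  by rewrite -mulrA; move: (rho ^+ n.+1) (4 ^+ n.+1 * gap E x r') => X Y; lra.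
have h2 : gap E x r <= lint (fun y => `|conv rho f y - f y|) + b * gap E x r.
  rewrite /gap -lintZ// -lintD//; last exact: LinfcZ.
  apply: le_lint => //; first by apply: LinfcD => //; exact: LinfcZ.
  move=> y; have [yG|yG] := boolP (y \in ball x r `\` E); last first.
    have -> : \1_(ball x r `\` E) y = 0 :> R by rewrite indicE (negbTE yG).
    by rewrite mulr0 addr0.
  have -> : \1_(ball x r `\` E) y = 1 :> R by rewrite indicE yG.
  rewrite mulr1; rewrite inE in yG; have [xy nE] := yG.
  have -> : f y = 1 by rewrite /f psi1// indicE mem_set// mulr1.
  have : conv rho f y <= b.
    apply: le_trans (conv_le_lint y rho0 lf f0) _; rewrite ler_wpM2l//.
    by rewrite exprn_ge0// divr_ge0// ltW.
  exact: norm_gap.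
have h3 : b * gap E x r <= 2^-1 * gap E x r by rewrite ler_wpM2r ?gap_ge0.
have h4 : gap E x r <= 2 * ((rho * (2 * c)) *+ n.+1) by exact: absorb h1 h2 h3.
have sE : (r' - r) = 4 * s by rewrite /s; field.
apply: (@le_trans _ _ (2 * ((rho * (2 * c)) *+ n.+1) * (r' - r))).
  by rewrite ler_wpM2r// subr_ge0 ltW.
have -> : 2 * ((rho * (2 * c)) *+ n.+1) * (r' - r) = 16 * C * n.+1%:R * rho * gap E x r'.
  rewrite sE /c -(mulr_natr (rho * _)); move: (n.+1%:R : R) => N; field; rewrite gt_eqF//.
apply: ler_wpM2r; first exact: gap_ge0.
by apply: ler_wpM2r; [exact: ltW|rewrite /K lerDr ltW].
Qed.

(** De Giorgi's iteration of [gap_decay] along radii that decrease from [r] to [r / 2]. *)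
Lemma OM_density : exists2 c : R, 0 < c & forall E x r, OM E -> 0 < r -> ball x r `<=` collar ->
  (leb (ball x r `\` E) <= (c * r ^+ n.+1)%:E)%E -> leb (ball x (r / 2) `\` E) = 0%E.
Proof.
have [K K0 HK] := gap_decay.
pose k := (4 * K * 4 ^+ n.+1)^-1.
have k0 : 0 < k by rewrite invr_gt0 !mulr_gt0// exprn_gt0.
exists (k ^+ n.+1 / K); first by rewrite divr_gt0// exprn_gt0.
move=> E x r oE r0 xc; have [mE _ _ _] := oE.
rewrite -!gapE// lee_fin => gr.
pose rs (i : nat) := r / 2 * (1 + 2^-1 ^+ i).
have h2 i : 0 < (2^-1 : R) ^+ i by rewrite exprn_gt0.
have h2le i : (2^-1 : R) ^+ i <= 1 by rewrite exprn_ile1 ?invr_ge0 ?invf_le1 ?ler1n.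
have rs0 : rs 0%N = r by rewrite /rs expr0; field.
have rs_gt i : 0 < rs i by rewrite mulr_gt0 ?divr_gt0// ltr_pwDl// ltW.
have rs_le i : rs i <= r.
  rewrite -[leRHS]rs0 /rs ler_pM2l ?divr_gt0// expr0 lerD2l//.
have rs_ge i : r / 2 <= rs i by rewrite /rs ler_peMr ?divr_ge0 ?(ltW r0)// lerDl ltW.
have rsB i : rs i - rs i.+1 = r / 4 * 2^-1 ^+ i by rewrite /rs exprS; field.
pose q : R := 4^-1 ^+ n.+1.
have q0 : 0 < q by rewrite exprn_gt0.
have decay i : gap E x (rs i) <= q ^+ i * gap E x r.
  elim: i => [|i ih]; first by rewrite rs0 expr0 mul1r.
  (* The scale decreases like 4 ^- i and the steps of the radii like 2 ^- i only, so
     that the volumes keep decreasing by the factor q. *)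
  pose rho := k * r * 4^-1 ^+ i.
  have rho0 : 0 < rho by rewrite !mulr_gt0// exprn_gt0.
  have rlt : rs i.+1 < rs i by rewrite -subr_gt0 rsB mulr_gt0// divr_gt0.
  have bc : ball x (rs i) `<=` collar by move=> y xy; apply: xc; exact: le_ball xy.
  have small : K * gap E x (rs i) <= rho ^+ n.+1.
    apply: (@le_trans _ _ (K * (q ^+ i * gap E x r))); first by rewrite ler_pM2l.
    have -> : rho ^+ n.+1 = q ^+ i * (k * r) ^+ n.+1.
      by rewrite /rho /q exprMn mulrC -!exprM mulnC.
    rewrite mulrCA ler_pM2l ?exprn_gt0// exprMn.
    by move: gr; rewrite mulrAC ler_pdivlMr// mulrC.
  have := HK E x (rs i.+1) (rs i) rho oE (rs_gt _) rlt rho0 bc small.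
  rewrite rsB => h.
  have h4 : gap E x (rs i.+1) <= q * gap E x (rs i).
    have p0 : 0 < r / 4 * 2^-1 ^+ i by rewrite mulr_gt0 ?divr_gt0.
    rewrite -(ler_pM2r p0); apply: le_trans h _.
    rewrite [leRHS]mulrAC ler_wpM2r ?gap_ge0//.
    rewrite /rho (_ : 4^-1 ^+ i = 2^-1 ^+ i * 2^-1 ^+ i); last first.
      by rewrite -exprMn; congr (_ ^+ _); field.
    have -> : q = (4 ^+ n.+1)^-1 by rewrite /q exprVn.
    rewrite /k.
    have P0 : 0 < (4 : R) ^+ n.+1 by rewrite exprn_gt0.
    move: (4 ^+ n.+1) P0 => P P0; have := h2le i; move: (2^-1 ^+ i) (h2 i) => t t0 t1.
    have -> : K * ((4 * K * P)^-1 * r * (t * t)) = P^-1 * (r / 4 * t) * t.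
      by field; rewrite !gt_eqF.
    by rewrite ler_piMr// mulr_ge0 ?mulr_ge0 ?divr_ge0 ?invr_ge0 ?(ltW r0) ?(ltW t0) ?(ltW P0).
  by apply: le_trans h4 _; rewrite exprS -mulrA ler_pM2l.
have cv : q ^+ i * gap E x r @[i --> \oo] --> (0 : R).
  rewrite -(mul0r (gap E x r)); apply: cvgMl; apply: cvg_expr.
  rewrite ger0_norm ?(ltW q0)// /q exprn_ilt1 ?invr_ge0 ?invf_lt1 ?ltr1n//.
have : gap E x (r / 2) <= 0.
  rewrite -(cvg_lim _ cv)//; apply: limr_ge; first exact: cvgP cv.
  apply: nearW => i; apply: le_trans (decay i); exact: gap_mono.
by move=> g0; apply/eqP; rewrite eqe eq_le g0 gap_ge0.
Qed.

(** At the boundary points the complement of [E] has positive density at all small scales,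
    by [OM_density] and [normalized_bdry]; so its smoothed indicators stay away from 0
    there, although they tend to 0 in mean on [E]. *)
Lemma OM_bdry_null E : OM E -> normalized E -> leb (E `&` bdry E) = 0%E.
Proof.
move=> oE nE; have [mE cE fE minE] := oE; have [c c0 HC] := OM_density.
have [M MP] := collar_bounded delta bE0.
have mbd : Lmeasurable (bdry E).
  apply: borel_Lmeasurable; apply: measurableD; first by apply: closed_borel; exact: closed_closure.
  by apply: open_borel; exact: open_interior.
pose K := E `&` bdry E.
have mK : Lmeasurable K by exact: measurableI.
have mcol : Lmeasurable collar by apply: borel_Lmeasurable; apply: open_borel; exact: open_collar.
pose A := collar `\` E; have mA : Lmeasurable A by exact: measurableD.
have lA : Linfc (\1_A : Rn -> R) by apply: (Linfc_indic (M := M)) => // x [/MP].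
have cc x : closure E x -> closure E0 x.
  by move=> cx; have := closure_subset cE cx; rewrite -(closure_id _).1//; exact: closed_closure.
have lK : Linfc (\1_K : Rn -> R).
  by apply: (Linfc_indic (M := M)) => // x [/cE/(closure_collar d0)/MP].
pose R0 := delta / 2 / n.+1%:R; have R00 : 0 < R0 by rewrite !divr_gt0.
have bc x r : bdry E x -> r <= R0 -> ball x r `<=` collar.
  move=> [cx _] rR y; rewrite -ball_normE/= => xy.
  have xd : (dist x E0 < (delta / 2)%:E)%E by apply: dist_closure; [exact: cc|rewrite divr_gt0].
  have exy : enorm (x - y) < delta / 2.
    apply: le_lt_trans (enorm_le_norm _) _; rewrite mulrC -ltr_pdivlMr//.
    exact: lt_le_trans xy rR.
  have dd : delta / 2 + delta / 2 = delta by field.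
  by have := dist_lt_near xd exy; rewrite dd.
have dens x r : bdry E x -> 0 < r -> r <= R0 -> c * r ^+ n.+1 <= gap E x r.
  move=> bx r0 rR; rewrite leNgt; apply/negP => /ltW; rewrite -lee_fin gapE// => h.
  have := HC E x r oE r0 (bc x r bx rR) h.
  have r2 : 0 < r / 2 by rewrite divr_gt0.
  have oB : open (ball x (r / 2)) by exact: ball_open.
  have xB : ball x (r / 2) x by exact: ballxx.
  have [_] := normalized_bdry mE nE bx oB xB.
  by move/eqP.
have lKE : (lint (\1_K : Rn -> R))%:E = leb K.
  by apply: (lint_indic (M := M)) => // x [/cE/(closure_collar d0)/MP].
apply/eqP; rewrite -[leb _]lKE eqe eq_le; apply/andP; split; last first.
  by apply: lint_ge0 => x; rewrite indicE.
pose s_ (k : nat) := 2 * R0 * k.+1%:R^-1.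
have s0 k : 0 < s_ k by rewrite !mulr_gt0 ?invr_gt0.
have sR k : s_ k / 2 <= R0.
  rewrite /s_ (_ : _ / 2 = R0 * k.+1%:R^-1); last by field; rewrite addrC natr1.
  by rewrite ler_piMr ?(ltW R00)// invf_le1// ler1n.
have sc : s_ k @[k --> \oo] --> (0 : R).
  by rewrite -(mulr0 (2 * R0)); apply: cvgMr; exact: cvg_harmonic.
have c4 : 0 < c / 4 ^+ n.+1 by rewrite divr_gt0// exprn_gt0.
have low k : c / 4 ^+ n.+1 * lint (\1_K : Rn -> R) <= lint (fun x => `|conv (s_ k) \1_A x - \1_A x|).
  have lcA := conv_Linfc (s0 k) lA.
  rewrite -lintZ//; apply: le_lint; [exact: LinfcZ|by apply: Linfc_norm; exact: LinfcB|move=> x].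
  have [xK|xK] := boolP (x \in K); last by rewrite indicE (negbTE xK) mulr0.
  have -> : \1_K x = 1 :> R by rewrite indicE xK.
  rewrite mulr1; rewrite inE in xK; have [Ex bx] := xK.
  have -> : \1_A x = 0 :> R by rewrite indicE memNset// => -[].
  rewrite subr0; apply: le_trans (ler_norm _).
  have sk2 : 0 < s_ k / 2 by rewrite divr_gt0.
  have lG := gap_Linfc x (s_ k / 2) mE.
  apply: (@le_trans _ _ (conv (s_ k) (\1_(ball x (s_ k / 2) `\` E) : Rn -> R) x)); last first.
    apply: le_conv => // y; apply: indic_le => z [xz nE']; split => //.
    exact: (bc x _ bx (sR k)).
  apply: le_trans (conv_ge_lint (s0 k) lG _ _); last 2 first.
  - by move=> y; rewrite indicE.
  - by move=> y xy; rewrite indicE memNset// => -[]; rewrite -ball_normE/= ltNge (ltW xy).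
  rewrite -[lint _]/(gap E x (s_ k / 2)).
  apply: (@le_trans _ _ ((2 * s_ k) ^- n.+1 * (c * (s_ k / 2) ^+ n.+1))).
    have e : (2 * s_ k) ^- n.+1 * (s_ k / 2) ^+ n.+1 = (4 ^+ n.+1)^-1.
      rewrite -(exprVn (2 * s_ k)) -exprMn -exprVn; congr (_ ^+ _); field.
      by rewrite gt_eqF.
    by rewrite mulrCA e.
  apply: ler_wpM2l; last exact: (dens x _ bx sk2 (sR k)).
  by rewrite invr_ge0 exprn_ge0// mulr_ge0// ltW.
have cv := conv_cvg s0 sc lA.
rewrite -(ler_pM2l c4) mulr0 -(cvg_lim _ cv)//; apply: limr_ge; first exact: cvgP cv.
exact: nearW.
Qed.

End boundary.

(** * The arrival time *)

Lemma admissibleN (R : realType) (n : nat) (xi : 'I_n.+1 -> 'rV[R]_n.+1 -> R) :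
  admissible xi -> admissible (fun i x => -1 * xi i x).
Proof.
move=> [cxi xi1]; split=> [i|x]; first exact: C1cZ.
by under eq_bigr do rewrite mulN1r sqrrN.
Qed.

Section arrival.
Context {R : realType} {n : nat}.
Local Notation Rn := 'rV[R]_n.+1.
Implicit Types (x y : Rn) (A F V W : set Rn).
Variables (E0 : set Rn) (delta : R).
Hypotheses (bE0 : bounded_set E0) (oE0 : open E0) (d0 : 0 < delta)
  (E0min : outward_minimizing delta E0).
Local Notation OM := (OM E0 delta).
Local Notation collar := (collar E0 delta).

Let open_leb V x : open V -> V x -> leb V != 0%E.
Proof.
move=> oV Vx; have /nbhs_ballP[r /= r0 rV] := open_nbhs_nbhs (conj oV Vx).
rewrite gt_eqF//; apply: lt_le_trans (_ : (leb (ball x r) <= _)%E).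
  by apply: lt_le_trans (leb_ball_ge x r0); rewrite lte_fin exprn_gt0// divr_gt0.
apply: le_measure; rewrite ?inE//; first exact: ball_Lmeasurable.
by apply: borel_Lmeasurable; exact: open_borel.
Qed.

Let leb_sub0 A F : Lmeasurable A -> Lmeasurable F -> A `<=` F -> leb F = 0%E -> leb A = 0%E.
Proof.
move=> mA mF AF F0; apply/eqP; rewrite eq_le measure_ge0 andbT -F0.
by apply: le_measure; rewrite ?inE.
Qed.

Section one_scheme.
Variables (E : nat -> set Rn) (h : R).
Hypotheses (h0 : 0 < h) (schemeE : implicit_scheme h E0 E).
Hypothesis step : forall G F, OM G -> Lmeasurable F ->
  (forall F', Lmeasurable F' -> (step_energy h G F <= step_energy h G F')%E) ->
  [/\ (tv \1_F <= tv \1_G)%E, leb (F `\` closure G) = 0%E & forall F', Lmeasurable F' ->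
    F' `<=` collar -> leb (F `\` F') = 0%E -> (tv \1_F <= tv \1_F')%E].

Let openE0 : open (E 0%N). Proof. by rewrite schemeE.1. Qed.

(** True for [E0] because it is open, and for its successors because they are normalized. *)
Let closure_pos k V x : Lmeasurable (E k) -> closure (E k) x -> open V -> V x ->
  leb (E k `&` V) != 0%E.
Proof.
move=> mE cx oV Vx.
have mV : Lmeasurable V by apply: borel_Lmeasurable; exact: open_borel.
have [ix|nix] := pselect (interior (E k) x).
  have oI : open (interior (E k) `&` V) by apply: openI => //; exact: open_interior.
  apply/negP => /eqP EV0; have /eqP := open_leb oI (conj ix Vx); apply.
  apply: leb_sub0 EV0 => //; [|exact: measurableI|].
    by apply: borel_Lmeasurable; exact: open_borel.
  by move=> y [/interior_subset Ey Vy].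
case: k mE cx nix => [|k] mE cx nix.
  have [y [Ey Vy]] := cx V (open_nbhs_nbhs (conj oV Vx)).
  have oI : open (E 0%N `&` V) by exact: openI.
  exact: (open_leb oI (conj Ey Vy)).
have [_ nE _] := schemeE.2 k.
exact: (normalized_bdry mE nE (conj cx nix) oV Vx).1.
Qed.

Let scheme_step k : OM (E k) -> OM (E k.+1) /\ (tv \1_(E k.+1) <= tv \1_(E k))%E /\
  closure (E k.+1) `<=` closure (E k).
Proof.
move=> oE; have [mE nE minE] := schemeE.2 k.
have [h1 h2 h3] := step oE mE minE.
have [mk ck fk _] := oE.
have cc : closure (E k.+1) `<=` closure (E k).
  move=> x cx; apply: contrapT => nc.
  have oV : open (~` closure (E k)) by apply: closed_openC; exact: closed_closure.
  by have /eqP := closure_pos mE cx oV nc; apply; rewrite -setDE.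
split; last by [].
split => //; last exact: le_lt_trans h1 fk.
move=> x /subset_closure/cc cx; have := closure_subset ck cx.
by rewrite -(closure_id _).1//; exact: closed_closure.
Qed.

Lemma scheme_OM k : OM (E k).
Proof.
elim: k => [|k ih]; last by have [] := scheme_step ih.
by rewrite schemeE.1; exact: OM_E0.
Qed.

Lemma scheme_tv_le k : (tv \1_(E k) <= tv \1_E0)%E.
Proof.
elim: k => [|k ih]; first by rewrite schemeE.1.
by have [_ [h1 _]] := scheme_step (scheme_OM k); exact: le_trans h1 ih.
Qed.

Let scheme_meas k : Lmeasurable (E k).
Proof. by have [] := scheme_OM k. Qed.

(** The sets need not be nested, but their closures are, and the part of [E k.+1] in its
    boundary is negligible by [OM_bdry_null]: an interior point of [E k.+1] in [V] is in
    the closure of [E k], which therefore meets the neighbourhoods of that point in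
    positive measure. *)
Lemma scheme_nested k V : open V -> leb (E k `&` V) != 0%E -> exists2 x, V x &
  forall i, (i <= k)%N -> E i x.
Proof.
move=> oV EV; suff [W [oW [x Wx] WV WE]] : exists W, [/\ open W, W !=set0, W `<=` V &
    forall i, (i <= k)%N -> W `<=` E i].
  by exists x; [exact: WV|move=> i ik; exact: WE].
elim: k V oV EV => [|k ih] V oV EV.
  exists (E 0%N `&` V); split => //.
  - exact: openI.
  - by apply/set0P; apply: contraNneq EV => ->; rewrite measure0.
  - by move=> i; rewrite leqn0 => /eqP -> x [].
have [_ nE _] := schemeE.2 k; have mE := scheme_meas k.+1.
have bd0 := OM_bdry_null bE0 d0 (scheme_OM k.+1) nE.
have mV : Lmeasurable V by apply: borel_Lmeasurable; exact: open_borel.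
have [x [ix Vx]] : exists x, interior (E k.+1) x /\ V x.
  apply: contrapT => /forallNP H; move/eqP: EV; apply.
  apply: leb_sub0 bd0 => //; first exact: measurableI.
    apply: measurableI => //; apply: borel_Lmeasurable; apply: measurableD.
      by apply: closed_borel; exact: closed_closure.
    by apply: open_borel; exact: open_interior.
  move=> x [Ex Vx]; split => //; split; first exact: subset_closure.
  by move=> ix; exact: (H x).
have oW : open (interior (E k.+1) `&` V) by apply: openI => //; exact: open_interior.
have cx : closure (E k) x.
  have [_ [_ cc]] := scheme_step (scheme_OM k).
  by apply: cc; apply: subset_closure; exact: interior_subset.
have [W [oW' W0 WV WE]] := ih _ oW (closure_pos (scheme_meas k) cx oW (conj ix Vx)).
exists W; split => // [y /WV[]//|i].
rewrite leq_eqVlt => /predU1P[-> y /WV[/interior_subset]//|]; exact: WE.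
Qed.

Section arrival_bound.
Variables (u : Rn -> R) (eps : R).
Hypotheses (cu : continuous u) (u0 : forall x, 0 <= u x) (su : tsupp u `<=` closure E0)
  (eps0 : 0 < eps)
  (hu : forall x, (`|arrival_time h E x - (u x)%:E| <= eps%:E)%E).

Let partial_arrival m x : R := h * \sum_(k < m) \1_(E k) x.

Let partial_arrival_le m x : ((partial_arrival m x)%:E <= arrival_time h E x)%E.
Proof.
rewrite /partial_arrival /arrival_time EFinM lee_pmul2l ?lte_fin//.
rewrite -sumEFin -(big_mkord xpredT (fun k => (\1_(E k) x)%:E)).
by apply: nneseries_lim_ge => k _ _; rewrite lee_fin indicE.
Qed.

Let arrival_le x : (arrival_time h E x <= (u x + eps)%:E)%E.
Proof.
have := hu x; move/(le_trans (lee_abs _)); rewrite leeBlDr//.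
by rewrite addrC EFinD.
Qed.

Let arrival_fin x : arrival_time h E x \is a fin_num.
Proof.
rewrite fin_numElt; apply/andP; split; last exact: le_lt_trans (arrival_le x) (ltry _).
by apply: lt_le_trans (partial_arrival_le 0 x); exact: ltNyr.
Qed.

Let w x : R := fine (arrival_time h E x).

Let wE : arrival_time h E = fun x => (w x)%:E.
Proof. by apply/funext => x; rewrite fineK. Qed.

Let partial_arrival_cvg x : partial_arrival m x @[m --> \oo] --> w x.
Proof.
have := arrival_fin x; rewrite /w /arrival_time.
have c : (\sum_(0 <= k < m) (\1_(E k) x : R)%:E)%E @[m --> \oo] -->
    (\sum_(0 <= k <oo) (\1_(E k) x : R)%:E)%E.
  by apply: is_cvg_nneseries => k _ _; rewrite lee_fin indicE.
have {}c : (h%:E * \sum_(0 <= k < m) (\1_(E k) x : R)%:E)%E @[m --> \oo] -->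
    (h%:E * \sum_(0 <= k <oo) (\1_(E k) x : R)%:E)%E by exact: cvgeZl.
move=> f; rewrite -(fineK f) in c; move/fine_cvg: c.
rewrite (_ : fine \o _ = fun m => partial_arrival m x)//.
by apply/funext => m /=; rewrite sumEFin -EFinM /= big_mkord.
Qed.

Let u_supp x : ~ closure E0 x -> u x = 0.
Proof.
move=> nc; apply/eqP/negPn/negP => ux; apply: nc; apply: su.
exact: subset_closure.
Qed.

Let u_Linfc : Linfc u.
Proof.
have [M MP] := collar_bounded delta bE0; apply: (Linfc_continuous (M := M)) => // x Mx.
by apply: u_supp => /(closure_collar d0)/MP; rewrite ltNge Mx.
Qed.

(** At the points of the first [k.+1] sets the arrival time is at least [k.+1 * h], and by
    [scheme_nested] such points exist in every open set that meets [E k] in positive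
    measure; the set where [u] is too small is open. *)
Let late k : leb (E k `&` [set x | u x < k.+1%:R * h - eps]) = 0%E.
Proof.
have oV : open [set x | u x < k.+1%:R * h - eps].
  rewrite (_ : [set x | _] = u @^-1` [set r | r < k.+1%:R * h - eps])//.
  by apply: open_comp; [move=> x _; exact: cu|exact: open_lt].
apply/eqP/negPn/negP => /(scheme_nested oV)[x /= ux Ex].
move: ux; rewrite ltNge => /negP; apply; rewrite lerBlDr -lee_fin.
apply: le_trans (arrival_le x); apply: le_trans (partial_arrival_le k.+1 x).
rewrite lee_fin /partial_arrival mulrC ler_pM2l//.
rewrite (eq_bigr (fun=> 1)); first by rewrite sumr_const card_ord.
by move=> i _; rewrite indicE mem_set//; apply: Ex; rewrite -ltnS.
Qed.

Let p k : R := fine (tv \1_(E k)).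

Let pE k : tv \1_(E k) = (p k)%:E.
Proof. by rewrite fineK// ge0_fin_numE ?tv_ge0//; have [] := scheme_OM k. Qed.

Let p_le k : p k <= p 0%N.
Proof. by rewrite -lee_fin -!pE [in leRHS]schemeE.1 scheme_tv_le. Qed.

Let p_ge0 k : 0 <= p k. Proof. exact: fine_ge0 (tv_ge0 _). Qed.

Variable c : R.
Hypothesis uc : (tv u <= c%:E)%E.

Let W t : R := fine (tv (fun x => Num.min (u x) t)).

Let WE t : 0 <= t -> tv (fun x => Num.min (u x) t) = (W t)%:E.
Proof.
move=> t0; rewrite fineK// ge0_fin_numE ?tv_ge0//; apply: le_lt_trans (le_lt_trans uc (ltry _)).
by apply: le_trans (tv_cut t0 u_Linfc u0); rewrite leeDr// tv_ge0.
Qed.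

Let W_le t : 0 <= t -> W t <= c.
Proof.
move=> t0; rewrite -lee_fin -WE//; apply: le_trans uc.
by apply: le_trans (tv_cut t0 u_Linfc u0); rewrite leeDr// tv_ge0.
Qed.

Let W_ge0 t : 0 <= W t. Proof. exact: fine_ge0 (tv_ge0 _). Qed.

(** Divided by [h], the slice of [u] between the two heights is a competitor of [E k], since
    by [late] it is 1 almost everywhere on [E k]. *)
Let slice_step k : eps <= k%:R * h -> h * p k + W (k%:R * h - eps) <= W (k.+1%:R * h - eps).
Proof.
move=> ek; set s := k%:R * h - eps; have s0 : 0 <= s by rewrite subr_ge0.
have tE : k.+1%:R * h - eps = s + h by rewrite -natr1 /s; ring.
rewrite tE; have st : 0 <= s <= s + h by rewrite s0 lerDl ltW.
have lsl := slice_Linfc st u_Linfc.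
have sl01 x : 0 <= slice s (s + h) u x <= h.
  rewrite /slice addrAC subrr add0r; apply/andP; split.
    by rewrite le_min le_max lexx orbT ltW.
  by rewrite ge_min lexx orbT.
have hslice := tv_slice st u_Linfc u0.
have slfin : tv (slice s (s + h) u) \is a fin_num.
  rewrite ge0_fin_numE ?tv_ge0//; apply: le_lt_trans (ltry (W (s + h))).
  rewrite -WE; last by rewrite addr_ge0// ltW.
  by apply: le_trans hslice; rewrite leeDr// tv_ge0.
have sh0 : 0 <= s + h by rewrite addr_ge0// ltW.
have := hslice; rewrite (WE s0) (WE sh0) -(fineK slfin) -EFinD lee_fin.
apply: le_trans; rewrite addrC lerD2l -ler_pdivlMl// -lee_fin -pE.
have h1 : (tv (fun x => (h^-1 * slice s (s + h) u x)%R) <= (h^-1 * fine (tv (slice s (s + h) u)))%:E)%E.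
  apply: tvZ_le; [exact: Linfc_bdd_meas|by rewrite invr_ge0 ltW|by rewrite fineK].
apply: le_trans h1; apply: (OM_functional (scheme_OM k) _ _ _ (late k)).
- exact: LinfcZ.
- move=> x; have /andP[a b] := sl01 x.
  by rewrite mulr_ge0 ?invr_ge0 ?(ltW h0)//= ler_pdivrMl// mulr1.
- move=> x nc; rewrite /slice u_supp; last by move/(closure_collar d0).
  by rewrite sub0r max_r ?oppr_le0// min_l ?mulr0// addrAC subrr add0r ltW.
- move=> x Ex nx; have ux : k.+1%:R * h - eps <= u x.
    by rewrite leNgt; apply/negP => ux; apply: nx.
  rewrite tE in ux; rewrite /slice addrAC subrr add0r max_l; last first.
    by rewrite subr_ge0 (le_trans _ ux)// lerDl ltW.
  by rewrite min_r ?lerBrDl// mulVf// gt_eqF.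
Qed.

(** The slices telescope; the first times, for which [k * h < eps] leaves no slice, are
    paid by the perimeter of [E0], the largest of all. *)
Let perimeter_sum m :
  \sum_(k < m) h * p k <= Num.min (m%:R * h) (eps + h) * p 0%N + W (Num.max (m%:R * h - eps) 0).
Proof.
elim: m => [|m ih].
  rewrite big_ord0 addr_ge0// mulr_ge0// le_min mul0r lexx addr_ge0// ltW//.
rewrite big_ord_recr/=; apply: le_trans (lerD ih (lexx _)) _.
have mh : m%:R * h <= m.+1%:R * h by rewrite ler_pM2r// ler_nat.
have [em|em] := leP eps (m%:R * h).
  rewrite !max_l ?subr_ge0 ?(le_trans em)// -addrA [W _ + _]addrC.
  apply: lerD; last exact: slice_step.
  by rewrite ler_wpM2r// le_min !ge_min mh/= lexx orbT.
have mE : m.+1%:R * h = m%:R * h + h by rewrite -natr1; ring.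
rewrite (max_r (_ : m%:R * h - eps <= 0)) ?subr_le0 ?(ltW em)//.
have -> : W 0 = 0.
  rewrite /W (_ : (fun x => _) = fun=> 0) ?tv0//.
  by apply/funext => x; rewrite min_r.
rewrite addr0 (min_l (_ : m%:R * h <= eps + h)); last by rewrite (le_trans (ltW em))// lerDl ltW.
rewrite (min_l (_ : m.+1%:R * h <= eps + h)); last by rewrite mE lerD2r ltW.
apply: (@le_trans _ _ (m.+1%:R * h * p 0%N)); last by rewrite lerDl.
by rewrite mE mulrDl lerD2l ler_pM2l.
Qed.

(** The gradient of the arrival time is a superposition of those of the
    indicators, so that its mass is at most the sum of the perimeters. *)
Lemma arrival_variation_le mu : is_gradient (arrival_time h E) mu ->
  fine (vector_variation mu setT) <= c + (eps + h) * fine (tv \1_E0).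
Proof.
move=> gmu; have p0E : p 0%N = fine (tv \1_E0) by rewrite /p schemeE.1.
rewrite -p0E; set B := c + _.
have B0 : 0 <= B.
  by rewrite addr_ge0 ?mulr_ge0 ?addr_ge0 ?(ltW eps0) ?(ltW h0)//; exact: le_trans (W_le (lexx 0)).
rewrite -lee_fin fineK ?vv_fin_num//.
have mpa m : Lfun (partial_arrival m).
  apply: LfunM; first exact: Lfun_cst.
  by apply: Lfun_sum => k; exact: Lfun_indic.
have mw : Lfun w.
  by apply: (measurable_fun_cvg mpa) => x _; exact: partial_arrival_cvg.
have [_ [M [uM _]]] := u_Linfc.
have w_le x : w x <= M + eps.
  have := arrival_le x; rewrite wE lee_fin => /le_trans; apply.
  by rewrite lerD2r (le_trans (ler_norm _)).
have w_ge0 x : 0 <= w x.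
  have := partial_arrival_le 0 x.
  by rewrite wE lee_fin /partial_arrival big_ord0 mulr0.
have bw : bdd_meas w by split => //; exists (M + eps) => x; rewrite ger0_norm.
rewrite wE in gmu; apply: variation_le => //; first exact: openT.
move=> xi axi _; rewrite (gradient_pairing bw gmu axi.1).
pose zeta i x := -1 * xi i x.
have azeta : admissible zeta by exact: admissibleN.
have dz x : dv zeta x = - dv xi x by rewrite (dvZ _ _ axi.1) mulN1r.
have lz := dv_Linfc azeta.1; have lx := dv_Linfc axi.1.
have -> : - lint (fun x => w x * dv xi x) = lint (fun x => w x * dv zeta x).
  rewrite -lintN; last exact: bdd_meas_mul.
  by congr lint; apply/funext => x; rewrite dz mulrN.
have [||||_ cv] := @lint_cvg _ _ (fun m x => partial_arrival m x * dv zeta x)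
    (fun x => w x * dv zeta x) (fun x => (M + eps) * `|dv zeta x|).
- by move=> m; apply: LfunM => //; exact: lz.1.
- by apply: LinfcZ; exact: Linfc_norm.
- move=> m x; rewrite normrM ler_wpM2r// ger0_norm.
    by apply: le_trans (w_le x); rewrite -lee_fin; have := partial_arrival_le m x; rewrite wE.
  by rewrite mulr_ge0 ?(ltW h0)// sumr_ge0// => k _; rewrite indicE.
- by move=> x; apply: cvgMl; exact: partial_arrival_cvg.
rewrite -(cvg_lim _ cv)//; apply: limr_le; first exact: cvgP cv.
apply: nearW => m.
have lEz k : Linfc (fun x => \1_(E k) x * dv zeta x).
  by apply: bdd_meas_mul => //; exact: bdd_meas_indic.
rewrite (_ : (fun x => _) = fun x => h * \sum_(k < m) \1_(E k) x * dv zeta x); last first.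
  by apply/funext => x; rewrite /partial_arrival -mulrA mulr_suml.
rewrite lintZ; last exact: Linfc_sum.
rewrite lint_sum// mulr_sumr.
apply: (@le_trans _ _ (\sum_(k < m) h * p k)).
  apply: ler_sum => k _; rewrite ler_pM2l//.
  have /tv_leP : (tv \1_(E k) <= (p k)%:E)%E by rewrite pE.
  exact.
apply: le_trans (perimeter_sum m) _; rewrite /B addrC.
apply: lerD; first by apply: W_le; rewrite le_max lexx orbT.
by rewrite ler_wpM2r// ge_min lexx orbT.
Qed.

End arrival_bound.
End one_scheme.
End arrival.

Lemma tv_le_variation (R : realType) (n : nat) (u : 'rV[R]_n.+1 -> R) mu :
  bdd_meas u -> is_gradient (fun x => (u x)%:E) mu ->
  (tv u <= (fine (vector_variation mu setT))%:E)%E.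
Proof.
move=> bu gu; apply/tv_leP => xi axi.
pose zeta i x := -1 * xi i x.
have azeta : admissible zeta by exact: admissibleN.
have -> : lint (fun x => u x * dv xi x) = pairing mu zeta.
  rewrite (gradient_pairing bu gu azeta.1) -lintN; last first.
    by apply: bdd_meas_mul => //; apply: dv_Linfc azeta.1.
  by congr lint; apply/funext => x; rewrite (dvZ _ _ axi.1) mulN1r mulrN opprK.
have c1 : continuous (fun _ : 'rV[R]_n.+1 => 1 : R) by exact: cst_continuous.
have := pairing_le_variation mu c1 (@Bfun_cst _ (borel R n) R 1) (fun=> ler01) azeta.
rewrite (_ : (fun i x => 1 * zeta i x) = zeta).
  by rewrite -(mint_indic _ (@measurableT _ (borel R n))) indicT.
by apply/funext => i; apply/funext => x; rewrite mul1r.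
Qed.

Theorem proposition5p1 (R : realType) (n : nat) (E0 : set 'rV[R]_n.+1)
    (delta : R) (E : R -> nat -> set 'rV[R]_n.+1)
    (h : nat -> R) (u : 'rV[R]_n.+1 -> R)
    (Duh : nat -> 'I_n.+1 -> {charge set (borel R n) -> \bar R})
    (Du : 'I_n.+1 -> {charge set (borel R n) -> \bar R}) :
  bounded_set E0 -> open E0 -> 0 < delta -> outward_minimizing delta E0 ->
  (forall t, 0 < t -> implicit_scheme t E0 (E t)) ->
  (forall j, 0 < h j) -> nonincreasing_seq h -> h j @[j --> \oo] --> 0 ->
  continuous u -> (forall x, 0 <= u x) -> tsupp u `<=` closure E0 ->
  (forall e, 0 < e -> \forall j \near \oo, forall x,
    (`|arrival_time (h j) (E (h j)) x - (u x)%:E| <= e%:E)%E) ->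
  (forall j, is_gradient (arrival_time (h j) (E (h j))) (Duh j)) ->
  is_gradient (fun x => (u x)%:E) Du ->
  weak_cvg_vector Duh Du ->
  weak_cvg (fun j => vector_variation (Duh j)) (vector_variation Du)
  /\ vector_variation (Duh j) setT @[j --> \oo] --> vector_variation Du setT.
Proof.
move=> bE0 oE0 d0 E0min hE h0 _ hc cu u0 su hu gDuh gDu wc.
apply: (variation_weak_cvg wc) => e e0.
have [t t0 step] := minimizing_step bE0 d0.
set P := fine (tv \1_E0); have P0 : 0 <= P by exact: fine_ge0 (tv_ge0 _).
have e1 : 0 < e / 2 / (1 + P) by rewrite !divr_gt0// ltr_pwDl.
have bu : bdd_meas u.
  have [M MP] := collar_bounded delta bE0; apply: Linfc_bdd_meas.
  apply: (Linfc_continuous (M := M)) => // x Mx; apply/eqP/negPn/negP => ux.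
  have /(closure_collar d0)/MP : closure E0 x by apply: su; exact: subset_closure.
  by rewrite ltNge Mx.
have uc := tv_le_variation bu gDu.
have /cvgrPdist_lt/(_ _ t0) near1 := hc; have /cvgrPdist_lt/(_ _ e1) near2 := hc.
have := hu _ e1; apply: filter_app; move: near2; apply: filter_app; move: near1.
apply: filterS => j; rewrite !sub0r !normrN gtr0_norm// => hj1 hj2 hj3.
have := arrival_variation_le bE0 oE0 d0 E0min (h0 j) (hE _ (h0 j)) _ cu u0 su e1 hj3 uc (gDuh j).
move/(_ (fun G F oG mF => step (h j) G F (h0 j) hj1 oG mF)).
move/le_trans; apply; rewrite lerD2l.
apply: (@le_trans _ _ ((e / (1 + P)) * P)).
  by rewrite ler_wpM2r//; apply: ltW; rewrite -ltrBrDl (_ : _ - _ = e / 2 / (1 + P))//; field;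
    rewrite gt_eqF// ltr_pwDl.
by rewrite mulrAC ler_pdivrMr ?ltr_pwDl// ler_pM2l// lerDr.
Qed.
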